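(* Let $r,R\in(0,1)$ and suppose $f \colon \mathbb{A}_{2,r} \to \mathbb{A}_{3,R}$ is a proper holomorphic map. Then $f$ is unitarily equivalent to exactly one of the following two maps: (i) the affine embedding $$(z_1,z_2) \mapsto \left( \sqrt{\frac{1-R^2}{1-r^2}} \, z_1 , \sqrt{\frac{1-R^2}{1-r^2}} \, z_2 , \sqrt{\frac{R^2-r^2}{1-r^2}} \right),$$ where $R \geq r$ (in this case $N_f = 2$ and $k_f = 1$); (ii) the homogeneous map $H_2$, $$(z_1,z_2) \mapsto \left( z_1^2 , \sqrt{2} \, z_1 z_2 , z_2^2 \right),$$ where $R = r^2$ (in this case $N_f = 3$ and $k_f = 2$).
   Context: For $0<r<1$, $\mathbb{A}_{n,r} = \{ z \in \mathbb{C}^n : r < \|z\| < 1 \}$. Two maps $f,g \colon \mathbb{A}_{n,r} \to \mathbb{A}_{N,R}$ are unitarily equivalent if there exist unitary matrices $V \in U(n)$ and $W \in U(N)$ with $f = W g V$, i.e. $f(z)=W\,g(Vz)$. For $X\subset\mathbb{C}^N$, $\operatorname{aff}(X)$ is the smallest complex affine subspace containing $X$; dimensions are complex. The embedding dimension is $N_f = \dim \operatorname{aff} f(\mathbb{A}_{n,r})$ and the general hyperplane rank is $k_f = \max\{ \dim \operatorname{aff}(f(H \cap \mathbb{A}_{n,r})) : H \subset \mathbb{C}^n \text{ an affine hyperplane}\}$. *)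

(* Defs.v *)
From HB Require Import structures.
From mathcomp Require Import all_boot all_order all_algebra.
From mathcomp Require Import spectral complex.
From mathcomp Require Import boolp classical_sets reals topology normedtype derive.

Set Implicit Arguments.
Unset Strict Implicit.
Unset Printing Implicit Defensive.

Import Order.TTheory GRing.Theory Num.Theory.
Import numFieldNormedType.Exports.
Local Open Scope classical_set_scope.
Local Open Scope complex_scope.
Local Open Scope ring_scope.

(* [K[i]] packaged as a numClosedFieldType: MathComp-Analysis attaches the
   topology and the norm to the elements of an abstract numFieldType, and does
   not find them on the bare type [K[i]]. *)
Definition cplx (K : realType) : numClosedFieldType := K[i].

Section Maps.
Variable K : realType.
Local Notation C := (cplx K).

(* The Euclidean norm; the library's norm on ['cV[C]_n] is the max norm, and
   is only used for its topology. *)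
Definition enorm n (z : 'cV[C]_n) : C := sqrtC (\sum_(i < n) `|z i 0| ^+ 2).

Definition annulus n (r : K) : set 'cV[C]_n :=
  [set z | (r%:C : C) < enorm z < 1].

(* ['cV[C]_n] is normed over [C], so [differentiable] is differentiability in the
   complex sense, at every point of [A]; [A] is meant to be open. *)
Definition holomorphic_on m n (A : set 'cV[C]_m) (f : 'cV[C]_m -> 'cV[C]_n) :=
  forall z, A z -> differentiable f z.

Definition proper_on m n (A : set 'cV[C]_m) (B : set 'cV[C]_n)
    (f : 'cV[C]_m -> 'cV[C]_n) :=
  [/\ {within A, continuous f}, f @` A `<=` B &
      forall L : set 'cV[C]_n, compact L -> L `<=` B -> compact (A `&` f @^-1` L)].

(* When [A] is an annulus [V *m z] stays in it, unitary maps being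
   isometries, so only the values of [f] and [g] on [A] matter. *)
Definition unitarily_equivalent m n (A : set 'cV[C]_m)
    (f g : 'cV[C]_m -> 'cV[C]_n) :=
  exists V : 'M[C]_m, exists W : 'M[C]_n,
    [/\ V \is unitarymx, W \is unitarymx &
        forall z, A z -> f z = W *m g (V *m z)].

Definition affine_subspace n (p : 'cV[C]_n) (U : {vspace 'cV[C]_n}) :
  set 'cV[C]_n := [set z | z - p \in U].

Definition aff n (X : set 'cV[C]_n) : set 'cV[C]_n :=
  [set z | forall p U, X `<=` affine_subspace p U -> affine_subspace p U z].

(* The affine hull of the empty set is empty (for [0 < n]) and has no direction;
   its dimension is set to 0, which does not affect the maximum below. *)
Definition affdim n (X : set 'cV[C]_n) : nat :=
  xget 0%N [set d | exists p, exists2 U,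
                      aff X = affine_subspace p U & \dim U = d].

Definition hyperplane n (H : set 'cV[C]_n) : Prop :=
  exists p, exists2 U, H = affine_subspace p U & (\dim U).+1 = n.

Definition embedding_dim m n (A : set 'cV[C]_m) (f : 'cV[C]_m -> 'cV[C]_n) :=
  affdim (f @` A).

(* The index [d] ranges up to [n] because the affine hulls live in ['cV[C]_n]. *)
Definition hyperplane_rank m n (A : set 'cV[C]_m) (f : 'cV[C]_m -> 'cV[C]_n) :=
  \max_(d < n.+1 |
         `[< exists2 H, hyperplane H & affdim (f @` (H `&` A)) = d >]) d.

(* [Num.sqrt] is 0 on negative numbers; the last square root is the intended one
   when [r <= R]. *)
Definition affine_embedding (r R : K) (z : 'cV[C]_2) : 'cV[C]_3 :=
  let c : C := (Num.sqrt ((1 - R ^+ 2) / (1 - r ^+ 2)))%:C in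
  let d : C := (Num.sqrt ((R ^+ 2 - r ^+ 2) / (1 - r ^+ 2)))%:C in
  \col_(i < 3) [:: c * z 0 0; c * z 1 0; d]`_i.

Definition H2 (z : 'cV[C]_2) : 'cV[C]_3 :=
  \col_(i < 3) [:: z 0 0 ^+ 2; sqrtC 2 * z 0 0 * z 1 0; z 1 0 ^+ 2]`_i.
End Maps.

Arguments annulus [K] n r _.

(* Main.v *)
(* By the Hartogs phenomenon [f] extends to a holomorphic map [F] of the ball;
   properness gives [|F| = R] on the sphere [|z| = r] and [|F| -> 1] radially at the
   unit sphere. Polarizing the first identity, [<F z, F u> = R^2] whenever
   [<z, u> = r^2]. If [F] takes linearly independent values at three points of some
   complex line, Cramer's rule continues [F] across a piece of the unit sphere, where
   [|F| = 1] polarizes to [<F z, F u> = 1] whenever [<z, u> = 1]; comparing the two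
   relations gives [F (r^2 z) = R^2 F z], hence [<F z, F u> = <z, u>^d] with
   [r^(2d) = R^2], and counting dimensions [d = 2]. Otherwise [F] maps complex lines to
   complex lines, so its image lies in an affine plane and the same argument applies
   to a rescaled projection of [F] to [C^2], with [d = 1]. Maps with equal Gram kernels
   differ by a unitary matrix.

   Holomorphic functions of one variable are handled by the Goursat lemma and circle
   means formed from dyadic Riemann sums, without path integrals. *)
Require Import Defs.
From HB Require Import structures.
From mathcomp Require Import all_boot all_order all_algebra.
From mathcomp Require Import spectral complex.
From mathcomp Require Import ring lra.
From mathcomp Require Import boolp classical_sets set_interval reals.
From mathcomp Require Import interval_inference topology normedtype derive sequences realfun exp trigo.

Set Implicit Arguments.
Unset Strict Implicit.
Unset Printing Implicit Defensive.

Import Order.TTheory GRing.Theory Num.Theory.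
Import numFieldNormedType.Exports.
Local Open Scope classical_set_scope.
Local Open Scope ring_scope.

(** Properness gives no boundary regularity at the unit sphere: only radial limits of [|F|] are at
    hand, so reflection cannot start there. The inner sphere lies in the interior of the domain of
    [F], and its polarized relation is a linear system for the conjugate of [F u] with coefficients
    [F z], where [z] runs over the complex line [<z, u> = r^2]. This is why independence of three
    values on one line, rather than of three arbitrary values, separates the two cases. The two
    spheres are compared as follows: if [<z, w> = 1] with [w] just outside the unit ball, then
    [<z, r^2 w> = r^2], so the same coefficients [F z] determine both [F (r^2 w)] and the continued
    value at [w], up to the factor [R^2]. The scaling law makes [t -> <F (t z), F u>] a monomial in
    [t], and polarization at [t = r^2 / <z, u>] fixes its coefficient. The power [<z, u>^d] is also
    the kernel of a map with [d + 1] independent components, and equal kernels have equal linear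
    relations; hence [3 = d + 1], and [2 = d + 1] for the projection. *)

HB.lock Definition cm (K : realType) (z : cplx K) : K := complex.Re `|z|.
Arguments cm {K} z.

(** * Real inequalities behind the later estimates *)

Section RealInequalities.
Variable K : realFieldType.
Implicit Types a b c d e x y z : K.

Lemma ltr_of_dist x a b : `|b - a| < x - a -> b < x.
Proof. by rewrite ltr_norml => /andP[]; lra. Qed.

Lemma gtr_of_dist x a b : `|b - a| < a - x -> x < b.
Proof. by rewrite ltr_norml => /andP[]; lra. Qed.

Lemma normD_le x y a b c : `|y| <= a -> a <= b -> b <= c / 2 -> `|x| <= c -> `|y + x| <= 2 * c.
Proof. by move=> *; apply: le_trans (ler_normD _ _) _; have := normr_ge0 x; lra. Qed.

Lemma norm_le2 x a : `|x - 1| <= 2 * a -> a <= 1 / 2 -> `|x| <= 2.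
Proof. by move=> h ha; have := ler_normD (x - 1) 1; rewrite subrK normr1; lra. Qed.

Lemma add_le3 a b c : b <= c -> a <= 2 * c -> a + b <= 3 * c.
Proof. by lra. Qed.

Lemma add_le4 a b c d : a <= 2 * (d * c) -> b <= 2 * c * d -> a + b <= 4 * (d * c).
Proof. by lra. Qed.

Lemma add_le_eps a b c d e : 0 <= d -> d <= e / 10 -> 0 <= c ->
  a <= 3 * (d * c) -> b <= 4 * (d * c) -> a + b <= e * c.
Proof.
move=> d0 de c0 h1 h2; have : d * c <= e / 10 * c by exact: ler_wpM2r.
have : 0 <= d * c by exact: mulr_ge0.
by lra.
Qed.

Lemma sqr_sub1_lt x a b : 0 <= x -> x < 1 + a -> 0 < a -> a <= b / 4 -> b <= 1 / 2 -> x ^+ 2 - 1 < b.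
Proof. by move=> *; nra. Qed.

Lemma add_half_lt a b x d : a < b -> b <= d / 2 -> x < d / 12 -> a + 6 * x < d.
Proof. by lra. Qed.

Lemma shrink_lt1 a b x : 0 < a -> a < 1 -> x <= 1 + b -> b <= 1 - a -> a * x < 1.
Proof. by move=> *; nra. Qed.

Lemma dist_le x a s e : x <= a -> a <= x + e -> 0 <= s -> s <= e -> `|x + s - a| <= e.
Proof. by move=> *; rewrite ler_norml; apply/andP; split; lra. Qed.

Lemma convex_le x y z t : 0 <= t <= 1 -> x <= z -> y <= z -> (1 - t) * x + t * y <= z.
Proof. by move=> /andP[*]; nra. Qed.

Lemma dist1_lt x e : 0 < e -> x < 1 -> 1 - e / 2 < x -> `|x - 1| < e.
Proof. by move=> *; rewrite ltr_norml; apply/andP; split; lra. Qed.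

Lemma lerp_ge x y t : y <= x -> t <= 1 -> y <= x + t * (y - x).
Proof. by move=> *; nra. Qed.

Lemma half_lt x y : 0 < x -> x <= y -> x / 2 < y.
Proof. by lra. Qed.

Lemma sqr_add_lt x y e : 0 <= x -> 0 <= y -> x < e / 2 -> y < e / 2 -> x ^+ 2 + y ^+ 2 < e ^+ 2.
Proof. by move=> *; nra. Qed.

Lemma le_sub1_of_dist x y d : `|x - y| < (1 - y) / 2 -> d <= (1 - y) / 2 -> x <= 1 - d.
Proof. by rewrite ltr_norml => /andP[]; lra. Qed.
End RealInequalities.

(** * Real and imaginary parts, conjugation and the real-valued modulus *)

Section Modulus.
Variable K : realType.
Local Notation C := (cplx K).
Implicit Types (x y : K) (z w : C).

Definition rc x : C := real_complex K x.
Definition re z : K := complex.Re z.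
Definition im z : K := complex.Im z.
Definition ci : C := Complex 0 1.
Definition cj z : C := conjc z.

Fact rc_additive : additive rc. Proof. exact: real_complex_is_additive. Qed.
Fact rc_multiplicative : multiplicative rc.
Proof. exact: real_complex_is_multiplicative. Qed.
HB.instance Definition _ := GRing.isAdditive.Build K C rc rc_additive.
HB.instance Definition _ := GRing.isMultiplicative.Build K C rc rc_multiplicative.
Fact cj_additive : additive cj. Proof. exact: conjc_is_additive. Qed.
Fact cj_multiplicative : multiplicative cj.
Proof. exact: conjc_is_multiplicative. Qed.
HB.instance Definition _ := GRing.isAdditive.Build C C cj cj_additive.
HB.instance Definition _ := GRing.isMultiplicative.Build C C cj cj_multiplicative.
Fact re_additive : additive re. Proof. by move=> [a b] [c d]. Qed.
Fact im_additive : additive im. Proof. by move=> [a b] [c d]. Qed.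
HB.instance Definition _ := GRing.isAdditive.Build C K re re_additive.
HB.instance Definition _ := GRing.isAdditive.Build C K im im_additive.

Lemma rcD x y : rc (x + y) = rc x + rc y. Proof. exact: rmorphD. Qed.
Lemma rcB x y : rc (x - y) = rc x - rc y. Proof. exact: rmorphB. Qed.
Lemma rcN x : rc (- x) = - rc x. Proof. exact: rmorphN. Qed.
Lemma rcM x y : rc (x * y) = rc x * rc y. Proof. exact: rmorphM. Qed.
Lemma rcV x : rc x^-1 = (rc x)^-1. Proof. exact: fmorphV. Qed.
Lemma rcX x n : rc (x ^+ n) = rc x ^+ n. Proof. exact: rmorphXn. Qed.
Lemma rcn n : rc n%:R = n%:R. Proof. exact: rmorph_nat. Qed.
Lemma rc0 : rc 0 = 0. Proof. by []. Qed.
Lemma rc1 : rc 1 = 1. Proof. by []. Qed.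
Lemma rc_sum I (s : seq I) (P : pred I) (F : I -> K) :
  rc (\sum_(i <- s | P i) F i) = \sum_(i <- s | P i) rc (F i).
Proof. exact: rmorph_sum. Qed.
Lemma cjD z w : cj (z + w) = cj z + cj w. Proof. exact: rmorphD. Qed.
Lemma cjB z w : cj (z - w) = cj z - cj w. Proof. exact: rmorphB. Qed.
Lemma cjN z : cj (- z) = - cj z. Proof. exact: rmorphN. Qed.
Lemma cjM z w : cj (z * w) = cj z * cj w. Proof. exact: rmorphM. Qed.
Lemma cjV z : cj z^-1 = (cj z)^-1. Proof. exact: fmorphV. Qed.
Lemma cjX z n : cj (z ^+ n) = cj z ^+ n. Proof. exact: rmorphXn. Qed.
Lemma cj0 : cj 0 = 0. Proof. exact: rmorph0. Qed.
Lemma cj1 : cj 1 = 1. Proof. exact: rmorph1. Qed.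
Lemma cj_sum I (s : seq I) (P : pred I) (F : I -> C) :
  cj (\sum_(i <- s | P i) F i) = \sum_(i <- s | P i) cj (F i).
Proof. exact: rmorph_sum. Qed.
Lemma rcI : injective rc. Proof. by move=> x y []. Qed.
Lemma rc_le x y : (rc x <= rc y) = (x <= y). Proof. exact: lecR. Qed.
Lemma rc_lt x y : (rc x < rc y) = (x < y). Proof. exact: ltcR. Qed.
Lemma re_rc x : re (rc x) = x. Proof. by []. Qed.
Lemma im_rc x : im (rc x) = 0. Proof. by []. Qed.
Lemma cj_rc x : cj (rc x) = rc x. Proof. exact: conjc_real. Qed.
Lemma cjK : involutive cj. Proof. exact: conjcK. Qed.
Lemma re_cj z : re (cj z) = re z. Proof. by case: z. Qed.
Lemma im_cj z : im (cj z) = - im z. Proof. by case: z. Qed.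
Lemma cplxE z : z = rc (re z) + ci * rc (im z). Proof. exact: complexE. Qed.
Lemma ci2 : ci * ci = -1. Proof. by rewrite -expr2; exact: sqr_i. Qed.
Lemma reM z w : re (z * w) = re z * re w - im z * im w.
Proof. by case: z; case: w. Qed.
Lemma imM z w : im (z * w) = re z * im w + im z * re w.
Proof. by case: z; case: w. Qed.
Lemma reD z w : re (z + w) = re z + re w. Proof. exact: raddfD. Qed.
Lemma imD z w : im (z + w) = im z + im w. Proof. exact: raddfD. Qed.
Lemma reB z w : re (z - w) = re z - re w. Proof. exact: raddfB. Qed.
Lemma imB z w : im (z - w) = im z - im w. Proof. exact: raddfB. Qed.
Lemma re1 : re 1 = 1. Proof. by []. Qed.
Lemma im1 : im 1 = 0. Proof. by []. Qed.
Lemma re_ci : re ci = 0. Proof. by []. Qed.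
Lemma im_ci : im ci = 1. Proof. by []. Qed.
Lemma re_eq z w : re z = re w -> im z = im w -> z = w.
Proof. by move=> h1 h2; rewrite (cplxE z) (cplxE w) h1 h2. Qed.

Lemma cmE z : `|z| = rc (cm z).
Proof. by rewrite cm.unlock normc_def. Qed.
Lemma cm2 z : cm z ^+ 2 = re z ^+ 2 + im z ^+ 2.
Proof. by apply: rcI; rewrite rmorphXn /= -cmE -add_Re2_Im2. Qed.
Lemma cm_ge0 z : 0 <= cm z. Proof. by rewrite cm.unlock normc_def /= sqrtr_ge0. Qed.
Lemma cmM z w : cm (z * w) = cm z * cm w.
Proof. by apply: rcI; rewrite rmorphM /= -!cmE normrM. Qed.
Lemma cmD z w : cm (z + w) <= cm z + cm w.
Proof. by rewrite -rc_le rcD -!cmE; exact: ler_normD. Qed.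
Lemma cmN z : cm (- z) = cm z. Proof. by rewrite cm.unlock normrN. Qed.
Lemma cmBC z w : cm (z - w) = cm (w - z). Proof. by rewrite -cmN opprB. Qed.
Lemma cmB z w : cm (z - w) <= cm z + cm w.
Proof. by rewrite -(cmN w) cmD. Qed.
Lemma cm_rc x : cm (rc x) = `|x|.
Proof. by rewrite cm.unlock normc_def /= expr0n addr0 sqrtr_sqr. Qed.
Lemma cm0 : cm (0 : C) = 0. Proof. by rewrite cm.unlock normr0. Qed.
Lemma cm1 : cm (1 : C) = 1. Proof. by rewrite cm.unlock normr1. Qed.
Lemma cm_ci : cm (ci : C) = 1.
Proof. by rewrite cm.unlock normc_def /= expr0n add0r expr1n sqrtr1. Qed.
Lemma cm_eq0 z : (cm z == 0) = (z == 0).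
Proof. by rewrite -(inj_eq rcI) rmorph0 -cmE normr_eq0. Qed.
Lemma cm_gt0 z : (0 < cm z) = (z != 0).
Proof. by rewrite lt0r cm_eq0 cm_ge0 andbT. Qed.
Lemma cmV z : cm (z^-1) = (cm z)^-1.
Proof.
apply: rcI; rewrite fmorphV /= -!cmE; exact: normfV.
Qed.
Lemma cmX z n : cm (z ^+ n) = cm z ^+ n.
Proof. by elim: n => [|n IH]; rewrite ?expr0 ?cm1 // !exprS cmM IH. Qed.
Lemma cm_cj z : cm (cj z) = cm z.
Proof. by apply/eqP; rewrite -(@eqrXn2 _ 2) ?cm_ge0 // !cm2 re_cj im_cj sqrrN. Qed.
Lemma re_le z : `|re z| <= cm z.
Proof.
rewrite -(@ler_pXn2r _ 2) ?nnegrE ?cm_ge0 // cm2 real_normK ?num_real //.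
by rewrite lerDl sqr_ge0.
Qed.
Lemma im_le z : `|im z| <= cm z.
Proof.
rewrite -(@ler_pXn2r _ 2) ?nnegrE ?cm_ge0 // cm2 real_normK ?num_real //.
by rewrite lerDr sqr_ge0.
Qed.
Lemma cm_le_reim z : cm z <= `|re z| + `|im z|.
Proof.
rewrite {1}(cplxE z); apply: le_trans (cmD _ _) _.
by rewrite cmM cm_ci mul1r !cm_rc.
Qed.
Lemma cmBl z w : cm z - cm w <= cm (z - w).
Proof. by rewrite lerBlDr -{1}(subrK w z) cmD. Qed.
Lemma mul_cj z : z * cj z = rc (cm z ^+ 2).
Proof. by rewrite rmorphXn /= -cmE sqr_normc. Qed.
Lemma cj_ci : cj ci = - ci.
Proof. by apply: re_eq; rewrite ?re_cj ?im_cj raddfN /= ?oppr0. Qed.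

Lemma cm_ballP (a : C) (P : set C) :
  nbhs a P <-> exists2 d : K, 0 < d & forall z, cm (z - a) < d -> P z.
Proof.
split.
  move=> /nbhs_ballP [e /= e0 h].
  (* Radii of balls are elements of [cplx K]; [0 < e] forces the imaginary part to vanish. *)
  have ee : e = rc (re e).
    apply: re_eq; first by [].
    by move: (e0); rewrite ltcE => /andP[/eqP h' _].
  exists (re e); first by move: e0; rewrite ee -(rmorph0 rc) rc_lt.
  move=> z hz; apply: h; rewrite /ball /= ee cmE cmBC.
  by change ((cm (z - a))%:C < (re e)%:C)%C; rewrite ltcR.
case=> d d0 h; apply/nbhs_ballP; exists (rc d); first by rewrite /= -(rmorph0 rc) rc_lt.
by move=> z hz; apply: h; move: hz; rewrite /ball /= cmE cmBC rc_lt.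
Qed.
End Modulus.
Arguments ci {K}.
Arguments ci : simpl never.
Arguments rc : simpl never.
Arguments re : simpl never.
Arguments im : simpl never.
Arguments cj : simpl never.

(** * Continuity and complex differentiability in one variable *)

HB.lock Definition cont (K : realType) (g : cplx K -> cplx K) a : Prop :=
  {for a, continuous g}.
Arguments cont {K} g a.

Section Holomorphy.
Variable K : realType.
Local Notation C := (cplx K).
Implicit Types (g h : C -> C) (a z w c : C).

Lemma contP (g : C -> C) a : cont g a <->
  forall e : K, 0 < e -> exists2 d : K, 0 < d &
    forall z, cm (z - a) < d -> cm (g z - g a) < e.
Proof.
rewrite cont.unlock; split=> [h e e0|h P].
  have /h /cm_ballP [d d0 hd] : nbhs (g a) [set w | cm (w - g a) < e].
    by apply/cm_ballP; exists e.
  by exists d => // z /hd.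
move=> /cm_ballP [e e0 he]; have [d d0 hd] := h _ e0.
by apply/cm_ballP; exists d => // z /hd /he.
Qed.

Lemma cont_eq (g h : C -> C) a : (\forall z \near a, g z = h z) ->
  cont h a -> cont g a.
Proof.
move=> gh /contP hc; apply/contP => e /hc [d d0 hd].
have /cm_ballP [d' d'0 hd'] := gh; exists (Num.min d d'); first by rewrite lt_min d0.
move=> z; rewrite lt_min => /andP[zd zd'].
by rewrite hd' // (nbhs_singleton gh); exact: hd.
Qed.

Lemma contD g h a : cont g a -> cont h a ->
  cont (fun z => g z + h z) a.
Proof. rewrite cont.unlock => gc hc; exact: (@cvgD _ C _ _ _ g h _ _ gc hc). Qed.
Lemma contM g h a : cont g a -> cont h a ->
  cont (fun z => g z * h z) a.
Proof. rewrite cont.unlock => gc hc; exact: (@cvgM C _ _ _ g h _ _ gc hc). Qed.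
Lemma contV g a : g a != 0 -> cont g a ->
  cont (fun z => (g z)^-1) a.
Proof. rewrite cont.unlock => g0 gc; apply: (@cvgV C _ _ _ g _ g0 gc). Qed.
Lemma cont_cst c a : cont (fun _ : C => c) a.
Proof. by rewrite cont.unlock; exact: cst_continuous. Qed.
Lemma cont_id a : cont (fun z : C => z) a.
Proof. by rewrite cont.unlock; exact: cvg_id. Qed.
Lemma cont_comp g h a : cont h a -> cont g (h a) ->
  cont (fun z => g (h z)) a.
Proof. rewrite cont.unlock => hc gc; exact: (continuous_comp hc gc). Qed.

Lemma contB g h a : cont g a -> cont h a -> cont (fun z => g z - h z) a.
Proof. rewrite cont.unlock => gc hc; exact: (@cvgB _ C _ _ _ g h _ _ gc hc). Qed.

(* Caratheodory's form of complex differentiability at [a]: the witness is the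
   difference quotient, already extended to [a] by the derivative. *)
Definition hol g a := exists2 phi : C -> C,
  cont phi a & forall z, g z = g a + phi z * (z - a).

Lemma hol_cont g a : hol g a -> cont g a.
Proof.
move=> [phi pc hg].
have -> : g = fun z => g a + phi z * (z + - a).
  by apply/funext => z; exact: hg.
apply: contD; first exact: cont_cst.
apply: contM pc _; apply: contD; [exact: cont_id|exact: cont_cst].
Qed.

Lemma hol_cst c a : hol (fun=> c) a.
Proof. by exists (fun=> 0); [exact: cont_cst|move=> z; rewrite mul0r addr0]. Qed.

Lemma hol_id a : hol (fun z => z) a.
Proof. by exists (fun=> 1); [exact: cont_cst|move=> z; rewrite mul1r addrC subrK]. Qed.

Lemma holD g h a : hol g a -> hol h a -> hol (fun z => g z + h z) a.
Proof.
move=> [p pc gE] [q qc hE]; exists (fun z => p z + q z); first exact: contD.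
by move=> z; rewrite (gE z) (hE z); ring.
Qed.

Lemma holM g h a : hol g a -> hol h a -> hol (fun z => g z * h z) a.
Proof.
move=> [p pc gE] hh; have hc := hol_cont hh; case: hh => [q qc hE].
exists (fun z => p z * h z + g a * q z).
  by apply: contD; [exact: contM pc hc|exact: contM (@cont_cst (g a) a) qc].
by move=> z; rewrite {1}(gE z) mulrDl mulrDl {1}(hE z); ring.
Qed.

Lemma holN g a : hol g a -> hol (fun z => - g z) a.
Proof.
move=> h; have -> : (fun z => - g z) = (fun z => -1 * g z).
  by apply/funext => z; rewrite mulN1r.
by apply: holM => //; exact: hol_cst.
Qed.

Lemma holB g h a : hol g a -> hol h a -> hol (fun z => g z - h z) a.
Proof. by move=> hg hh; apply: holD => //; exact: holN. Qed.

Lemma hol_comp g h a : hol h a -> hol g (h a) -> hol (fun z => g (h z)) a.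
Proof.
move=> hh; have hc := hol_cont hh; case: hh => [q qc hE] [p pc gE].
exists (fun z => p (h z) * q z).
  exact: contM (cont_comp hc pc) qc.
by move=> z; rewrite {1}gE {2}(hE z); ring.
Qed.

(** The factorisation in [hol] is global in [z], so the quotient of [h] cannot serve where [g]
    differs from [h]; the difference quotient of [g], patched at [a], replaces it. *)
Lemma hol_eq g h a : (\forall z \near a, g z = h z) -> hol h a -> hol g a.
Proof.
move=> gh [p pc hE]; have gha := nbhs_singleton gh.
exists (fun z => if z == a then p a else (g z - g a) / (z - a)).
  apply: cont_eq pc; apply: filterS gh => z ghz.
  case: eqVneq => [->//|za]; rewrite ghz gha (hE z).
  by apply: (canLR (mulfK _)); [rewrite subr_eq0|ring].
move=> z; case: eqVneq => [->|za]; first by rewrite subrr mulr0 addr0.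
by rewrite divfK ?subr_eq0 // addrC subrK.
Qed.

Lemma hol_inv a : a != 0 -> hol (fun z => z^-1) a.
Proof.
move=> a0; pose p z : C := - (z * a)^-1.
(* Since [0^-1] is 0, the inverse is first changed at 0 so that it factors through [p] everywhere;
   the change is invisible near [a]. *)
have : hol (fun z => if z == 0 then a^-1 + p z * (z - a) else z^-1) a.
  exists p.
    have -> : p = (fun z => -1 * (z * a)^-1) by apply/funext=> z; rewrite mulN1r.
    apply: contM; first exact: cont_cst.
    apply: contV; first by rewrite mulf_neq0.
    by apply: contM; [exact: cont_id|exact: cont_cst].
  move=> z; rewrite (negbTE a0) /p; case: eqVneq => // z0.
  by field; rewrite z0 a0.
apply: hol_eq; apply/cm_ballP; exists (cm a); first by rewrite cm_gt0.
move=> z; case: eqVneq => // ->; by rewrite sub0r cmN ltxx.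
Qed.

Lemma holV g a : g a != 0 -> hol g a -> hol (fun z => (g z)^-1) a.
Proof. by move=> g0 hg; apply: (hol_comp hg); exact: hol_inv. Qed.

Lemma hol_div g h a : h a != 0 -> hol g a -> hol h a -> hol (fun z => g z / h z) a.
Proof. by move=> h0 hg hh; apply: holM => //; exact: holV. Qed.

Lemma holX g n a : hol g a -> hol (fun z => g z ^+ n) a.
Proof.
move=> hg; elim: n => [|n IH].
  by under eq_fun do rewrite expr0; exact: hol_cst.
by under eq_fun do rewrite exprS; exact: holM.
Qed.

Lemma hol_sum I (s : seq I) (P : pred I) (F : I -> C -> C) a :
  (forall i, P i -> hol (F i) a) -> hol (fun z => \sum_(i <- s | P i) F i z) a.
Proof.
move=> h; elim: s => [|i s IH].
  by under eq_fun do rewrite big_nil; exact: hol_cst.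
case Pi : (P i); last by under eq_fun do rewrite big_cons Pi; exact: IH.
by under eq_fun do rewrite big_cons Pi; apply: holD => //; exact: h.
Qed.

Lemma hol_affine a b c : hol (fun z => a + z * b) c.
Proof.
apply: holD; first exact: hol_cst.
by apply: holM; [exact: hol_id|exact: hol_cst].
Qed.

Lemma hol_conj g a : hol g (cj a) -> hol (fun z => cj (g (cj z))) a.
Proof.
move=> [p pc gE]; exists (fun z => cj (p (cj z))).
  apply/contP => e e0; have /contP/(_ e e0)[d d0 hd] := pc.
  exists d => // z hz; rewrite -raddfB /= cm_cj; apply: hd.
  by rewrite -raddfB /= cm_cj.
by move=> z; rewrite (gE (cj z)) rmorphD rmorphM raddfB /= !cjK.
Qed.

(* Removable singularities are allowed at isolated points. *)
Definition qhol g a := cont g a /\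
  \forall z \near a, z != a -> hol g z.

Lemma hol_qhol g a : (\forall z \near a, hol g z) -> qhol g a.
Proof.
move=> h; split; first by apply: hol_cont; exact: nbhs_singleton h.
by apply: filterS h.
Qed.

Definition slope g a d z := if z == a then d else (g z - g a) / (z - a).

Lemma hol_slope g a : hol g a -> exists2 d : C, cont (slope g a d) a &
  forall z, g z = g a + slope g a d z * (z - a).
Proof.
move=> [p pc gE]; exists (p a).
  suff -> : slope g a (p a) = p by [].
  apply/funext => z; rewrite /slope; case: eqVneq => [->//|za].
  by rewrite (gE z) addrC addKr mulfK // subr_eq0.
move=> z; rewrite /slope; case: eqVneq => [->|za]; first by rewrite subrr mulr0 addr0.
by rewrite divfK ?subr_eq0 // addrC subrK.
Qed.

Lemma hol_slope_off g a d z : z != a -> hol g z -> hol (slope g a d) z.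
Proof.
move=> za hz; have : hol (fun w => (g w - g a) / (w - a)) z.
  apply: hol_div; rewrite ?subr_eq0 //.
    by apply: holB => //; exact: hol_cst.
  by apply: holB; [exact: hol_id|exact: hol_cst].
apply: hol_eq; apply/cm_ballP; exists (cm (a - z)).
  by rewrite cm_gt0 subr_eq0 eq_sym.
by move=> w; rewrite /slope; case: eqVneq => // ->; rewrite ltxx.
Qed.

Lemma nbhs_neq a b : a != b -> \forall z \near a, z != b.
Proof.
move=> ab; apply/cm_ballP; exists (cm (b - a)).
  by rewrite cm_gt0 subr_eq0 eq_sym.
by move=> w; case: eqVneq => // ->; rewrite ltxx.
Qed.

(** The reason for working with [qhol]: the class is stable under divided differences, so these can
    be iterated before singularities are known to be removable. *)
Lemma slope_qhol g a d z : (z = a -> cont (slope g a d) a) ->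
  qhol g z -> qhol (slope g a d) z.
Proof.
move=> hc [gc hh]; split.
  case: (eqVneq z a) => [za|za]; first by rewrite za; exact: hc.
  have : cont (fun w => (g w - g a) / (w - a)) z.
    apply: contM; first exact: contB gc (@cont_cst (g a) z).
    apply: contV; first by rewrite subr_eq0.
    exact: contB (@cont_id z) (@cont_cst a z).
  apply: cont_eq; apply: filterS (nbhs_neq za) => w wa.
  by rewrite /slope (negbTE wa).
case: (eqVneq z a) => [za|za].
  by apply: filterS hh => w hw wz; apply: hol_slope_off; [rewrite -za|exact: hw].
apply: filterS2 (nbhs_neq za) hh => w wa hw wz.
by apply: hol_slope_off => //; exact: hw.
Qed.
End Holomorphy.

(** * The complex exponential *)

HB.lock Definition cexp (K : realType) (w : cplx K) : cplx K :=
  rc (expR (re w)) * (rc (cos (im w)) + ci * rc (sin (im w))).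

Arguments cexp {K} w.

Section ComplexExponential.
Variable K : realType.
Local Notation C := (cplx K).

Lemma is_derive_eps (f : K -> K) (x d e : K) : is_derive x 1 f d -> 0 < e ->
  exists2 D : K, 0 < D & forall h, `|h| < D -> `|f (x + h) - f x - d * h| <= e * `|h|.
Proof.
move=> [/[dup] df cf dfE] e0.
have : h^-1 *: ((f \o shift x) (h *: 1) - f x) @[h --> 0^'] --> d.
  by rewrite -dfE; exact: cf.
move=> /cvgrPdist_le /(_ _ e0) H.
have /nbhs_ballP [D /= D0 HD] : nbhs (0:K) (fun h => h != 0 ->
   `|d - h^-1 *: ((f \o shift x) (h *: 1) - f x)| <= e).
  by apply: filterS H => h.
exists D => // h hD; case: (eqVneq h 0) => [->|h0].
  by rewrite addr0 subrr mulr0 subr0 !normr0 mulr0.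
have := HD h; rewrite /ball /= sub0r normrN => /(_ hD h0).
rewrite /= /shift /= scaler1 (addrC h) => /(ler_wpM2r (normr_ge0 h)).
apply: le_trans; rewrite -normrM distrC.
rewrite mulrBl -[_ *: _]/(h^-1 * _) mulrAC mulVf // mul1r.
by rewrite mulrC.
Qed.

Lemma re_cexp (w : C) : re (cexp w) = expR (re w) * cos (im w).
Proof. by rewrite cexp.unlock !(reM, imM, reD, imD) !re_rc !im_rc re_ci im_ci; ring. Qed.

Lemma im_cexp (w : C) : im (cexp w) = expR (re w) * sin (im w).
Proof. by rewrite cexp.unlock !(reM, imM, reD, imD) !re_rc !im_rc re_ci im_ci; ring. Qed.

Lemma cexpD (z w : C) : cexp (z + w) = cexp z * cexp w.
Proof.
rewrite cexp.unlock reD imD expRD cosD sinD !rmorphD !rmorphN !rmorphM /=.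
by have := ci2 K; move: ci => i i2; ring: i2.
Qed.

Lemma cm_cis (t : K) : cm (rc (cos t) + ci * rc (sin t)) = 1 :> K.
Proof.
apply/eqP; rewrite -(@eqrXn2 _ 2) ?cm_ge0 // cm2 reD imD reM imM !re_rc !im_rc re_ci im_ci.
apply/eqP; rewrite expr1n -[RHS](cos2Dsin2 t); ring.
Qed.

Lemma cm_cexp (w : C) : cm (cexp w) = expR (re w).
Proof. by rewrite cexp.unlock cmM cm_cis mulr1 cm_rc ger0_norm // expR_ge0. Qed.

Lemma cexp_neq0 (w : C) : cexp w != 0.
Proof. by rewrite -cm_eq0 cm_cexp gt_eqF // expR_gt0. Qed.

Lemma cexp_eps (e : K) : 0 < e -> exists2 D : K, 0 < D &
  forall w : C, cm w < D -> cm (cexp w - 1 - w) <= e * cm w.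
Proof.
(* The real and imaginary parts of the remainder cost [3 e'] and [4 e'] times [cm w], which [e / 10]
   covers; [1 / 2] keeps [expR (re w)] at most 2. *)
move=> e0; pose e' := Num.min (e / 10) (1 / 2).
have e'0 : 0 < e' by rewrite lt_min; apply/andP; split; lra.
have e'1 : e' <= e / 10 by rewrite ge_min lexx.
have e'2 : e' <= 1 / 2 by rewrite ge_min lexx orbT. clearbody e'.
have [D1 D10 h1] := is_derive_eps (is_derive_expR (0 : K)) e'0.
have [D2 D20 h2] := is_derive_eps (is_derive_sin (0 : K)) e'0.
have [D3 D30 h3] := is_derive_eps (is_derive_cos (0 : K)) e'0.
exists (Num.min (Num.min D1 D2) (Num.min D3 e')).
  by rewrite !lt_min D10 D20 D30 e'0.
move=> w; rewrite !lt_min => /andP[/andP[w1 w2] /andP[w3 w4]].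
have rw := re_le w; have iw := im_le w.
have {h1} := h1 (re w) (le_lt_trans rw w1).
have {h2} := h2 (im w) (le_lt_trans iw w2).
have {h3} := h3 (im w) (le_lt_trans iw w3).
rewrite !add0r cos0 sin0 expR0 oppr0 mul0r !mul1r !subr0 ?addr0 => h3 h2 h1.
apply: le_trans (cm_le_reim _) _.
rewrite !(reB, imB) re1 im1 re_cexp im_cexp subr0.
move: h1 h2 h3; set E := expR _; set c := cos _; set s := sin _.
set x := re w in rw *; set y := im w in iw *; set n := cm w in rw iw w4 * => h1 h2 h3.
have n0 : 0 <= n := cm_ge0 w.
have ineq (u a b : K) : `|u| <= a -> a <= b -> - b <= u /\ u <= b.
  by move=> h h'; apply/andP; rewrite -ler_norml; exact: le_trans h'.
have a1 : e' * `|x| <= e' * n by apply: ler_wpM2l => //; exact: ltW.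
have a2 : e' * `|y| <= e' * n by apply: ler_wpM2l => //; exact: ltW.
have [b1 b2] := ineq _ _ _ h1 a1; have [b3 b4] := ineq _ _ _ h2 a2.
have [b5 b6] := ineq _ _ _ h3 a2; have [b7 b8] := ineq _ _ _ rw (lexx n).
have [b9 b10] := ineq _ _ _ iw (lexx n).
have en : e' * n <= n / 2 by rewrite [n / 2]mulrC -[2^-1]div1r ler_wpM2r.
have E2 : `|E - 1| <= 2 * n.
  by rewrite -[E - 1](subrK x); exact: normD_le h1 a1 en rw.
have E3 : `|E| <= 2 by exact: norm_le2 E2 (le_trans (ltW w4) e'2).
have t1 : `|E * c - 1 - x| <= 3 * (e' * n).
  have -> : E * c - 1 - x = E * (c - 1) + (E - 1 - x) by ring.
  apply: le_trans (ler_normD _ _) _; rewrite normrM.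
  have : `|E| * `|c - 1| <= 2 * (e' * n).
    by apply: ler_pM => //; exact: le_trans h3 a2.
  exact: add_le3 (le_trans h1 a1).
have t2 : `|E * s - y| <= 4 * (e' * n).
  have -> : E * s - y = E * (s - y) + (E - 1) * y by ring.
  apply: le_trans (ler_normD _ _) _; rewrite !normrM.
  have p1 : `|E| * `|s - y| <= 2 * (e' * n).
    by apply: ler_pM => //; exact: le_trans h2 a2.
  have p2 : `|E - 1| * `|y| <= 2 * n * e'.
    by apply: ler_pM => //; apply: le_trans iw _; exact: ltW.
  exact: add_le4 p1 p2.
exact: add_le_eps (ltW e'0) e'1 n0 t1 t2.
Qed.

Lemma hol_cexp (a : C) : hol cexp a.
Proof.
exists (fun z => cexp a * (if z == a then 1 else (cexp (z - a) - 1) / (z - a))).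
  apply: contM; first exact: cont_cst.
  apply/contP => e e0; have e20 : 0 < e / 2 by lra.
  have [D D0 hD] := cexp_eps e20.
  exists D => // z zD; rewrite eqxx; case: eqVneq => [_|za].
    by rewrite subrr cm0.
  have z0 : 0 < cm (z - a) by rewrite cm_gt0 subr_eq0.
  have -> : (cexp (z - a) - 1) / (z - a) - 1 = (cexp (z - a) - 1 - (z - a)) / (z - a).
    by rewrite [RHS]mulrBl divff ?subr_eq0.
  rewrite cmM cmV ltr_pdivrMr //; apply: le_lt_trans (hD _ zD) _.
  by rewrite ltr_pM2r //; lra.
move=> z; case: eqVneq => [->|za]; first by rewrite subrr mulr0 addr0.
rewrite -mulrA divfK ?subr_eq0 // mulrBr -cexpD mulr1.
by rewrite [in cexp (a + _)]addrC subrK addrC subrK.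
Qed.

(** Normalised to period 1, so that circles are parametrised by the unit interval of the dyadic
    sums. *)
Definition cis (s : K) : C := cexp (ci * rc (2 * pi * s)).

Lemma cis_cexp (x s : K) : cexp (rc x + ci * rc (2 * pi * s)) = rc (expR x) * cis s.
Proof.
rewrite cexpD; congr (_ * _).
by rewrite cexp.unlock re_rc im_rc cos0 sin0 rmorph0 rmorph1 mulr0 addr0 mulr1.
Qed.

Lemma cisE s : cis s = rc (cos (2 * pi * s)) + ci * rc (sin (2 * pi * s)).
Proof.
rewrite /cis cexp.unlock; set t := 2 * pi * s.
have -> : re (ci * rc t) = 0 by rewrite reM re_rc im_rc re_ci im_ci; ring.
have -> : im (ci * rc t) = t by rewrite imM re_rc im_rc re_ci im_ci; ring.
by rewrite expR0 rmorph1 mul1r.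
Qed.

Lemma cm_cisE s : cm (cis s) = 1. Proof. by rewrite cisE cm_cis. Qed.
Lemma cis0 : cis 0 = 1. Proof. by rewrite cisE mulr0 cos0 sin0 rmorph0 mulr0 addr0 rmorph1. Qed.
Lemma cis1 : cis 1 = 1.
Proof. by rewrite cisE mulr1 mulrC mulr_natr cos2pi sin2pi rmorph0 mulr0 addr0 rmorph1. Qed.
Lemma cisD s t : cis (s + t) = cis s * cis t.
Proof. by rewrite /cis -cexpD -mulrDr -rmorphD /= -mulrDr. Qed.
Lemma cj_cis s : cj (cis s) = (cis s)^-1.
Proof.
have c0 : cis s != 0 := cexp_neq0 _.
by apply: (mulfI c0); rewrite mul_cj cm_cisE expr1n rmorph1 divff.
Qed.
End ComplexExponential.

(** * Goursat's lemma on parallelograms *)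

Section Goursat.
Variable K : realType.
Local Notation C := (cplx K).
Implicit Types (f g : K -> C) (G : C -> C) (p v w z : C).

(* Left Riemann sums of order [2 ^ n] over the unit interval. *)
Fixpoint dmean n (f : K -> C) : C :=
  if n is m.+1 then (dmean m (fun s => f (s / 2)) + dmean m (fun s => f ((s + 1) / 2))) / 2
  else f 0.

Lemma eq_dmean n f g : (forall s : K, 0 <= s <= 1 -> f s = g s) -> dmean n f = dmean n g.
Proof.
elim: n f g => [|n IH] f g h /=; first by apply: h; rewrite lexx ler01.
congr ((_ + _) / 2); apply: IH => s /andP[s0 s1]; apply: h; apply/andP; split; lra.
Qed.

Lemma dmeanD n f g : dmean n (fun s => f s + g s) = dmean n f + dmean n g.
Proof. by elim: n f g => [|n IH] f g //=; rewrite !IH; field. Qed.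

Lemma dmeanZ n (c : C) f : dmean n (fun s => c * f s) = c * dmean n f.
Proof. by elim: n f => [|n IH] f //=; rewrite !IH; field. Qed.

Lemma dmeanB n f g : dmean n (fun s => f s - g s) = dmean n f - dmean n g.
Proof. by elim: n f g => [|n IH] f g //=; rewrite !IH; field. Qed.

Lemma dmean_cst n (c : C) : dmean n (fun=> c) = c.
Proof. by elim: n => [|n IH] //=; rewrite !IH; field. Qed.

Lemma dmean_le n f (M : K) : (forall s : K, 0 <= s <= 1 -> cm (f s) <= M) -> cm (dmean n f) <= M.
Proof.
elim: n f => [|n IH] f h /=; first by apply: h; rewrite lexx ler01.
rewrite cmM cmV.
have -> : (2 : C) = rc 2 by rewrite rmorph_nat.
rewrite cm_rc ger0_norm // ler_pdivrMr //.
apply: le_trans (cmD _ _) _; have -> : M * 2 = M + M by ring.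
by apply: lerD; apply: IH => s /andP[s0 s1]; apply: h; apply/andP; split; lra.
Qed.

Definition edge n G p v : C := v * dmean n (fun s => G (p + rc s * v)).

Lemma edgeS n G p v : edge n.+1 G p v = edge n G p (v / 2) + edge n G (p + v / 2) (v / 2).
Proof.
rewrite /edge /=.
rewrite (@eq_dmean n (fun s => G (p + rc (s / 2) * v)) (fun s => G (p + rc s * (v / 2)))); last first.
  by move=> s _; rewrite rcM rcV rcn; congr (G _); field.
rewrite (@eq_dmean n (fun s => G (p + rc ((s + 1) / 2) * v))
          (fun s => G (p + v / 2 + rc s * (v / 2)))); last first.
  by move=> s _; rewrite rcM rcD rcV rc1 rcn; congr (G _); field.
by field.
Qed.

Definition boundary n G p v w : C :=
  edge n G p v + edge n G (p + v) w - edge n G (p + w) v - edge n G p w.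

(** Subdivision is exact at finite order: each inner edge occurs twice, as the same sum with
    opposite signs, so it cancels before any limit is taken. *)
Lemma boundaryS n G p v w : boundary n.+1 G p v w =
  boundary n G p (v / 2) (w / 2) + boundary n G (p + v / 2) (v / 2) (w / 2) +
  boundary n G (p + w / 2) (v / 2) (w / 2) +
  boundary n G (p + v / 2 + w / 2) (v / 2) (w / 2).
Proof.
rewrite /boundary !edgeS.
have -> : p + v / 2 + v / 2 = p + v by field.
have -> : p + w / 2 + w / 2 = p + w by field.
have -> : p + w / 2 + v / 2 = p + v / 2 + w / 2 by rewrite addrAC.
have -> : p + v + w / 2 = p + v / 2 + w / 2 + v / 2 by field.
have -> : p + w + v / 2 = p + v / 2 + w / 2 + w / 2 by field.
ring.
Qed.

Lemma edgeD n G H p v : edge n (fun z => G z + H z) p v = edge n G p v + edge n H p v.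
Proof. by rewrite /edge dmeanD mulrDr. Qed.

Lemma boundaryD n G H p v w :
  boundary n (fun z => G z + H z) p v w = boundary n G p v w + boundary n H p v w.
Proof. by rewrite /boundary !edgeD; ring. Qed.

(* The discrete sums are already exact on affine functions. *)
Lemma boundary_affine n (a b : C) p v w : boundary n (fun z => a + b * z) p v w = 0.
Proof.
have eE q u : edge n (fun z => a + b * z) q u =
    u * (a + b * q) + b * u * u * dmean n (fun s => rc s).
  rewrite /edge.
  rewrite (@eq_dmean n _ (fun s => (a + b * q) + (b * u) * rc s)); last first.
    by move=> s _; ring.
  by rewrite dmeanD dmean_cst dmeanZ; ring.
by rewrite /boundary !eE; ring.
Qed.

Definition para p v w : set C :=
  [set z | exists x y : K, [/\ 0 <= x <= 1, 0 <= y <= 1 & z = p + rc x * v + rc y * w]].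

Lemma edge_le n G p v (M : K) :
  (forall s : K, 0 <= s <= 1 -> cm (G (p + rc s * v)) <= M) -> cm (edge n G p v) <= cm v * M.
Proof. by move=> h; rewrite cmM ler_wpM2l ?cm_ge0 //; exact: dmean_le. Qed.

Lemma boundary_le n G p v w (M : K) : (forall z, para p v w z -> cm (G z) <= M) ->
  cm (boundary n G p v w) <= 2 * (cm v + cm w) * M.
Proof.
move=> h; have i0 : 0 <= (0 : K) <= 1 by apply/andP; split; lra.
have i1 : 0 <= (1 : K) <= 1 by apply/andP; split; lra.
have e1 : cm (edge n G p v) <= cm v * M.
  apply: edge_le => s hs; apply: h; exists s, 0; split=> //.
  by rewrite rc0; ring.
have e2 : cm (edge n G (p + v) w) <= cm w * M.
  apply: edge_le => s hs; apply: h; exists 1, s; split=> //.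
  by rewrite rc1; ring.
have e3 : cm (edge n G (p + w) v) <= cm v * M.
  apply: edge_le => s hs; apply: h; exists s, 1; split=> //.
  by rewrite rc1; ring.
have e4 : cm (edge n G p w) <= cm w * M.
  apply: edge_le => s hs; apply: h; exists 0, s; split=> //.
  by rewrite rc0; ring.
rewrite /boundary; apply: le_trans (cmB _ _) _.
have := cmB (edge n G p v + edge n G (p + v) w) (edge n G (p + w) v).
have := cmD (edge n G p v) (edge n G (p + v) w).
lra.
Qed.

Lemma nested_point (x : nat -> K) (t : nat -> K) :
  (forall k, x k <= x k.+1 /\ x k.+1 + t k.+1 <= x k + t k) -> (forall k, 0 <= t k) ->
  exists a, forall k, x k <= a <= x k + t k.
Proof.
move=> h t0.
have le_x i j : (i <= j)%N -> x i <= x j.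
  by move=> /subnK <-; elim: (j - i)%N => // k IH; apply: le_trans IH _; have [] := h (k + i)%N.
have ge_x i j : (i <= j)%N -> x j + t j <= x i + t i.
  by move=> /subnK <-; elim: (j - i)%N => // k IH; apply: le_trans IH; have [] := h (k + i)%N.
have ub i j : x j <= x i + t i.
  case: (leqP i j) => ij; first by have := ge_x _ _ ij; have := t0 j; lra.
  by have := le_x _ _ (ltnW ij); have := t0 i; lra.
have hs : has_sup (range x) by split; [exists (x 0), 0|exists (x 0 + t 0) => _ [j _ <-]].
exists (sup (range x)) => k; apply/andP; split.
  by apply: (sup_upper_bound hs); exists k.
by apply: ge_sup; [exists (x 0), 0|move=> _ [j _ <-]].
Qed.

Lemma half_pow_lt (e M : K) : 0 < e -> exists k : nat, M / 2 ^+ k < e.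
Proof.
move=> e0; have [k hk] : exists k : nat, `|M| / e < k%:R.
  by exists (Num.bound (`|M| / e)); apply: archi_boundP; rewrite divr_ge0 // ltW.
exists k; have p0 : 0 < (2 : K) ^+ k by rewrite exprn_gt0.
rewrite ltr_pdivrMr //.
have : (k%:R : K) <= 2 ^+ k by rewrite -natrX ler_nat ltnW // ltn_expl.
move: hk; rewrite ltr_pdivrMr // => hk hk'.
apply: le_lt_trans (ler_norm _) _; apply: lt_le_trans hk _.
by rewrite mulrC ler_pM2l.
Qed.

(** Bisection for an eventual bound: if all four quarters satisfy it from some order on, so does the
    whole. A failure thus descends to quarters shrinking to a point, where the first-order expansion
    of [G] gives the bound at every order. *)
Lemma goursat G p v w : (forall z, para p v w z -> hol G z) ->
  forall e : K, 0 < e -> exists N, forall n, (N <= n)%N -> cm (boundary n G p v w) <= e.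
Proof.
move=> hG e e0; pose D := cm v + cm w.
have D0 : 0 <= D by rewrite addr_ge0 ?cm_ge0.
(* The [+ 1] covers a parallelogram reduced to a point, where [D] is 0. *)
pose e' := e / (2 * D ^+ 2 + 1).
have e'0 : 0 < e' by rewrite divr_gt0 //; have := sqr_ge0 D; lra.
pose q (x y : K) := p + rc x * v + rc y * w.
pose P (st : K * K * nat) := let: (x, y, k) := st in
  exists N, forall n, (N <= n)%N ->
   cm (boundary n G (q x y) (v / 2 ^+ k) (w / 2 ^+ k)) <= e' * (2 * (D / 2 ^+ k) ^+ 2).
suff [N hN] : P (0, 0, 0).
  exists N => n /hN; rewrite /q rc0 !mul0r !addr0 expr0 !divr1.
  move=> h; apply: le_trans h _; rewrite /e' mulrAC ler_pdivrMr; last by have := sqr_ge0 D; lra.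
  by rewrite ler_pM2l //; lra.
apply: contrapT => nP0.
(* The relation is vacuous at states satisfying [P], so every state has a successor, as
   [dependent_choice] asks. *)
pose R (st st' : K * K * nat) := ~ P st -> ~ P st' /\
  exists i j : bool, st' = (st.1.1 + i%:R / 2 ^+ st.2.+1, st.1.2 + j%:R / 2 ^+ st.2.+1, st.2.+1).
have half (x : C) k : x / 2 ^+ k / 2 = x / 2 ^+ k.+1.
  by rewrite exprSr invfM mulrA.
have step st : {st' | R st st'}.
  apply: cid; case: (pselect (P st)) => [Ps|nPs]; first by exists st.
  apply: contrapT => nex.
  case: st nPs nex => [[x y] k] nPs nex; apply: nPs.
  have PP (i j : bool) : P (x + i%:R / 2 ^+ k.+1, y + j%:R / 2 ^+ k.+1, k.+1).
    apply: contrapT => nP; apply: nex.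
    by exists (x + i%:R / 2 ^+ k.+1, y + j%:R / 2 ^+ k.+1, k.+1) => _; split=> //; exists i, j.
  have [N1 h1] := PP false false; have [N2 h2] := PP true false.
  have [N3 h3] := PP false true; have [N4 h4] := PP true true.
  (* One more than the sum of the thresholds: [boundaryS] relates order [n.+1] of the whole to order
     [n] of the quarters. *)
  exists (N1 + N2 + N3 + N4).+1; case=> // n hn.
  have l3 : (N1 + N2 + N3 <= n)%N := leq_trans (leq_addr N4 _) hn.
  have l2 := leq_trans (leq_addr N3 _) l3.
  have {}h1 := h1 n (leq_trans (leq_addr N2 _) l2).
  have {}h2 := h2 n (leq_trans (leq_addl N1 _) l2).
  have {}h3 := h3 n (leq_trans (leq_addl _ N3) l3).
  have {}h4 := h4 n (leq_trans (leq_addl _ N4) hn).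
  rewrite boundaryS !half.
  have E0 : q x y = q (x + false%:R / 2 ^+ k.+1) (y + false%:R / 2 ^+ k.+1).
    by rewrite !mul0r !addr0.
  have tE : rc (true%:R / 2 ^+ k.+1) = 1 / 2 ^+ k.+1 :> C.
    by rewrite rcM rcV rcX !rcn.
  have E1 : q x y + v / 2 ^+ k.+1 = q (x + true%:R / 2 ^+ k.+1) (y + false%:R / 2 ^+ k.+1).
    rewrite /q !mul0r !addr0 [in RHS]rcD tE; field.
    by rewrite expf_neq0 // pnatr_eq0.
  have E2 : q x y + w / 2 ^+ k.+1 = q (x + false%:R / 2 ^+ k.+1) (y + true%:R / 2 ^+ k.+1).
    rewrite /q !mul0r !addr0 [in RHS]rcD tE; field.
    by rewrite expf_neq0 // pnatr_eq0.
  have E3 : q x y + v / 2 ^+ k.+1 + w / 2 ^+ k.+1 =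
      q (x + true%:R / 2 ^+ k.+1) (y + true%:R / 2 ^+ k.+1).
    rewrite /q ![in RHS]rcD tE; field.
    by rewrite expf_neq0 // pnatr_eq0.
  rewrite {1}E3 {1}E2 {1}E1 {1}E0.
  have -> : e' * (2 * (D / 2 ^+ k) ^+ 2) = 4 * (e' * (2 * (D / 2 ^+ k.+1) ^+ 2)).
    by rewrite (exprS 2 k); field; rewrite expf_neq0.
  set A1 := boundary _ _ _ _ _ in h1 *; set A2 := boundary _ _ _ _ _ in h2 *.
  set A3 := boundary _ _ _ _ _ in h3 *; set A4 := boundary _ _ _ _ _ in h4 *.
  have := cmD (A1 + A2 + A3) A4; have := cmD (A1 + A2) A3; have := cmD A1 A2.
  clear -h1 h2 h3 h4; lra.
have [F [F0 FS]] := dependent_choice step (0, 0, 0).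
have nPF k : ~ P (F k).
  by elim: k => [|k IH]; [rewrite F0|have [] := FS k IH].
have F2 k : (F k).2 = k.
  elim: k => [|k IH]; first by rewrite F0.
  by have [_ [i [j ->]]] := FS k (nPF k); rewrite /= IH.
have tS k : (1 / 2 ^+ k : K) = 1 / 2 ^+ k.+1 + 1 / 2 ^+ k.+1.
  by rewrite exprS; field.
have t0 k : (0 : K) <= 1 / 2 ^+ k by rewrite divr_ge0 ?exprn_ge0.
have b0 (i : bool) k : 0 <= (i%:R : K) / 2 ^+ k <= 1 / 2 ^+ k.
  by have := t0 k; case: i; rewrite ?mul0r ?lexx => -> //.
have [|a ha] := @nested_point (fun k => (F k).1.1) (fun k => 1 / 2 ^+ k) _ t0.
  move=> k; have [_ [i [j ->]]] := FS k (nPF k); rewrite F2 /= (tS k).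
  by have /andP[] := b0 i k.+1; split; lra.
have [|b hb] := @nested_point (fun k => (F k).1.2) (fun k => 1 / 2 ^+ k) _ t0.
  move=> k; have [_ [i [j ->]]] := FS k (nPF k); rewrite F2 /= (tS k).
  by have /andP[] := b0 j k.+1; split; lra.
have zQ : para p v w (q a b).
  exists a, b; split=> //; [have := ha 0|have := hb 0];
    by rewrite F0 expr0 divr1 add0r.
have [phi /contP /(_ _ e'0) [d d0 hd] GE] := hG _ zQ.
have [k hk] := half_pow_lt D d0.
apply: (nPF k); have := F2 k; case EF: (F k) => [[x y] k'] /= ->.
exists 0%N => n _.
have /andP[a1 a2] := ha k; have /andP[b1 b2] := hb k.
rewrite EF /= in a1 a2 b1 b2.
(* Linearisation at the common point of the quarters. The affine part contributes exactly 0 at every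
   order, so only the remainder has to be estimated. *)
rewrite (_ : G = fun z => (G (q a b) - phi (q a b) * q a b + phi (q a b) * z) +
                   (phi z - phi (q a b)) * (z - q a b)); last first.
  by apply/funext => z; rewrite {1}GE; ring.
rewrite boundaryD boundary_affine add0r.
have -> : e' * (2 * (D / 2 ^+ k) ^+ 2) =
    2 * (cm (v / 2 ^+ k) + cm (w / 2 ^+ k)) * (e' * (D / 2 ^+ k)).
  have -> : (2 ^+ k : C) = rc (2 ^+ k) by rewrite rcX rcn.
  rewrite !cmM !cmV cm_rc ger0_norm ?exprn_ge0 //.
  rewrite -[cm v / _ + _]mulrDl -/D expr2; ring.
apply: boundary_le => z [s [t [hs ht ->]]].
have kE (u : C) (r : K) : rc r * (u / 2 ^+ k) = rc (r / 2 ^+ k) * u.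
  by rewrite rcM rcV rcX rcn mulrAC mulrA.
have dist : cm (q x y + rc s * (v / 2 ^+ k) + rc t * (w / 2 ^+ k) - q a b) <= D / 2 ^+ k.
  rewrite !kE.
  have -> : q x y + rc (s / 2 ^+ k) * v + rc (t / 2 ^+ k) * w - q a b =
     rc (x + s / 2 ^+ k - a) * v + rc (y + t / 2 ^+ k - b) * w.
    by rewrite /q !rcB !rcD; ring.
  apply: le_trans (cmD _ _) _; rewrite !cmM !cm_rc mulrDl addrC addrC.
  have sk (r : K) : 0 <= r <= 1 -> 0 <= r / 2 ^+ k <= 1 / 2 ^+ k.
    move=> /andP[r0 r1]; rewrite divr_ge0 ?exprn_ge0 //=.
    by rewrite ler_wpM2r // invr_ge0 exprn_ge0.
  have /andP[s0 s1] := sk _ hs; have /andP[u0 u1] := sk _ ht.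
  rewrite div1r in a2 b2 s1 u1.
  by apply: lerD; rewrite mulrC; apply: ler_wpM2l; rewrite ?cm_ge0 //;
    [exact: dist_le a1 a2 s0 s1 | exact: dist_le b1 b2 u0 u1].
rewrite cmM; apply: ler_pM; rewrite ?cm_ge0 //.
by apply/ltW/hd; exact: le_lt_trans dist hk.
Qed.
End Goursat.

(** * Means over circles and their independence of the radius *)

Section CircleMeans.
Variable K : realType.
Local Notation C := (cplx K).
Implicit Types (g h : C -> C) (a z w c : C) (u v : nat -> C).

Definition small u := forall e : K, 0 < e -> exists N, forall n, (N <= n)%N -> cm (u n) <= e.

Lemma eq_small u v : (forall n, u n = v n) -> small u -> small v.
Proof. by move=> /funext ->. Qed.

(** Compactness in the form of a Lebesgue number: [P d t] survives shrinking [d], so local scales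
    have a common one. Moduli of continuity, bounds (with [d] the inverse of the bound) and margins
    all take this shape below. *)
Lemma itv_uniform (P : K -> K -> Prop) :
  (forall d d' t, d' <= d -> P d t -> P d' t) ->
  (forall s : K, 0 <= s <= 1 -> exists2 d, 0 < d & forall t, `|t - s| < d -> P d t) ->
  exists2 d, 0 < d & forall t : K, 0 <= t <= 1 -> P d t.
Proof.
move=> mono loc.
have /compact_near_coveringP := @segment_compact K 0 1.
move=> /(_ _ (at_right (0 : K)) P _) H.
have {H} : \forall d \near at_right (0 : K), `[0, 1]%classic `<=` P d.
  apply: H => s; rewrite /= in_itv /= => /loc [d d0 hd].
  exists (ball s d, [set x | 0 < x < d]) => /=.
    split; first exact: nbhsx_ballx.
    by apply/nbhs_ballP; exists d => //= x; rewrite /ball /= sub0r normrN =>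
      hx x0; rewrite x0 /=; apply: le_lt_trans hx; exact: ler_norm.
  move=> [t x] [/= st /andP[x0 xd]]; apply: (mono d); first exact: ltW.
  by apply: hd; move: st; rewrite /ball /= distrC.
move=> /nbhs_ballP [d /= d0 hd].
exists (d / 2); first by lra.
move=> t ht; apply: (hd (d / 2)); last by rewrite /= in_itv.
  by rewrite /ball /= sub0r normrN ger0_norm; lra.
by rewrite /=; lra.
Qed.

Lemma cis_cont (s e : K) : 0 < e ->
  exists2 d, 0 < d & forall t, `|t - s| < d -> cm (cis t - cis s) < e.
Proof.
move=> e0; have /hol_cont /contP /(_ _ e0) [d d0 hd] := hol_cexp (ci * rc (2 * pi * s)).
have p0 := pi_gt0 K; exists (d / (2 * pi)); first by rewrite divr_gt0 //; lra.
move=> t; rewrite ltr_pdivlMr; last by lra.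
move=> ht; apply: hd; rewrite -mulrBr -rcB -mulrBr cmM cm_ci mul1r cm_rc.
by rewrite normrM ger0_norm 1?mulrC //; lra.
Qed.

Definition circ a (rho s : K) : C := a + rc rho * cis s.
Definition cmean n g a (rho : K) := dmean n (fun s => g (circ a rho s)).

Lemma cm_circ a (rho s : K) : 0 <= rho -> cm (circ a rho s - a) = rho.
Proof. by move=> r0; rewrite /circ addrC addKr cmM cm_cisE mulr1 cm_rc ger0_norm. Qed.

Lemma circ_cont a (rho s e : K) : 0 < e -> exists2 d, 0 < d &
  forall rho' t, `|rho' - rho| < d -> `|t - s| < d -> cm (circ a rho' t - circ a rho s) < e.
Proof.
move=> e0; have q0 : 0 < e / 2 / (`|rho| + 1).
  by rewrite divr_gt0 //; have := normr_ge0 rho; lra.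
have [d d0 hd] := cis_cont s q0; exists (Num.min d (e / 2)); first by rewrite lt_min d0; lra.
move=> rho' t; rewrite !lt_min => /andP[_ h1] /andP[/hd h2 _].
have -> : circ a rho' t - circ a rho s =
    rc (rho' - rho) * cis t + rc rho * (cis t - cis s) by rewrite /circ rcB; ring.
apply: le_lt_trans (cmD _ _) _; rewrite !cmM cm_cisE !cm_rc mulr1.
move: h2; rewrite ltr_pdivlMr; last by have := normr_ge0 rho; lra.
move=> h2; have := cm_ge0 (cis t - cis s); nra.
Qed.

Lemma circle_bounded g a (rho : K) : 0 <= rho ->
  (forall z, cm (z - a) = rho -> cont g z) ->
  exists2 M, 0 < M & forall s : K, 0 <= s <= 1 -> cm (g (circ a rho s)) <= M.
Proof.
move=> r0 gc.
(* The bound is encoded as the inverse of the scale; the second disjunct keeps the predicate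
   monotone when [d] is not positive. *)
have [||d d0 hd] := @itv_uniform (fun d t => cm (g (circ a rho t)) <= d^-1 \/ d <= 0).
- move=> d d' t dd [h|h]; last by right; exact: le_trans dd h.
  case: (ltP 0 d') => d'0; last by right.
  by left; apply: le_trans h _; rewrite lef_pV2 // posrE //; exact: lt_le_trans dd.
- move=> s hs; have /gc/contP/(_ _ ltr01) [e e0 he] := cm_circ a s r0.
  have [d d0 hd] := circ_cont a rho s e0.
  pose M := cm (g (circ a rho s)) + 1.
  have M0 : 0 < M by rewrite /M; have := cm_ge0 (g (circ a rho s)); lra.
  exists (Num.min d M^-1); first by rewrite lt_min d0 invr_gt0.
  move=> t; rewrite lt_min => /andP[td _]; left.
  have /he h : cm (circ a rho t - circ a rho s) < e by apply: hd => //; rewrite subrr normr0.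
  apply: (@le_trans _ _ M).
    have := cmBl (g (circ a rho t)) (g (circ a rho s)); rewrite /M; lra.
  by rewrite -[leLHS]invrK lef_pV2 ?posrE ?invr_gt0 ?lt_min ?d0 ?invr_gt0 // ge_min lexx orbT.
- exists d^-1; first by rewrite invr_gt0.
  by move=> s /hd [//|]; rewrite leNgt d0.
Qed.

Lemma circle_unif g a (rho : K) : 0 <= rho ->
  (forall z, cm (z - a) = rho -> cont g z) -> forall e : K, 0 < e ->
  exists2 d, 0 < d & forall rho' (s : K), `|rho' - rho| < d -> 0 <= s <= 1 ->
    cm (g (circ a rho' s) - g (circ a rho s)) <= e.
Proof.
move=> r0 gc e e0.
have [||d d0 hd] := @itv_uniform (fun d t => forall rho', `|rho' - rho| < d ->
    cm (g (circ a rho' t) - g (circ a rho t)) <= e).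
- by move=> d d' t dd h rho' hr; apply: h; exact: lt_le_trans dd.
- move=> s hs; have e20 : 0 < e / 2 by lra.
  have /gc/contP/(_ _ e20) [e' e'0 he] := cm_circ a s r0.
  have [d d0 hd] := circ_cont a rho s e'0; exists d => // t td rho' hr.
  have h1 := he _ (hd rho' t hr td).
  have h2 : cm (g (circ a rho t) - g (circ a rho s)) < e / 2.
    by apply: he; apply: hd; rewrite ?subrr ?normr0.
  have := cmB (g (circ a rho' t) - g (circ a rho s)) (g (circ a rho t) - g (circ a rho s)).
  by rewrite (_ : _ - _ - _ = g (circ a rho' t) - g (circ a rho t)); [lra|ring].
- by exists d => // rho' s hr hs; exact: hd.
Qed.

(** The map [a + cexp w] carries a rectangle of height [2 * pi] onto the ring. The two sides of
    constant angle cancel by periodicity, and those of constant modulus are multiples of the circle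
    means. *)
Lemma cmean_ring g a (r1 r2 : K) : 0 < r1 -> r1 <= r2 ->
  (forall z, r1 <= cm (z - a) <= r2 -> hol g z) ->
  small (fun n => cmean n g a r2 - cmean n g a r1).
Proof.
move=> r10 r12 hg e e0; have r20 := lt_le_trans r10 r12.
pose G w := g (a + cexp w); have p0 := pi_gt0 K.
pose v := rc (ln r2 - ln r1) : C; pose w := ci * rc (2 * pi) : C.
have cw : cm w = 2 * pi by rewrite cmM cm_ci mul1r cm_rc ger0_norm //; lra.
have w0 : w != 0 by rewrite -cm_eq0 cw; apply/eqP; lra.
have sw s : rc s * w = ci * rc (2 * pi * s) :> C by rewrite /w !rcM; ring.
have GE x s : G (rc x + rc s * w) = g (circ a (expR x) s).
  by rewrite /G /circ sw cis_cexp.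
have [||N hN] := @goursat K G (rc (ln r1)) v w _ (e * cm w).
- move=> _ [x [y [/andP[x0 x1] _ ->]]].
  have -> : rc (ln r1) + rc x * v + rc y * w =
      rc (ln r1 + x * (ln r2 - ln r1)) + rc y * w.
    by rewrite /v [in RHS]rcD rcM.
  have l12 : 0 <= ln r2 - ln r1 by rewrite subr_ge0 ler_ln.
  apply: hol_comp.
    by apply: holD; [exact: hol_cst|exact: hol_cexp].
  apply: hg; rewrite sw cis_cexp -/(circ _ _ _) cm_circ ?expR_ge0 //.
  have q1 := mulr_ge0 x0 l12.
  have q2 : 0 <= (1 - x) * (ln r2 - ln r1) by rewrite mulr_ge0 // subr_ge0.
  by apply/andP; split; [rewrite -[leLHS](lnK r10)|rewrite -[leRHS](lnK r20)];
    rewrite ler_expR; lra.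
- by apply: mulr_gt0 => //; rewrite cw mulr_gt0.
exists N => n /hN; suff -> : boundary n G (rc (ln r1)) v w =
    w * (cmean n g a r2 - cmean n g a r1).
  by rewrite cmM mulrC ler_pM2r // cw mulr_gt0.
have per : edge n G (rc (ln r1) + w) v = edge n G (rc (ln r1)) v.
  congr (_ * _); apply: eq_dmean => s _.
  rewrite /G /v -rcM [_ + w + _]addrAC -rcD; congr (g (a + _)).
  have -> : w = ci * rc (2 * pi * 1) by rewrite mulr1.
  rewrite cis_cexp cis1 mulr1.
  by rewrite -[X in cexp X]addr0 -[X in cexp (_ + X)](mulr0 ci) -rc0 -(mulr0 (2 * pi)) cis_cexp cis0 mulr1.
rewrite /boundary per /edge /cmean.
rewrite (@eq_dmean _ n (fun s => G (rc (ln r1) + v + rc s * w)) (fun s => g (circ a r2 s))); last first.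
  by move=> s _; rewrite /v -rcD (addrC (ln r1)) subrK GE lnK.
rewrite (@eq_dmean _ n (fun s => G (rc (ln r1) + rc s * w)) (fun s => g (circ a r1 s))); last first.
  by move=> s _; rewrite GE lnK.
ring.
Qed.

Lemma cmean_unif g a (rho : K) : 0 <= rho ->
  (forall z, cm (z - a) = rho -> cont g z) -> forall e : K, 0 < e ->
  exists2 d, 0 < d & forall rho' n, `|rho' - rho| < d ->
    cm (cmean n g a rho' - cmean n g a rho) <= e.
Proof.
move=> r0 gc e e0; have [d d0 hd] := circle_unif r0 gc e0.
by exists d => // rho' n hr; rewrite /cmean -dmeanB; apply: dmean_le => s; exact: hd.
Qed.

(* An exceptional circle, on which [g] is only continuous, can be crossed. *)
Lemma cmean_ring_crossing g a (r1 r0 r2 : K) : 0 < r1 -> r1 < r0 < r2 ->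
  (forall z, r1 <= cm (z - a) <= r2 -> cm (z - a) != r0 -> hol g z) ->
  (forall z, cm (z - a) = r0 -> cont g z) ->
  small (fun n => cmean n g a r2 - cmean n g a r1).
Proof.
move=> r10 /andP[r1r0 r0r2] hg gc e e0; have r0p := lt_trans r10 r1r0.
have e40 : 0 < e / 4 by lra.
have [d d0 hd] := cmean_unif (ltW r0p) gc e40.
pose d' := Num.min (d / 2) (Num.min ((r0 - r1) / 2) ((r2 - r0) / 2)).
have d'0 : 0 < d' by rewrite !lt_min; apply/andP; split; [lra|apply/andP; split; lra].
have d'1 : d' <= d / 2 by rewrite ge_min lexx.
have d'2 : d' <= (r0 - r1) / 2 by rewrite !ge_min lexx orbT.
have d'3 : d' <= (r2 - r0) / 2 by rewrite !ge_min lexx !orbT.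
have [||z hz|N1 h1] := @cmean_ring g a (r0 + d') r2 _ _ _ (e / 4) e40; try lra.
  by apply: hg; [|apply/eqP]; lra.
have [||z hz|N2 h2] := @cmean_ring g a r1 (r0 - d') _ _ _ (e / 4) e40; try lra.
  by apply: hg; [|apply/eqP]; lra.
exists (N1 + N2)%N => n hn.
have {}h1 := h1 n (leq_trans (leq_addr _ _) hn).
have {}h2 := h2 n (leq_trans (leq_addl _ _) hn).
have h3 : cm (cmean n g a (r0 + d') - cmean n g a r0) <= e / 4.
  by apply: hd; rewrite addrC addKr ger0_norm; lra.
have h4 : cm (cmean n g a (r0 - d') - cmean n g a r0) <= e / 4.
  by apply: hd; rewrite addrC addKr normrN ger0_norm; lra.
have -> : cmean n g a r2 - cmean n g a r1 = (cmean n g a r2 - cmean n g a (r0 + d')) +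
   ((cmean n g a (r0 + d') - cmean n g a r0) - (cmean n g a (r0 - d') - cmean n g a r0)) +
   (cmean n g a (r0 - d') - cmean n g a r1) by ring.
apply: le_trans (cmD _ _) _; apply: le_trans (lerD (cmD _ _) (lexx _)) _.
have := cmB (cmean n g a (r0 + d') - cmean n g a r0) (cmean n g a (r0 - d') - cmean n g a r0).
lra.
Qed.

(** The radius is shrunk to 0. Only continuity is asked at the centre, which suits [qhol]
    functions. *)
Lemma mean_value g a (rho : K) : 0 < rho -> cont g a ->
  (forall z, 0 < cm (z - a) <= rho -> hol g z) -> small (fun n => cmean n g a rho - g a).
Proof.
move=> r0 gc hg e e0; have e20 : 0 < e / 2 by lra.
have /contP /(_ _ e20) [d d0 hd] := gc.
pose d' := Num.min (d / 2) rho.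
have d'0 : 0 < d' by rewrite lt_min r0 andbT; lra.
have d'1 : d' <= d / 2 by rewrite ge_min lexx.
have d'2 : d' <= rho by rewrite ge_min lexx orbT.
have [|z hz|N hN] := @cmean_ring g a d' rho d'0 _ _ (e / 2) e20 => //.
  by apply: hg; lra.
exists N => n /hN h1.
have h2 : cm (cmean n g a d' - g a) <= e / 2.
  rewrite /cmean -(dmean_cst n (g a)) -dmeanB; apply: dmean_le => s hs.
  by apply/ltW/hd; rewrite cm_circ; lra.
have := cmD (cmean n g a rho - cmean n g a d') (cmean n g a d' - g a).
by rewrite addrA subrK; lra.
Qed.
End CircleMeans.

(** * The maximum principle for sums of squared moduli *)

HB.lock Definition contK (K : realType) (u : cplx K -> K) a : Prop :=
  {for a, continuous u}.
Arguments contK {K} u a.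

Section MaximumPrinciple.
Variable K : realType.
Local Notation C := (cplx K).
Implicit Types (g h : C -> C) (a z w c : C).

Lemma contKP (u : C -> K) a : contK u a <->
  forall e : K, 0 < e -> exists2 d : K, 0 < d &
    forall z, cm (z - a) < d -> `|u z - u a| < e.
Proof.
rewrite contK.unlock; split=> [h e e0|h].
  have /cm_ballP [d d0 hd] : nbhs a [set z | `|u a - u z| < e].
    by move: h; rewrite /prop_for /continuous_at => /cvgrPdist_lt /(_ _ e0).
  by exists d => // z /hd /=; rewrite distrC.
apply: (cvgrPdist_lt (F := nbhs a) u (u a)).2 => e /h [d d0 hd]; apply/cm_ballP; exists d => // z /hd.
by rewrite distrC.
Qed.

Lemma contKD (u v : C -> K) a : contK u a -> contK v a -> contK (fun z => u z + v z) a.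
Proof. rewrite contK.unlock => hu hv; exact: (@cvgD _ K _ _ _ u v _ _ hu hv). Qed.
Lemma contKM (u v : C -> K) a : contK u a -> contK v a -> contK (fun z => u z * v z) a.
Proof. rewrite contK.unlock => hu hv; exact: (@cvgM K _ _ _ u v _ _ hu hv). Qed.
Lemma contK_cst (c : K) a : contK (fun=> c) a.
Proof. by rewrite contK.unlock; exact: cst_continuous. Qed.
Lemma contK_cm g a : cont g a -> contK (fun z => cm (g z)) a.
Proof.
move=> /contP hg; apply/contKP => e /hg [d d0 hd]; exists d => // z /hd; apply: le_lt_trans.
by rewrite ler_norml lerNl opprB -[cm (g z - _)]cm_cj -[cm (cj _)]cmN -cjN opprB cm_cj cmBl
  cmBC cmBl.
Qed.
Lemma contK_sum I (s : seq I) (P : pred I) (F : I -> C -> K) a :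
  (forall i, P i -> contK (F i) a) -> contK (fun z => \sum_(i <- s | P i) F i z) a.
Proof.
move=> h; elim: s => [|i s IH].
  by under eq_fun do rewrite big_nil; exact: contK_cst.
case Pi : (P i); last by under eq_fun do rewrite big_cons Pi; exact: IH.
by under eq_fun do rewrite big_cons Pi; apply: contKD; [exact: h|exact: IH].
Qed.

Lemma cont_sum I (s : seq I) (P : pred I) (F : I -> C -> C) a :
  (forall i, P i -> cont (F i) a) -> cont (fun z => \sum_(i <- s | P i) F i z) a.
Proof.
move=> h; elim: s => [|i s IH].
  by under eq_fun do rewrite big_nil; exact: cont_cst.
case Pi : (P i); last by under eq_fun do rewrite big_cons Pi; exact: IH.
by under eq_fun do rewrite big_cons Pi; apply: contD; [exact: h|exact: IH].
Qed.

Lemma disc_compact a (rho : K) : compact [set z : C | cm (z - a) <= rho].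
Proof.
case: (ltP rho 0) => r0.
  suff -> : [set z : C | cm (z - a) <= rho] = set0 by exact: compact0.
  by apply/seteqP; split=> // z /= hz; have := cm_ge0 (z - a); lra.
pose phi (p : K * K) : C := a + (rc p.1 + ci * rc p.2).
have phic : continuous phi.
  move=> [x y] P /cm_ballP [d d0 hd]; have d20 : 0 < d / 2 by lra.
  exists (ball x (d / 2), ball y (d / 2)); first by split; exact: nbhsx_ballx.
  move=> [s t] [/= hs ht]; apply: hd.
  have -> : phi (s, t) - phi (x, y) = rc (s - x) + ci * rc (t - y) by rewrite /phi /= !rcB; ring.
  apply: le_lt_trans (cmD _ _) _; rewrite cmM cm_ci mul1r !cm_rc.
  move: hs ht; rewrite /ball /= distrC => h1; rewrite distrC => h2; lra.
have cI : compact (phi @` (`[- rho, rho]%classic `*` `[- rho, rho]%classic)).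
  apply: continuous_compact; first by apply: continuous_subspaceT.
  by apply: compact_setX; exact: segment_compact.
apply: (subclosed_compact _ cI).
  move=> z cz.
  rewrite /= leNgt; apply/negP => hz.
  have Fn : nbhs z [set w : C | rho < cm (w - a)].
    apply/cm_ballP; exists (cm (z - a) - rho); first by lra.
    move=> w hw /=; have := cmD (w - a) (z - w); rewrite addrC addrA subrK.
    rewrite (cmBC z w); lra.
  have [w [/= h1 h2]] := cz _ Fn.
  by move: h2; rewrite ltNge h1.
move=> z /= hz; exists (re (z - a), im (z - a)).
  split; rewrite /= in_itv /= -ler_norml; apply: le_trans hz; [exact: re_le|exact: im_le].
by rewrite /phi /= -cplxE addrC subrK.
Qed.

Lemma disc_max a (rho : K) (u : C -> K) : 0 <= rho ->
  (forall z, cm (z - a) <= rho -> contK u z) ->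
  exists2 z, cm (z - a) <= rho & forall w, cm (w - a) <= rho -> u w <= u z.
Proof.
move=> r0 hu; have [||z] := @compact_EVT_max _ K u _ _ (@disc_compact a rho).
- by exists a; rewrite /= subrr cm0.
- by apply: continuous_in_subspaceT => z; rewrite inE => /hu; rewrite contK.unlock.
rewrite inE => /= hz h; exists z => // w hw; apply: h; exact: mem_set.
Qed.

Lemma re_dmean_le n (f : K -> C) (M : K) : (forall s : K, 0 <= s <= 1 -> re (f s) <= M) ->
  re (dmean n f) <= M.
Proof.
elim: n f => [|n IH] f h /=; first by apply: h; apply/andP; split; lra.
have -> : (2 : C)^-1 = rc 2^-1 by rewrite rcV rcn.
rewrite reM re_rc im_rc mulr0 subr0 reD.
have : re (dmean n (fun s => f (s / 2))) <= M.
  by apply: IH => s /andP[s0 s1]; apply: h; apply/andP; split; lra.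
have : re (dmean n (fun s => f ((s + 1) / 2))) <= M.
  by apply: IH => s /andP[s0 s1]; apply: h; apply/andP; split; lra.
lra.
Qed.

Lemma qhol_cont g a : qhol g a -> cont g a. Proof. by case. Qed.

(* If [z0] beats the boundary, then for small [e] so does a maximum point [z1] of
   [sum |g_i|^2 + e |z - a|^2]; the real part of a suitable holomorphic function
   then violates the mean value property at [z1]. *)
Lemma max_principle (I : finType) (g : I -> C -> C) a (rho M : K) :
  0 < rho -> (forall z, cm (z - a) <= rho -> forall i, qhol (g i) z) ->
  (forall z, cm (z - a) = rho -> \sum_i cm (g i z) ^+ 2 <= M) ->
  forall z, cm (z - a) <= rho -> \sum_i cm (g i z) ^+ 2 <= M.
Proof.
move=> r0 hg hM z0 hz0; rewrite leNgt; apply/negP => hlt.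
set S := fun z => \sum_i cm (g i z) ^+ 2.
(* On the boundary circle the added term equals half of the excess [S z0 - M], so no maximum point
   of [u] can lie there. *)
pose e := (S z0 - M) / 2 / rho ^+ 2.
have e0 : 0 < e by rewrite /e divr_gt0 ?exprn_gt0 // divr_gt0 // subr_gt0.
pose u z := S z + e * (cm (z - a) * cm (z - a)).
have uc z : cm (z - a) <= rho -> contK u z.
  move=> hz; apply: contKD.
    apply: contK_sum => i _; have /contK_cm hc := qhol_cont (hg z hz i).
    exact: (contKM hc hc).
  have hc : contK (fun w => cm (w - a)) z.
    by apply: contK_cm; apply: contB; [exact: cont_id|exact: cont_cst].
  by apply: contKM; [exact: contK_cst|exact: (contKM hc hc)].
have [z1 hz1 z1max] := disc_max (ltW r0) uc.
have hin : cm (z1 - a) < rho.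
  rewrite lt_neqAle hz1 andbT; apply/eqP => hz1e.
  have := z1max _ hz0; have := hM _ hz1e; rewrite -/(S z1) /u hz1e.
  have : e * (rho * rho) = (S z0 - M) / 2 by rewrite /e; field; exact: lt0r_neq0.
  have : 0 <= e * (cm (z0 - a) * cm (z0 - a)).
    by apply: mulr_ge0; [exact: ltW|apply: mulr_ge0; exact: cm_ge0].
  have : M < S z0 := hlt; lra.
have /cm_ballP [d d0 hd] : \forall z \near z1, forall i, z != z1 -> hol (g i) z.
  have H i : \forall z \near z1, z != z1 -> hol (g i) z by have [] := hg z1 hz1 i.
  exact: (@filter_forall C I (fun i z => z != z1 -> hol (g i) z) (nbhs z1) _ H).
pose dl := Num.min (d / 2) (rho - cm (z1 - a)).
have dl0 : 0 < dl by rewrite lt_min; apply/andP; split; lra.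
have dl1 : dl <= d / 2 by rewrite ge_min lexx.
have dl2 : dl <= rho - cm (z1 - a) by rewrite ge_min lexx orbT.
pose A := S z1.
(* By [2 Re (conj p * q) <= |p|^2 + |q|^2] and the choice of [z1], [re (L z)] is at most
   [2 * A - e * dl ^+ 2] on the circle, while [L z1] is [2 * A]. *)
pose L z := 2 * \sum_i cj (g i z1) * g i z + rc (2 * e) * (cj (z1 - a) * (z - z1)).
have L1 : L z1 = rc (2 * A).
  rewrite /L subrr !mulr0 addr0 rcM rcn /A /S rc_sum; congr (_ * _).
  by apply: eq_bigr => i _; rewrite mulrC mul_cj.
have Lc : cont L z1.
  apply: contD; last first.
    apply: contM; first exact: cont_cst.
    apply: contM; first exact: cont_cst.
    by apply: contB; [exact: cont_id|exact: cont_cst].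
  apply: contM; first exact: cont_cst.
  apply: cont_sum => i _; apply: contM; first exact: cont_cst.
  exact: qhol_cont (hg z1 hz1 i).
have Lh z : 0 < cm (z - z1) <= dl -> hol L z.
  move=> /andP[zp zd]; have gz i : hol (g i) z.
    by apply: hd; [lra|rewrite -subr_eq0 -cm_eq0 gt_eqF].
  apply: holD; apply: holM; try exact: hol_cst.
    by apply: hol_sum => i _; apply: holM => //; exact: hol_cst.
  apply: holM; first exact: hol_cst.
  by apply: holB; [exact: hol_id|exact: hol_cst].
have Lre z : cm (z - z1) = dl -> re (L z) <= 2 * A - e * dl ^+ 2.
  move=> hz; have hz' : cm (z - a) <= rho.
    by have := cmD (z - z1) (z1 - a); rewrite addrA subrK; lra.
  have h1 := z1max _ hz'; rewrite /u -!expr2 in h1.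
  have h2 : 2 * re (\sum_i cj (g i z1) * g i z) <= S z + A.
    rewrite raddf_sum /S /A /S mulr_sumr -big_split /=; apply: ler_sum => i _.
    have := sqr_ge0 (cm (g i z - g i z1)); rewrite (cm2 (_ - _)) reB imB !cm2 reM re_cj im_cj.
    by clear; move: (re (g i z)) (im (g i z)) (re (g i z1)) (im (g i z1)) => p q r s; nra.
  have h3 : cm (z - a) ^+ 2 = cm (z1 - a) ^+ 2 + dl ^+ 2 + 2 * re (cj (z1 - a) * (z - z1)).
    rewrite -hz !cm2 reM re_cj im_cj.
    have -> : re (z - a) = re (z - z1) + re (z1 - a) by rewrite !reB; ring.
    have -> : im (z - a) = im (z - z1) + im (z1 - a) by rewrite !imB; ring.
    ring.
  have -> : re (L z) = 2 * re (\sum_i cj (g i z1) * g i z) + 2 * e * re (cj (z1 - a) * (z - z1)).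
    rewrite /L reD; congr (_ + _); last by rewrite reM re_rc im_rc mul0r subr0.
    by rewrite -rcn reM re_rc im_rc mul0r subr0.
  move: h1; rewrite h3 -/A; move: (re (cj _ * _)) (re (\sum_i _)) h2 => p q h2.
  have := e0; lra.
have [|N hN] := @mean_value _ L z1 dl dl0 Lc Lh (e * dl ^+ 2 / 2).
  by rewrite divr_gt0 // mulr_gt0 // exprn_gt0.
have {hN} h1 := hN N (leqnn N); rewrite L1 in h1.
have h2 : re (cmean N L z1 dl) <= 2 * A - e * dl ^+ 2.
  by apply: re_dmean_le => s hs; apply: Lre; rewrite cm_circ // ltW.
have := re_le (cmean N L z1 dl - L z1); rewrite reB L1 re_rc ler_norml => /andP[h3 _].
have : 0 < e * dl ^+ 2 by rewrite mulr_gt0 // exprn_gt0.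
by move: h1 h2 h3; clear; lra.
Qed.

Lemma max_principle1 g a (rho M : K) : 0 < rho -> 0 <= M ->
  (forall z, cm (z - a) <= rho -> qhol g z) ->
  (forall z, cm (z - a) = rho -> cm (g z) <= M) ->
  forall z, cm (z - a) <= rho -> cm (g z) <= M.
Proof.
move=> r0 M0 hg hM z hz.
have := @max_principle 'I_1 (fun=> g) a rho (M ^+ 2) r0.
move=> /(_ (fun z hz _ => hg z hz)) H; have {H} : \sum_(i < 1) cm (g z) ^+ 2 <= M ^+ 2.
  apply: H hz => w hw; rewrite big_ord1.
  by rewrite ler_pXn2r ?nnegrE ?cm_ge0 //; exact: hM.
by rewrite big_ord1 ler_pXn2r ?nnegrE ?cm_ge0.
Qed.
End MaximumPrinciple.

(** * The identity theorem, by division of zeros *)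

Section IdentityTheorem.
Variable K : realType.
Local Notation C := (cplx K).
Implicit Types (g h : C -> C) (a z w c p q : C).

Definition acc_zeros g p := forall e : K, 0 < e -> exists z, [/\ z != p, cm (z - p) < e & g z = 0].

(** Schwarz's lemma: on the boundary circle the denominator of the divided difference is at least
    [r], and the maximum principle carries the bound inside. *)
Lemma slope_bound g a p d (rho r M : K) : 0 < rho -> 0 < r ->
  (forall z, cm (z - p) <= rho -> qhol g z) -> cont (slope g a d) a ->
  (forall z, cm (z - p) = rho -> r <= cm (z - a)) ->
  (forall z, cm (z - p) = rho -> cm (g z - g a) <= M) -> 0 <= M ->
  forall z, cm (z - p) <= rho -> qhol (slope g a d) z /\ cm (slope g a d z) <= M / r.
Proof.
move=> rho0 r0 hg hc hr hM M0.
have hq z : cm (z - p) <= rho -> qhol (slope g a d) z.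
  by move=> hz; apply: slope_qhol; [move=> _|exact: hg].
move=> z hz; split; first exact: hq.
apply: (max_principle1 rho0 _ hq _ hz); first by rewrite divr_ge0 // ltW.
move=> w hw; have hwr := hr w hw.
have wa : w != a by rewrite -subr_eq0 -cm_gt0; exact: lt_le_trans hwr.
rewrite /slope (negbTE wa) cmM cmV.
apply: ler_pM; rewrite ?cm_ge0 ?invr_ge0 ?cm_ge0 //; first exact: hM.
by rewrite lef_pV2 // posrE //; exact: lt_le_trans hwr.
Qed.

(** Dividing out a zero within [rho / 4] of [p] gains a factor [2 / 3]: the quotient is at most
    [M / (3 / 4 * rho)], and the restored factor is at most [rho / 2]. The remaining zeros still
    accumulate at [p], so the gain repeats; this takes the place of power series. *)
Lemma zeros_decay (m : nat) g p (rho M : K) : 0 < rho ->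
  (forall z, cm (z - p) <= rho -> qhol g z) ->
  (forall z, cm (z - p) <= rho -> cm (g z) <= M) -> acc_zeros g p ->
  forall z, cm (z - p) <= rho / 4 -> cm (g z) <= M * (2 / 3) ^+ m.
Proof.
move=> rho0; elim: m g M => [|m IH] g M hq hM ha z hz.
  by rewrite expr0 mulr1; apply: hM; lra.
have pp : cm (p - p) <= rho by rewrite subrr cm0 ltW.
have M0 : 0 <= M := le_trans (cm_ge0 _) (hM p pp).
have [_ /cm_ballP [d d0 hd]] := hq p pp.
have [|z1 [z1p]] := ha (Num.min d (rho / 4)); first by rewrite lt_min d0; lra.
rewrite lt_min => /andP[z1d z1r] gz1.
have [D sc sE] := hol_slope (hd _ z1d z1p).
have hr w : cm (w - p) = rho -> 3 / 4 * rho <= cm (w - z1).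
  by move=> hw; have := cmD (w - z1) (z1 - p); rewrite addrA subrK; lra.
have hM' w : cm (w - p) = rho -> cm (g w - g z1) <= M.
  by move=> hw; rewrite gz1 subr0; apply: hM; rewrite hw.
have r0 : 0 < 3 / 4 * rho by lra.
have hb := slope_bound rho0 r0 hq sc hr hM' M0.
have ha' : acc_zeros (slope g z1 D) p.
  move=> e e0; have [|z2 [z2p]] := ha (Num.min e (cm (z1 - p))).
    by rewrite lt_min e0 cm_gt0 subr_eq0.
  rewrite lt_min => /andP[z2e z21] gz2; exists z2; split=> //.
  rewrite /slope; case: eqVneq => [z21e|_]; first by move: z21; rewrite z21e ltxx.
  by rewrite gz2 gz1 subrr mul0r.
have := IH _ _ (fun w hw => (hb w hw).1) (fun w hw => (hb w hw).2) ha' z hz.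
rewrite sE gz1 add0r cmM exprS => h.
have h2 : cm (z - z1) <= rho / 2.
  by have := cmB (z - p) (z1 - p); rewrite opprB addrA subrK; lra.
have -> : M * (2 / 3 * (2 / 3) ^+ m) = M / (3 / 4 * rho) * (2 / 3) ^+ m * (rho / 2).
  by field; apply: lt0r_neq0.
by apply: ler_pM; rewrite ?cm_ge0.
Qed.

Lemma pow_lt (x M e : K) : 0 <= x < 1 -> 0 < e -> exists m, M * x ^+ m < e.
Proof.
move=> /andP[x0 x1] e0; pose M' := `|M| + 1.
have M0 : 0 < M' by rewrite /M'; have := normr_ge0 M; lra.
have : (fun m => x ^+ m) @ \oo --> (0 : K) by apply: cvg_expr; rewrite ger0_norm.
move=> /cvgrPdist_lt /(_ (e / M')) []; first by rewrite divr_gt0.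
move=> N _ /(_ N (leqnn N)); rewrite sub0r normrN ger0_norm ?exprn_ge0 //.
rewrite ltr_pdivlMr // mulrC => h; exists N; apply: le_lt_trans h.
by apply: ler_wpM2r; rewrite ?exprn_ge0 // /M'; have := ler_norm M; lra.
Qed.

Lemma le_pow_eq0 (x M y : K) : 0 <= x < 1 -> 0 <= y -> (forall m, y <= M * x ^+ m) -> y = 0.
Proof.
move=> x01 y0 h; apply/eqP; rewrite eq_le y0 andbT leNgt; apply/negP => yp.
by have [m hm] := pow_lt M x01 yp; have := h m; lra.
Qed.

Lemma identity_local g p : (\forall z \near p, hol g z) -> acc_zeros g p ->
  \forall z \near p, g z = 0.
Proof.
move=> /cm_ballP [d d0 hd] ha; pose rho := d / 2.
have rho0 : 0 < rho by rewrite /rho; lra.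
have gq z : cm (z - p) <= rho -> qhol g z.
  move=> hz; apply: hol_qhol; apply/cm_ballP; exists (d / 2); first by lra.
  move=> w hw; apply: hd; have := cmD (w - z) (z - p); rewrite addrA subrK.
  by rewrite /rho in hz; lra.
have [z1 _ hM] := @disc_max _ p rho (fun z => cm (g z)) (ltW rho0)
  (fun z hz => contK_cm (qhol_cont (gq z hz))).
apply/cm_ballP; exists (rho / 4); first by lra.
move=> z hz; apply/eqP; rewrite -cm_eq0; apply/eqP.
apply: (@le_pow_eq0 (2 / 3) (cm (g z1))); rewrite ?cm_ge0 //; first by apply/andP; split; lra.
by move=> m; apply: (zeros_decay m rho0 gq hM ha); exact: ltW.
Qed.

Lemma itv_induction (P : K -> Prop) : P 0 ->
  (forall t : K, 0 <= t <= 1 -> P t -> exists2 d, 0 < d & forall s : K, 0 <= s <= 1 -> `|s - t| < d -> P s) ->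
  (forall t : K, 0 <= t <= 1 -> (forall d, 0 < d -> exists s : K, [/\ 0 <= s <= 1, `|s - t| < d & P s]) -> P t) ->
  forall t : K, 0 <= t <= 1 -> P t.
Proof.
move=> P0 Po Pc; pose S := [set t : K | 0 <= t <= 1 /\ forall s : K, 0 <= s <= t -> P s].
have S0 : S 0.
  split; first by apply/andP; split; lra.
  by move=> s hs; have -> : s = 0 by lra.
have hs : has_sup S by split; [exists 0|exists 1 => t [/andP[]]].
have u0 : 0 <= sup S by apply: (sup_upper_bound hs).
have u1 : sup S <= 1 by apply: ge_sup; [exists 0|move=> t [/andP[]]].
have below s : 0 <= s < sup S -> P s.
  move=> /andP[s0 su]; have [t [_ tS] st] := sup_adherent (eps := sup S - s) ltac:(lra) hs.
  by apply: tS; lra.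
have Pu : P (sup S).
  case: (eqVneq (sup S) 0) => [->//|un0].
  have up : 0 < sup S by rewrite lt0r un0.
  apply: Pc; first by rewrite u0.
  move=> d d0; exists (Num.max 0 (sup S - d / 2)).
  have m1 : 0 <= Num.max 0 (sup S - d / 2) by rewrite le_max lexx.
  have m2 : sup S - d / 2 <= Num.max 0 (sup S - d / 2) by rewrite le_max lexx orbT.
  have m3 : Num.max 0 (sup S - d / 2) < sup S by rewrite gt_max up /=; lra.
  split; [lra|rewrite ler0_norm; lra|by apply: below; rewrite m1].
have [|d d0 hd] := Po (sup S) _ Pu; first by rewrite u0.
have : sup S = 1.
  apply/eqP; rewrite eq_le u1 leNgt /=; apply/negP => ul.
  pose t := Num.min 1 (sup S + d / 2).
  have t1 : t <= 1 by rewrite ge_min lexx.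
  have t2 : t <= sup S + d / 2 by rewrite ge_min lexx orbT.
  have t3 : sup S < t by rewrite lt_min ul /=; lra.
  have : S t.
    split; first by lra.
    move=> s /andP[s0 st]; case: (ltP s (sup S)) => su; first by apply: below; rewrite s0.
    apply: hd; first by rewrite s0 (le_trans st).
    rewrite ger0_norm ?subr_ge0 // ltrBlDl (le_lt_trans st) // (le_lt_trans t2) //.
    by rewrite ltrD2l ltr_pdivrMr // ltr_pMr // ltr1n.
  by move/(sup_upper_bound hs); lra.
move=> us t /andP[t0 t1]; case: (ltP t (sup S)) => tu; first by apply: below; rewrite t0.
by have -> : t = sup S by lra.
Qed.

Lemma zero_near_ex g a b (e : K) : (\forall z \near a, g z = 0) -> 0 < e ->
  exists z, [/\ z != b, cm (z - a) < e & g z = 0].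
Proof.
move=> /cm_ballP [d d0 hd] e0; pose m := Num.min d e / 2.
have m0 : 0 < m by rewrite /m divr_gt0 // lt_min d0.
have m1 : m < d by have : Num.min d e <= d; [rewrite ge_min lexx|rewrite /m; lra].
have m2 : m < e by have : Num.min d e <= e; [rewrite ge_min lexx orbT|rewrite /m; lra].
have cmz (x : K) : 0 < x -> cm (a + rc x - a) = x.
  by move=> x0; rewrite addrC addKr cm_rc gtr0_norm.
case: (eqVneq (a + rc m) b) => [ab|ab]; last first.
  by exists (a + rc m); split; rewrite ?cmz //; apply: hd; rewrite cmz.
have m20 : 0 < m / 2 by lra.
exists (a + rc (m / 2)); split; [|by rewrite cmz //; lra|by apply: hd; rewrite cmz //; lra].
rewrite -ab -subr_eq0 opprD addrACA subrr add0r -rcB -cm_eq0 cm_rc normr_eq0.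
by apply/eqP; lra.
Qed.

Lemma segment_near a b (t e : K) : 0 < e -> exists2 d, 0 < d &
  forall s : K, `|s - t| < d -> cm (a + rc s * b - (a + rc t * b)) < e.
Proof.
move=> e0; have b0 := cm_ge0 b; exists (e / (cm b + 1)); first by rewrite divr_gt0 //; lra.
move=> s; rewrite ltr_pdivlMr; last by lra.
have -> : a + rc s * b - (a + rc t * b) = rc (s - t) * b by rewrite rcB; ring.
by rewrite cmM cm_rc; have := normr_ge0 (s - t); nra.
Qed.

(** Every later continuation along a path follows a segment, and holomorphy near the segment is all
    that it requires. *)
Theorem identity_segment g p v :
  (forall t : K, 0 <= t <= 1 -> \forall z \near (p + rc t * v), hol g z) ->
  acc_zeros g p -> forall t : K, 0 <= t <= 1 -> \forall z \near (p + rc t * v), g z = 0.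
Proof.
move=> hg ha; apply: itv_induction.
- have := hg 0; rewrite rc0 mul0r addr0 => /(_ _)/identity_local; apply => //.
  by apply/andP; split; lra.
- move=> t ht /cm_ballP [d d0 hd].
  have d20 : 0 < d / 2 by lra.
  have [d' d'0 hd'] := segment_near p v t d20; exists d' => // s hs /hd' st.
  apply/cm_ballP; exists (d / 2) => // z hz; apply: hd.
  by have := cmD (z - (p + rc s * v)) (p + rc s * v - (p + rc t * v)); rewrite addrA subrK; lra.
- move=> t ht H; apply: identity_local; first exact: hg.
  move=> e e0; have e20 : 0 < e / 2 by lra.
  have [d d0 hd] := segment_near p v t e20.
  have [s [hs /hd st Ps]] := H _ d0.
  have [z [zt zs gz]] := zero_near_ex (p + rc t * v) Ps e20.
  exists z; split=> //.
  by have := cmD (z - (p + rc s * v)) (p + rc s * v - (p + rc t * v)); rewrite addrA subrK; lra.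
Qed.

(** Two applications of [slope_bound] bound the second divided difference. The constants depend on
    [M] and [rho] alone, so the estimate can be averaged over a family. *)
Lemma quadratic_remainder g a (rho M : K) : 0 < rho ->
  (forall z, cm (z - a) < 2 * rho -> hol g z) ->
  (forall z, cm (z - a) < 2 * rho -> cm (g z) <= M) ->
  exists2 d, cm d <= 2 * M / rho & forall z, cm (z - a) <= rho / 2 ->
    cm (g z - g a - d * (z - a)) <= 8 * M / rho ^+ 2 * cm (z - a) ^+ 2.
Proof.
move=> rho0 hg hM.
have hq z : cm (z - a) <= rho -> qhol g z.
  move=> hz; apply: hol_qhol; apply/cm_ballP; exists (2 * rho - cm (z - a)); first by lra.
  by move=> w hw; apply: hg; have := cmD (w - z) (z - a); rewrite addrA subrK; lra.
have aa : cm (a - a) = 0 by rewrite subrr cm0.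
have [d sc sE] := hol_slope (hg a ltac:(rewrite aa; lra)).
have Ma := hM a ltac:(rewrite aa; lra).
have M0 := le_trans (cm_ge0 _) Ma.
have hb : forall z, cm (z - a) <= rho -> qhol (slope g a d) z /\ cm (slope g a d z) <= 2 * M / rho.
  apply: slope_bound => //; try lra; first by move=> w ->.
  by move=> w hw; have := cmB (g w) (g a); have := hM w; rewrite hw => /(_ ltac:(lra)); lra.
have sa : slope g a d a = d by rewrite /slope eqxx.
exists d; first by rewrite -[X in cm X]sa; apply: (hb a _).2; rewrite aa ltW.
move=> z hz; case: (eqVneq z a) => [->|za].
  by rewrite !subrr mulr0 subrr cm0 expr0n mulr0.
have hz' : hol (slope g a d) z by apply: hol_slope_off => //; apply: hg; lra.
have [d' sc' sE'] := hol_slope hz'.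
have r20 : 0 < rho / 2 by lra.
have M1 : 0 <= 4 * M / rho by rewrite divr_ge0 ?(ltW rho0) //; lra.
have : cm (slope (slope g a d) z d' a) <= 4 * M / rho / (rho / 2).
  apply: (slope_bound (p := a) rho0 r20 (fun w hw => (hb w hw).1) sc' _ _ M1 _).2.
  - by move=> w hw; have := cmD (w - z) (z - a); rewrite addrA subrK; lra.
  - move=> w hw; have := cmB (slope g a d w) (slope g a d z).
    have := (hb w ltac:(lra)).2; have := (hb z ltac:(lra)).2.
    have -> : 4 * M / rho = 2 * M / rho + 2 * M / rho by field; exact: lt0r_neq0.
    lra.
  - by rewrite aa ltW.
rewrite /slope eqxx (negbTE za) eq_sym (negbTE za) cmM cmV ler_pdivrMr; last first.
  by rewrite cm_gt0 subr_eq0 eq_sym.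
move=> h; have -> : g z - g a - d * (z - a) = - ((d - (g z - g a) / (z - a)) * (z - a)).
  by field; rewrite subr_eq0.
rewrite cmN cmM expr2 mulrA ler_wpM2r ?cm_ge0 //; apply: le_trans h _.
have -> : 4 * M / rho / (rho / 2) = 8 * M / rho ^+ 2 by field; exact: lt0r_neq0.
by rewrite cmBC.
Qed.
End IdentityTheorem.

(** * Cauchy's formula on rings and removable singularities *)

Section CauchyFormula.
Variable K : realType.
Local Notation C := (cplx K).
Implicit Types (g h : C -> C) (a z w c l : C) (u v : nat -> C) (f : K -> C).

Fact ultra_nat : exists U : set_system nat, UltraFilter U /\ \oo `<=` U.
Proof. exact: ultraFilterLemma. Qed.

(* Limits along a fixed ultrafilter exist for all bounded sequences. *)
Definition nat_ultra : set_system nat := sval (cid ultra_nat).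
Local Notation U := nat_ultra.
#[local] Instance nat_ultra_ultra : UltraFilter U := (svalP (cid ultra_nat)).1.
#[local] Instance nat_ultra_proper : ProperFilter U := @ultra_proper _ _ nat_ultra_ultra.

Definition is_ulim u l := forall e : K, 0 < e -> U [set n | cm (u n - l) < e].

Lemma is_ulim_small u l : small (fun n => u n - l) -> is_ulim u l.
Proof.
move=> h e e0; have [|N hN] := h (e / 2); first by lra.
apply: (svalP (cid ultra_nat)).2; exists N => // n hn; rewrite /=.
by apply: le_lt_trans (hN n hn) _; lra.
Qed.

Lemma is_ulimD u v l l' : is_ulim u l -> is_ulim v l' -> is_ulim (fun n => u n + v n) (l + l').
Proof.
move=> hu hv e e0; have e20 : 0 < e / 2 by lra.
apply: filterS (filterI (hu _ e20) (hv _ e20)) => n /= [h1 h2].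
by have := cmD (u n - l) (v n - l'); rewrite addrACA -opprD; lra.
Qed.

Lemma is_ulimZ c u l : is_ulim u l -> is_ulim (fun n => c * u n) (c * l).
Proof.
move=> hu e e0; have c0 := cm_ge0 c.
have e20 : 0 < e / (cm c + 1) by rewrite divr_gt0 //; lra.
apply: filterS (hu _ e20) => n /=; rewrite -mulrBr cmM ltr_pdivlMr; last by lra.
by have := cm_ge0 (u n - l); nra.
Qed.

Lemma is_ulim_le u l (M : K) : is_ulim u l -> (forall n, cm (u n) <= M) -> cm l <= M.
Proof.
move=> hu hM; rewrite leNgt; apply/negP => Ml.
have e0 : 0 < cm l - M by lra.
have [n /= hn] := @filter_ex _ U _ _ (hu _ e0).
by have := hM n; have := cmBl l (u n); rewrite cmBC; lra.
Qed.

Lemma is_ulim_unique u l l' : is_ulim u l -> is_ulim u l' -> l = l'.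
Proof.
move=> h h'; apply/eqP; rewrite -subr_eq0 -cm_eq0 eq_le cm_ge0 andbT.
apply: (@is_ulim_le (fun n => u n + (-1) * u n)); last first.
  by move=> n; rewrite mulN1r subrr cm0.
have -> : l - l' = l + -1 * l' by rewrite mulN1r.
by apply: is_ulimD => //; exact: is_ulimZ.
Qed.

Lemma is_ulim_ex u (M : K) : (forall n, cm (u n) <= M) -> exists l, is_ulim u l.
Proof.
move=> hM; have [|l [_ hl]] := @disc_compact K 0 M (u @ U) _.
  by apply: filterS (@filterT _ U _) => n _ /=; rewrite subr0.
exists l => e e0; case: (in_ultra_setVsetC [set n | cm (u n - l) < e] nat_ultra_ultra) => // hn.
have [|w [/= h1 h2]] := hl [set w | ~ (cm (w - l) < e)] [set w | cm (w - l) < e] hn _.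
  by apply/cm_ballP; exists e.
by [].
Qed.

Definition ulim u : C := xget 0 (is_ulim u).

Lemma ulimP u (M : K) : (forall n, cm (u n) <= M) -> is_ulim u (ulim u).
Proof. by move=> /is_ulim_ex h; exact: xgetPex. Qed.

Lemma ulimE u l : is_ulim u l -> ulim u = l.
Proof. by move=> h; apply: (is_ulim_unique _ h); apply: xgetPex; exists l. Qed.

Definition bdd f := exists M : K, forall s : K, 0 <= s <= 1 -> cm (f s) <= M.

(** A linear mean defined on all bounded functions, whether or not the sums converge. *)
Definition umean f : C := ulim (fun n => dmean n f).

Lemma umeanP f : bdd f -> is_ulim (fun n => dmean n f) (umean f).
Proof. by move=> [M hM]; apply: (@ulimP _ M) => n; exact: dmean_le. Qed.

Lemma bddZ c f : bdd f -> bdd (fun s => c * f s).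
Proof. by move=> [M hM]; exists (cm c * M) => s hs; rewrite cmM ler_wpM2l ?cm_ge0 //; exact: hM. Qed.

Lemma umeanD f f' : bdd f -> bdd f' -> umean (fun s => f s + f' s) = umean f + umean f'.
Proof.
move=> hf hf'; apply: ulimE; under eq_fun do rewrite dmeanD.
by apply: is_ulimD; exact: umeanP.
Qed.

Lemma umeanZ c f : bdd f -> umean (fun s => c * f s) = c * umean f.
Proof.
move=> hf; apply: ulimE; under eq_fun do rewrite dmeanZ.
by apply: is_ulimZ; exact: umeanP.
Qed.

Lemma eq_umean f f' : (forall s : K, 0 <= s <= 1 -> f s = f' s) -> umean f = umean f'.
Proof. by move=> h; congr ulim; apply/funext => n; exact: eq_dmean. Qed.

Lemma umeanB f f' : bdd f -> bdd f' -> umean (fun s => f s - f' s) = umean f - umean f'.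
Proof.
move=> hf hf'; rewrite -(mulN1r (umean f')) -umeanZ // -umeanD //; last exact: bddZ.
by apply: eq_umean => s _; rewrite mulN1r.
Qed.

Lemma umean_le f (M : K) : (forall s : K, 0 <= s <= 1 -> cm (f s) <= M) -> cm (umean f) <= M.
Proof.
move=> h; apply: (is_ulim_le (umeanP _)); first by exists M.
by move=> n; exact: dmean_le.
Qed.

Lemma umean_cst c : umean (fun=> c) = c.
Proof.
apply: ulimE => e e0; apply: filterS (@filterT _ U _) => n _ /=.
by rewrite dmean_cst subrr cm0.
Qed.

Lemma umean_small f c : small (fun n => dmean n f - c) -> umean f = c.
Proof. by move=> h; apply: ulimE; exact: is_ulim_small. Qed.

Lemma umean_small2 f f' : bdd f -> bdd f' -> small (fun n => dmean n f - dmean n f') ->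
  umean f = umean f'.
Proof.
move=> hf hf' h; apply/eqP; rewrite -subr_eq0 -umeanB //; apply/eqP.
apply: umean_small; apply: eq_small h => n; by rewrite dmeanB subr0.
Qed.

Lemma hol_of_quadratic g a d (r c : K) : 0 < r ->
  (forall z, cm (z - a) <= r -> cm (g z - g a - d * (z - a)) <= c * cm (z - a) ^+ 2) -> hol g a.
Proof.
move=> r0 h; exists (slope g a d); last first.
  move=> z; rewrite /slope; case: eqVneq => [->|za]; first by rewrite subrr mulr0 addr0.
  by rewrite divfK ?subr_eq0 // addrC subrK.
apply/contP => e e0; have c0 : 0 < `|c| + 1 by have := normr_ge0 c; lra.
exists (Num.min r (e / (`|c| + 1))); first by rewrite lt_min r0 divr_gt0.
move=> z; rewrite lt_min => /andP[zr ze].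
rewrite /slope eqxx; case: eqVneq => [_|za]; first by rewrite subrr cm0.
have z0 : 0 < cm (z - a) by rewrite cm_gt0 subr_eq0.
have -> : (g z - g a) / (z - a) - d = (g z - g a - d * (z - a)) / (z - a).
  by field; rewrite subr_eq0.
rewrite cmM cmV ltr_pdivrMr //; apply: le_lt_trans (h z (ltW zr)) _.
rewrite expr2 mulrA ltr_pM2r //; move: ze; rewrite ltr_pdivlMr //.
have := ler_norm c; nra.
Qed.

(** Differentiation under the mean: the remainders of [quadratic_remainder] are uniform in [s], so
    their mean is still quadratic. *)
Lemma hol_umean (f : K -> C -> C) a (rho M : K) : 0 < rho ->
  (forall s : K, 0 <= s <= 1 -> forall t, cm (t - a) < rho -> hol (f s) t /\ cm (f s t) <= M) ->
  hol (fun t => umean (fun s => f s t)) a.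
Proof.
move=> rho0 h; pose r := rho / 2; have r0 : 0 < r by rewrite /r; lra.
have r2 : 2 * r = rho by rewrite /r; field.
(* The derivatives are picked by choice, with default 0 outside the interval; boundedness is all
   that [umean] asks of the resulting function of [s]. *)
have D (s : K) : {d : C | 0 <= s <= 1 -> cm d <= 2 * M / r /\ forall z, cm (z - a) <= r / 2 ->
    cm (f s z - f s a - d * (z - a)) <= 8 * M / r ^+ 2 * cm (z - a) ^+ 2}.
  apply: cid; case: (boolP (0 <= s <= 1)) => [hs|_]; last by exists 0.
  have [||d h1 h2] := @quadratic_remainder _ (f s) a r M r0.
  - by move=> z; rewrite r2 => /(h s hs)[].
  - by move=> z; rewrite r2 => /(h s hs)[].
  - by exists d.
have bD : bdd (fun s => sval (D s)) by exists (2 * M / r) => s hs; have [] := svalP (D s) hs.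
have bf t : cm (t - a) < rho -> bdd (fun s => f s t).
  by move=> ht; exists M => s hs; have [] := h s hs t ht.
apply: (@hol_of_quadratic _ a (umean (fun s => sval (D s))) (r / 2) (8 * M / r ^+ 2)); first by lra.
move=> z hz; have hz' : cm (z - a) < rho by lra.
have ba : bdd (f^~ a) by apply: bf; rewrite subrr cm0.
have bza : bdd (fun s => f s z - f s a).
  have [M1 h1] := bf _ hz'; have [M2 h2] := ba; exists (M1 + M2) => s hs.
  by have := cmB (f s z) (f s a); have := h1 s hs; have := h2 s hs; lra.
have -> : umean (f^~ z) - umean (f^~ a) - umean (fun s => sval (D s)) * (z - a) =
    umean (fun s => (f s z - f s a) - (z - a) * sval (D s)).
  rewrite (umeanB bza (bddZ (z - a) bD)).
  by rewrite (umeanB (bf z hz') ba) (umeanZ (z - a) bD) (mulrC (z - a)).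
by apply: umean_le => s hs; rewrite (mulrC (z - a)); exact: (svalP (D s) hs).2.
Qed.

Definition circmean g a (rho : K) : C := umean (fun s => g (circ a rho s)).

Lemma circ_bdd g a (rho : K) : 0 <= rho -> (forall z, cm (z - a) = rho -> cont g z) ->
  bdd (fun s => g (circ a rho s)).
Proof. by move=> r0 h; have [M _ hM] := circle_bounded r0 h; exists M. Qed.

Lemma circmean_ring g a (r1 r2 : K) : 0 < r1 -> r1 <= r2 ->
  (forall z, r1 <= cm (z - a) <= r2 -> hol g z) -> circmean g a r2 = circmean g a r1.
Proof.
move=> r10 r12 h; have r20 := lt_le_trans r10 r12.
apply: umean_small2; last exact: cmean_ring.
  by apply: circ_bdd; [exact: ltW|move=> z hz; apply/hol_cont/h; rewrite hz r12 lexx].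
by apply: circ_bdd; [exact: ltW|move=> z hz; apply/hol_cont/h; rewrite hz r12 lexx].
Qed.

Lemma circmean_center g a (rho : K) : 0 < rho -> cont g a ->
  (forall z, 0 < cm (z - a) <= rho -> hol g z) -> circmean g a rho = g a.
Proof. by move=> r0 gc hg; apply: umean_small; exact: mean_value. Qed.

(** Cauchy's kernel [1 / (w - z)] relative to the normalised angle: on a circle about [a],
    [dw / (2 pi i)] is [w - a] times the angle element. *)
Definition kernel a z w : C := (w - a) / (w - z).

Lemma hol_kernel a z w : w != z -> hol (kernel a z) w.
Proof.
move=> wz; apply: hol_div; rewrite ?subr_eq0 //; apply: holB;
  by [exact: hol_id|exact: hol_cst].
Qed.

Lemma cm_neq a z w : cm (w - a) != cm (z - a) -> w != z.
Proof. by apply: contraNneq => ->. Qed.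

Lemma kernel_mean_in a z (rho : K) : 0 < rho -> rho < cm (z - a) -> circmean (kernel a z) a rho = 0.
Proof.
move=> r0 rz; rewrite circmean_center //.
- by rewrite /kernel subrr mul0r.
- by apply/hol_cont/hol_kernel/(@cm_neq a); rewrite subrr cm0 lt_eqF // (lt_trans r0).
- move=> w /andP[_ hw]; apply/hol_kernel/(@cm_neq a).
  by rewrite lt_eqF //; exact: le_lt_trans rz.
Qed.

(** The kernel is 1 plus [(z - a) / (w - z)]; the mean of the latter does not depend on the radius
    and tends to 0 as the radius grows. *)
Lemma kernel_mean_out a z (rho : K) : cm (z - a) < rho -> circmean (kernel a z) a rho = 1.
Proof.
move=> rz; have z0 := cm_ge0 (z - a); have r0 := le_lt_trans z0 rz.
pose p w : C := (z - a) / (w - z).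
have hp w : cm (z - a) < cm (w - a) -> hol p w.
  move=> hw; apply: hol_div; first by rewrite subr_eq0 (@cm_neq a) // gt_eqF.
    exact: hol_cst.
  by apply: holB; [exact: hol_id|exact: hol_cst].
have bp r : rho <= r -> bdd (fun s => p (circ a r s)).
  move=> hr; apply: circ_bdd; first by lra.
  by move=> w hw; apply/hol_cont/hp; rewrite hw; lra.
have -> : circmean (kernel a z) a rho = 1 + circmean p a rho.
  have b1 : bdd (fun=> 1 : C) by exists 1 => s _; rewrite cm1.
  rewrite /circmean -[X in X + _](umean_cst 1) -(umeanD b1 (bp rho (lexx _))).
  apply: eq_umean => s _; rewrite /kernel /p.
  have : circ a rho s - z != 0.
    by rewrite subr_eq0 (@cm_neq a) // cm_circ ?gt_eqF // ltW.
  by move=> h; field.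
suff -> : circmean p a rho = 0 by rewrite addr0.
apply/eqP; rewrite -cm_eq0 eq_le cm_ge0 andbT leNgt; apply/negP => h.
set m := cm (circmean p a rho) in h.
(* A radius so large that the bound [cm (z - a) / (r - cm (z - a))] falls below [m]. *)
pose r := rho + cm (z - a) + 2 * cm (z - a) / m.
have q0 : 0 <= 2 * cm (z - a) / m by rewrite divr_ge0 ?(ltW h) //; lra.
have rr : rho <= r by rewrite /r; lra.
have : m <= cm (z - a) / (r - cm (z - a)).
  rewrite /m -(circmean_ring r0 rr); last by move=> w hw; apply: hp; lra.
  apply: umean_le => s _; rewrite /p cmM cmV ler_wpM2l //.
  rewrite lef_pV2 ?posrE; [|rewrite cm_gt0 subr_eq0 (@cm_neq a) // cm_circ; lra|lra].
  have := cmBl (circ a r s - a) (z - a); rewrite cm_circ; last by lra.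
  by rewrite opprB addrA subrK.
rewrite ler_pdivlMr; last by lra.
have -> : r - cm (z - a) = rho + 2 * cm (z - a) / m by rewrite /r; ring.
rewrite mulrDr mulrCA divff ?gt_eqF // mulr1.
have := mulr_gt0 h r0; lra.
Qed.

(** The function [h], the divided difference at [z] times [w - a], is only known to be continuous at
    [z]; its means are compared across the circle through [z] by [cmean_ring_crossing]. *)
Lemma cauchy_ring g a z (r1 r2 : K) : 0 < r1 -> r1 < cm (z - a) < r2 ->
  (forall w, r1 <= cm (w - a) <= r2 -> hol g w) ->
  circmean (fun w => g w * kernel a z w) a r2 - circmean (fun w => g w * kernel a z w) a r1 = g z.
Proof.
move=> r10 /andP[rz1 rz2] hg.
have [d sc sE] := hol_slope (hg z ltac:(lra)).
pose h w := slope g z d w * (w - a).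
have hh w : r1 <= cm (w - a) <= r2 -> w != z -> hol h w.
  move=> hw wz; apply: holM; first by apply: hol_slope_off => //; exact: hg.
  by apply: holB; [exact: hol_id|exact: hol_cst].
have hc w : r1 <= cm (w - a) <= r2 -> cont h w.
  move=> hw; case: (eqVneq w z) => [->|wz]; last by apply/hol_cont/hh.
  apply: contM; first exact: sc.
  by apply: contB; [exact: cont_id|exact: cont_cst].
have neq r s : 0 <= r -> r != cm (z - a) -> circ a r s != z.
  by move=> r0 rz; rewrite (@cm_neq a) // cm_circ.
have kb r : r1 <= r <= r2 -> r != cm (z - a) -> bdd (fun s => g (circ a r s) * kernel a z (circ a r s)) /\
    bdd (fun s => kernel a z (circ a r s)).
  move=> hr rz; split.
    apply: (@circ_bdd (fun w => g w * kernel a z w)); first by lra.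
    move=> w hw; apply: hol_cont; apply: holM; first by apply: hg; rewrite hw.
    by apply/hol_kernel/(@cm_neq a); rewrite hw.
  apply: circ_bdd; first by lra.
  by move=> w hw; apply/hol_cont/hol_kernel/(@cm_neq a); rewrite hw.
have E r : r1 <= r <= r2 -> r != cm (z - a) -> circmean h a r =
    circmean (fun w => g w * kernel a z w) a r - g z * circmean (kernel a z) a r.
  move=> hr rz; have [b1 b2] := kb r hr rz.
  rewrite /circmean -umeanZ // -umeanB //; last exact: bddZ.
  apply: eq_umean => s _; have cz := neq r s ltac:(lra) rz.
  by rewrite /h /slope (negbTE cz) /kernel; field; rewrite subr_eq0.
have : circmean h a r2 = circmean h a r1.
  apply: umean_small2.
  - by apply: circ_bdd; [lra|move=> w hw; apply: hc; lra].
  - by apply: circ_bdd; [lra|move=> w hw; apply: hc; lra].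
  - apply: (@cmean_ring_crossing _ h a r1 (cm (z - a)) r2).
    + exact: r10.
    + by rewrite rz1.
    + by move=> w hw /cm_neq wz; exact: hh.
    + by move=> w hw; apply: hc; lra.
have r12 : r1 <= r2 by lra.
rewrite (E r2 ltac:(by rewrite r12 lexx) ltac:(by rewrite gt_eqF)).
rewrite (E r1 ltac:(by rewrite r12 lexx) ltac:(by rewrite lt_eqF)).
rewrite (kernel_mean_in r10 rz1) (kernel_mean_out rz2) mulr0 mulr1 subr0 => <-.
by rewrite opprB addrC subrK.
Qed.

(** On a ring about [a] Cauchy's formula has an outer term, holomorphic at [a], and an inner one
    that vanishes with the inner radius because [g] is bounded. *)
Theorem removable_singularity g a : qhol g a -> hol g a.
Proof.
move=> [gc /cm_ballP [d d0 hd]].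
have /contP /(_ _ ltr01) [d' d'0 hd'] := gc.
pose M := cm (g a) + 1; pose rho := Num.min d d' / 2.
have M0 : 0 < M by rewrite /M; have := cm_ge0 (g a); lra.
have rho0 : 0 < rho by rewrite /rho divr_gt0 // lt_min d0.
have rd : rho < d by have : Num.min d d' <= d; [rewrite ge_min lexx|rewrite /rho; lra].
have rd' : rho < d' by have : Num.min d d' <= d'; [rewrite ge_min lexx orbT|rewrite /rho; lra].
have gM w : cm (w - a) <= rho -> cm (g w) <= M.
  by move=> hw; have := cmBl (g w) (g a); have := hd' w ltac:(lra); rewrite /M; lra.
have gh w : 0 < cm (w - a) <= rho -> hol g w.
  by move=> hw; apply: hd; [lra|rewrite -subr_eq0 -cm_gt0; lra].
pose Phi z := circmean (fun w => g w * kernel a z w) a rho.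
have PhiE z : 0 < cm (z - a) < rho -> g z = Phi z.
  move=> /andP[z0 zr]; apply/eqP; rewrite -subr_eq0 -cm_eq0 eq_le cm_ge0 andbT leNgt; apply/negP => h.
  set m := cm (g z - Phi z) in h.
  (* Solves [M * r / (cm (z - a) - r) < m]: with this [r] the left side is [M * m / (2 * M + m)]. *)
  pose r := cm (z - a) * m / (2 * (M + m)).
  have r0 : 0 < r by rewrite /r divr_gt0 ?mulr_gt0 //; lra.
  have rE : r * (2 * (M + m)) = cm (z - a) * m by rewrite /r divfK // gt_eqF //; lra.
  have rz : r < cm (z - a) by rewrite -(ltr_pM2r (x := 2 * (M + m))) ?rE ?ltr_pM2l //; lra.
  have := cauchy_ring (g := g) r0 (z := z) (a := a) (r2 := rho).
  rewrite rz zr => /(_ isT) CR.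
  have {CR} : Phi z - g z = circmean (fun w => g w * kernel a z w) a r.
    by rewrite -CR ?opprB 1?addrC ?subrK // => w hw; apply: gh; lra.
  move=> /(congr1 (@cm K)); rewrite cmBC -/m => mE.
  have : m <= M * (r / (cm (z - a) - r)).
    rewrite mE; apply: umean_le => s _; rewrite cmM; apply: ler_pM; rewrite ?cm_ge0 //.
      by apply: gM; rewrite cm_circ; lra.
    rewrite /kernel cmM cmV cm_circ; last exact: ltW.
    rewrite ler_wpM2l ?(ltW r0) // lef_pV2 ?posrE.
    2: by rewrite cm_gt0 subr_eq0 (@cm_neq a) // cm_circ ?lt_eqF // ltW.
    2: by lra.
    have := cmBl (z - a) (circ a r s - a); rewrite cm_circ; last exact: ltW.
    by rewrite (cmBC (circ _ _ _)) opprB addrA subrK.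
  rewrite mulrA ler_pdivlMr; last by lra.
  have := mulr_gt0 M0 r0; have := mulr_gt0 h r0; have := mulr_gt0 h z0; lra.
have Phih : hol Phi a.
  apply: (@hol_umean _ a (rho / 2) (M * (rho / (rho / 2)))); first by lra.
  move=> s hs t ht.
  have cr : cm (circ a rho s - a) = rho by rewrite cm_circ // ltW.
  have tr : rho / 2 <= cm (circ a rho s - t).
    have := cmBl (circ a rho s - a) (t - a); rewrite cr opprB addrA subrK; lra.
  have t0 : circ a rho s - t != 0 by rewrite -cm_gt0; lra.
  split.
    apply: holM; first exact: hol_cst.
    apply: hol_div => //; first exact: hol_cst.
    by apply: holB; [exact: hol_cst|exact: hol_id].
  rewrite cmM; apply: ler_pM; rewrite ?cm_ge0 //; first by apply: gM; rewrite cr.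
  rewrite /kernel cmM cmV cr ler_wpM2l ?(ltW rho0) // lef_pV2 ?posrE //; lra.
have Phia : g a = Phi a.
  apply/eqP; rewrite -subr_eq0 -cm_eq0 eq_le cm_ge0 andbT leNgt; apply/negP => h.
  have h2 : 0 < cm (g a - Phi a) / 2 by lra.
  have /contP /(_ _ h2) [d1 d10 h1] := gc.
  have /hol_cont /contP /(_ _ h2) [d2 d20 h2'] := Phih.
  pose x := Num.min rho (Num.min d1 d2) / 2.
  have mn : 0 < Num.min rho (Num.min d1 d2) by rewrite !lt_min rho0 d10.
  have x0 : 0 < x by rewrite divr_gt0.
  have x1 : x < rho by apply: half_lt mn _; rewrite ge_min lexx.
  have x2 : x < d1 by apply: half_lt mn _; rewrite !ge_min lexx orbT.
  have x3 : x < d2 by apply: half_lt mn _; rewrite !ge_min lexx !orbT.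
  pose y := a + rc x; have ya : cm (y - a) = x by rewrite /y addrC addKr cm_rc gtr0_norm.
  have e1 := h1 y ltac:(by rewrite ya); have e2 := h2' y ltac:(by rewrite ya).
  have e3 : g y = Phi y by apply: PhiE; rewrite ya x0.
  rewrite -e3 in e2; have := cmD (g a - g y) (g y - Phi a).
  rewrite addrA subrK (cmBC (g a) (g y)) => /le_lt_trans /(_ (ltrD e1 e2)).
  by rewrite -splitr ltxx.
apply: hol_eq Phih; apply/cm_ballP; exists rho => // z zr.
case: (eqVneq z a) => [->//|za]; apply: PhiE.
by rewrite cm_gt0 subr_eq0 za.
Qed.
End CauchyFormula.

(** * Euclidean norm, hermitian and bilinear pairings, holomorphy along lines *)

HB.lock Definition nrm2 (K : realType) n (z : 'cV[cplx K]_n) : K := \sum_i cm (z i 0) ^+ 2.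
Arguments nrm2 {K n} z.
HB.lock Definition nrm (K : realType) n (z : 'cV[cplx K]_n) : K := Num.sqrt (nrm2 z).
Arguments nrm {K n} z.
(** The bilinear pairing is kept beside the hermitian [dotc] because it is holomorphic in both
    arguments. *)
HB.lock Definition dotb (K : realType) n (z w : 'cV[cplx K]_n) : cplx K :=
  \sum_i z i 0 * w i 0.
Arguments dotb {K n} z w.

Section Vectors.
Variable K : realType.
Local Notation C := (cplx K).

Section Algebra.
Variable n : nat.
Implicit Types (z w p u v : 'cV[C]_n).

Definition cjv z : 'cV[C]_n := map_mx (@cj K) z.
Definition dotc z w : C := dotb z (cjv w).

Lemma cjvE z i : cjv z i 0 = cj (z i 0). Proof. by rewrite mxE. Qed.
Lemma cjvK z : cjv (cjv z) = z.
Proof. by apply/matrixP => i j; rewrite !mxE cjK. Qed.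
Lemma cjvD z w : cjv (z + w) = cjv z + cjv w. Proof. exact: map_mxD. Qed.
Lemma cjvB z w : cjv (z - w) = cjv z - cjv w. Proof. exact: map_mxB. Qed.
Lemma cjvZ (c : C) z : cjv (c *: z) = cj c *: cjv z. Proof. exact: map_mxZ. Qed.
Lemma cjv0 : cjv 0 = 0. Proof. exact: map_mx0. Qed.

Lemma dotbC z w : dotb z w = dotb w z.
Proof. by rewrite dotb.unlock; apply: eq_bigr => i _; rewrite mulrC. Qed.
Lemma dotbDl z w p : dotb (z + w) p = dotb z p + dotb w p.
Proof. by rewrite dotb.unlock -big_split; apply: eq_bigr => i _; rewrite mxE mulrDl. Qed.
Lemma dotbZl (c : C) z p : dotb (c *: z) p = c * dotb z p.
Proof. by rewrite dotb.unlock mulr_sumr; apply: eq_bigr => i _; rewrite mxE mulrA. Qed.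
Lemma dotbNl z p : dotb (- z) p = - dotb z p.
Proof. by rewrite -scaleN1r dotbZl mulN1r. Qed.
Lemma dotbBl z w p : dotb (z - w) p = dotb z p - dotb w p.
Proof. by rewrite dotbDl dotbNl. Qed.
Lemma dotb0l p : dotb 0 p = 0. Proof. by rewrite -(scale0r 0) dotbZl mul0r. Qed.
Lemma dotbDr z w p : dotb p (z + w) = dotb p z + dotb p w.
Proof. by rewrite dotbC dotbDl !(dotbC _ p). Qed.
Lemma dotbZr (c : C) z p : dotb p (c *: z) = c * dotb p z.
Proof. by rewrite dotbC dotbZl (dotbC _ p). Qed.
Lemma dotbBr z w p : dotb p (z - w) = dotb p z - dotb p w.
Proof. by rewrite dotbC dotbBl !(dotbC _ p). Qed.
Lemma dotb0r p : dotb p 0 = 0. Proof. by rewrite dotbC dotb0l. Qed.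
Lemma cj_dotb z w : cj (dotb z w) = dotb (cjv z) (cjv w).
Proof. by rewrite dotb.unlock cj_sum; apply: eq_bigr => i _; rewrite cjM !cjvE. Qed.

Lemma dotcDl z w p : dotc (z + w) p = dotc z p + dotc w p. Proof. exact: dotbDl. Qed.
Lemma dotcBl z w p : dotc (z - w) p = dotc z p - dotc w p. Proof. exact: dotbBl. Qed.
Lemma dotcZl (c : C) z p : dotc (c *: z) p = c * dotc z p. Proof. exact: dotbZl. Qed.
Lemma dotcDr z w p : dotc p (z + w) = dotc p z + dotc p w.
Proof. by rewrite /dotc cjvD dotbDr. Qed.
Lemma dotcBr z w p : dotc p (z - w) = dotc p z - dotc p w.
Proof. by rewrite /dotc cjvB dotbBr. Qed.
Lemma dotcZr (c : C) z p : dotc p (c *: z) = cj c * dotc p z.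
Proof. by rewrite /dotc cjvZ dotbZr. Qed.
Lemma cj_dotc z w : cj (dotc z w) = dotc w z.
Proof. by rewrite /dotc cj_dotb cjvK dotbC. Qed.

Lemma dotcc z : dotc z z = rc (nrm2 z).
Proof. by rewrite /dotc dotb.unlock nrm2.unlock rc_sum; apply: eq_bigr => i _; rewrite cjvE mul_cj. Qed.
Lemma nrm2_ge0 z : 0 <= nrm2 z.
Proof. by rewrite nrm2.unlock; apply: sumr_ge0 => i _; exact: sqr_ge0. Qed.
Lemma nrm2_cjv z : nrm2 (cjv z) = nrm2 z.
Proof. by rewrite nrm2.unlock; apply: eq_bigr => i _; rewrite cjvE cm_cj. Qed.
Lemma nrm2Z (c : C) z : nrm2 (c *: z) = cm c ^+ 2 * nrm2 z.
Proof. by rewrite nrm2.unlock mulr_sumr; apply: eq_bigr => i _; rewrite mxE cmM exprMn. Qed.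
Lemma nrm20 : nrm2 (0 : 'cV[C]_n) = 0. Proof. by rewrite -(scale0r 0) nrm2Z cm0 expr0n mul0r. Qed.
Lemma nrm2N z : nrm2 (- z) = nrm2 z.
Proof. by rewrite -scaleN1r nrm2Z cmN cm1 expr1n mul1r. Qed.
Lemma nrm2_eq0 z : (nrm2 z == 0) = (z == 0).
Proof.
apply/eqP/eqP => [|->]; last exact: nrm20.
move=> /eqP; rewrite nrm2.unlock psumr_eq0; last by move=> i _; exact: sqr_ge0.
move=> /allP h; apply/matrixP => i j; rewrite ord1 mxE.
by apply/eqP; have := h i (mem_index_enum _); rewrite sqrf_eq0 cm_eq0.
Qed.
Lemma nrm2_gt0 z : (0 < nrm2 z) = (z != 0).
Proof. by rewrite lt0r nrm2_eq0 nrm2_ge0 andbT. Qed.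
Lemma nrm2D z w : nrm2 (z + w) = nrm2 z + nrm2 w + 2 * re (dotc z w).
Proof.
apply: rcI; rewrite -dotcc dotcDl !dotcDr !dotcc !rcD rcM.
have -> : rc (re (dotc z w)) = (dotc z w + dotc w z) / 2.
  rewrite -(cj_dotc z w) {2}(cplxE (dotc z w)) (cplxE (cj _)) re_cj im_cj.
  by rewrite rcN; field.
by rewrite rcn; field.
Qed.
Lemma nrm2B z w : nrm2 (z - w) = nrm2 z + nrm2 w - 2 * re (dotc z w).
Proof. by rewrite nrm2D nrm2N -[X in dotc z X]scaleN1r dotcZr cjN cj1 mulN1r raddfN mulrN. Qed.
Lemma nrm2BC z w : nrm2 (z - w) = nrm2 (w - z). Proof. by rewrite -nrm2N opprB. Qed.

Lemma cauchy_schwarz z w : cm (dotc z w) ^+ 2 <= nrm2 z * nrm2 w.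
Proof.
case: (eqVneq w 0) => [->|w0].
  by rewrite /dotc cjv0 dotb0r cm0 expr0n nrm20 mulr0.
have W : 0 < nrm2 w by rewrite nrm2_gt0.
have := nrm2_ge0 (rc (nrm2 w) *: z - dotc z w *: w).
rewrite nrm2B !nrm2Z dotcZl dotcZr cj_dotc cm_rc real_normK ?num_real //.
have -> : re (rc (nrm2 w) * (dotc w z * dotc z w)) = nrm2 w * cm (dotc z w) ^+ 2.
  by rewrite -(cj_dotc z w) (mulrC (cj _)) mul_cj -rcM.
set x := cm _ ^+ 2 => h.
have : 0 <= nrm2 w * (nrm2 w * nrm2 z - x) by move: h; nra.
by rewrite pmulr_rge0 // subr_ge0 mulrC.
Qed.

Lemma nrm_ge0 z : 0 <= nrm z. Proof. by rewrite nrm.unlock sqrtr_ge0. Qed.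
Lemma nrm_sqr z : nrm z ^+ 2 = nrm2 z. Proof. by rewrite nrm.unlock sqr_sqrtr // nrm2_ge0. Qed.
Lemma nrm0 : nrm (0 : 'cV[C]_n) = 0. Proof. by rewrite nrm.unlock nrm20 sqrtr0. Qed.
Lemma nrmN z : nrm (- z) = nrm z. Proof. by rewrite nrm.unlock nrm2N. Qed.
Lemma nrmBC z w : nrm (z - w) = nrm (w - z). Proof. by rewrite nrm.unlock nrm2BC. Qed.
Lemma nrmZ (c : C) z : nrm (c *: z) = cm c * nrm z.
Proof. by rewrite nrm.unlock nrm2Z sqrtrM ?sqr_ge0 // sqrtr_sqr ger0_norm ?cm_ge0. Qed.
Lemma nrm_cjv z : nrm (cjv z) = nrm z. Proof. by rewrite nrm.unlock nrm2_cjv. Qed.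
Lemma cm_dotc z w : cm (dotc z w) <= nrm z * nrm w.
Proof.
rewrite -(@ler_pXn2r _ 2) ?nnegrE ?mulr_ge0 ?cm_ge0 ?nrm_ge0 //.
by rewrite exprMn !nrm_sqr cauchy_schwarz.
Qed.
Lemma cm_dotb z w : cm (dotb z w) <= nrm z * nrm w.
Proof. by rewrite -(cjvK w) -/(dotc _ _) nrm_cjv cm_dotc. Qed.
Lemma nrmD z w : nrm (z + w) <= nrm z + nrm w.
Proof.
have z0 := nrm_ge0 z; have w0 := nrm_ge0 w.
rewrite -(@ler_pXn2r _ 2) ?nnegrE ?addr_ge0 ?nrm_ge0 // nrm_sqr nrm2D -!nrm_sqr.
have := le_trans (ler_norm _) (le_trans (re_le (dotc z w)) (cm_dotc z w)).
by move: (re _) (nrm z) (nrm w) => x y t; nra.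
Qed.
Lemma nrm_lt z (x : K) : 0 < x -> (nrm z < x) = (nrm2 z < x ^+ 2).
Proof. by move=> x0; rewrite -nrm_sqr ltr_pXn2r // nnegrE ?nrm_ge0 // ltW. Qed.
Lemma nrm2_lt1 z : (nrm2 z < 1) = (nrm z < 1).
Proof. by rewrite nrm_lt // expr1n. Qed.
Lemma nrm_eq1 z : nrm2 z = 1 -> nrm z = 1. Proof. by rewrite nrm.unlock => ->; rewrite sqrtr1. Qed.
Lemma cm_le_nrm z i : cm (z i 0) <= nrm z.
Proof.
rewrite -(@ler_pXn2r _ 2) ?nnegrE ?nrm_ge0 ?cm_ge0 // nrm_sqr nrm2.unlock (bigD1 i) //=.
by rewrite lerDl; apply: sumr_ge0 => j _; exact: sqr_ge0.
Qed.
Lemma nrm_eq0 z : (nrm z == 0) = (z == 0).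
Proof. by rewrite -sqrf_eq0 nrm_sqr nrm2_eq0. Qed.
Lemma nrm_gt0 z : (0 < nrm z) = (z != 0).
Proof. by rewrite lt0r nrm_eq0 nrm_ge0 andbT. Qed.

(* Holomorphy along every complex line through [p]. *)
Definition lhol (F : 'cV[C]_n -> C) p := forall v, hol (fun t => F (p + t *: v)) 0.

Lemma lhol_line F p v (t : C) : lhol F (p + t *: v) -> hol (fun t => F (p + t *: v)) t.
Proof.
move=> /(_ v) h; have -> : (fun t => F (p + t *: v)) =
    (fun s => F (p + t *: v + (s - t) *: v)).
  by apply/funext => s; rewrite -addrA -scalerDl addrC [t + _]addrC subrK addrC.
apply: (@hol_comp _ (fun s => F (p + t *: v + s *: v)) (fun s => s - t)).
  by apply: holB; [exact: hol_id|exact: hol_cst].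
by rewrite subrr.
Qed.

Definition vcont (F : 'cV[C]_n -> C) p := forall e : K, 0 < e ->
  exists2 d : K, 0 < d & forall z, nrm (z - p) < d -> cm (F z - F p) < e.

Lemma nrm_line_cont p v (t : C) : contK (fun t => nrm (p + t *: v)) t.
Proof.
apply/contKP => e e0; have v0 := nrm_ge0 v.
exists (e / (nrm v + 1)); first by rewrite divr_gt0 //; lra.
move=> s; rewrite ltr_pdivlMr; last by lra.
move=> hs; have h : nrm ((s - t) *: v) < e.
  by rewrite nrmZ; have := cm_ge0 (s - t); nra.
have E : p + s *: v = p + t *: v + (s - t) *: v by rewrite -addrA -scalerDl [t + _]addrC subrK.
have h1 := nrmD (p + t *: v) ((s - t) *: v); rewrite -E in h1.
have h2 := nrmD (p + s *: v) (- ((s - t) *: v)); rewrite {1}E addrK nrmN in h2.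
rewrite ltr_norml ltrBlDl ltrBrDl (le_lt_trans h1) ?ltrD2l // andbT.
by rewrite ltrBlDr (le_lt_trans h2) ?ltrD2l.
Qed.

Lemma near_lt_nrm p v (t : C) (x : K) : nrm (p + t *: v) < x ->
  \forall s \near t, nrm (p + s *: v) < x.
Proof.
move=> h; have e0 : 0 < x - nrm (p + t *: v) by lra.
have /contKP /(_ _ e0) [d d0 hd] := @nrm_line_cont p v t.
apply/cm_ballP; exists d; first exact: d0.
by move=> s /hd; exact: ltr_of_dist.
Qed.

Lemma near_gt_nrm p v (t : C) (x : K) : x < nrm (p + t *: v) ->
  \forall s \near t, x < nrm (p + s *: v).
Proof.
move=> h; have e0 : 0 < nrm (p + t *: v) - x by lra.
have /contKP /(_ _ e0) [d d0 hd] := @nrm_line_cont p v t.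
apply/cm_ballP; exists d; first exact: d0.
by move=> s /hd; exact: gtr_of_dist.
Qed.
End Algebra.
End Vectors.

(** * Hartogs extension from the shell to the ball *)

Section Hartogs.
Variable K : realType.
Local Notation C := (cplx K).
Implicit Types (z w v : 'cV[C]_2) (a b c t : C).

Definition mk2 a b : 'cV[C]_2 := \col_(i < 2) [:: a; b]`_i.

Lemma mk2_0 a b : mk2 a b 0 0 = a. Proof. by rewrite mxE. Qed.
Lemma mk2_1 a b : mk2 a b 1 0 = b. Proof. by rewrite mxE. Qed.
Lemma mk2E z : z = mk2 (z 0 0) (z 1 0).
Proof.
apply/matrixP => i j; rewrite ord1 mxE.
case: i => -[|[|//]] hi /=; congr (z _ 0); exact: val_inj.
Qed.
Lemma mk2D a b c d : mk2 a b + mk2 c d = mk2 (a + c) (b + d).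
Proof. by apply/matrixP => i j; rewrite !mxE; case: i => -[|[|//]]. Qed.
Lemma mk2Z t a b : t *: mk2 a b = mk2 (t * a) (t * b).
Proof. by apply/matrixP => i j; rewrite !mxE; case: i => -[|[|//]]. Qed.
Lemma mk2B a b c d : mk2 a b - mk2 c d = mk2 (a - c) (b - d).
Proof. by apply/matrixP => i j; rewrite !mxE; case: i => -[|[|//]]. Qed.
Lemma nrm2_mk2 a b : nrm2 (mk2 a b) = cm a ^+ 2 + cm b ^+ 2.
Proof. by rewrite nrm2.unlock 2!big_ord_recl big_ord0 addr0 !mxE. Qed.
Lemma nrm2_2 z : nrm2 z = cm (z 0 0) ^+ 2 + cm (z 1 0) ^+ 2.
Proof. by rewrite {1}(mk2E z) nrm2_mk2. Qed.

Variables (F : 'cV[C]_2 -> C) (r : K).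
Hypothesis r01 : 0 < r < 1.
Hypothesis Fhol : forall z, r ^+ 2 < nrm2 z < 1 -> lhol F z.
Hypothesis Fcont : forall z, r ^+ 2 < nrm2 z < 1 -> vcont F z.

(** In the slice of height [b], the circle of radius [rho] then lies in the shell where [F] is
    holomorphic. *)
Definition admissible b (rho : K) := 0 < rho /\ r ^+ 2 < rho ^+ 2 + cm b ^+ 2 < 1.

(** Cauchy's integral in the first variable with the second one frozen; it reads [F] on the circle
    only, so it makes sense for points of the hole. *)
Definition slice_mean a b (rho : K) : C :=
  circmean (fun x => F (mk2 x b) * kernel 0 a x) 0 rho.

Lemma circ0 (rho s : K) : circ 0 rho s = rc rho * cis s :> C.
Proof. by rewrite /circ add0r. Qed.

Lemma hol_slice x b : r ^+ 2 < cm x ^+ 2 + cm b ^+ 2 < 1 -> hol (fun x => F (mk2 x b)) x.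
Proof.
move=> h; have -> : (fun x => F (mk2 x b)) = (fun x => F (mk2 0 b + x *: mk2 1 0)).
  by apply/funext => y; rewrite mk2Z mk2D mulr1 mulr0 add0r addr0.
by apply/lhol_line/Fhol; rewrite mk2Z mk2D mulr1 mulr0 add0r addr0 nrm2_mk2.
Qed.

Lemma sq_cont (g : C -> C) x : hol g x -> contK (fun t => cm (g t) ^+ 2) x.
Proof. by move=> /hol_cont /contK_cm h; exact: (contKM h h). Qed.

Lemma contK_lt (u : C -> K) x (e : K) : contK u x -> u x < e -> \forall y \near x, u y < e.
Proof.
move=> /contKP h ux; have e0 : 0 < e - u x by lra.
have [d d0 hd] := h _ e0; apply/cm_ballP; exists d => // y /hd.
by rewrite ltr_norml => /andP[]; lra.
Qed.

Lemma contK_gt (u : C -> K) x (e : K) : contK u x -> e < u x -> \forall y \near x, e < u y.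
Proof.
move=> /contKP h ux; have e0 : 0 < u x - e by lra.
have [d d0 hd] := h _ e0; apply/cm_ballP; exists d => // y /hd.
by rewrite ltr_norml => /andP[]; lra.
Qed.

Lemma near_admissible (g : C -> C) x (rho : K) : hol g x -> admissible (g x) rho ->
  \forall y \near x, admissible (g y) rho.
Proof.
move=> /sq_cont gc [rho0 /andP[h1 h2]].
have n1 : \forall y \near x, cm (g y) ^+ 2 < 1 - rho ^+ 2 by apply: (contK_lt gc); lra.
have n2 : \forall y \near x, r ^+ 2 - rho ^+ 2 < cm (g y) ^+ 2 by apply: (contK_gt gc); lra.
by apply: filterS2 n1 n2 => y h3 h4; split=> //; apply/andP; split; lra.
Qed.

Lemma slice_bounded b d (rho : K) : admissible b rho ->
  exists2 e, 0 < e & forall t (s : K), 0 <= s <= 1 -> cm t < e ->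
    cm (F (mk2 (circ 0 rho s) (b + t * d))) <= e^-1.
Proof.
move=> [rho0 hb].
have [||e e0 he] := @itv_uniform _ (fun e s => forall t, cm t < e ->
    cm (F (mk2 (circ 0 rho s) (b + t * d))) <= e^-1).
- move=> e e' s ee h t ht; have e0 : 0 < e' := le_lt_trans (cm_ge0 t) ht.
  apply: le_trans (h t (lt_le_trans ht ee)) _.
  by rewrite lef_pV2 // posrE //; exact: lt_le_trans ee.
- move=> s hs; set p := mk2 (circ 0 rho s) b.
  have cr s' : cm (circ 0 rho s') = rho by rewrite -[X in cm X]subr0 cm_circ // ltW.
  have /Fcont /(_ _ ltr01) [e e0 he] : r ^+ 2 < nrm2 p < 1 by rewrite nrm2_mk2 cr.
  have e20 : 0 < e / 2 by lra.
  have [e1 e10 he1] := circ_cont 0 rho s e20.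
  pose M := cm (F p) + 1; have M0 : 0 < M by rewrite /M; have := cm_ge0 (F p); lra.
  have d0 := cm_ge0 d.
  pose e2 := e / 2 / (cm d + 1); have e20' : 0 < e2 by rewrite /e2 divr_gt0 //; lra.
  pose e3 := Num.min e1 (Num.min e2 M^-1).
  have e30 : 0 < e3 by rewrite !lt_min e10 e20' invr_gt0.
  have e31 : e3 <= e1 by rewrite ge_min lexx.
  have e32 : e3 <= e2 by rewrite !ge_min lexx orbT.
  have e33 : e3 <= M^-1 by rewrite !ge_min lexx !orbT.
  exists e3 => // s' hs' t ht.
  have h1 : cm (circ 0 rho s' - circ 0 rho s) < e / 2.
    by apply: he1; [rewrite subrr normr0|exact: lt_le_trans e31].
  have h2 : cm (t * d) < e / 2.
    have : cm t < e2 := lt_le_trans ht e32.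
    rewrite cmM ltr_pdivlMr ?ltr_wpDl ?cm_ge0 // mulrDr mulr1 => /(le_lt_trans _); apply.
    by rewrite lerDl cm_ge0.
  have : nrm (mk2 (circ 0 rho s') (b + t * d) - p) < e.
    rewrite nrm_lt // mk2B nrm2_mk2 [b + _]addrC addrK.
    have := cm_ge0 (circ 0 rho s' - circ 0 rho s); have := cm_ge0 (t * d).
    move=> c1 c2; exact: sqr_add_lt c2 c1 h1 h2.
  move=> /he h; apply: (@le_trans _ _ M).
    have := cmBl (F (mk2 (circ 0 rho s') (b + t * d))) (F p); rewrite /M; lra.
  by rewrite -[leLHS]invrK lef_pV2 ?posrE ?invr_gt0.
exists e => // t s hs ht; exact: he.
Qed.

Lemma hol_slice_mean a b c d (rho : K) : admissible b rho -> rho != cm a ->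
  hol (fun t => slice_mean (a + t * c) (b + t * d) rho) 0.
Proof.
move=> adm ra; have rho0 := adm.1.
pose m := `|rho - cm a| / 2.
have m0 : 0 < m by rewrite /m divr_gt0 // normr_gt0 subr_eq0.
have [e e0 he] := slice_bounded d adm.
have hb := hol_affine b d 0; have ha := hol_affine a c 0.
have adm' : admissible (b + 0 * d) rho by rewrite mul0r addr0.
have /cm_ballP [e1 e10 he1] := near_admissible hb adm'.
have /contP /(_ _ m0) [e2 e20 he2] := hol_cont ha.
pose q := Num.min e (Num.min e1 e2).
have q0 : 0 < q by rewrite !lt_min e0 e10.
have q1 : q <= e by rewrite ge_min lexx.
have q2 : q <= e1 by rewrite !ge_min lexx orbT.
have q3 : q <= e2 by rewrite !ge_min lexx !orbT.
apply: (@hol_umean _ (fun s t => F (mk2 (circ 0 rho s) (b + t * d)) *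
   kernel 0 (a + t * c) (circ 0 rho s)) 0 q (e^-1 * (rho / m)) q0) => s hs t; rewrite subr0 => ht.
have cr : cm (circ 0 rho s) = rho by rewrite -[X in cm X]subr0 cm_circ // ltW.
have far : m <= cm (circ 0 rho s - (a + t * c)).
  have h1 : cm (a + t * c - (a + 0 * c)) < m by apply: he2; rewrite subr0; exact: lt_le_trans q3.
  rewrite mul0r addr0 in h1.
  have h2 : 2 * m <= cm (circ 0 rho s - a).
    have := cmBl (circ 0 rho s) a; have := cmBl a (circ 0 rho s).
    rewrite (cmBC a) cr /m mulrC divfK // => u1 u2.
    by rewrite ler_norml; apply/andP; split; lra.
  have := cmBl (circ 0 rho s - a) (a + t * c - a).
  by rewrite opprB addrA subrK; lra.
have nz : circ 0 rho s - (a + t * c) != 0 by rewrite -cm_gt0; exact: lt_le_trans far.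
split.
  apply: holM.
    have -> : (fun t => F (mk2 (circ 0 rho s) (b + t * d))) =
        (fun t => F (mk2 (circ 0 rho s) b + t *: mk2 0 d)).
      by apply/funext => y; rewrite mk2Z mk2D mulr0 addr0.
    apply: lhol_line; apply: Fhol; rewrite mk2Z mk2D mulr0 addr0 nrm2_mk2 cr.
    by apply: (he1 t _).2; rewrite subr0; exact: lt_le_trans q2.
  apply: hol_div; [exact: nz|exact: hol_cst|].
  by apply: holB; [exact: hol_cst|exact: hol_affine].
rewrite cmM; apply: ler_pM; rewrite ?cm_ge0 //; first by apply: he => //; exact: lt_le_trans q1.
rewrite /kernel subr0 cmM cmV cr ler_wpM2l ?(ltW rho0) //.
by rewrite lef_pV2 ?posrE //; exact: lt_le_trans far.
Qed.

Lemma slice_mean_eq a b (rho rho' : K) : admissible b rho -> admissible b rho' ->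
  (cm a < rho /\ cm a < rho') \/ (rho < cm a /\ rho' < cm a) ->
  slice_mean a b rho = slice_mean a b rho'.
Proof.
wlog le : rho rho' / rho' <= rho.
  move=> H h1 h2 h3; case: (leP rho' rho) => [|/ltW] le; first exact: H.
  by apply/esym/H => //; case: h3 => -[]; [left|right].
move=> [r0 /andP[h1 h2]] [r0' /andP[h1' h2']] side.
apply: circmean_ring => // x; rewrite subr0 => /andP[x1 x2].
apply: holM.
  apply: hol_slice; apply/andP; split.
    by apply: lt_le_trans h1' _; rewrite lerD2r ler_pXn2r // nnegrE ?cm_ge0 // ltW.
  by apply: le_lt_trans h2; rewrite lerD2r ler_pXn2r // nnegrE ?cm_ge0 // ltW.
apply/hol_kernel/(@cm_neq _ 0); rewrite !subr0; apply/eqP => xa.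
by case: side; rewrite -xa; lra.
Qed.

(** The root of the midpoint of the interval in which [rho ^+ 2] has to lie for the circle to be
    admissible and of radius below [cm a]. *)
Definition inner_radius a b : K :=
  Num.sqrt ((Num.max 0 (r ^+ 2 - cm b ^+ 2) + Num.min (cm a ^+ 2) (1 - cm b ^+ 2)) / 2).

Lemma inner_radiusP a b : a != 0 -> r ^+ 2 - cm a ^+ 2 < cm b ^+ 2 < 1 ->
  admissible b (inner_radius a b) /\ inner_radius a b < cm a.
Proof.
move=> a0 /andP[h1 h2]; have ca : 0 < cm a by rewrite cm_gt0.
have ca2 : 0 < cm a ^+ 2 by rewrite exprn_gt0.
have r2 : r ^+ 2 < 1 by move: r01 => /andP[? ?]; rewrite expr_lt1 // ltW.
set lo := Num.max 0 (r ^+ 2 - cm b ^+ 2); set hi := Num.min (cm a ^+ 2) (1 - cm b ^+ 2).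
have l1 : 0 <= lo by rewrite le_max lexx.
have l2 : r ^+ 2 - cm b ^+ 2 <= lo by rewrite le_max lexx orbT.
have u1 : hi <= cm a ^+ 2 by rewrite ge_min lexx.
have u2 : hi <= 1 - cm b ^+ 2 by rewrite ge_min lexx orbT.
have lh : lo < hi by rewrite lt_min !gt_max; apply/andP; split; apply/andP; split; lra.
have q : 0 < (lo + hi) / 2 by lra.
have sq : inner_radius a b ^+ 2 = (lo + hi) / 2 by rewrite /inner_radius sqr_sqrtr // ltW.
have p0 : 0 < inner_radius a b by rewrite sqrtr_gt0.
split; first by split=> //; rewrite sq; apply/andP; split; lra.
by rewrite -(@ltr_pXn2r _ 2) ?nnegrE ?(ltW ca) ?(ltW p0) // sq; lra.
Qed.

(* As [b] moves outward past [|b| = r] with [a] fixed, the circle shrinks to a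
   slice disc on which the integrand is holomorphic and vanishes at the centre. *)
Lemma slice_mean_inside0 a b (rho : K) : admissible b rho -> rho < cm a -> slice_mean a b rho = 0.
Proof.
move=> adm ra; have [rho0 /andP[h1 h2]] := adm; have /andP[r0 r1] := r01.
have a0 : a != 0 by rewrite -cm_gt0; exact: lt_trans ra.
pose g x := slice_mean a x (inner_radius a x).
have rho2 : rho ^+ 2 < cm a ^+ 2.
  by rewrite ltr_pXn2r // nnegrE ?cm_ge0 // ltW.
have rho2p : 0 < rho ^+ 2 by rewrite exprn_gt0.
have D b' : r ^+ 2 - cm a ^+ 2 < cm b' ^+ 2 < 1 -> \forall x \near b', hol g x.
  move=> hb.
  have key x : r ^+ 2 - cm a ^+ 2 < cm x ^+ 2 < 1 -> hol g x.
    move=> hx; have [ax ix] := inner_radiusP a0 hx.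
    (* The radius is frozen at its value for [x]; by [slice_mean_eq] the radii of nearby points give
       the same mean. *)
    have hh : hol (fun y => slice_mean a y (inner_radius a x)) x.
      have := @hol_slice_mean a x 0 1 (inner_radius a x) ax ltac:(by rewrite lt_eqF).
      have -> : (fun y => slice_mean a y (inner_radius a x)) =
         (fun y => (fun t => slice_mean (a + t * 0) (x + t * 1) (inner_radius a x)) (y - x)).
        by apply/funext => y; rewrite mulr0 addr0 mulr1 addrC subrK.
      move=> h; apply: (@hol_comp _ (fun t => slice_mean (a + t * 0) (x + t * 1) (inner_radius a x))
        (fun y => y - x)); last by rewrite subrr.
      by apply: holB; [exact: hol_id|exact: hol_cst].
    apply: hol_eq hh.
    have n1 := near_admissible (hol_id x) ax.
    have n2 := contK_lt (sq_cont (hol_id x)) (proj2 (andP hx)).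
    have n3 := contK_gt (sq_cont (hol_id x)) (proj1 (andP hx)).
    apply: filterS3 n1 n2 n3 => y ay y1 y2.
    have [ay' iy] := @inner_radiusP a y a0 ltac:(by rewrite y2 y1).
    by apply: slice_mean_eq => //; right.
  have n2 := contK_lt (sq_cont (hol_id b')) (proj2 (andP hb)).
  have n3 := contK_gt (sq_cont (hol_id b')) (proj1 (andP hb)).
  by apply: filterS2 n2 n3 => y y1 y2; apply: key; rewrite y1 y2.
have zero x : r ^+ 2 < cm x ^+ 2 < 1 -> g x = 0.
  move=> /andP[x1 x2]; have xx : r ^+ 2 - cm a ^+ 2 < cm x ^+ 2 < 1.
    by apply/andP; split => //; have := sqr_ge0 (cm a); lra.
  have [ax ix] := inner_radiusP a0 xx; have [i0 /andP[i1 i2]] := ax.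
  have ha y : cm (y - 0) <= inner_radius a x -> hol (fun y => F (mk2 y x) * kernel 0 a y) y.
    rewrite subr0 => hy; apply: holM.
      apply: hol_slice; apply/andP; split; first by have := sqr_ge0 (cm y); lra.
      by apply: le_lt_trans i2; rewrite lerD2r ler_pXn2r // nnegrE ?cm_ge0 // ltW.
    by apply/hol_kernel/(@cm_neq _ 0); rewrite !subr0 lt_eqF //; exact: le_lt_trans ix.
  rewrite /g /slice_mean circmean_center //.
  - by rewrite /kernel subrr mul0r mulr0.
  - by apply/hol_cont/ha; rewrite subrr cm0 ltW.
  - by move=> y /andP[_]; exact: ha.
have br : cm b ^+ 2 < 1 by lra.
have lo : r ^+ 2 - cm a ^+ 2 < cm b ^+ 2 by lra.
have cb := cm_ge0 b.
have b1 : cm b < 1 by rewrite -(@expr_lt1 _ 2).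
(* The path to [b] is radial. It starts at modulus [x], beyond [r], where [g] is already known to
   vanish, and the modulus decreases along it to [cm b]. *)
pose u : C := if b == 0 then 1 else b / rc (cm b).
have bu : b = rc (cm b) * u.
  rewrite /u; case: eqVneq => [->|b0]; first by rewrite cm0 rc0 mul0r.
  by rewrite mulrC divfK // -(rc0 K) (inj_eq (@rcI K)) cm_eq0.
have cu : cm u = 1.
  rewrite /u; case: eqVneq => [_|b0]; first exact: cm1.
  by rewrite cmM cmV cm_rc (ger0_norm cb) divff // cm_eq0.
pose x := (Num.max r (cm b) + 1) / 2.
have m1 : r <= Num.max r (cm b) by rewrite le_max lexx.
have m2 : cm b <= Num.max r (cm b) by rewrite le_max lexx orbT.
have m3 : Num.max r (cm b) < 1 by rewrite gt_max r1.
have x1 : x < 1 by rewrite /x; lra.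
have xr : r < x by rewrite /x; lra.
have xb : cm b < x by rewrite /x; lra.
have x0 : 0 <= x := ltW (lt_trans r0 xr).
have x21 : x ^+ 2 < 1 by rewrite expr_lt1.
have rx2 : r ^+ 2 < x ^+ 2 by rewrite ltr_pXn2r // nnegrE ltW.
have pt (y : K) : rc x * u + rc y * ((rc (cm b) - rc x) * u) = rc (x + y * (cm b - x)) * u.
  by rewrite rcD rcM rcB; ring.
have cpt (y : K) : 0 <= y -> cm (rc y * u) = y.
  by move=> y0; rewrite cmM cu mulr1 cm_rc ger0_norm.
have gb : g b = 0.
  have : \forall z \near (rc x * u + rc 1 * ((rc (cm b) - rc x) * u)), g z = 0.
    apply: (identity_segment (g := g)); last by rewrite ler01 lexx.
      move=> t /andP[t0 t1]; apply: D; rewrite pt.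
      have q1 : cm b <= x + t * (cm b - x) by exact: lerp_ge (ltW xb) t1.
      have q2 : x + t * (cm b - x) <= x by rewrite gerDl mulr_ge0_le0 // subr_le0 ltW.
      rewrite cpt; last exact: le_trans q1.
      have q3 : cm b ^+ 2 <= (x + t * (cm b - x)) ^+ 2.
        by rewrite ler_pXn2r // nnegrE //; exact: le_trans q1.
      have q4 : (x + t * (cm b - x)) ^+ 2 <= x ^+ 2.
        by rewrite ler_pXn2r // nnegrE (le_trans cb).
      by rewrite (lt_le_trans lo q3) (le_lt_trans q4 x21).
    have n1 : \forall y \near (rc x * u), cm y ^+ 2 < 1.
      by apply: (contK_lt (sq_cont (hol_id _))); rewrite cpt.
    have n2 : \forall y \near (rc x * u), r ^+ 2 < cm y ^+ 2.
      by apply: (contK_gt (sq_cont (hol_id _))); rewrite cpt.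
    have /cm_ballP [e e0 he] : \forall z \near (rc x * u), g z = 0.
      by apply: filterS2 n1 n2 => z z1 z2; apply: zero; rewrite z1 z2.
    move=> e' e'0; have [] := @zero_near_ex _ g (rc x * u) (rc x * u) e' _ e'0.
      by apply/cm_ballP; exists e.
    by move=> z [? ? ?]; exists z.
  move/nbhs_singleton; rewrite pt mul1r addrC subrK -bu => //.
have bb : r ^+ 2 - cm a ^+ 2 < cm b ^+ 2 < 1 by rewrite lo.
have [ax ix] := inner_radiusP a0 bb.
by rewrite -gb; apply: slice_mean_eq => //; right.
Qed.

(** Puts the circle at squared norm midway between [Num.max (nrm2 z) (r ^+ 2)] and 1, hence in the
    shell and around [z 0 0]. *)
Definition outer_radius z : K :=
  Num.sqrt ((Num.max (nrm2 z) (r ^+ 2) + 1) / 2 - cm (z 1 0) ^+ 2).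

Definition hartogs z : C := slice_mean (z 0 0) (z 1 0) (outer_radius z).

Lemma outer_radiusP z : nrm2 z < 1 ->
  admissible (z 1 0) (outer_radius z) /\ cm (z 0 0) < outer_radius z.
Proof.
move=> z1; have /andP[r0 r1] := r01; set m := Num.max (nrm2 z) (r ^+ 2).
have m1 : nrm2 z <= m by rewrite le_max lexx.
have m2 : r ^+ 2 <= m by rewrite le_max lexx orbT.
have m3 : m < 1 by rewrite gt_max z1 expr_lt1 // ltW.
have zE := nrm2_2 z.
have p : 0 < (m + 1) / 2 - cm (z 1 0) ^+ 2 by have := sqr_ge0 (cm (z 0 0)); lra.
have sq : outer_radius z ^+ 2 = (m + 1) / 2 - cm (z 1 0) ^+ 2 by rewrite sqr_sqrtr // ltW.
have p0 : 0 < outer_radius z by rewrite sqrtr_gt0.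
split; first by split=> //; rewrite sq; apply/andP; split; lra.
by rewrite -(@ltr_pXn2r _ 2) ?nnegrE ?cm_ge0 ?(ltW p0) // sq; lra.
Qed.

(** The radius varies with the point, but along a short piece of line the radius of [z] serves every
    point, by [slice_mean_eq]. *)
Lemma hartogs_lhol z : nrm2 z < 1 -> lhol hartogs z.
Proof.
move=> z1 v; have [az oz] := outer_radiusP z1.
pose rho := outer_radius z.
have := @hol_slice_mean (z 0 0) (z 1 0) (v 0 0) (v 1 0) rho az ltac:(by rewrite gt_eqF).
apply: hol_eq.
have e0 : z + 0 *: v = z by rewrite scale0r addr0.
have n1 : \forall t \near (0 : C), nrm (z + t *: v) < 1.
  by apply: near_lt_nrm; rewrite e0 -nrm2_lt1.
have az' : admissible (z 1 0 + 0 * v 1 0) rho by rewrite mul0r addr0.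
have n2 := near_admissible (hol_affine (z 1 0) (v 1 0) 0) az'.
have n3 : \forall t \near (0 : C), cm (z 0 0 + t * v 0 0) < rho.
  apply: contK_lt; first by apply/contK_cm/hol_cont/hol_affine.
  by rewrite mul0r addr0.
apply: filterS3 n1 n2 n3 => t; rewrite -nrm2_lt1 => t1 t2 t3.
have [at' ot] := outer_radiusP t1; move: at' ot.
rewrite /hartogs; move: (outer_radius _) => rho' at' ot.
have E i : (z + t *: v) i 0 = z i 0 + t * v i 0 by rewrite !mxE.
by rewrite !E in at' ot *; apply: slice_mean_eq => //; left.
Qed.

Lemma hartogs_eq z : r ^+ 2 < nrm2 z < 1 -> hartogs z = F z.
Proof.
move=> /andP[z1 z2]; have [az oz] := outer_radiusP z2; have [o0 /andP[o1 o2]] := az.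
have zE := nrm2_2 z; rewrite /hartogs.
set a := z 0 0 in zE oz *; set b := z 1 0 in zE oz az o1 o2 *; set rho := outer_radius z in oz az o0 o1 o2 *.
rewrite [in RHS](mk2E z) -/a -/b.
(* For [a = 0] there is no room for an inner circle; but then [cm b > r], the whole slice disc lies
   in the shell, and the mean value at its centre applies. *)
case: (eqVneq a 0) => [a0|a0].
  have hs x : cm (x - 0) <= rho -> hol (fun x => F (mk2 x b)) x.
    rewrite subr0 => hx; apply: hol_slice; apply/andP; split.
      by move: zE; rewrite a0 cm0 expr0n /=; have := sqr_ge0 (cm x); lra.
    by apply: le_lt_trans o2; rewrite lerD2r ler_pXn2r // nnegrE ?cm_ge0 // ltW.
  rewrite a0 -(@circmean_center _ (fun x => F (mk2 x b)) 0 rho) //.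
  - apply: eq_umean => s _; rewrite /kernel subr0 divff ?mulr1 //.
    by rewrite -cm_gt0 -[X in cm X]subr0 cm_circ // ltW.
  - by apply/hol_cont/hs; rewrite subrr cm0 ltW.
  - by move=> x /andP[_]; exact: hs.
have bb : r ^+ 2 - cm a ^+ 2 < cm b ^+ 2 < 1.
  by apply/andP; split; [lra|have := sqr_ge0 (cm a); lra].
have [ai ia] := inner_radiusP a0 bb; have [i0 /andP[i1 i2]] := ai.
have := @cauchy_ring _ (fun x => F (mk2 x b)) 0 a (inner_radius a b) rho i0.
rewrite subr0 ia oz -/(slice_mean _ _ _) -/(slice_mean _ _ _) => /(_ isT) <-.
  by rewrite (slice_mean_inside0 ai ia) subr0.
move=> x; rewrite subr0 => /andP[x1 x2]; apply: hol_slice; apply/andP; split.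
  by apply: lt_le_trans i1 _; rewrite lerD2r ler_pXn2r // nnegrE ?cm_ge0 // ltW.
by apply: le_lt_trans o2; rewrite lerD2r ler_pXn2r // nnegrE ?cm_ge0 // ltW.
Qed.
End Hartogs.

(** * Polarization of a norm identity on a sphere *)

Section Polarization.
Variable K : realType.
Local Notation C := (cplx K).

Definition vhol m n (F : 'cV[C]_m -> 'cV[C]_n) p := forall i, lhol (fun z => F z i 0) p.
(** Conjugating argument and value keeps holomorphy, and turns [dotc (F z) (F u)] into
    [dotb (F z) (refl F w)] with [w = cjv u]. *)
Definition refl m n (F : 'cV[C]_m -> 'cV[C]_n) w := cjv (F (cjv w)).

Lemma refl_cjv m n (F : 'cV[C]_m -> 'cV[C]_n) z : refl F (cjv z) = cjv (F z).
Proof. by rewrite /refl cjvK. Qed.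

Lemma vhol_line m n (F : 'cV[C]_m -> 'cV[C]_n) p v (t : C) i :
  vhol F (p + t *: v) -> hol (fun t => F (p + t *: v) i 0) t.
Proof. by move=> h; apply: (@lhol_line _ _ (fun z => F z i 0)); exact: h. Qed.

Lemma vhol_refl m n (F : 'cV[C]_m -> 'cV[C]_n) p : vhol F (cjv p) -> vhol (refl F) p.
Proof.
move=> h i v; have -> : (fun t => refl F (p + t *: v) i 0) =
    (fun t => cj ((fun s => F (cjv p + s *: cjv v) i 0) (cj t))).
  by apply/funext => t; rewrite /refl cjvE cjvD cjvZ.
by apply: (@hol_conj _ (fun s => F (cjv p + s *: cjv v) i 0)); rewrite cj0; exact: h.
Qed.

Lemma hol_dotb n (X Y : C -> 'cV[C]_n) (t : C) : (forall i, hol (fun s => X s i 0) t) ->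
  (forall i, hol (fun s => Y s i 0) t) -> hol (fun s => dotb (X s) (Y s)) t.
Proof.
move=> hX hY; rewrite dotb.unlock; apply: hol_sum => i _.
by apply: holM; [exact: hX|exact: hY].
Qed.

(** The Cayley transform of a small real number; it supplies points of a circle accumulating at a
    given one. *)
Lemma unit_near (e : K) : 0 < e -> exists w : C, [/\ cm w = 1, w != 1 & cm (w - 1) < e].
Proof.
move=> e0; pose x : K := e / 4; have x0 : 0 < x by rewrite /x; lra.
pose q : C := 1 - ci * rc x; pose w := cj q / q.
have qr : re q = 1 by rewrite /q reB reM re1 re_ci im_ci re_rc im_rc; ring.
have q1 : 1 <= cm q by apply: le_trans (re_le q); rewrite qr normr1.
have q0 : q != 0 by rewrite -cm_gt0; lra.
have wE : w - 1 = 2 * ci * rc x / q.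
  have cq : cj q = q + 2 * ci * rc x by rewrite /q cjB cj1 cjM cj_ci cj_rc; ring.
  by rewrite /w cq; field.
have cw : cm (w - 1) = 2 * x / cm q.
  by rewrite wE !cmM cmV cm_ci mulr1 -(rcn K 2) !cm_rc !ger0_norm // ltW.
exists w; split.
- by rewrite /w cmM cmV cm_cj divff // cm_eq0.
- by rewrite -subr_eq0 -cm_gt0 cw divr_gt0 //; lra.
- rewrite cw ltr_pdivrMr; last by lra.
  by rewrite /x; nra.
Qed.

Lemma convex_lt (y a b c : K) : 0 <= y <= 1 -> a < c -> b < c -> (1 - y) * a + y * b < c.
Proof.
move=> /andP[y0 y1] ac bc; case: (ltP 0 y) => [yp|yn]; last first.
  have -> : y = 0 by lra.
  lra.
have : 0 < y * (c - b) by rewrite mulr_gt0 // subr_gt0.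
have : 0 <= (1 - y) * (c - a) by rewrite mulr_ge0 ?subr_ge0 // ltW.
lra.
Qed.

Section CircleReflection.
Variables (m n : nat) (X : 'cV[C]_m -> 'cV[C]_n) (D : set 'cV[C]_m) (s kappa M : K).
Variables (z u : 'cV[C]_m).
Hypothesis zu : dotc z u = rc s.
Hypothesis zsu : nrm2 z < s < nrm2 u.
Let e := z - u.
Let xi := (nrm2 z - s) / nrm2 e.
Let eta := (s - nrm2 u) / nrm2 e.
Hypothesis DM : forall t, cm t < M -> D (z + (t - rc xi) *: e).
Hypothesis xiM : `|xi| < M.
Hypothesis etaM : `|eta| < M.
Hypothesis XD : forall p, D p -> vhol X p.
Hypothesis Xk : forall p, D p -> nrm2 p = s -> nrm2 (X p) = kappa.

Let eE : nrm2 e = nrm2 z + nrm2 u - 2 * s.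
Proof. by rewrite /e nrm2B zu re_rc. Qed.
Let e0 : 0 < nrm2 e.
Proof.
rewrite nrm2_gt0 /e subr_eq0; apply/eqP => zu'.
by move: zsu; rewrite zu'; lra.
Qed.
Let xe : xi - eta = 1.
Proof.
rewrite /xi /eta -mulrBl (_ : _ - _ = nrm2 e) ?divff ?gt_eqF //.
by rewrite eE; ring.
Qed.
Let c := z - rc xi *: e.
Let uE : u = c + rc eta *: e.
Proof.
rewrite /c -addrA -scaleNr -scalerDl -rcN -rcD.
have -> : - xi + eta = -1 by rewrite -xe opprB addrC.
by rewrite rcN rc1 scaleN1r /e opprB addrC subrK.
Qed.
Let cE t : z + (t - rc xi) *: e = c + t *: e.
Proof. by rewrite scalerBl /c addrCA addrC. Qed.
Let ze : dotc z e = rc (nrm2 z - s). Proof. by rewrite /e dotcBr dotcc zu rcB. Qed.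
Let nrmc t : nrm2 (c + t *: e) = nrm2 z + (cm t ^+ 2 - xi ^+ 2) * nrm2 e.
Proof.
rewrite -cE nrm2D nrm2Z dotcZr ze reM re_cj re_rc im_rc mulr0 subr0 reB re_rc.
rewrite !cm2 reB imB re_rc im_rc.
have -> : nrm2 z - s = xi * nrm2 e by rewrite /xi divfK // gt_eqF.
ring.
Qed.
Let sg : 0 < xi * eta.
Proof.
rewrite /xi /eta mulrACA mulr_gt0 //; last by rewrite mulr_gt0 // invr_gt0.
move: zsu => /andP[h1 h2]; nra.
Qed.

Let psi t := dotb (X (c + t *: e)) (refl X (cjv c + (rc (xi * eta) / t) *: cjv e)).

(** On the line through [z] and [u] the norm of [c + t *: e] depends on [cm t] only, and the sphere
    cuts out the circle [cm t ^+ 2 = xi * eta]. The points [z] and [u] have parameters [xi] and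
    [eta], mirror images in that circle. There [xi * eta / t] is the conjugate of [t], so [psi] is
    constant; its value at [xi] is the pairing sought. *)
Lemma circle_reflection : dotc (X z) (X u) = rc kappa.
Proof.
have /andP[zs su] := zsu.
have xi0 : xi < 0 by rewrite /xi pmulr_llt0 ?invr_gt0 // subr_lt0.
have eta0 : eta < 0 by rewrite /eta pmulr_llt0 ?invr_gt0 // subr_lt0.
pose sig := Num.sqrt (xi * eta).
have sig0 : 0 < sig by rewrite sqrtr_gt0.
have sig2 : sig ^+ 2 = xi * eta by rewrite sqr_sqrtr // ltW.
have psi_hol t : t != 0 -> cm t < M -> xi * eta < M * cm t -> hol psi t.
  move=> t0 tM qM; apply: hol_dotb => i.
    by apply: vhol_line; apply: XD; rewrite -cE; exact: DM.
  apply: (@hol_comp _ (fun q => refl X (cjv c + q *: cjv e) i 0) (fun q => rc (xi * eta) / q)).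
    by apply: hol_div => //; [exact: hol_cst|exact: hol_id].
  apply: vhol_line; apply: vhol_refl; apply: XD.
  rewrite cjvD cjvZ !cjvK -cE; apply: DM.
  by rewrite cm_cj cmM cmV cm_rc gtr0_norm // ltr_pdivrMr // cm_gt0.
have psi_circle t : cm t = sig -> psi t = rc kappa.
  move=> ht; have t0 : t != 0 by rewrite -cm_gt0 ht.
  have ct : rc (xi * eta) / t = cj t by rewrite -sig2 -ht -mul_cj mulrAC divff ?mul1r.
  rewrite /psi ct -cjvZ -cjvD refl_cjv -/(dotc _ _) dotcc Xk //.
    rewrite -cE; apply: DM; rewrite ht -(@ltr_pXn2r _ 2) ?nnegrE ?(ltW sig0) //; last first.
      by apply: le_trans (ltW xiM).
    rewrite sig2; move: xiM etaM; rewrite !ltr0_norm // => h1 h2; nra.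
  rewrite nrmc ht sig2.
  have -> : xi * eta - xi ^+ 2 = - xi * (xi - eta) by ring.
  by rewrite xe mulr1 mulNr /xi divfK ?gt_eqF //; ring.
have M0 : 0 < M by apply: le_lt_trans xiM.
move: (xiM) (etaM); rewrite !ltr0_norm // => xM eM.
have sigM : sig < M.
  by rewrite -(@ltr_pXn2r _ 2) ?nnegrE ?(ltW sig0) ?(ltW M0) // sig2; nra.
have pt (y : K) : rc (- sig) + rc y * rc (xi + sig) = rc (- sig + y * (xi + sig)) :> C.
  by rewrite -rcM -rcD.
(* Both parameters are negative, so the path leaves the circle at [- sig] and runs along the real
   axis to [xi]; on it [t] and [xi * eta / t] both stay below [M] in modulus. *)
have : \forall t \near (rc (- sig) + rc 1 * rc (xi + sig)), psi t - rc kappa = 0.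
  apply: (identity_segment (g := fun t => psi t - rc kappa)); last by rewrite ler01 lexx.
  - move=> y hy; rewrite pt; set x := _ + _ * _.
    have xE : x = (1 - y) * - sig + y * xi by rewrite /x; ring.
    have x0 : x < 0 by rewrite xE; apply: convex_lt => //; rewrite oppr_lt0.
    have xM' : - x < M.
      have -> : - x = (1 - y) * sig + y * - xi by rewrite xE; ring.
      exact: convex_lt.
    have xM2 : xi * eta < M * - x.
      have -> : M * - x = - ((1 - y) * - (M * sig) + y * - (M * - xi)) by rewrite xE; ring.
      rewrite ltrNr; apply: convex_lt => //; rewrite ltrN2.
        by rewrite -sig2 expr2 ltr_pM2r.
      by nra.
    have cx : cm (rc x : C) = - x by rewrite cm_rc ltr0_norm.
    have ic : contK (fun t : C => cm t) (rc x) by apply: contK_cm; exact: cont_id.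
    have n1 : \forall t \near rc x, (t : C) != 0.
      by apply: nbhs_neq; rewrite -cm_gt0 cx; lra.
    have n2 : \forall t \near rc x, cm (t : C) < M by apply: (contK_lt ic); rewrite cx.
    have n3 : \forall t \near rc x, xi * eta / M < cm (t : C).
      by apply: (contK_gt ic); rewrite cx ltr_pdivrMr // (mulrC (- x)).
    apply: filterS3 n1 n2 n3 => t t0 tM tM'.
    apply: holB; last exact: hol_cst.
    by apply: psi_hol => //; rewrite (mulrC M) -ltr_pdivrMr.
  - move=> d d0; have [w [w1 wn wd]] := unit_near (divr_gt0 d0 sig0).
    exists (rc (- sig) * w).
    have s0 : (rc (- sig) : C) != 0 by rewrite -cm_gt0 cm_rc normrN gtr0_norm.
    split.
    + by rewrite -subr_eq0 -{2}[rc (- sig)]mulr1 -mulrBr mulf_neq0 // subr_eq0.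
    + by rewrite -{2}[rc (- sig)]mulr1 -mulrBr cmM cm_rc normrN gtr0_norm // mulrC -ltr_pdivlMr.
    + by rewrite psi_circle ?subrr // cmM w1 mulr1 cm_rc normrN gtr0_norm.
move/nbhs_singleton/eqP; rewrite subr_eq0 pt mul1r addrC addrK => /eqP <-.
rewrite /psi rcM mulrAC divff ?mul1r; last by rewrite -cm_gt0 cm_rc normr_gt0 lt_eqF.
rewrite -[rc eta]cj_rc -cjvZ -cjvD -uE refl_cjv.
by rewrite /c subrK.
Qed.
End CircleReflection.

Definition uball n : set 'cV[C]_n := [set z | nrm2 z < 1].

Lemma segment_ball n (p v : 'cV[C]_n) (t : K) : 0 <= t <= 1 -> nrm p < 1 -> nrm (p + v) < 1 ->
  nrm (p + rc t *: v) < 1.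
Proof.
move=> /andP[t0 t1] h1 h2.
have -> : p + rc t *: v = rc (1 - t) *: p + rc t *: (p + v).
  by rewrite scalerDr addrA -scalerDl -rcD subrK rc1 scale1r.
apply: le_lt_trans (nrmD _ _) _; rewrite !nrmZ !cm_rc !ger0_norm //; last by lra.
by apply: convex_lt => //; rewrite t0.
Qed.

Section Sphere.
Variables (m n : nat) (F : 'cV[C]_m -> 'cV[C]_n) (r kappa : K).
Hypothesis r0 : 0 < r.
Hypothesis Fh : forall z, nrm2 z < 1 -> vhol F z.
Hypothesis Fr : forall z, nrm2 z = r ^+ 2 -> nrm2 z < 1 -> nrm2 (F z) = kappa.

(** The case where the sphere separates the two points, so that they lie on opposite sides of the
    circle of [circle_reflection]. *)
Let pol1 z u : nrm2 z < r ^+ 2 < nrm2 u -> nrm2 u < 1 -> dotc z u = rc (r ^+ 2) ->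
  dotc (F z) (F u) = rc kappa.
Proof.
move=> zru u1 zu; set e := z - u; set xi := (nrm2 z - r ^+ 2) / nrm2 e.
have eE : nrm2 e = nrm2 z + nrm2 u - 2 * r ^+ 2 by rewrite /e nrm2B zu re_rc.
have e0 : 0 < nrm2 e.
  rewrite nrm2_gt0 /e subr_eq0; apply/eqP => zu'; move: zru; rewrite zu'; lra.
have xiE : xi * nrm2 e = nrm2 z - r ^+ 2 by rewrite /xi divfK // gt_eqF.
set eta := (r ^+ 2 - nrm2 u) / nrm2 e.
have etaE : eta * nrm2 e = r ^+ 2 - nrm2 u by rewrite /eta divfK // gt_eqF.
(* The squared radius of the disc that the unit ball cuts out of the line. *)
pose M2 := (1 - nrm2 z) / nrm2 e + xi ^+ 2; pose M := Num.sqrt M2.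
have z1 : nrm2 z < 1 by lra.
have xe : xi - eta = 1.
  rewrite /xi /eta -mulrBl (_ : _ - _ = nrm2 e) ?divff ?gt_eqF //.
  by rewrite eE; ring.
have q1 : xi ^+ 2 < M2 by rewrite /M2 ltrDr divr_gt0 //; lra.
have q2 : eta ^+ 2 < M2.
  rewrite -(ltr_pM2r e0) /M2 mulrDl divfK ?gt_eqF //.
  have -> : eta ^+ 2 * nrm2 e = eta * (eta * nrm2 e) by ring.
  have -> : xi ^+ 2 * nrm2 e = xi * (xi * nrm2 e) by ring.
  rewrite xiE etaE; have -> : eta = xi - 1 by lra.
  have : xi * nrm2 e - eta * nrm2 e = nrm2 e by rewrite -mulrBl xe mul1r.
  rewrite eE in xiE; move: zru u1 xiE; nra.
have M20 : 0 < M2 by apply: le_lt_trans q1; exact: sqr_ge0.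
have MM : M ^+ 2 = M2 by rewrite sqr_sqrtr // ltW.
have M0 : 0 <= M by exact: sqrtr_ge0.
have sq (x : K) : x ^+ 2 < M2 -> `|x| < M.
  by move=> h; rewrite -(@ltr_pXn2r _ 2) ?nnegrE // real_normK ?num_real // MM.
apply: (@circle_reflection m n F (@uball m) (r ^+ 2) kappa M z u zu zru) => //.
- move=> t tM; rewrite /uball /= -/e -/xi nrm2D nrm2Z dotcZr.
  have -> : dotc z e = rc (nrm2 z - r ^+ 2) by rewrite /e dotcBr dotcc zu rcB.
  rewrite reM re_cj re_rc im_rc mulr0 subr0 reB re_rc -xiE cm2 reB imB re_rc im_rc.
  have : cm t ^+ 2 < M2 by rewrite -MM ltr_pXn2r // nnegrE ?cm_ge0.
  rewrite /M2 -(ltr_pM2r e0) mulrDl divfK ?gt_eqF // cm2; nra.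
- exact: sq.
- exact: sq.
- by move=> p hp hr; apply: Fr.
Qed.

(** For fixed [u] the relation is holomorphic in [z] on the line [dotc z u = r ^+ 2]. It holds near
    [z0], the point of this line closest to the origin, which lies inside the small sphere, and
    continues from there to [z]. *)
Let pol2 z u : nrm2 z < 1 -> r ^+ 2 < nrm2 u -> nrm2 u < 1 -> dotc z u = rc (r ^+ 2) ->
  dotc (F z) (F u) = rc kappa.
Proof.
move=> z1 ru u1 zu; have u0 : 0 < nrm2 u by apply: le_lt_trans ru; exact: sqr_ge0.
pose z0 := rc (r ^+ 2 / nrm2 u) *: u.
have z0u : dotc z0 u = rc (r ^+ 2) by rewrite /z0 dotcZl dotcc -rcM divfK // gt_eqF.
have r2 : 0 < r ^+ 2 by rewrite exprn_gt0.
have nz0 : nrm2 z0 < r ^+ 2.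
  rewrite /z0 nrm2Z cm_rc real_normK ?num_real // expr_div_n.
  have -> : (r ^+ 2) ^+ 2 / nrm2 u ^+ 2 * nrm2 u = r ^+ 2 * (r ^+ 2 / nrm2 u).
    by field; rewrite gt_eqF.
  by rewrite -[ltRHS]mulr1 ltr_pM2l // ltr_pdivrMr // mul1r.
pose g t := dotb (F (z0 + t *: (z - z0))) (cjv (F u)) - rc kappa.
have : \forall t \near ((0 : C) + rc 1 * 1), g t = 0.
  apply: (identity_segment (g := g)); last by rewrite ler01 lexx.
  - move=> y hy; rewrite add0r mulr1.
    have hn : nrm (z0 + rc y *: (z - z0)) < 1.
      by apply: segment_ball; rewrite ?(addrC z0) ?subrK -?nrm2_lt1 //; lra.
    apply: filterS (near_lt_nrm hn) => t ht; apply: holB; last exact: hol_cst.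
    apply: hol_dotb => i; last exact: hol_cst.
    by apply: vhol_line; apply: Fh; rewrite nrm2_lt1.
  - have hn : nrm (z0 + (0 : C) *: (z - z0)) < r by rewrite scale0r addr0 nrm_lt.
    move=> e' e'0; have := @zero_near_ex _ g 0 0 e' _ e'0; apply.
    apply: filterS (near_lt_nrm hn) => t ht; apply/eqP; rewrite subr_eq0; apply/eqP.
    apply: pol1 => //; first by rewrite -nrm_lt // ht.
    by rewrite dotcDl dotcZl dotcBl z0u zu subrr mulr0 addr0.
move/nbhs_singleton/eqP; rewrite /g add0r mulr1 rc1 scale1r (addrC z0) subrK subr_eq0.
by move/eqP.
Qed.

Lemma sphere_polarization z u : nrm2 z < 1 -> nrm2 u < 1 -> dotc z u = rc (r ^+ 2) ->
  dotc (F z) (F u) = rc kappa.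
Proof.
move=> z1 u1 zu; case: (ltP (r ^+ 2) (nrm2 u)) => ru; first exact: pol2.
case: (ltP (r ^+ 2) (nrm2 z)) => rz.
  rewrite -(cj_rc kappa) -(@pol2 u z u1 rz z1) ?cj_dotc //.
  by rewrite -(cj_rc (r ^+ 2)) -zu cj_dotc.
(* Neither point is outside the sphere, so Cauchy-Schwarz is an equality and forces [z = u] on the
   sphere itself. *)
have := cauchy_schwarz z u; rewrite zu cm_rc ger0_norm ?sqr_ge0 //.
have r2 : 0 < r ^+ 2 by rewrite exprn_gt0.
move: rz ru; set a := nrm2 z; set b := nrm2 u => az bu h.
have a0 : 0 <= a by exact: nrm2_ge0.
have ar : a = r ^+ 2 by nra.
have br : b = r ^+ 2 by nra.
have : nrm2 (z - u) = 0 by rewrite nrm2B zu re_rc -/a -/b ar br; ring.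
move/eqP; rewrite nrm2_eq0 subr_eq0 => /eqP <-.
by rewrite dotcc Fr.
Qed.

End Sphere.
End Polarization.

(** * Determinants of values of a map along a line *)

Section Scaling.
Variable K : realType.
Local Notation C := (cplx K).

(** Determinants are polynomials in the entries; one argument serves both holomorphy and
    continuity. *)
Lemma det_closed (T : Type) (P : (T -> C) -> Prop) n (A : T -> 'M[C]_n) :
  (forall c, P (fun=> c)) -> (forall f g, P f -> P g -> P (fun t => f t + g t)) ->
  (forall f g, P f -> P g -> P (fun t => f t * g t)) ->
  (forall i j, P (fun t => A t i j)) -> P (fun t => \det (A t)).
Proof.
move=> Pc PD PM PA.
have Psum (I : Type) (s : seq I) (G : I -> T -> C) : (forall i, P (G i)) -> P (fun t => \sum_(i <- s) G i t).
  move=> h; elim: s => [|i s IH]; first by under eq_fun do rewrite big_nil.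
  by under eq_fun do rewrite big_cons; exact: PD.
have Pprod (I : Type) (s : seq I) (G : I -> T -> C) : (forall i, P (G i)) -> P (fun t => \prod_(i <- s) G i t).
  move=> h; elim: s => [|i s IH]; first by under eq_fun do rewrite big_nil.
  by under eq_fun do rewrite big_cons; exact: PM.
rewrite /determinant; apply: Psum => s; apply: PM => //.
by apply: Pprod => i.
Qed.

Lemma hol_det n (A : C -> 'M[C]_n) t : (forall i j, hol (fun s => A s i j) t) ->
  hol (fun s => \det (A s)) t.
Proof.
apply: (@det_closed C (fun f => hol f t) n A) => [c|f g|f g].
- exact: hol_cst.
- exact: holD.
- exact: holM.
Qed.

Lemma vcont_cst n (c : C) (p : 'cV[C]_n) : vcont (fun=> c) p.
Proof. by move=> e e0; exists 1 => // z _; rewrite subrr cm0. Qed.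

Lemma vcont_comp n (g : C -> C) f (p : 'cV[C]_n) : cont g (f p) -> vcont f p -> vcont (fun z => g (f z)) p.
Proof.
move=> /contP gc fc e /gc [d d0 hd]; have [d' d'0 hd'] := fc _ d0.
by exists d' => // z /hd' /hd.
Qed.

Lemma vcontD n f g (p : 'cV[C]_n) : vcont f p -> vcont g p -> vcont (fun z => f z + g z) p.
Proof.
move=> fc gc e e0; have e20 : 0 < e / 2 by lra.
have [d d0 hd] := fc _ e20; have [d' d'0 hd'] := gc _ e20.
exists (Num.min d d'); first by rewrite lt_min d0.
move=> z; rewrite lt_min => /andP[/hd h1 /hd' h2].
by rewrite opprD addrACA; apply: le_lt_trans (cmD _ _) _; lra.
Qed.

Lemma vcontM n f g (p : 'cV[C]_n) : vcont f p -> vcont g p -> vcont (fun z => f z * g z) p.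
Proof.
(* A product is a difference of squares, which reduces the claim to sums and to composition with
   functions of one variable. *)
move=> fc gc; have E : (fun z => f z * g z) =
  (fun z => 4^-1 * ((f z + g z) ^+ 2 + (-1) * (f z + -1 * g z) ^+ 2)).
  by apply/funext => z; field.
have sq (x : C) : cont (fun y => y ^+ 2) x by apply/hol_cont/holX/hol_id.
have li (c x : C) : cont (fun y => c * y) x.
  by apply/hol_cont/holM; [exact: hol_cst|exact: hol_id].
rewrite E; apply: (vcont_comp (g := fun y => 4^-1 * y)); first exact: li.
apply: vcontD; first by apply: (vcont_comp (g := fun y => y ^+ 2)); [exact: sq|exact: vcontD].
apply: (vcont_comp (g := fun y => -1 * y)); first exact: li.
apply: (vcont_comp (g := fun y => y ^+ 2)); first exact: sq.
apply: vcontD => //; apply: (vcont_comp (g := fun y => -1 * y)) => //; exact: li.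
Qed.

Lemma vcont_dotb n (a p : 'cV[C]_n) : vcont (dotb a) p.
Proof.
move=> e e0; have a0 := nrm_ge0 a; exists (e / (nrm a + 1)); first by rewrite divr_gt0 //; lra.
move=> z; rewrite ltr_pdivlMr; last by lra.
move=> h; rewrite -dotbBr; apply: le_lt_trans (cm_dotb _ _) _.
by have := nrm_ge0 (z - p); nra.
Qed.

Lemma vcont_neq0 n f (p : 'cV[C]_n) : vcont f p -> f p != 0 ->
  exists2 d : K, 0 < d & forall z, nrm (z - p) < d -> f z != 0.
Proof.
rewrite -cm_gt0 => fc f0; have [d d0 hd] := fc _ f0; exists d => // z /hd.
by case: eqVneq => // ->; rewrite sub0r cmN ltxx.
Qed.

Definition tuple_mx N (F : 'cV[C]_2 -> 'cV[C]_N) (a : 'I_N -> 'cV[C]_2) : 'M[C]_N :=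
  \matrix_(i, k) F (a i) k 0.

Lemma tuple_mx_mul N F (a : 'I_N -> 'cV[C]_2) x i : (tuple_mx F a *m x) i 0 = dotb (F (a i)) x.
Proof. by rewrite dotb.unlock mxE; apply: eq_bigr => k _; rewrite mxE. Qed.

Lemma not_acc_zeros (g : C -> C) p : ~ acc_zeros g p ->
  exists2 e : K, 0 < e & forall z, z != p -> cm (z - p) < e -> g z != 0.
Proof.
move=> h; apply: contrapT => h'; apply: h => e e0; apply: contrapT => h2; apply: h'.
by exists e => // z zp ze; apply/eqP => gz; apply: h2; exists z.
Qed.

Section TupleNear.
Variables (N : nat) (F : 'cV[C]_2 -> 'cV[C]_N).
Hypothesis Fh : forall z, nrm z < 1 -> vhol F z.
Variables (p0 e : 'cV[C]_2) (s : 'I_N -> C).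
Hypothesis p01 : nrm p0 < 1.
Hypothesis s1 : forall i, nrm (p0 + s i *: e) < 1.
Hypothesis D1 : \det (tuple_mx F (fun i => p0 + s i *: e)) != 0.

Lemma hol_tuple (a d : 'I_N -> 'cV[C]_2) (t : C) : (forall i, nrm (a i + t *: d i) < 1) ->
  hol (fun t => \det (tuple_mx F (fun i => a i + t *: d i))) t.
Proof.
move=> h; apply: hol_det => i k.
have -> : (fun t => tuple_mx F (fun i => a i + t *: d i) i k) = (fun t => F (a i + t *: d i) k 0).
  by apply/funext => x; rewrite mxE.
by apply: vhol_line; exact: Fh.
Qed.

Lemma near_hol_tuple (a d : 'I_N -> 'cV[C]_2) (t : C) : (forall i, nrm (a i + t *: d i) < 1) ->
  \forall t \near t, hol (fun t => \det (tuple_mx F (fun i => a i + t *: d i))) t.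
Proof.
move=> h; have H i : \forall t \near t, nrm (a i + t *: d i) < 1 by exact: near_lt_nrm.
have /cm_ballP [d' d'0 hd'] : \forall x \near t, forall i, nrm (a i + x *: d i) < 1.
  exact: (@filter_forall C 'I_N (fun i x => nrm (a i + x *: d i) < 1) (nbhs t) _ H).
by apply/cm_ballP; exists d' => // x /hd'; exact: hol_tuple.
Qed.

(** Independence is moved to a parallel line near [q]: the tuple is first contracted towards [p0],
    then translated by nearly [q - p0]. In both moves the determinant is holomorphic in the
    parameter and nonzero at one end, so parameters as close as desired to the other end keep it
    nonzero. *)
Lemma tuple_near q (eps : K) : nrm q < 1 -> 0 < eps -> exists p (c : 'I_N -> C),
  [/\ nrm (p - q) < eps, forall i, nrm (p + c i *: e - q) < eps, forall i, nrm (p + c i *: e) < 1 &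
      \det (tuple_mx F (fun i => p + c i *: e)) != 0].
Proof.
move=> q1 eps0; pose S := \sum_i cm (s i) * nrm e.
have S0 : 0 <= S by apply: sumr_ge0 => i _; rewrite mulr_ge0 ?cm_ge0 ?nrm_ge0.
have leS i : cm (s i) * nrm e <= S.
  by rewrite /S (bigD1 i) //= lerDl; apply: sumr_ge0 => j _; rewrite mulr_ge0 ?cm_ge0 ?nrm_ge0.
pose m := Num.max (nrm p0) (nrm q).
have m1 : nrm p0 <= m by rewrite le_max lexx.
have m2 : nrm q <= m by rewrite le_max lexx orbT.
have m3 : m < 1 by rewrite gt_max p01.
pose del := Num.min eps (1 - m) / 2.
have del0 : 0 < del by rewrite divr_gt0 // lt_min eps0; lra.
have del1 : 2 * del <= eps by rewrite /del mulrC divfK // ge_min lexx.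
have del2 : 2 * del <= 1 - m by rewrite /del mulrC divfK // ge_min lexx orbT.
have del3 : del < 2 * del by rewrite mulr_natl mulr2n ltrDl.
pose g1 t := \det (tuple_mx F (fun i => p0 + t *: (s i *: e))).
have [|e1 e10 he1] := @not_acc_zeros g1 0.
  move=> ha; have : \forall z \near (0 + rc 1 * 1), g1 z = 0.
    apply: (identity_segment _ ha); last by rewrite ler01 lexx.
    move=> y hy; apply: near_hol_tuple => i; rewrite add0r mulr1.
    exact: segment_ball.
  move/nbhs_singleton; rewrite /g1 add0r mulr1 rc1.
  under [in X in tuple_mx _ X]eq_fun do rewrite scale1r.
  by move=> h; move: D1; rewrite h eqxx.
pose eta := Num.min (e1 / 2) (del / (S + 1)).
have Sp : 0 < S + 1 by lra.
have eta0 : 0 < eta by rewrite lt_min divr_gt0 //= divr_gt0.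
have eta1 : eta <= e1 / 2 by rewrite ge_min lexx.
have eta2 : eta * S < del.
  have : eta <= del / (S + 1) by rewrite ge_min lexx orbT.
  by rewrite ler_pdivlMr //; nra.
have ceta : cm (rc eta : C) = eta by rewrite cm_rc gtr0_norm.
have ze i : nrm (rc eta *: (s i *: e)) < del.
  rewrite !nrmZ ceta; apply: le_lt_trans eta2.
  by rewrite ler_wpM2l // ltW.
have g1eta : g1 (rc eta) != 0.
  apply: he1; first by rewrite -cm_gt0 ceta.
  by rewrite subr0 ceta (le_lt_trans eta1) // ltr_pdivrMr // ltr_pMr // ltr1n.
pose v := q - p0.
pose g2 t := \det (tuple_mx F (fun i => p0 + rc eta *: (s i *: e) + t *: v)).
have [|e2 e20 he2] := @not_acc_zeros g2 1.
  move=> ha; have : \forall z \near (1 + rc 1 * (-1)), g2 z = 0.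
    apply: (identity_segment _ ha); last by rewrite ler01 lexx.
    move=> y /andP[y0 y1]; apply: near_hol_tuple => i.
    have -> : p0 + rc eta *: (s i *: e) + (1 + rc y * -1) *: v =
        (rc (1 - y) *: q + rc y *: p0) + rc eta *: (s i *: e).
      rewrite /v rcB rc1; move: (rc eta *: _) (rc y) => w0 y'; clear.
      apply/matrixP => k j; rewrite !mxE.
      by move: (p0 k j) (q k j) (w0 k j) => A B D; ring.
    apply: le_lt_trans (nrmD _ _) _; apply: (@le_lt_trans _ _ (m + del)); last by rewrite -ltrBrDl (lt_le_trans del3).
    apply: lerD; last exact: ltW.
    apply: le_trans (nrmD _ _) _; rewrite !nrmZ !cm_rc !ger0_norm ?subr_ge0 //.
    by apply: convex_le m2 m1; rewrite y0 y1.
  move/nbhs_singleton; rewrite /g2 rc1 mul1r subrr.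
  under [in X in tuple_mx _ X]eq_fun do rewrite scale0r addr0.
  by move=> h; move: g1eta; rewrite /g1 h eqxx.
have v0 := nrm_ge0 v.
pose x := Num.min (e2 / 2) (del / (nrm v + 1)).
have x0 : 0 < x by rewrite lt_min divr_gt0 //= divr_gt0 // (le_lt_trans v0) // ltrDl.
have x1 : x <= e2 / 2 by rewrite ge_min lexx.
have x2 : x * nrm v < del.
  have : x <= del / (nrm v + 1) by rewrite ge_min lexx orbT.
  move: v0 x0 => v0 x0; rewrite ler_pdivlMr ?ltr_wpDl // mulrDr mulr1 => /(lt_le_trans _); apply.
  by rewrite ltrDl.
have cx : cm (rc x : C) = x by rewrite cm_rc gtr0_norm.
pose p := p0 + (1 + rc x) *: v.
have pq : p - q = rc x *: v.
  by rewrite /p /v scalerDl scale1r addrA (addrC p0) subrK addrAC subrr add0r.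
have npq : nrm (p - q) < del by rewrite pq nrmZ cx.
have bq i : nrm (p + (rc eta * s i) *: e - q) < 2 * del.
  rewrite addrAC -scalerA; apply: le_lt_trans (nrmD _ _) _.
  by rewrite mulr_natl mulr2n; exact: ltrD npq (ze i).
exists p, (fun i => rc eta * s i); split.
- exact: lt_trans npq (lt_le_trans del3 del1).
- by move=> i; exact: lt_le_trans (bq i) del1.
- move=> i; have := nrmD (p + (rc eta * s i) *: e - q) q.
  rewrite subrK => /le_lt_trans; apply; apply: lt_le_trans (ltr_leD (bq i) m2) _.
  by rewrite -lerBrDr.
- have E1 : 1 + rc x - 1 = rc x :> C by rewrite addrC addKr.
  have h1 : 1 + rc x != 1 :> C by rewrite -subr_eq0 E1 -cm_gt0 cx.
  have h2 : cm (1 + rc x - 1 : C) < e2 by rewrite E1 cx (le_lt_trans x1) // ltr_pdivrMr // ltr_pMr // ltr1n.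
  have := he2 _ h1 h2; rewrite /g2.
  suff -> : (fun i => p0 + rc eta *: (s i *: e) + (1 + rc x) *: v) =
      (fun i => p + (rc eta * s i) *: e) by [].
  by apply/funext => i; rewrite /p [LHS]addrAC (scalerA (rc eta) (s i) e).
Qed.
End TupleNear.

Definition perp2 (v : 'cV[C]_2) := mk2 (- v 1 0) (v 0 0).
Lemma dotb2 (z w : 'cV[C]_2) : dotb z w = z 0 0 * w 0 0 + z 1 0 * w 1 0.
Proof.
rewrite dotb.unlock 2!big_ord_recl big_ord0 addr0.
by have -> : lift ord0 ord0 = 1 :> 'I_2 by apply/val_inj.
Qed.
Lemma dotb_perp2 v : dotb v (perp2 v) = 0.
Proof. by rewrite dotb2 mk2_0 mk2_1; ring. Qed.
Lemma nrm2_perp2 v : nrm2 (perp2 v) = nrm2 v.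
Proof. by rewrite nrm2_mk2 cmN addrC -nrm2_2. Qed.
End Scaling.

(** * Continuation across the unit sphere and polarization there *)

Section ScalingTheorem.
Variable K : realType.
Local Notation C := (cplx K).
Variables (N : nat) (F : 'cV[C]_2 -> 'cV[C]_N) (r kappa : K).
Hypothesis r0 : 0 < r.
Hypothesis Fh : forall z, nrm z < 1 -> vhol F z.
Hypothesis pol : forall z w, nrm z < 1 -> nrm w < 1 -> dotb z w = rc (r ^+ 2) ->
  dotb (F z) (refl F w) = rc kappa.
Hypothesis rad : forall u, nrm u = 1 -> forall eps : K, 0 < eps -> exists2 del, 0 < del &
  forall t : K, 1 - del < t < 1 -> `|nrm2 (F (rc t *: u)) - 1| < eps.

Let r2_gt0 : 0 < r ^+ 2. Proof. by rewrite exprn_gt0. Qed.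

Let reflh w : nrm w < 1 -> vhol (refl F) w.
Proof. by move=> h; apply: vhol_refl; apply: Fh; rewrite nrm_cjv. Qed.

Section Extension.
Variables (w0 : 'cV[C]_2) (a : 'I_N -> 'cV[C]_2).
Hypothesis w01 : nrm w0 = 1.
Hypothesis aw0 : forall i, dotb (a i) w0 = rc (r ^+ 2).
Hypothesis a1 : forall i, nrm (a i) < 1.
Hypothesis Da : \det (tuple_mx F a) != 0.

(** The factor that brings [a i] back onto the line [dotb z w = r ^+ 2] when [w] leaves [w0]; it is
    1 at [w0]. *)
Let phi i w : C := rc (r ^+ 2) / dotb (a i) w.
Let am w i := phi i w *: a i.
Let Mx w := tuple_mx F (am w).

(* [F] on the line [dotb z w = r ^+ 2] determines [refl F w] by polarization;
   Cramer's rule then continues [refl F] across the unit sphere near [w0]. *)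
Definition extension w : 'cV[C]_N := (\det (Mx w))^-1 *: (\adj (Mx w) *m const_mx (rc kappa)).

Definition good w := [/\ forall i, dotb (a i) w != 0, forall i, nrm (am w i) < 1 & \det (Mx w) != 0].

Let phi0 i : phi i w0 = 1.
Proof. by rewrite /phi aw0 divff // -cm_gt0 cm_rc gtr0_norm. Qed.

Let g i k (t : C) := F (t *: a i) k 0.
Let g_hol i k t : nrm (t *: a i) < 1 -> hol (g i k) t.
Proof.
move=> h; have -> : g i k = fun t => F (0 + t *: a i) k 0.
  by apply/funext => s; rewrite add0r.
by apply: vhol_line; rewrite add0r; exact: Fh.
Qed.

Lemma good_near : exists2 d, 0 < d & forall w, nrm (w - w0) < d -> good w.
Proof.
have r2n : (rc (r ^+ 2) : C) != 0 by rewrite -cm_gt0 cm_rc gtr0_norm.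
have H1 i : exists2 d, 0 < d & forall w, nrm (w - w0) < d -> dotb (a i) w != 0.
  apply: vcont_neq0; first exact: vcont_dotb.
  by rewrite aw0.
have phic i : vcont (phi i) w0.
  apply: (vcont_comp (g := fun x => rc (r ^+ 2) / x)); last exact: vcont_dotb.
  by apply/hol_cont/hol_div; [rewrite aw0|exact: hol_cst|exact: hol_id].
have H2 i : exists2 d, 0 < d & forall w, nrm (w - w0) < d -> nrm (am w i) < 1.
  have e0 : 0 < 1 - nrm (a i) by have := a1 i; lra.
  have [d d0 hd] := phic i _ e0; exists d => // w /hd; rewrite phi0 => h.
  have -> : am w i = a i + (phi i w - 1) *: a i by rewrite scalerBl scale1r addrC subrK.
  apply: le_lt_trans (nrmD _ _) _; rewrite nrmZ.
  by have := nrm_ge0 (a i); have := a1 i; have := cm_ge0 (phi i w - 1); nra.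
have H3 : exists2 d, 0 < d & forall w, nrm (w - w0) < d -> \det (Mx w) != 0.
  apply: (@vcont_neq0 K 2 (fun w => \det (Mx w))); last first.
    suff -> : Mx w0 = tuple_mx F a by [].
    by congr tuple_mx; apply/funext => i; rewrite /am phi0 scale1r.
  apply: (@det_closed K _ (fun f => vcont f w0) N Mx) => [c|f h|f h|i k].
  - exact: vcont_cst.
  - exact: vcontD.
  - exact: vcontM.
  - have -> : (fun w => Mx w i k) = (fun w => g i k (phi i w)).
      by apply/funext => w; rewrite mxE.
    apply: vcont_comp => //; apply/hol_cont/g_hol; rewrite phi0 scale1r; exact: a1.
have fin (P : 'I_N -> 'cV[C]_2 -> Prop) :
    (forall i, exists2 d : K, 0 < d & forall w, nrm (w - w0) < d -> P i w) ->
    exists2 d : K, 0 < d & forall w, nrm (w - w0) < d -> forall i, P i w.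
  move=> h; pose D i := sval (cid2 (h i)).
  exists (\big[Num.min/1]_i D i).
    elim/big_ind : _ => // [x y x0 y0|i _]; first by rewrite lt_min x0.
    by rewrite /D; case: cid2.
  move=> w hw i; have : nrm (w - w0) < D i.
    by apply: lt_le_trans hw _; rewrite (bigD1 i) //= ge_min lexx.
  by rewrite /D; case: cid2 => /= d d0 hd /hd.
have [d1 d10 h1] := fin _ H1; have [d2 d20 h2] := fin _ H2; have [d3 d30 h3] := H3.
exists (Num.min d1 (Num.min d2 d3)); first by rewrite !lt_min d10 d20.
by move=> w; rewrite !lt_min => /andP[/h1 ? /andP[/h2 ? /h3 ?]].
Qed.

Lemma extension_hol w : good w -> vhol extension w.
Proof.
move=> [g1 g2 g3] k v.
have phih i : hol (fun t => phi i (w + t *: v)) 0.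
  apply: hol_div; [by rewrite scale0r addr0; exact: g1|exact: hol_cst|].
  have -> : (fun t => dotb (a i) (w + t *: v)) = (fun t => dotb (a i) w + t * dotb (a i) v).
    by apply/funext => t; rewrite dotbDr dotbZr.
  exact: hol_affine.
have Mh i j : hol (fun t => Mx (w + t *: v) i j) 0.
  have -> : (fun t => Mx (w + t *: v) i j) = (fun t => g i j (phi i (w + t *: v))).
    by apply/funext => t; rewrite mxE.
  apply: (hol_comp (phih i)); apply: g_hol.
  by rewrite scale0r addr0; exact: g2.
have -> : (fun t => extension (w + t *: v) k 0) = (fun t => (\det (Mx (w + t *: v)))^-1 *
    \sum_j (\adj (Mx (w + t *: v)) k j * rc kappa)).
  apply/funext => t; rewrite /extension mxE; congr (_ * _); rewrite mxE.
  by apply: eq_bigr => j _; rewrite [const_mx _ _ _]mxE.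
apply: holM.
  by apply: holV; [rewrite scale0r addr0|exact: hol_det].
apply: hol_sum => j _; apply: holM; last exact: hol_cst.
have -> : (fun t => (\adj (Mx (w + t *: v))) k j) = (fun t => (-1) ^+ (j + k) *
    \det (row' j (col' k (Mx (w + t *: v))))).
  by apply/funext => t; rewrite mxE.
apply: holM; first exact: hol_cst.
apply: hol_det => p q.
have -> : (fun t => row' j (col' k (Mx (w + t *: v))) p q) =
  (fun t => Mx (w + t *: v) (lift j p) (lift k q)) by apply/funext => t; rewrite !mxE.
exact: Mh.
Qed.

Lemma extension_eq w : good w -> nrm w < 1 -> extension w = refl F w.
Proof.
move=> [g1 g2 g3] w1.
have E : Mx w *m refl F w = const_mx (rc kappa).
  apply/matrixP => i j; rewrite ord1 tuple_mx_mul mxE (pol (g2 i) w1) // dotbZl /phi divfK //.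
by rewrite /extension -E mulmxA mul_adj_mx mul_scalar_mx scalerA mulVf // scale1r.
Qed.

Variable del : K.
Hypothesis del0 : 0 < del.
Hypothesis del_good : forall w, nrm (w - w0) < del -> good w.

Let contK_nrm2 (X : C -> 'cV[C]_N) t : (forall i, hol (fun s => X s i 0) t) -> contK (fun s => nrm2 (X s)) t.
Proof.
move=> h; have -> : (fun s => nrm2 (X s)) = (fun s => \sum_i cm (X s i 0) ^+ 2).
  by apply/funext => s; rewrite nrm2.unlock.
by apply: contK_sum => i _; apply: sq_cont.
Qed.

(** On the ray to [w] the extension is [refl F], whose squared norm tends to 1 by the radial limits;
    continuity of the extension gives the value at [w]. *)
Lemma extension_sphere w : nrm (w - w0) < del -> nrm w = 1 -> nrm2 (extension w) = 1.
Proof.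
move=> wd w1; apply/eqP; rewrite -subr_eq0 -normr_eq0 eq_le normr_ge0 andbT leNgt; apply/negP => h.
set x := `|_| in h; have x20 : 0 < x / 2 by lra.
have cw : nrm (cjv w) = 1 by rewrite nrm_cjv.
have [d1 d10 h1] := rad cw x20.
have Ec : contK (fun t => nrm2 (extension (0 + t *: w))) 1.
  apply: contK_nrm2 => i; apply: vhol_line.
  by rewrite add0r scale1r; apply/extension_hol/del_good.
have /contKP /(_ _ x20) [d2 d20 h2] := Ec.
have [d3 d30 h3] : exists2 d, 0 < d & forall t, cm (t - 1) < d -> nrm (- w0 + t *: w) < del.
  by apply/cm_ballP; apply: near_lt_nrm; rewrite scale1r addrC.
pose y := Num.min 1 (Num.min d1 (Num.min d2 d3)).
have y0 : 0 < y by rewrite !lt_min d10 d20 d30 ltr01.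
have y1 : y <= 1 by rewrite ge_min lexx.
have yd1 : y <= d1 by rewrite !ge_min lexx !orbT.
have yd2 : y <= d2 by rewrite !ge_min lexx !orbT.
have yd3 : y <= d3 by rewrite !ge_min lexx !orbT.
pose t := 1 - y / 2.
have yh : 0 < y / 2 by rewrite divr_gt0.
have yh1 : y / 2 < y by rewrite ltr_pdivrMr // ltr_pMr // ltr1n.
have ct : cm (rc t - 1 : C) = y / 2.
  by rewrite -rc1 -rcB cm_rc /t addrAC subrr add0r normrN gtr0_norm.
have e1 := h1 t ltac:(by rewrite ltrD2l ltrN2 gtrBl (lt_le_trans yh1)).
have e2 := h2 (rc t) ltac:(by rewrite ct (lt_le_trans yh1)).
have e3 := h3 (rc t) ltac:(by rewrite ct (lt_le_trans yh1)).
move: e2; rewrite !add0r scale1r extension_eq; last 2 first.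
- by apply: del_good; rewrite addrC.
- by rewrite nrmZ w1 mulr1 cm_rc ger0_norm ?gtrBl // subr_ge0 ltW // (lt_le_trans yh1).
rewrite /refl cjvZ cj_rc nrm2_cjv => e2.
have : x <= `|nrm2 (F (rc t *: cjv w)) - nrm2 (extension w)| + `|nrm2 (F (rc t *: cjv w)) - 1|.
  by rewrite /x distrC; apply: le_trans (ler_distD (nrm2 (F (rc t *: cjv w))) _ _) _; rewrite addrC distrC (distrC _ 1).
lra.
Qed.

Let Omega : set 'cV[C]_2 := [set w | nrm (w - w0) < del].

(** In [circle_reflection], [w] has parameter [- x / nrm2 e], and a disc of twice that radius holds
    both parameters. Its points are within [3 * x / nrm e] of [w]; the lower bound on [nrm2 (z - w)]
    turns this into [6 * Num.sqrt x]. *)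
Let outer_local z w x : nrm2 w = 1 + x -> 0 < x -> nrm2 z < 1 -> x / 4 < nrm2 (z - w) ->
  nrm (w - w0) + 6 * Num.sqrt x < del -> dotc z w = rc 1 ->
  dotc (extension z) (extension w) = rc 1.
Proof.
move=> wx x0 z1 zwx wd zw; set e := z - w.
have eE : nrm2 e = nrm2 z + nrm2 w - 2 * 1 by rewrite /e nrm2B zw re_rc.
have s0 : 0 < Num.sqrt x by rewrite sqrtr_gt0.
have s2 : Num.sqrt x ^+ 2 = x by rewrite sqr_sqrtr // ltW.
have ne0 := nrm_ge0 e; have ne2 := nrm_sqr e.
have e0 : 0 < nrm2 e by apply: lt_trans zwx; lra.
have ne : Num.sqrt x / 2 < nrm e.
  have sx2 : 0 <= Num.sqrt x / 2 by lra.
  rewrite -(@ltr_pXn2r _ 2) ?nnegrE // ne2 expr_div_n s2; apply: le_lt_trans zwx; lra.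
have n0 : 0 < nrm e by apply: lt_trans ne; lra.
set M := 2 * (x / nrm2 e).
have xe : 0 < x / nrm2 e by rewrite divr_gt0.
have xn : x / nrm2 e * nrm e < 2 * Num.sqrt x.
  have -> : x / nrm2 e * nrm e = x / nrm e by rewrite -ne2; field; rewrite gt_eqF.
  by rewrite ltr_pdivrMr // -{1}s2; nra.
have etaE : (1 - nrm2 w) / nrm2 e = - (x / nrm2 e) by rewrite wx opprD addrA subrr add0r mulNr.
have xiE : (nrm2 z - 1) / nrm2 e = 1 - x / nrm2 e.
  have -> : nrm2 z - 1 = nrm2 e + (1 - nrm2 w) by rewrite eE; ring.
  by rewrite mulrDl divff ?gt_eqF // etaE.
have q0 : 1 - x / nrm2 e < 0.
  by rewrite -xiE pmulr_llt0 ?invr_gt0 //; lra.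
apply: (@circle_reflection K 2 N extension Omega 1 1 M z w zw) => //.
- by rewrite wx; apply/andP; split; lra.
- move=> t tM; rewrite -/e xiE /Omega /=.
  have -> : z + (t - rc (1 - x / nrm2 e)) *: e - w0 = (w - w0) + (t + rc (x / nrm2 e)) *: e.
    have -> : t - rc (1 - x / nrm2 e) = (t + rc (x / nrm2 e)) - 1 by rewrite rcB rc1; ring.
    rewrite scalerBl scale1r; move: (_ *: e) => v; apply/matrixP => k j; rewrite !mxE.
    by move: (z k j) (v k j) (w k j) (w0 k j) => A B D A'; ring.
  apply: le_lt_trans (nrmD _ _) _; rewrite nrmZ.
  have c1 : cm (t + rc (x / nrm2 e)) < 3 * (x / nrm2 e).
    apply: le_lt_trans (cmD _ _) _; rewrite cm_rc gtr0_norm //.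
    by move: tM; rewrite /M; lra.
  have : cm (t + rc (x / nrm2 e)) * nrm e < 6 * Num.sqrt x by nra.
  lra.
- by rewrite -/e xiE /M ltr0_norm //; lra.
- by rewrite -/e etaE normrN gtr0_norm // /M; lra.
- by move=> p hp; apply/extension_hol/del_good.
- move=> p hp p1; apply: extension_sphere => //.
  by rewrite nrm.unlock p1 sqrtr1.
Qed.

(** The point [z0] of the line [dotc z w = 1] is near [w0] yet far enough from [w] for
    [outer_local]; from there the relation continues along the line inside the ball, with [refl F]
    in place of the extension. *)
Lemma extension_polarization z w x : nrm2 w = 1 + x -> 0 < x <= 1 / 2 ->
  nrm (w - w0) + 6 * Num.sqrt x < del -> nrm z < 1 -> dotc z w = 1 ->
  dotc (refl F z) (extension w) = 1.
Proof.
move=> wx /andP[x0 x1] wd z1 zw.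
have s0 : 0 < Num.sqrt x by rewrite sqrtr_gt0.
have s2 : Num.sqrt x ^+ 2 = x by rewrite sqr_sqrtr // ltW.
have x4 : 0 <= x / 4 by rewrite divr_ge0 // ltW.
(* The factor [y] puts [z0] on the line, and [s] moves it sideways: [x / 3] is large enough for
   [nrm2 (z0 - w) > x / 4] and, as [x <= 1 / 2], small enough for [nrm2 z0 < 1]. *)
pose s := Num.sqrt (x / 3); have ss : s ^+ 2 = x / 3 by rewrite sqr_sqrtr //; lra.
pose y := (1 + x)^-1; have y0 : 0 < y by rewrite invr_gt0; lra.
have yx : y * (1 + x) = 1 by rewrite mulVf // gt_eqF //; lra.
pose u := perp2 (cjv w).
have uw : dotc u w = 0 by rewrite /dotc dotbC dotb_perp2.
have wu : dotc w u = 0 by rewrite -cj_dotc uw cj0.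
have nu : nrm2 u = 1 + x by rewrite /u nrm2_perp2 nrm2_cjv.
have ww : dotc w w = rc (1 + x) by rewrite dotcc wx.
pose z0 := rc y *: w + rc s *: u.
have z0w : dotc z0 w = 1 by rewrite /z0 dotcDl !dotcZl uw ww mulr0 addr0 -rcM yx rc1.
have nz0 : nrm2 z0 = y + x / 3 * (1 + x).
  rewrite /z0 nrm2D !nrm2Z !cm_rc !real_normK ?num_real // ss nu wx dotcZl dotcZr wu !mulr0.
  by rewrite addr0; congr (_ + _); rewrite expr2 -mulrA yx mulr1.
have z0m : nrm2 z0 < 1.
  by rewrite nz0 -(@ltr_pM2r _ (1 + x)) ?mulrDl ?yx; last lra; nra.
have z0e : nrm2 (z0 - w) = x ^+ 2 * y + x / 3 * (1 + x).
  rewrite nrm2B nz0 wx z0w re1; have E : x * (y * (1 + x)) = x by rewrite yx mulr1.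
  lra.
have z0d : nrm (z0 - w0) < del.
  have E : z0 - w0 = (w - w0) + (z0 - w) by rewrite (addrC (w - w0)) addrA subrK.
  have h1 : nrm (z0 - w) <= Num.sqrt x.
    rewrite -(@ler_pXn2r _ 2) ?nnegrE ?nrm_ge0 // ?ltW // nrm_sqr s2 z0e.
    have : x ^+ 2 * y <= x ^+ 2 by rewrite ler_piMr ?sqr_ge0 //; nra.
    nra.
  by rewrite E; apply: le_lt_trans (nrmD _ _) _; lra.
pose h t := dotb (refl F (z0 + t *: (z - z0))) (cjv (extension w)) - 1.
have : \forall t \near ((0 : C) + rc 1 * 1), h t = 0.
  apply: (identity_segment (g := h)); last by rewrite ler01 lexx.
  - move=> t ht; rewrite add0r mulr1.
    have hn : nrm (z0 + rc t *: (z - z0)) < 1.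
      by apply: segment_ball => //; rewrite -?nrm2_lt1 // nrm2_lt1 (addrC z0) subrK.
    apply: filterS (near_lt_nrm hn) => t' ht'; apply: holB; last exact: hol_cst.
    apply: hol_dotb => i; last exact: hol_cst.
    by apply: vhol_line; exact: reflh.
  - move=> e' e'0; have := @zero_near_ex _ h 0 0 e' _ e'0; apply.
    have n1 : \forall t \near (0 : C), nrm (z0 + t *: (z - z0)) < 1.
      by apply: near_lt_nrm; rewrite scale0r addr0 -nrm2_lt1.
    have n2 : \forall t \near (0 : C), nrm ((z0 - w0) + t *: (z - z0)) < del.
      by apply: near_lt_nrm; rewrite scale0r addr0.
    have n3 : \forall t \near (0 : C), Num.sqrt (x / 4) < nrm ((z0 - w) + t *: (z - z0)).
      apply: near_gt_nrm; rewrite scale0r addr0.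
      rewrite -(@ltr_pXn2r _ 2) ?nnegrE ?nrm_ge0 ?sqrtr_ge0 // nrm_sqr z0e sqr_sqrtr; last by lra.
      have : 0 <= x ^+ 2 * y by rewrite mulr_ge0 ?sqr_ge0 // ltW.
      nra.
    near=> t.
    have t1 : nrm (z0 + t *: (z - z0)) < 1 by near: t; exact: n1.
    have t2 : nrm ((z0 - w0) + t *: (z - z0)) < del by near: t; exact: n2.
    have t3 : Num.sqrt (x / 4) < nrm ((z0 - w) + t *: (z - z0)) by near: t; exact: n3.
    have gd : good (z0 + t *: (z - z0)) by apply: del_good; rewrite addrAC.
    have qw : dotc (z0 + t *: (z - z0)) w = rc 1.
      by rewrite dotcDl dotcZl dotcBl zw z0w subrr mulr0 addr0.
    have q1 : nrm2 (z0 + t *: (z - z0)) < 1 by rewrite nrm2_lt1.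
    have q2 : x / 4 < nrm2 (z0 + t *: (z - z0) - w).
      move: t3; rewrite -(@ltr_pXn2r _ 2) ?nnegrE ?nrm_ge0 ?sqrtr_ge0 // sqr_sqrtr // nrm_sqr.
      by rewrite addrAC.
    have := outer_local wx x0 q1 q2 wd qw.
    rewrite (extension_eq gd t1) rc1 /h /dotc => ->.
    by rewrite subrr.
move/nbhs_singleton/eqP; rewrite /h add0r mulr1 rc1 scale1r (addrC z0) subrK subr_eq0.
by move/eqP.
Unshelve. all: by end_near.
Qed.
End Extension.
End ScalingTheorem.

(** * Continuation along lines, convexity of balls, orthogonal directions *)

Section LineIdentity.
Variable K : realType.
Local Notation C := (cplx K).

Lemma line_identity n (g : 'cV[C]_n -> C) p v :
  (forall t : K, 0 <= t <= 1 -> \forall s \near rc t, hol (fun s => g (p + s *: v)) s) ->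
  (\forall s \near (0 : C), g (p + s *: v) = 0) -> g (p + v) = 0.
Proof.
move=> hg h0; have : \forall s \near ((0 : C) + rc 1 * 1), g (p + s *: v) = 0.
  apply: (identity_segment (g := fun s => g (p + s *: v))); last by apply/andP; split; lra.
  - by move=> t ht; rewrite add0r mulr1; exact: hg.
  - by move=> e e0; exact: (zero_near_ex _ h0 e0).
by move/nbhs_singleton; rewrite add0r mulr1 rc1 scale1r.
Qed.

Lemma det_mul_eq0 n (A : 'M[C]_n) (x : 'cV_n) : \det A != 0 -> A *m x = 0 -> x = 0.
Proof.
move=> dA Ax; have : \adj A *m (A *m x) = 0 by rewrite Ax mulmx0.
rewrite mulmxA mul_adj_mx mul_scalar_mx => /eqP; rewrite scaler_eq0 (negPf dA) /=.
by move/eqP.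
Qed.

Lemma lerp_sub n (a b c : 'cV[C]_n) (t : K) :
  (a - c) + rc t *: (b - a) = rc (1 - t) *: (a - c) + rc t *: (b - c).
Proof.
rewrite rcB rc1 scalerBl scale1r -[RHS]addrA; congr (_ + _).
by rewrite [RHS]addrC -scalerBr opprB addrA subrK.
Qed.

Lemma nrm_lerp_lt n (a b : 'cV[C]_n) (t x : K) : 0 <= t <= 1 -> nrm a < x -> nrm b < x ->
  nrm (rc (1 - t) *: a + rc t *: b) < x.
Proof.
move=> ht ax bx; have /andP[t0 t1] := ht; apply: le_lt_trans (nrmD _ _) _.
rewrite !nrmZ !cm_rc !ger0_norm ?subr_ge0 //.
exact: convex_lt.
Qed.

Lemma unit_perp (e : 'cV[C]_2) : exists w, nrm w = 1 /\ dotb e w = 0.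
Proof.
case: (eqVneq e 0) => [->|e0].
  exists (mk2 1 0); rewrite dotb0l; split => //.
  by apply: nrm_eq1; rewrite nrm2_mk2 cm0 cm1 expr0n expr1n addr0.
have ne : nrm e != 0 by rewrite nrm_eq0.
exists (rc (nrm e)^-1 *: perp2 e); split; last by rewrite dotbZr dotb_perp2 mulr0.
have E : nrm (perp2 e) = nrm e by rewrite nrm.unlock nrm2_perp2.
by rewrite nrmZ E cm_rc ger0_norm ?mulVf // invr_ge0 nrm_ge0.
Qed.
End LineIdentity.

(** * The scaling law from one independent tuple on a line *)

Section ScalingByTuples.
Variable K : realType.
Local Notation C := (cplx K).
Variables (N : nat) (F : 'cV[C]_2 -> 'cV[C]_N) (r : K).
Hypothesis r0 : 0 < r.
Hypothesis r1 : r < 1.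
Hypothesis Fh : forall z, nrm z < 1 -> vhol F z.
Variables (p0 e : 'cV[C]_2) (s : 'I_N -> C).
Hypothesis p01 : nrm p0 < 1.
Hypothesis s1 : forall i, nrm (p0 + s i *: e) < 1.
Hypothesis D1 : \det (tuple_mx F (fun i => p0 + s i *: e)) != 0.

Lemma tuple_on_line : exists w (a : 'I_N -> 'cV[C]_2), [/\ nrm w = 1, dotb e w = 0,
  forall i, dotb (a i) w = rc (r ^+ 2), forall i, nrm (a i) < 1 & \det (tuple_mx F a) != 0].
Proof.
have [w [w1 ew]] := unit_perp e.
have x0 : 0 < r ^+ 2 by rewrite exprn_gt0.
have x1 : r ^+ 2 < 1 by rewrite expr_lt1 // ltW.
set x := r ^+ 2 in x0 x1 *.
pose q := rc x *: cjv w.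
have nq : nrm q = x by rewrite nrmZ nrm_cjv w1 mulr1 cm_rc gtr0_norm.
have qw : dotb q w = rc x.
  have : dotc w w = 1 by rewrite dotcc -nrm_sqr w1 expr1n rc1.
  by rewrite dotbZl dotbC => ww; rewrite -/(dotc w w) ww mulr1.
(* Small enough that [x * (x + eps) < x - eps], which keeps the tuple in the ball after the
   rescaling by [rho]. *)
pose eps := x * (1 - x) / 4; have eps0 : 0 < eps by rewrite /eps; nra.
have [|p [c [pq aq a1 Da]]] := tuple_near Fh p01 s1 D1 (q := q) _ eps0; first by rewrite nq.
pose a i := p + c i *: e.
have aw i : dotb (a i) w = dotb p w by rewrite /a dotbDl dotbZl ew mulr0 addr0.
set beta := dotb p w in aw.
have bx : cm (beta - rc x) < eps.
  rewrite -qw -dotbBl; apply: le_lt_trans (cm_dotb _ _) _; by rewrite w1 mulr1.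
have b0 : x - eps < cm beta.
  have := cmBl (rc x) beta; rewrite cm_rc gtr0_norm // cmBC; lra.
have xe : eps < x by rewrite /eps; nra.
have bp : 0 < cm beta by lra.
have bn : beta != 0 by rewrite -cm_gt0.
(* The tuple sits at height [beta], only close to [x]. Scaling it by [rho] corrects the modulus, and
   a unimodular factor on [w] corrects the phase. *)
pose rho := x / cm beta; have rho0 : 0 < rho by rewrite divr_gt0.
have ra i : rho * nrm (a i) < 1.
  have h : nrm (a i) < x + eps.
    by have := nrmD (a i - q) q; rewrite subrK nq; have := aq i; rewrite -/(a i); lra.
  rewrite /rho mulrAC ltr_pdivrMr // mul1r.
  have : x * nrm (a i) < x * (x + eps) by rewrite ltr_pM2l.
  have t0 : 0 < x * (1 - x) by rewrite mulr_gt0 // subr_gt0.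
  have : eps * (1 + x) <= x * (1 - x) by rewrite /eps; nra.
  lra.
(* Scaling by [rho] alone might destroy independence. If every [rho * om] did, the determinant would
   vanish on a circle, hence along the ray from [rho] to 1, where it belongs to the original
   tuple. *)
have [om [om1 hom]] : exists om : C, cm om = 1 /\
    \det (tuple_mx F (fun i => a i + (rc rho * om - 1) *: a i)) != 0.
  apply: contrapT => h; pose g t := \det (tuple_mx F (fun i => a i + t *: a i)).
  have gz om : cm om = 1 -> g (rc rho * om - 1) = 0.
    move=> om1; apply/eqP/negPn/negP => gn; apply: h; by exists om.
  have : \forall z \near (rc rho - 1 + rc 1 * (1 - rc rho)), g z = 0.
    apply: (identity_segment (g := g)); last by rewrite ler01 lexx.
    - move=> t ht; apply: near_hol_tuple => // i.
      have -> : a i + (rc rho - 1 + rc t * (1 - rc rho)) *: a i = rc ((1 - t) * rho + t * 1) *: a i.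
        rewrite -{1}(scale1r (a i)) -scalerDl; congr (_ *: _).
        by rewrite rcD !rcM rcB rc1; ring.
      rewrite nrmZ cm_rc; move/andP: (ht) => [t0 t1].
      rewrite ger0_norm; last by rewrite addr_ge0 // mulr_ge0 // ?subr_ge0 // ltW.
      by rewrite mulrDl mulr1 -mulrA; apply: convex_lt => //; exact: a1.
    - move=> e' e'0; have e2 : 0 < e' / rho by rewrite divr_gt0.
      have [om [om1 omn ome]] := unit_near e2.
      have E : rc rho * om - 1 - (rc rho - 1) = rc rho * (om - 1) by ring.
      have cE : cm (rc rho * om - 1 - (rc rho - 1)) = rho * cm (om - 1).
        by rewrite E cmM cm_rc gtr0_norm.
      exists (rc rho * om - 1); split.
      + by rewrite -subr_eq0 -cm_gt0 cE mulr_gt0 // cm_gt0 subr_eq0.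
      + by rewrite cE mulrC -ltr_pdivlMr.
      + exact: gz.
  move/nbhs_singleton; rewrite /g rc1 mul1r (_ : rc rho - 1 + (1 - rc rho) = 0); last by ring.
  have -> : (fun i => a i + 0 *: a i) = a by apply/funext => i; rewrite scale0r addr0.
  by move=> g0; move: Da; rewrite -/a g0 eqxx.
have on : om != 0 by rewrite -cm_gt0 om1.
exists (rc (cm beta) / (om * beta) *: w), (fun i => a i + (rc rho * om - 1) *: a i).
have aE i : a i + (rc rho * om - 1) *: a i = (rc rho * om) *: a i.
  by rewrite scalerBl scale1r addrC subrK.
split => //.
- by rewrite nrmZ w1 mulr1 cmM cmV cmM om1 mul1r cm_rc gtr0_norm // divff // gt_eqF.
- by rewrite dotbZr ew mulr0.
- move=> i; rewrite aE dotbZl dotbZr aw /rho rcM rcV.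
  have rb : rc (cm beta) != 0 :> C by rewrite -cm_gt0 cm_rc gtr0_norm.
  by field; rewrite on bn rb.
- by move=> i; rewrite aE nrmZ cmM om1 mulr1 cm_rc gtr0_norm.
Qed.

(** The tuple is placed near [(1 - x) *: cjv w0], just inside the sphere. Its height [beta] over
    [w0] has modulus slightly below 1, so [beta^-1 *: w0] lies slightly outside. *)
Lemma tuple_outside w0 (m : K) : nrm w0 = 1 -> dotb e w0 = 0 -> 0 < m ->
  exists w (b : 'I_N -> 'cV[C]_2), [/\ 1 < nrm w, nrm (w - w0) < m,
  forall i, dotb (b i) w = 1, forall i, nrm (b i) < 1 & \det (tuple_mx F b) != 0].
Proof.
move=> w1 ew m0; pose x := Num.min 1 m / 4.
have x0 : 0 < x by rewrite divr_gt0 // lt_min ltr01.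
have xm : 4 * x <= m by rewrite /x mulrC divfK // ge_min lexx orbT.
have x1 : 4 * x <= 1 by rewrite /x mulrC divfK // ge_min lexx.
pose q := rc (1 - x) *: cjv w0.
have nq : nrm q = 1 - x by rewrite nrmZ nrm_cjv w1 mulr1 cm_rc ger0_norm //; lra.
have qw : dotb q w0 = rc (1 - x).
  have : dotc w0 w0 = 1 by rewrite dotcc -nrm_sqr w1 expr1n rc1.
  by rewrite dotbZl dotbC => ww; rewrite -/(dotc w0 w0) ww mulr1.
have eps0 : 0 < x / 2 by lra.
have [|p [c [pq aq a1 Da]]] := tuple_near Fh p01 s1 D1 (q := q) _ eps0; first by rewrite nq; lra.
set beta := dotb p w0.
have bx : cm (beta - rc (1 - x)) < x / 2.
  rewrite -qw -dotbBl; apply: le_lt_trans (cm_dotb _ _) _; by rewrite w1 mulr1.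
have c1x : cm (rc (1 - x) : C) = 1 - x by rewrite cm_rc ger0_norm //; lra.
have b0 : 1 - x - x / 2 < cm beta.
  have := cmBl (rc (1 - x)) beta; rewrite c1x cmBC; lra.
have b2 : cm beta < 1.
  have := cmD (beta - rc (1 - x)) (rc (1 - x)); rewrite subrK c1x; lra.
have bp : 0 < cm beta by lra.
have bn : beta != 0 by rewrite -cm_gt0.
exists (beta^-1 *: w0), (fun i => p + c i *: e); split => //.
- by rewrite nrmZ w1 mulr1 cmV -[ltLHS]invr1 ltf_pV2 // ?posrE.
- have -> : beta^-1 *: w0 - w0 = ((1 - beta) / beta) *: w0.
    by rewrite -{2}(scale1r w0) -scalerBl; congr (_ *: _); rewrite mulrBl divff // mul1r.
  rewrite nrmZ w1 mulr1 cmM cmV ltr_pdivrMr //.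
  have : cm (1 - beta) < 2 * x.
    have -> : 1 - beta = rc x - (beta - rc (1 - x)) by rewrite rcB rc1; ring.
    apply: le_lt_trans (cmB _ _) _; rewrite cm_rc gtr0_norm //; lra.
  nra.
- by move=> i; rewrite dotbZr dotbDl dotbZl ew mulr0 addr0 mulVf.
Qed.

Variable kappa : K.
Hypothesis pol : forall z w, nrm z < 1 -> nrm w < 1 -> dotb z w = rc (r ^+ 2) ->
  dotb (F z) (refl F w) = rc kappa.
Hypothesis rad : forall u, nrm u = 1 -> forall eps : K, 0 < eps -> exists2 del, 0 < del &
  forall t : K, 1 - del < t < 1 -> `|nrm2 (F (rc t *: u)) - 1| < eps.

(** Just outside the sphere [refl F (r ^+ 2 *: w)] and [kappa *: extension w] have the same
    pairings, [kappa], with independent values of [F]: the first by the inner relation, the second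
    by the outer one. The equality then crosses the sphere by continuation. *)
Theorem scaling z : nrm z < 1 -> F (rc (r ^+ 2) *: z) = rc kappa *: F z.
Proof.
have x0 : 0 < r ^+ 2 by rewrite exprn_gt0.
have x1 : r ^+ 2 < 1 by rewrite expr_lt1 // ltW.
have reflh w : nrm w < 1 -> vhol (refl F) w.
  by move=> h; apply: vhol_refl; apply: Fh; rewrite nrm_cjv.
have [w0 [a [w01 ew0 aw0 a1 Da]]] := tuple_on_line.
have [del del0 gd] := good_near r0 Fh aw0 a1 Da.
pose E := extension F r kappa a.
(* Bounds [nrm2 w - 1]: by [1 / 2] for [extension_polarization], by [1 - r ^+ 2] to keep
   [r ^+ 2 *: w] in the ball, and by [(del / 12) ^+ 2] to make [6 * Num.sqrt x] less than
   [del / 2]. *)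
pose X0 := Num.min (1 / 2) (Num.min (1 - r ^+ 2) ((del / 12) ^+ 2)).
have d12 : 0 < del / 12 by lra.
have X00 : 0 < X0 by rewrite !lt_min exprn_gt0 // subr_gt0 x1 andbT andbT; lra.
have X01 : X0 <= 1 / 2 by rewrite ge_min lexx.
have X02 : X0 <= 1 - r ^+ 2 by rewrite !ge_min lexx orbT.
have X03 : X0 <= (del / 12) ^+ 2 by rewrite !ge_min lexx !orbT.
(* The other half of [del] bounds the distance to [w0]; [X0 / 4] makes [nrm w < 1 + m] imply
   [nrm2 w - 1 < X0]. *)
pose m := Num.min (del / 2) (X0 / 4).
have m0 : 0 < m by rewrite lt_min; apply/andP; split; lra.
have m1 : m <= del / 2 by rewrite ge_min lexx.
have mdel : m <= del by apply: le_trans m1 _; lra.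
have m2 : m <= X0 / 4 by rewrite ge_min lexx orbT.
have mX0 : m <= X0 by apply: le_trans m2 _; rewrite ler_pdivrMr // ler_peMr ?ler1n // ltW.
have [w1 [b [w1n w1m bw1 b1 Db]]] := tuple_outside w01 ew0 m0.
have bw1' i : dotb (b i) w1 = rc (1 ^+ 2) by rewrite bw1 expr1n rc1.
have [d d0 gb] := good_near ltr01 Fh bw1' b1 Db.
pose h w k := refl F (rc (r ^+ 2) *: w) k 0 - (rc kappa *: E w) k 0.
have h_out w k : nrm (w - w1) < d -> 1 < nrm w -> nrm (w - w0) < m -> h w k = 0.
  move=> wd wn wm; have [g1 g2 g3] := gb _ wd.
  rewrite expr1n rc1 in g2 g3.
  pose b' i := (1 / dotb (b i) w) *: b i.
  have b'w i : dotb (b' i) w = 1 by rewrite /b' dotbZl mul1r mulVf.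
  pose x := nrm2 w - 1.
  have nw : nrm w < 1 + m.
    have := nrmD (w - w0) w0; rewrite subrK w01 => /le_lt_trans; apply.
    by rewrite addrC ltrD2l.
  have xp : 0 < x.
    by rewrite /x -nrm_sqr subr_gt0 expr_gt1 // ltW // (lt_trans ltr01).
  have xX : x < X0.
    by rewrite /x -nrm_sqr; exact: sqr_sub1_lt (nrm_ge0 w) nw m0 m2 X01.
  have b'1 i : nrm (b' i) < 1 by exact: g2.
  have xw : nrm2 w = 1 + x by rewrite /x addrC subrK.
  have xh : 0 < x <= 1 / 2 by rewrite xp /=; apply: ltW; apply: lt_le_trans X01.
  have xs : Num.sqrt x < del / 12.
    have xd : x < (del / 12) ^+ 2 by apply: lt_le_trans X03.
    by rewrite -(@ltr_pXn2r _ 2) ?nnegrE ?sqrtr_ge0 ?sqr_sqrtr // ltW.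
  have xd : nrm (w - w0) + 6 * Num.sqrt x < del by exact: add_half_lt wm m1 xs.
  have Eb i : dotb (F (b' i)) (E w) = 1.
    have b'w1 : dotc (cjv (b' i)) w = 1 by rewrite /dotc -cj_dotb b'w cj1.
    have b'n : nrm (cjv (b' i)) < 1 by rewrite nrm_cjv.
    have := extension_polarization Fh pol rad gd xw xh xd b'n b'w1.
    by rewrite /refl cjvK /dotc -cj_dotb => /(congr1 (@cj K)); rewrite cjK cj1.
  have rw : nrm (rc (r ^+ 2) *: w) < 1.
    rewrite nrmZ cm_rc gtr0_norm //; apply: shrink_lt1 x0 x1 _ X02.
    by apply: ltW; apply: lt_le_trans nw _; rewrite lerD2l.
  have Gb i : dotb (F (b' i)) (refl F (rc (r ^+ 2) *: w)) = rc kappa.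
    by apply: pol => //; rewrite dotbZr b'w mulr1.
  have : refl F (rc (r ^+ 2) *: w) - rc kappa *: E w = 0.
    apply: (det_mul_eq0 g3); apply/matrixP => i j.
    by rewrite ord1 tuple_mx_mul mxE dotbBr dotbZr -/(b' i) Gb Eb mulr1 subrr.
  by move/matrixP/(_ k 0); rewrite [LHS]mxE [X in _ + X = _]mxE [RHS]mxE.
have rhol p v t k : nrm (rc (r ^+ 2) *: (p + t *: v)) < 1 ->
    hol (fun t => refl F (rc (r ^+ 2) *: (p + t *: v)) k 0) t.
  have E' : (fun t => refl F (rc (r ^+ 2) *: (p + t *: v)) k 0) =
      (fun t => refl F (rc (r ^+ 2) *: p + t *: (rc (r ^+ 2) *: v)) k 0).
    by apply/funext => t'; rewrite scalerDr !scalerA (mulrC t').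
  by rewrite E' => hn; apply: vhol_line; apply: reflh; rewrite scalerA (mulrC t) -scalerA -scalerDr.
have h_in w k : nrm w < 1 -> nrm (w - w0) < m -> h w k = 0.
  move=> wn wm; have -> : w = w1 + (w - w1) by rewrite addrC subrK.
  apply: (line_identity (g := fun w => h w k)).
  - move=> t ht; have hs : nrm ((w1 - w0) + rc t *: (w - w1)) < m.
      by rewrite lerp_sub; apply: nrm_lerp_lt => //.
    apply: filterS (near_lt_nrm hs) => t' ht'.
    have n2 : nrm (w1 + t' *: (w - w1) - w0) < m by rewrite addrAC.
    apply: holB.
      apply: rhol; rewrite nrmZ cm_rc gtr0_norm //.
      apply: shrink_lt1 x0 x1 _ X02; have := nrmD (w1 + t' *: (w - w1) - w0) w0.
      rewrite subrK w01 => /le_trans; apply; rewrite addrC lerD2l; apply: le_trans (ltW n2) _.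
      exact: mX0.
    under eq_fun do rewrite mxE; apply: holM; first exact: hol_cst.
    by apply: vhol_line; exact: (extension_hol kappa Fh (gd _ (lt_le_trans n2 mdel))).
  - have n1 : \forall t \near (0 : C), nrm ((w1 - w1) + t *: (w - w1)) < d.
      by apply: near_lt_nrm; rewrite scale0r addr0 subrr nrm0.
    have n2 : \forall t \near (0 : C), nrm ((w1 - w0) + t *: (w - w1)) < m.
      by apply: near_lt_nrm; rewrite scale0r addr0.
    have n3 : \forall t \near (0 : C), 1 < nrm (w1 + t *: (w - w1)).
      by apply: near_gt_nrm; rewrite scale0r addr0.
    near=> t; apply: h_out; rewrite ?[_ - w1]addrAC ?[_ - w0]addrAC; near: t; [exact: n1|exact: n3|exact: n2].
(* Inside the ball the extension is [refl F], and the identity spreads from a neighbourhood of [ws]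
   to the whole ball along segments. *)
pose H w k := refl F (rc (r ^+ 2) *: w) k 0 - (rc kappa *: refl F w) k 0.
pose ws := rc (1 - m / 2) *: w0.
have mh : 0 < m / 2 by rewrite divr_gt0.
have mh1 : m / 2 < 1.
  by apply: half_lt m0 _; rewrite (le_trans mX0) // (le_trans X01) // ler_pdivrMr // mul1r ler1n.
have ws1 : nrm ws < 1.
  by rewrite nrmZ w01 mulr1 cm_rc ger0_norm ?subr_ge0 ?(ltW mh1) // gtrBl.
have wsm : nrm (ws - w0) < m.
  have -> : ws - w0 = rc (- (m / 2)) *: w0 by rewrite /ws rcB rc1 scalerBl scale1r addrAC subrr add0r rcN scaleNr.
  by rewrite nrmZ w01 mulr1 cm_rc normrN gtr0_norm // ltr_pdivrMr // ltr_pMr // ltr1n.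
have HH w k : nrm w < 1 -> H w k = 0.
  move=> wn; have -> : w = ws + (w - ws) by rewrite addrC subrK.
  apply: (line_identity (g := fun w => H w k)).
  - move=> t ht; have hs : nrm (ws + rc t *: (w - ws)) < 1.
      by apply: segment_ball => //; rewrite addrC subrK.
    apply: filterS (near_lt_nrm hs) => t' ht'; apply: holB.
      apply: rhol; rewrite nrmZ cm_rc gtr0_norm //.
      by apply: shrink_lt1 x0 x1 _ X02; apply: le_trans (ltW ht') _; rewrite lerDl ltW.
    under eq_fun do rewrite mxE; apply: holM; first exact: hol_cst.
    by apply: vhol_line; exact: reflh.
  - have n1 : \forall t \near (0 : C), nrm (ws + t *: (w - ws)) < 1.
      by apply: near_lt_nrm; rewrite scale0r addr0.
    have n2 : \forall t \near (0 : C), nrm ((ws - w0) + t *: (w - ws)) < m.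
      by apply: near_lt_nrm; rewrite scale0r addr0.
    near=> t; have t1 : nrm (ws + t *: (w - ws)) < 1 by near: t; exact: n1.
    have t2 : nrm (ws + t *: (w - ws) - w0) < m by rewrite addrAC; near: t; exact: n2.
    have gt := gd _ (lt_le_trans t2 mdel).
    by have := h_in _ k t1 t2; rewrite /h /E (extension_eq pol gt t1).
move=> zn; apply/matrixP => k j; rewrite ord1 {j}.
have := HH (cjv z) k; rewrite nrm_cjv => /(_ zn) /eqP; rewrite subr_eq0 => /eqP.
rewrite -[rc (r ^+ 2)]cj_rc -cjvZ !refl_cjv -[rc kappa]cj_rc -cjvZ !cjvE => /(congr1 (@cj K)).
by rewrite !cjK !cj_rc.
Unshelve. all: by end_near.
Qed.
End ScalingByTuples.

(** * Holomorphic solutions of a homogeneity equation *)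

Section PowerLaw.
Variable K : realType.
Local Notation C := (cplx K).
Implicit Types (phi : C -> C) (a b M : K).

Lemma fixed_limit phi a M t : 0 < a < 1 -> hol phi 0 -> 0 < M -> cm t < M ->
  (forall t, cm t < M -> phi (rc a * t) = phi t) -> phi t = phi 0.
Proof.
move=> /andP[a0 a1] /hol_cont/contP h M0 tM ph; apply/eqP; rewrite -subr_eq0 -cm_eq0 eq_le cm_ge0 andbT.
rewrite leNgt; apply/negP => /h [d d0 hd].
have [|n hn] := @pow_lt K a (cm t) d _ d0; first by rewrite a1 ltW.
have E m : phi (rc (a ^+ m) * t) = phi t /\ cm (rc (a ^+ m) * t) < M.
  elim: m => [|m [IH1 IH2]]; first by rewrite expr0 rc1 mul1r.
  rewrite exprS rcM -mulrA ph // cmM cm_rc gtr0_norm //; split => //.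
  apply: le_lt_trans IH2; apply: ler_piMl; [exact: cm_ge0|exact: ltW].
have [E1 _] := E n.
have : cm (phi (rc (a ^+ n) * t) - phi 0) < cm (phi t - phi 0).
  by apply: hd; rewrite subr0 cmM cm_rc gtr0_norm ?exprn_gt0 // mulrC.
by rewrite E1 ltxx.
Qed.

(** Along [a ^+ m * t] the function stays bounded, being continuous at 0, while the equation
    multiplies its value by [b ^+ m]. *)
Lemma growth_zero phi a b M t : 0 < a < 1 -> hol phi 0 -> 0 < M -> cm t < M -> 1 < b ->
  (forall t, cm t < M -> phi (rc a * t) = rc b * phi t) -> phi t = 0.
Proof.
move=> /andP[a0 a1] /hol_cont/contP /(_ _ ltr01) [d d0 hd] M0 tM b1 ph.
have b0 : 0 < b by lra.
have [|n hn] := @pow_lt K a (cm t) d _ d0; first by rewrite a1 ltW.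
have E m : rc (b ^+ m) * phi t = phi (rc (a ^+ m) * t) /\ cm (rc (a ^+ m) * t) < M.
  elim: m => [|m [IH1 IH2]]; first by rewrite !expr0 rc1 !mul1r.
  rewrite !exprS !rcM -!mulrA ph // IH1 cmM cm_rc gtr0_norm //; split => //.
  apply: le_lt_trans IH2; apply: ler_piMl; [exact: cm_ge0|exact: ltW].
apply/eqP; rewrite -cm_eq0; apply/eqP.
apply: (@le_pow_eq0 K b^-1 ((cm (phi 0) + 1) * b^-1 ^+ n)); rewrite ?cm_ge0 //.
  by rewrite invr_ge0 ltW //= invf_lt1.
move=> m; rewrite -mulrA -exprD exprVn ler_pdivlMr ?exprn_gt0 //.
have [E1 _] := E (n + m)%N; have : cm (rc (b ^+ (n + m)) * phi t) <= cm (phi 0) + 1.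
  rewrite E1; set z := rc _ * t.
  have hz : cm (z - 0) < d.
    rewrite subr0 /z cmM cm_rc gtr0_norm ?exprn_gt0 //; apply: le_lt_trans hn.
    rewrite mulrC ler_wpM2l ?cm_ge0 // exprD ler_piMr ?exprn_ge0 ?exprn_ile1 // ltW //.
  have := hd _ hz; have := cmD (phi z - phi 0) (phi 0); rewrite !subrK; lra.
by rewrite cmM cm_rc gtr0_norm ?exprn_gt0 // mulrC.
Qed.

(** The hypothesis [a ^+ d < b] bounds the order of the zero at 0. If [phi 0] is nonzero then
    [b = 1] and [phi] is constant; otherwise dividing by [t] replaces [b] by [b / a] and lowers [d],
    down to [1 < b], which forces 0. *)
Lemma power_law a M (d : nat) b phi : 0 < a < 1 -> 0 < M -> a ^+ d < b ->
  (forall t, cm t < M -> hol phi t) -> (forall t, cm t < M -> phi (rc a * t) = rc b * phi t) ->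
  exists e (c : C), (forall t, cm t < M -> phi t = c * t ^+ e) /\ (c = 0 \/ b = a ^+ e).
Proof.
move=> a01 M0; have /andP[a0 a1] := a01.
have M00 : cm (0 : C) < M by rewrite cm0.
elim: d b phi => [|d IH] b phi ab hp ph.
  exists 0%N, 0; split; last by left.
  by move=> t tM; rewrite mul0r; apply: (growth_zero a01 (hp 0 M00) M0 tM ab ph).
case: (eqVneq (phi 0) 0) => [p0|p0]; last first.
  have b1 : b = 1.
    have := ph 0 M00; rewrite mulr0 => /eqP; rewrite -subr_eq0 -{1}(mul1r (phi 0)) -mulrBl mulf_eq0 (negPf p0) orbF.
    by rewrite subr_eq0 -rc1 => /eqP /(@rcI K).
  exists 0%N, (phi 0); split; last by right.
  move=> t tM; rewrite expr0 mulr1; apply: (fixed_limit a01 (hp 0 M00) M0 tM) => s sM.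
  by rewrite ph // b1 rc1 mul1r.
have [q qc qE] := hol_slope (hp 0 M00); pose psi := slope phi 0 q.
have pE t : phi t = psi t * t by rewrite qE p0 add0r subr0.
have psih t : cm t < M -> hol psi t.
  move=> tM; case: (eqVneq t 0) => [t0|t0]; last by apply: hol_slope_off => //; exact: hp.
  apply: removable_singularity; apply: slope_qhol => //.
  apply: hol_qhol; rewrite t0; apply/cm_ballP; exists M => // w; rewrite subr0; exact: hp.
have psi1 t : cm t < M -> t != 0 -> psi (rc a * t) = rc (b / a) * psi t.
  move=> tM t0; have an : rc a != 0 :> C by rewrite -cm_gt0 cm_rc gtr0_norm.
  have := ph t tM; rewrite !pE => h; apply: (@mulIf _ (rc a * t)); first by rewrite mulf_neq0.
  by rewrite h rcM rcV; field.
(* Division loses the equation at [t = 0]; the identity theorem restores it. *)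
have psi2 t : cm t < M -> psi (rc a * t) = rc (b / a) * psi t.
  move=> tM; case: (eqVneq t 0) => [->|t0]; last exact: psi1.
  have : \forall t \near (0 : C), psi (rc a * t) - rc (b / a) * psi t = 0.
    apply: identity_local.
    - apply/cm_ballP; exists M => // w; rewrite subr0 => wM; apply: holB.
        apply: (hol_comp (g := psi)); first by apply: holM; [exact: hol_cst|exact: hol_id].
        apply: psih; rewrite cmM cm_rc gtr0_norm //; apply: le_lt_trans wM.
        by apply: ler_piMl; [exact: cm_ge0|exact: ltW].
      by apply: holM; [exact: hol_cst|exact: psih].
    - move=> e e0; pose x := Num.min e M / 2; have x0 : 0 < x by rewrite divr_gt0 // lt_min e0.
      have xe : x < e by have : Num.min e M <= e; [rewrite ge_min lexx|rewrite /x; lra].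
      have xM : x < M by have : Num.min e M <= M; [rewrite ge_min lexx orbT|rewrite /x; lra].
      have cx : cm (rc x : C) = x by rewrite cm_rc gtr0_norm.
      have xn : rc x != 0 :> C by rewrite -cm_gt0 cx.
      by exists (rc x); rewrite subr0 cx psi1 ?cx // subrr.
  by move/nbhs_singleton/eqP; rewrite subr_eq0 => /eqP.
have [|e [c [h1 h2]]] := IH (b / a) psi _ psih psi2; first by rewrite ltr_pdivlMr // mulrC -exprS.
exists e.+1, c; split; first by move=> t tM; rewrite pE h1 // exprSr mulrA.
case: h2 => [->|h2]; [by left|right].
by rewrite exprSr -h2 divfK // gt_eqF.
Qed.
End PowerLaw.

Lemma hol_dotc_line (K : realType) n (p v u : 'cV[cplx K]_n) t : hol (fun t => dotc (p + t *: v) u) t.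
Proof.
have -> : (fun t => dotc (p + t *: v) u) = (fun t => dotc p u + t * dotc v u).
  by apply/funext => s; rewrite /dotc dotbDl dotbZl.
exact: hol_affine.
Qed.

(** * The Gram kernel is a power of the inner product *)

Section Kernel.
Variable K : realType.
Local Notation C := (cplx K).
Variables (N : nat) (F : 'cV[C]_2 -> 'cV[C]_N) (r kappa : K).
Hypothesis r0 : 0 < r.
Hypothesis r1 : r < 1.
Hypothesis k01 : 0 < kappa < 1.
Hypothesis Fh : forall z, nrm z < 1 -> vhol F z.
Hypothesis pol : forall z u, nrm z < 1 -> nrm u < 1 -> dotc z u = rc (r ^+ 2) ->
  dotc (F z) (F u) = rc kappa.
Hypothesis sc : forall z, nrm z < 1 -> F (rc (r ^+ 2) *: z) = rc kappa *: F z.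

Let a01 : 0 < r ^+ 2 < 1.
Proof. by rewrite exprn_gt0 //= expr_lt1 // ltW. Qed.

Let F0 : F 0 = 0.
Proof.
have := @sc 0; rewrite nrm0 scaler0 => /(_ ltr01) /eqP.
rewrite -subr_eq0 -{1}(scale1r (F 0)) -scalerBl scaler_eq0 subr_eq0 => /orP[|/eqP //].
by rewrite -rc1 => /eqP/(@rcI K) k1; have := k01; rewrite -k1 ltxx andbF.
Qed.

Let hol_inner z u t : nrm (t *: z) < 1 -> hol (fun t => dotc (F (t *: z)) u) t.
Proof.
move=> h; apply: hol_dotb => i; last exact: hol_cst.
have -> : (fun t => F (t *: z) i 0) = (fun t => F (0 + t *: z) i 0) by apply/funext => s; rewrite add0r.
by apply: vhol_line; rewrite add0r; exact: Fh.
Qed.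

(** By scaling, [dotc (F (t *: z)) (F u)] is a monomial [c * t ^+ d]. The lower bound on
    [cm (dotc z u)] puts [t = r ^+ 2 / dotc z u] in its domain; polarization there gives the value
    [kappa = r ^+ 2 ^+ d], which fixes [c]. *)
Let radial z u : nrm z < 1 -> nrm u < 1 -> r ^+ 2 * nrm z < cm (dotc z u) ->
  exists d, kappa = r ^+ 2 ^+ d /\ dotc (F z) (F u) = dotc z u ^+ d.
Proof.
move=> z1 u1 zu; have /andP[a0 a1] := a01; have /andP[k0 k1] := k01.
have zu0 : 0 < cm (dotc z u).
  by apply: le_lt_trans zu; rewrite mulr_ge0 ?nrm_ge0 // ltW.
have zn : 0 < nrm z.
  by rewrite nrm_gt0; apply/eqP => z0; move: zu0; rewrite z0 /dotc dotb0l cm0 ltxx.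
have zun : dotc z u != 0 by rewrite -cm_gt0.
pose M := (nrm z)^-1; have M0 : 0 < M by rewrite invr_gt0.
have tz t : cm t < M -> nrm (t *: z) < 1 by rewrite nrmZ /M -[(nrm z)^-1]mul1r ltr_pdivlMr.
pose phi t := dotc (F (t *: z)) (F u).
have [d hd] : exists d, (r ^+ 2) ^+ d < kappa.
  by have [|d hd] := @pow_lt K (r ^+ 2) 1 kappa _ k0; [rewrite a1 ltW|exists d; rewrite mul1r in hd].
have [|t tM|e [c [h1 h2]]] := @power_law K (r ^+ 2) M d kappa phi a01 M0 hd.
- by move=> t /tz; exact: hol_inner.
- by rewrite /phi -scalerA sc ?dotcZl //; exact: tz.
have t0M : cm (rc (r ^+ 2) / dotc z u) < M.
  by rewrite cmM cmV cm_rc gtr0_norm // ltr_pdivrMr // mulrC ltr_pdivlMr.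
have := h1 _ t0M; rewrite /phi pol ?tz // ?dotcZl ?divfK // => kc.
have cn : c != 0.
  apply/eqP => c0; move: kc; rewrite c0 mul0r => /eqP.
  by rewrite -cm_eq0 cm_rc normr_eq0 gt_eqF.
case: h2 => [/eqP|ke]; first by rewrite (negPf cn).
exists e; split => //; have := h1 1; rewrite cm1 /phi scale1r expr1n mulr1 => -> //; last first.
  by rewrite /M invf_gt1.
move: kc; rewrite expr_div_n ke !rcX => /esym /eqP.
have an : rc r ^+ 2 ^+ e != 0 :> C by rewrite -!rcX -cm_gt0 cm_rc gtr0_norm // exprn_gt0.
rewrite mulrCA -[X in _ == X]mulr1 (inj_eq (mulfI an)) => /eqP h.
by rewrite (canRL (divfK (expf_neq0 e zun)) h) mul1r.
Qed.

(** The exponent is the same for all pairs because [kappa] determines it. The pairs out of reach of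
    [radial] follow by continuation in [u], starting from a multiple of [z]. *)
Lemma kernel_power : exists d, kappa = (r ^+ 2) ^+ d /\
  forall z u, nrm z < 1 -> nrm u < 1 -> dotc (F z) (F u) = dotc z u ^+ d.
Proof.
have /andP[a0 a1] := a01; have /andP[k0 k1] := k01.
(* The multiple of [z] of norm [y] lies in the ball, and its inner product with [z], of modulus
   [y * nrm z], exceeds the threshold [r ^+ 2 * nrm z]. *)
pose y := (1 + r ^+ 2) / 2; have y1 : r ^+ 2 < y by rewrite /y; lra.
have y2 : y < 1 by rewrite /y; lra.
have y0 : 0 < y by lra.
have nearz (z : 'cV[C]_2) : z != 0 -> let u := rc (y / nrm z) *: z in
    nrm u < 1 /\ r ^+ 2 * nrm z < cm (dotc z u).
  rewrite -nrm_gt0 => z0 u; have nu : nrm u = y.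
    have yz : 0 < y / nrm z by exact: divr_gt0.
    by rewrite /u nrmZ cm_rc gtr0_norm // divfK // gt_eqF.
  rewrite nu; split => //; rewrite /u dotcZr dotcc cj_rc -rcM cm_rc -nrm_sqr ger0_norm.
    by rewrite (expr2 (nrm z)) mulrA divfK ?gt_eqF // ltr_pM2r.
  by rewrite mulr_ge0 ?sqr_ge0 // divr_ge0 ?nrm_ge0 // ltW.
have inj d e : (r ^+ 2) ^+ d = (r ^+ 2) ^+ e -> d = e.
  by apply: ieexprIn => //; rewrite lt_eqF.
have [d [kd _]] : exists d, kappa = (r ^+ 2) ^+ d /\ True.
  have e10 : (mk2 (rc 2^-1) 0 : 'cV[C]_2) != 0.
    by rewrite -nrm2_gt0 nrm2_mk2 cm_rc cm0 expr0n addr0 exprn_gt0 // normr_gt0.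
  have n1 : nrm (mk2 (rc 2^-1) 0 : 'cV[C]_2) < 1.
    by rewrite -nrm2_lt1 nrm2_mk2 cm_rc cm0 expr0n addr0 gtr0_norm //; lra.
  have [u1 hu] := nearz _ e10; have [d [kd _]] := radial n1 u1 hu; by exists d.
have d0 : (0 < d)%N by case: d kd => // kd; move: k1; rewrite kd expr0 ltxx.
exists d; split => // z u z1 u1; case: (eqVneq z 0) => [->|zn].
  by rewrite F0 /dotc !dotb0l expr0n gtn_eqF.
have [w1 zw] := nearz z zn; set w := rc _ *: z in w1 zw.
rewrite -(cj_dotc u z) -(cj_dotc (F u) (F z)) -cjX; congr cj.
apply/eqP; rewrite -subr_eq0; apply/eqP; have -> : u = w + (u - w) by rewrite addrC subrK.
apply: (line_identity (g := fun u => dotc (F u) (F z) - dotc u z ^+ d)).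
- move=> t ht; have hs : nrm (w + rc t *: (u - w)) < 1.
    by apply: segment_ball => //; rewrite addrC subrK.
  apply: filterS (near_lt_nrm hs) => s hs'; apply: holB.
    apply: (@hol_dotb _ _ (fun s => F (w + s *: (u - w))) (fun=> cjv (F z))) => i.
      by apply: vhol_line; exact: Fh.
    exact: hol_cst.
  by apply: holX; exact: hol_dotc_line.
- have n1 : \forall s \near (0 : C), nrm (w + s *: (u - w)) < 1.
    by apply: near_lt_nrm; rewrite scale0r addr0.
  have n2 : \forall s \near (0 : C), r ^+ 2 * nrm z < cm (dotc (w + s *: (u - w)) z).
    apply: (@contK_gt K (fun s => cm (dotc (w + s *: (u - w)) z))).
      by apply: contK_cm; apply: hol_cont; exact: hol_dotc_line.
    by rewrite scale0r addr0 -cj_dotc cm_cj.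
  near=> s; have x1 : nrm (w + s *: (u - w)) < 1 by near: s; exact: n1.
  have : r ^+ 2 * nrm z < cm (dotc (w + s *: (u - w)) z) by near: s; exact: n2.
  move: (w + _) x1 => x x1; rewrite -cj_dotc cm_cj => x2.
  have [e [ke he]] := radial z1 x1 x2; have ed : e = d by apply: inj; rewrite -ke.
  by rewrite -(cj_dotc (F z)) he ed cjX subrr.
Unshelve. all: by end_near.
Qed.
End Kernel.

(** * Equal Gram kernels: linear relations, unitaries and dimension *)

Section Gram.
Variable K : realType.
Local Notation C := (cplx K).
Variable T : Type.

Definition rows_mx m n (X : T -> 'cV[C]_n) (t : 'I_m -> T) : 'M[C]_(m, n) :=
  \matrix_(i, k) X (t i) k 0.

Lemma mul_rows_mx m n (X : T -> 'cV[C]_n) (t : 'I_m -> T) c :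
  (c *m rows_mx X t)^T = \sum_i c 0 i *: X (t i).
Proof.
apply/matrixP => k j; rewrite ord1 mxE summxE mxE.
by apply: eq_bigr => i _; rewrite !mxE.
Qed.

Lemma dotc_sum m n (X : 'I_m -> 'cV[C]_n) u : dotc (\sum_i X i) u = \sum_i dotc (X i) u.
Proof.
rewrite /dotc; elim/big_rec2: _ => [|i x y _ h]; first by rewrite dotb0l.
by rewrite dotbDl h.
Qed.

Variables (P : T -> Prop) (n n' : nat) (X : T -> 'cV[C]_n) (Y : T -> 'cV[C]_n').
Hypothesis XY : forall t u, P t -> P u -> dotc (X t) (X u) = dotc (Y t) (Y u).

(** The norm of a linear combination is a function of the Gram matrix. *)
Lemma gram_relation m (t : 'I_m -> T) (c : 'rV[C]_m) : (forall i, P (t i)) ->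
  c *m rows_mx X t = 0 -> c *m rows_mx Y t = 0.
Proof.
move=> Pt /(congr1 trmx); rewrite mul_rows_mx trmx0 => h.
apply: trmx_inj; rewrite mul_rows_mx trmx0.
have E : nrm2 (\sum_i c 0 i *: Y (t i)) = nrm2 (\sum_i c 0 i *: X (t i)).
  apply: (@rcI K); rewrite -!dotcc !dotc_sum; apply: eq_bigr => i _; rewrite !dotcZl; congr (_ * _).
  rewrite -[LHS]cj_dotc -[RHS]cj_dotc !dotc_sum !cj_sum; apply: eq_bigr => j _.
  by rewrite !dotcZl !cjM !cj_dotc XY.
by apply/eqP; rewrite -nrm2_eq0 E h nrm20.
Qed.
End Gram.

Section Unitary.
Variable K : realType.
Local Notation C := (cplx K).

(** The matrix is the conjugate of [invmx A *m B]. Equality of the Gram matrices of the two tuples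
    makes it unitary, and equality of the pairings with the tuples carries it to every other
    point. *)
Lemma gram_unitary T (P : T -> Prop) n (X Y : T -> 'cV[C]_n) (t : 'I_n -> T) :
  (forall t u, P t -> P u -> dotc (X t) (X u) = dotc (Y t) (Y u)) ->
  (forall i, P (t i)) -> \det (rows_mx Y t) != 0 ->
  exists W : 'M[C]_n, W \is unitarymx /\ forall s, P s -> X s = W *m Y s.
Proof.
move=> XY Pt dY; set A := rows_mx X t; set B := rows_mx Y t.
have dA : \det A != 0.
  apply: contra dY => /det0P [c c0 cA]; apply/det0P; exists c; first exact: c0.
  exact: (gram_relation XY Pt cA).
have uA : A \in unitmx by rewrite unitmxE unitfE.
have conjE (m m' : nat) (M : 'M[C]_(m, m')) : map_mx (@cj K) (map_mx (@cj K) M) = M.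
  by apply/matrixP => i j; rewrite !mxE cjK.
have mulE Z s i : (rows_mx Z t *m cjv (Z s)) i 0 = dotc (Z (t i)) (Z s).
  by rewrite mxE /dotc dotb.unlock; apply: eq_bigr => k _; rewrite mxE.
have AB s : P s -> A *m cjv (X s) = B *m cjv (Y s).
  by move=> Ps; apply/matrixP => i j; rewrite ord1 !mulE XY.
have AA : A *m map_mx (@cj K) A^T = B *m map_mx (@cj K) B^T.
  apply/matrixP => i j; have := AB _ (Pt j) => /matrixP/(_ i 0).
  rewrite !mxE => h; rewrite -[LHS](_ : \sum_k A i k * cjv (X (t j)) k 0 = _).
    by rewrite h; apply: eq_bigr => k _; rewrite !mxE.
  by apply: eq_bigr => k _; rewrite !mxE.
pose V := invmx A *m B.
have VE : A *m V = B by rewrite mulmxA (mulmxV uA) mul1mx.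
exists (map_mx (@cj K) V); split.
  apply/unitarymxP.
  have -> : ((map_mx (@cj K) V) ^t (@Num.conj C))%sesqui = V^T.
    by apply/matrixP => i j; rewrite !mxE; exact: cjK.
  have : V *m map_mx (@cj K) V^T = 1%:M.
    have : A *m (V *m map_mx (@cj K) V^T) *m map_mx (@cj K) A^T = A *m map_mx (@cj K) A^T.
      rewrite AA mulmxA VE -mulmxA -map_mxM -trmx_mul VE //.
    have uA' : map_mx (@cj K) A^T \in unitmx by rewrite map_unitmx unitmx_tr.
    move=> h; apply: (can_inj (mulKmx uA)); rewrite mulmx1.
    by apply: (can_inj (mulmxK uA')); exact: h.
  move=> /(congr1 (map_mx (@cj K))); rewrite map_mxM conjE map_mx1 //.
move=> s Ps; rewrite -[X s]cjvK.
have -> : cjv (X s) = V *m cjv (Y s) by rewrite /V -mulmxA -AB // mulKmx.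
by rewrite /cjv map_mxM conjE.
Qed.

(** The square roots of binomial coefficients turn the inner product of two values into the binomial
    expansion of [dotc z u ^+ d]. *)
Definition veronese d (z : 'cV[C]_2) : 'cV[C]_d.+1 :=
  \col_k (rc (Num.sqrt ('C(d, k))%:R) * (z 0 0 ^+ (d - k) * z 1 0 ^+ k)).

Lemma dotc_veronese d z u : dotc (veronese d z) (veronese d u) = dotc z u ^+ d.
Proof.
rewrite /dotc [RHS](_ : _ = (z 0 0 * cj (u 0 0) + z 1 0 * cj (u 1 0)) ^+ d); last by rewrite dotb2 !mxE.
rewrite exprDn dotb.unlock; apply: eq_bigr => k _; rewrite !mxE !cjM cj_rc !cjX -[RHS]mulr_natr.
have -> : ('C(d, k)%:R : C) = rc (Num.sqrt ('C(d, k)%:R)) * rc (Num.sqrt ('C(d, k)%:R)).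
  by rewrite -rcM -expr2 sqr_sqrtr ?ler0n // rcn.
rewrite !exprMn; move: (rc _) => s; ring.
Qed.

Lemma left_kernel m n (A : 'M[C]_(m, n)) : (n < m)%N -> exists2 c : 'rV_m, c != 0 & c *m A = 0.
Proof.
move=> nm; have : kermx A != 0.
  by rewrite -mxrank_eq0 mxrank_ker -lt0n subn_gt0; apply: leq_ltn_trans nm; exact: rank_leq_col.
by move=> /rowV0Pn [v /sub_kermxP vA v0]; exists v.
Qed.

(** On points of the form [y (1, x i * y)] the coordinates are powers of [x i * y] up to nonzero
    weights, so a relation is one between the values of a Vandermonde matrix. *)
Lemma veronese_free d : exists t : 'I_d.+1 -> 'cV[C]_2, (forall i, nrm (t i) < 1) /\
  forall c : 'rV_d.+1, c *m rows_mx (@veronese d) t = 0 -> c = 0.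
Proof.
(* At most [1 / 2] even for [d = 0], and [i * y] stays below 1 for all indices, so the points lie in
   the ball. *)
pose y : K := (d.+2)%:R^-1.
have d2 : 0 < (d.+2)%:R :> K by rewrite ltr0n.
have y0 : 0 < y by rewrite invr_gt0.
pose x (i : 'I_d.+1) : C := rc (i%:R * y).
exists (fun i => rc y *: mk2 1 (x i * rc y)); split.
  move=> i.
  have iy : i%:R * y <= 1.
    rewrite ler_pdivrMr // mul1r ler_nat; apply: leq_trans (ltnW (ltn_ord i)) _; exact: leqnSn.
  have iy0 : 0 <= i%:R * y by rewrite mulr_ge0 ?ler0n // ltW.
  have y2 : y <= 1 / 2.
    by rewrite /y div1r lef_pV2 ?posrE ?ltr0n // ler_nat.
  rewrite -nrm2_lt1 nrm2Z nrm2_mk2 cm1 cmM !cm_rc (ger0_norm (ltW y0)) (ger0_norm iy0) expr1n.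
  have h1 : (i%:R * y * y) ^+ 2 <= 1 by rewrite expr_le1 ?mulr_ge0 ?ler0n ?(ltW y0) //; nra.
  have h2 : y ^+ 2 <= 1 / 4 by nra.
  have h3 : y ^+ 2 * (i%:R * y * y) ^+ 2 <= 1 / 4 * 1 by apply: ler_pM; rewrite ?sqr_ge0.
  lra.
move=> c cA; pose v : 'rV[C]_d.+1 := \row_i (x i * rc y).
have D : \det (Vandermonde d.+1 v) != 0.
  rewrite det_Vandermonde; apply/prodf_neq0 => i _; apply/prodf_neq0 => j ij.
  have yn : y != 0 by rewrite gt_eqF.
  rewrite !mxE subr_eq0 -!rcM; apply/eqP => /(@rcI K) /(mulIf yn) /(mulIf yn) /eqP.
  by rewrite eqr_nat gtn_eqF.
apply/matrixP => j i; rewrite ord1 mxE {j}.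
have cV : c *m (Vandermonde d.+1 v)^T = 0.
  apply/matrixP => j k; rewrite ord1 mxE.
  have yn : rc y != 0 :> C by rewrite -cm_gt0 cm_rc gtr0_norm.
  have bn : rc (Num.sqrt ('C(d, k))%:R) * rc y ^+ d != 0 :> C.
    rewrite mulf_neq0 ?expf_neq0 // -cm_gt0 cm_rc normr_gt0 gt_eqF // sqrtr_gt0 ltr0n bin_gt0.
    by rewrite -ltnS.
  apply: (mulfI bn); rewrite mxE mulr0.
  move/matrixP/(_ 0 k): cA; rewrite !mxE => h; apply: etrans h.
  rewrite mulr_sumr; apply: eq_bigr => l _; rewrite !mxE.
  have kd : (k <= d)%N by rewrite -ltnS.
  rewrite /= mulr1 !exprMn -[in rc y ^+ d](subnK kd) exprD.
  by move: (rc _ ^+ (d - k)) (rc y ^+ k) (rc (Num.sqrt _)) => A B s; ring.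
have dV : \det (Vandermonde d.+1 v)^T != 0 by rewrite det_tr.
apply/eqP; apply: contraNT dV => ci; apply/det0P; exists c => //.
by apply/negP => /eqP c0; move: ci; rewrite c0 mxE eqxx.
Qed.

(** Equal kernels transport relations both ways: more than [d.+1] independent values of [F], or more
    than [N] of [veronese], would inherit a relation from the other map. *)
Lemma kernel_dim N (F : 'cV[C]_2 -> 'cV[C]_N) d (a : 'I_N -> 'cV[C]_2) :
  (forall z u, nrm z < 1 -> nrm u < 1 -> dotc (F z) (F u) = dotc z u ^+ d) ->
  (forall i, nrm (a i) < 1) -> \det (tuple_mx F a) != 0 -> N = d.+1.
Proof.
move=> Fd a1 Da; have FV z u : nrm z < 1 -> nrm u < 1 ->
    dotc (F z) (F u) = dotc (veronese d z) (veronese d u).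
  by move=> z1 u1; rewrite Fd // dotc_veronese.
have VF z u : nrm z < 1 -> nrm u < 1 ->
    dotc (veronese d z) (veronese d u) = dotc (F z) (F u) by move=> z1 u1; rewrite FV.
apply/eqP; rewrite eqn_leq leqNgt [(d < N)%N]leqNgt; apply/andP; split; apply/negP => h.
- have [c c0 cA] := left_kernel (rows_mx (veronese d) a) h.
  have := gram_relation VF a1 cA; move=> cF; move/negP: Da; apply; apply/det0P.
  by exists c.
- have [t [t1 tc]] := veronese_free d.
  have [c c0 cA] := left_kernel (rows_mx F t) h.
  have := tc c (gram_relation FV t1 cA) => /eqP; rewrite (negPf c0) //.
Qed.
End Unitary.

(** * Maps with prescribed norm on two spheres, and reduction of the target *)

Section SphereMaps.
Variable K : realType.
Local Notation C := (cplx K).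

(** What the extended proper map retains of properness. Unlike properness itself, it passes to a
    rescaled projection onto a hyperplane. *)
Definition sphere_map N (F : 'cV[C]_2 -> 'cV[C]_N) (r kappa : K) :=
  [/\ forall z, nrm z < 1 -> vhol F z,
      forall z, nrm z = r -> nrm2 (F z) = kappa &
      forall u, nrm u = 1 -> forall eps : K, 0 < eps -> exists2 del, 0 < del &
        forall t : K, 1 - del < t < 1 -> `|nrm2 (F (rc t *: u)) - 1| < eps].

Variables (r : K).
Hypothesis r0 : 0 < r.
Hypothesis r1 : r < 1.

Lemma sphere_map_pol N (F : 'cV[C]_2 -> 'cV[C]_N) kappa : sphere_map F r kappa ->
  forall z u, nrm z < 1 -> nrm u < 1 -> dotc z u = rc (r ^+ 2) -> dotc (F z) (F u) = rc kappa.
Proof.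
move=> [Fh Fr _] z u z1 u1; apply: (sphere_polarization r0); rewrite ?nrm2_lt1 //.
- by move=> w; rewrite nrm2_lt1; exact: Fh.
- move=> w wr _; apply: Fr; rewrite nrm.unlock wr sqrtr_sqr ger0_norm //; exact: ltW.
Qed.

Lemma sphere_map_neq0 N (F : 'cV[C]_2 -> 'cV[C]_N) kappa : sphere_map F r kappa ->
  (forall z, nrm z < 1 -> F z = 0) -> False.
Proof.
move=> [_ _ rad] F0.
have u1 : nrm (mk2 1 0 : 'cV[C]_2) = 1.
  by apply: nrm_eq1; rewrite nrm2_mk2 cm1 cm0 expr0n expr1n addr0.
have [d d0 hd] := rad _ u1 _ ltr01.
pose y := Num.min d 1; have y0 : 0 < y by rewrite lt_min d0 ltr01.
have y1 : y <= 1 by rewrite ge_min lexx orbT.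
have yd : y <= d by rewrite ge_min lexx.
have := hd (1 - y / 2) ltac:(apply/andP; split; lra).
rewrite F0 ?nrm20 ?sub0r ?normrN ?normr1 ?ltxx //.
by rewrite nrmZ u1 mulr1 cm_rc ger0_norm; lra.
Qed.

Theorem nondegenerate_kernel N (F : 'cV[C]_2 -> 'cV[C]_N) kappa p e (s : 'I_N -> C) :
  sphere_map F r kappa -> kappa < 1 -> nrm p < 1 -> (forall i, nrm (p + s i *: e) < 1) ->
  \det (tuple_mx F (fun i => p + s i *: e)) != 0 ->
  exists d, [/\ N = d.+1, kappa = (r ^+ 2) ^+ d &
    forall z u, nrm z < 1 -> nrm u < 1 -> dotc (F z) (F u) = dotc z u ^+ d].
Proof.
move=> FS k1 p1 s1 D; have [Fh Fr rad] := FS; have pol := sphere_map_pol FS.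
have polb z w : nrm z < 1 -> nrm w < 1 -> dotb z w = rc (r ^+ 2) ->
    dotb (F z) (refl F w) = rc kappa.
  by move=> z1 w1 zw; apply: pol; rewrite ?nrm_cjv // /dotc cjvK.
have sc := scaling r0 r1 Fh p1 s1 D polb rad.
have a0 : 0 < r ^+ 2 by rewrite exprn_gt0.
have k0 : 0 < kappa.
  rewrite lt0r; apply/andP; split; last first.
    have nr : nrm (mk2 (rc r) 0 : 'cV[C]_2) = r.
      rewrite nrm.unlock nrm2_mk2 cm0 expr0n addr0 cm_rc real_normK ?num_real //.
      by rewrite sqrtr_sqr gtr0_norm.
    by rewrite -(Fr _ nr) nrm2_ge0.
  (* With [kappa = 0] the scaling law makes [F] vanish on the ball of radius [r ^+ 2], hence
     everywhere, against the radial limits. *)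
  apply/eqP => k0; apply: (sphere_map_neq0 FS) => z z1.
  have small0 w : nrm w < r ^+ 2 -> F w = 0.
    move=> wr; have an : rc (r ^+ 2) != 0 :> C by rewrite -cm_gt0 cm_rc gtr0_norm.
    have -> : w = rc (r ^+ 2) *: (rc (r ^+ 2)^-1 *: w) by rewrite scalerA rcV divff // scale1r.
    rewrite sc ?k0 ?rc0 ?scale0r // nrmZ cm_rc gtr0_norm ?invr_gt0 //.
    by rewrite mulrC ltr_pdivrMr // mul1r.
  apply/matrixP => i j; rewrite ord1 mxE -[z]add0r.
  apply: (line_identity (g := fun z => F z i 0)).
  - move=> t ht; have hs : nrm (0 + rc t *: z) < 1.
      by apply: segment_ball; rewrite ?nrm0 ?add0r.
    by apply: filterS (near_lt_nrm hs) => s' hs'; apply: vhol_line; exact: Fh.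
  - have n1 : \forall t \near (0 : C), nrm (0 + t *: z) < r ^+ 2.
      by apply: near_lt_nrm; rewrite scale0r addr0 nrm0.
    by apply: filterS n1 => t /small0 ->; rewrite mxE.
have k01 : 0 < kappa < 1 by rewrite k0.
have [d [kd Fd]] := kernel_power r0 r1 k01 Fh pol sc.
by exists d; split => //; exact: (kernel_dim Fd s1 D).
Qed.

(** A maximal independent tuple of values has fewer than [m] members and spans all values, so a
    vector of its kernel annihilates them. *)
Lemma span_functional m (T : Type) (P : T -> Prop) (X : T -> 'cV[C]_m) :
  (forall t : 'I_m -> T, (forall i, P (t i)) -> \det (rows_mx X t) = 0) ->
  exists x : 'cV[C]_m, x != 0 /\ forall t, P t -> dotb (X t) x = 0.
Proof.
move=> D0; pose Q k := `[< exists t : 'I_k -> T, (forall i, P (t i)) /\ row_free (rows_mx X t) >].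
have Q0 : exists k, Q k.
  have t0 : 'I_0 -> T by case.
  exists 0%N; apply/asboolP; exists t0; split; first by case.
  by rewrite -kermx_eq0; apply/eqP/matrixP => -[].
have Qm k : Q k -> (k <= m)%N.
  by move=> /asboolP [t [_ /eqP <-]]; exact: rank_leq_col.
have [k /asboolP [t [Pt tf]] kmax] := ex_maxnP Q0 Qm.
have km : (k < m)%N.
  rewrite ltn_neqAle Qm ?andbT; last by apply/asboolP; exists t.
  apply/eqP => km; move: t Pt tf; rewrite km => t Pt; rewrite row_free_unit unitmxE unitfE D0 //.
  by rewrite eqxx.
have sub s : P s -> ((X s)^T <= rows_mx X t)%MS.
  move=> Ps; apply: contraT => ns.
  pose tt (i : 'I_(1 + k)) := match fintype.split i with inl _ => s | inr j => t j end.
  suff : Q (1 + k)%N by move/kmax; rewrite add1n ltnn.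
  apply/asboolP; exists tt; split; first by move=> i; rewrite /tt; case: fintype.split.
  have -> : rows_mx X tt = col_mx (X s)^T (rows_mx X t).
    apply/matrixP => i j; rewrite !mxE /tt; case: fintype.split => i'; rewrite !mxE //.
    by rewrite ord1.
  rewrite -kermx_eq0; apply/rowV0P => c /sub_kermxP.
  rewrite -[c]hsubmxK mul_row_col; set c1 := lsubmx c; set c2 := rsubmx c => h.
  have c10 : c1 = 0.
    apply/eqP; rewrite -[_ == _]negbK; apply: contra ns => cn.
    have c1E : c1 = (c1 0 0)%:M by rewrite [LHS]mx11_scalar.
    have cn0 : c1 0 0 != 0.
      by apply: contraNneq cn => c0; rewrite c1E c0 raddf0.
    move: h; rewrite c1E mul_scalar_mx => /eqP; rewrite addr_eq0 => /eqP h.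
    have -> : (X s)^T = (c1 0 0)^-1 *: - (c2 *m rows_mx X t) by rewrite -h scalerA mulVf // scale1r.
    by rewrite scalemx_sub // eqmx_opp submxMl.
  move: h; rewrite c10 mul0mx add0r => /eqP; rewrite mulmx_free_eq0 // => /eqP ->.
  by rewrite row_mx0.
have [c c0 cA] := left_kernel (rows_mx X t)^T km.
exists c^T; split; first by rewrite trmx_eq0.
move=> s /sub /submxP [D DE].
have -> : dotb (X s) c^T = ((X s)^T *m c^T) 0 0.
  by rewrite dotb.unlock [RHS]mxE; apply: eq_bigr => i _; rewrite [in RHS]mxE.
by rewrite DE -mulmxA -[rows_mx X t *m _]trmxK trmx_mul trmxK cA trmx0 mulmx0 mxE.
Qed.

Lemma dotc_recl N (x y : 'cV[C]_N.+1) : dotc x y = x 0 0 * cj (y 0 0) +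
  dotc (\col_(i < N) x (lift ord0 i) 0) (\col_(i < N) y (lift ord0 i) 0).
Proof.
rewrite /dotc dotb.unlock big_ord_recl cjvE; congr (_ + _).
by apply: eq_bigr => i _; rewrite !mxE.
Qed.

Lemma refl_isometry N (v a b : 'cV[C]_N) (c := 2 / rc (nrm2 v) : C) :
  dotc (a - (c * dotc a v) *: v) (b - (c * dotc b v) *: v) = dotc a b.
Proof.
have cc : cj c = c by rewrite /c cjM cjV cj_rc -(rcn K 2) cj_rc.
rewrite dotcBl dotcZl !dotcBr !dotcZr cjM cc cj_dotc dotcc.
case: (eqVneq v 0) => [->|v0]; first by rewrite /dotc cjv0 !dotb0r; ring.
have v2 : rc (nrm2 v) != 0 :> C by rewrite -cm_gt0 cm_rc normr_gt0 gt_eqF // nrm2_gt0.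
by rewrite /c; move: (dotc a v) (dotc v b) (rc _) v2 => A B D D0; field.
Qed.

(* [x - c <x, v> v] is the reflection sending [n] to a multiple of the first
   basis vector; for [v = 0] the division by zero gives [c = 0], the identity. *)
Lemma drop_coordinate N (n : 'cV[C]_N.+1) : nrm n = 1 -> exists (c : C) v, forall x y,
  dotc x y = dotc x n * cj (dotc y n) +
    dotc (\col_(i < N) (x - (c * dotc x v) *: v) (lift ord0 i) 0)
         (\col_(i < N) (y - (c * dotc y v) *: v) (lift ord0 i) 0).
Proof.
move=> n1; pose e0 : 'cV[C]_N.+1 := \col_i (i == ord0)%:R.
have xe x : dotc x e0 = x 0 0.
  rewrite dotc_recl !mxE eqxx cj1 mulr1 /dotc dotb.unlock big1 ?addr0 // => i _.
  by rewrite !mxE /= cj0 mulr0.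
(* A complex reflection of this form exchanges [n] and [om *: e0] only if their inner product is
   real; [om] takes the phase of the first coordinate of [n]. *)
have [om [om1 rho]] : exists om : C, om * cj om = 1 /\ cj (n 0 0 * cj om) = n 0 0 * cj om.
  case: (eqVneq (n 0 0) 0) => [->|n0]; first by exists 1; rewrite cj1 mul0r mulr1 cj0.
  have cn : rc (cm (n 0 0)) != 0 :> C by rewrite -cm_gt0 cm_rc normr_gt0 cm_eq0.
  have nn : n 0 0 * cj (n 0 0) = rc (cm (n 0 0)) ^+ 2 by rewrite mul_cj rcX.
  exists (n 0 0 / rc (cm (n 0 0))); rewrite cjM cjV cj_rc; split.
    by rewrite mulrACA nn -invfM expr2 divff // mulf_neq0.
  by rewrite mulrA nn cjM cjV cjX cj_rc.
pose v := n - om *: e0; pose c : C := 2 / rc (nrm2 v).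
exists c, v => x y; pose M x := x - (c * dotc x v) *: v.
have nn : dotc n n = 1 by rewrite dotcc -nrm_sqr n1 expr1n rc1.
have vv : dotc v v = rc (nrm2 v) by rewrite dotcc.
have ne : dotc n e0 = n 0 0 := xe n.
have en : dotc e0 n = cj (n 0 0) by rewrite -cj_dotc ne.
have ee : dotc e0 e0 = 1 by rewrite xe mxE.
have nv : dotc n v = 1 - n 0 0 * cj om by rewrite /v dotcBr dotcZr nn ne mulrC.
have vvE : dotc v v = 2 * dotc n v.
  rewrite {1}/v dotcBl dotcZl /v !dotcBr !dotcZr nn ne en ee mulr1.
  have := rho; rewrite cjM cjK => rho'.
  rewrite mulrBr om1 [om * _]mulrC rho'; ring.
have Mn : M n = om *: e0.
  case: (eqVneq v 0) => [v0|v0].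
    by rewrite /M v0 scaler0 subr0; apply/eqP; rewrite -subr_eq0 -/v v0.
  have v2 : rc (nrm2 v) != 0 :> C by rewrite -cm_gt0 cm_rc normr_gt0 gt_eqF // nrm2_gt0.
  rewrite /M /c (_ : 2 / _ * _ = 1) ?scale1r ?subKr //.
  by rewrite mulrAC -vvE vv divff.
have MM a b : dotc (M a) (M b) = dotc a b by exact: refl_isometry.
have M0 a : dotc a n = cj om * M a 0 0.
  by rewrite -MM Mn dotcZr xe.
rewrite -(MM x y) dotc_recl; congr (_ + _).
by rewrite !M0 cjM cjK mulrACA [cj om * om]mulrC om1 mul1r.
Qed.

(** Dropping the constant coordinate lowers every squared norm by [cm delta ^+ 2]; dividing by
    [1 - cm delta ^+ 2] restores the radial limit 1 and gives the new [kappa]. *)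
Lemma sphere_map_reduce N (F : 'cV[C]_2 -> 'cV[C]_N.+1) kappa n (delta : C) :
  sphere_map F r kappa -> kappa < 1 -> nrm n = 1 ->
  (forall z, nrm z < 1 -> dotc (F z) n = delta) ->
  exists G : 'cV[C]_2 -> 'cV[C]_N,
    [/\ cm delta ^+ 2 < 1,
        sphere_map G r ((kappa - cm delta ^+ 2) / (1 - cm delta ^+ 2)),
        (kappa - cm delta ^+ 2) / (1 - cm delta ^+ 2) < 1 &
        forall z u, nrm z < 1 -> nrm u < 1 -> dotc (F z) (F u) =
          rc (cm delta ^+ 2) + rc (1 - cm delta ^+ 2) * dotc (G z) (G u)].
Proof.
move=> [Fh Fr rad] k1 n1 Fn; set dd := cm delta ^+ 2.
have d1 : dd < 1.
  have nr : nrm (mk2 (rc r) 0 : 'cV[C]_2) = r.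
    rewrite nrm.unlock nrm2_mk2 cm0 expr0n addr0 cm_rc real_normK ?num_real //.
    by rewrite sqrtr_sqr gtr0_norm.
  apply: le_lt_trans k1; rewrite -(Fr _ nr) /dd -(Fn (mk2 (rc r) 0)) ?nr //.
  by apply: le_trans (cauchy_schwarz _ _) _; rewrite -(nrm_sqr n) n1 expr1n mulr1.
have d1' : 0 < 1 - dd by lra.
have d0 : 0 <= dd by exact: sqr_ge0.
have [c [v hv]] := drop_coordinate n1.
pose q := (Num.sqrt (1 - dd))^-1.
have q2 : q ^+ 2 = (1 - dd)^-1 by rewrite exprVn sqr_sqrtr // ltW.
pose L x : 'cV[C]_N := \col_(i < N) (x - (c * dotc x v) *: v) (lift ord0 i) 0.
pose G z := rc q *: L (F z).
have FL z u : nrm z < 1 -> nrm u < 1 -> dotc (F z) (F u) = rc dd + dotc (L (F z)) (L (F u)).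
  by move=> z1 u1; rewrite hv !Fn // mul_cj.
have GL z u : dotc (G z) (G u) = rc ((1 - dd)^-1) * dotc (L (F z)) (L (F u)).
  by rewrite dotcZl dotcZr cj_rc mulrA -rcM -expr2 q2.
have FG z u : nrm z < 1 -> nrm u < 1 -> dotc (F z) (F u) = rc dd + rc (1 - dd) * dotc (G z) (G u).
  by move=> z1 u1; rewrite FL // GL mulrA -rcM divff ?rc1 ?mul1r // gt_eqF.
have nG z : nrm z < 1 -> nrm2 (G z) = (nrm2 (F z) - dd) / (1 - dd).
  move=> z1; apply: (@rcI K); rewrite -dotcc GL rcM mulrC; congr (_ * _).
  by rewrite rcB -dotcc FL // addrC addKr.
exists G; split => //.
- split.
  + move=> z z1 i w.
    have -> : (fun t => G (z + t *: w) i 0) = (fun t => rc q *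
        (F (z + t *: w) (lift ord0 i) 0 - c * dotc (F (z + t *: w)) v * v (lift ord0 i) 0)).
      by apply/funext => t; rewrite !mxE.
    have Fi k : hol (fun t => F (z + t *: w) k 0) 0 by exact: Fh.
    apply: holM; first exact: hol_cst.
    apply: holB; first exact: Fi.
    apply: holM; last exact: hol_cst.
    apply: holM; first exact: hol_cst.
    apply: (@hol_dotb _ _ (fun t => F (z + t *: w)) (fun=> cjv v)) => k //.
    exact: hol_cst.
  + by move=> z zr; rewrite nG ?zr // Fr.
  + move=> u u1 eps e0; have e1 : 0 < eps * (1 - dd) by rewrite mulr_gt0.
    have [del del0 hd] := rad u u1 _ e1; exists (Num.min del 1); first by rewrite lt_min del0 ltr01.
    move=> t /andP[t0 t1].
    have m1 : Num.min del 1 <= 1 by rewrite ge_min lexx orbT.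
    have m2 : Num.min del 1 <= del by rewrite ge_min lexx.
    have tn : nrm (rc t *: u) < 1 by rewrite nrmZ u1 mulr1 cm_rc ger0_norm //; lra.
    rewrite nG // -[X in _ - X](@divff _ (1 - dd)) ?gt_eqF // -mulrBl opprB addrA subrK.
    rewrite normrM [`|_^-1|]gtr0_norm ?invr_gt0 // ltr_pdivrMr //.
    by apply: hd; lra.
- by rewrite ltr_pdivrMr // mul1r; lra.
Qed.
End SphereMaps.

(** * The degenerate case: lines go to lines, hence the image is planar *)

Section Collinear.
Variable K : realType.
Local Notation C := (cplx K).

(** Stated as a relation with zero sum of coefficients, so that triples with coincident points count
    as collinear. *)
Definition coll n (x y z : 'cV[C]_n) := exists a b c : C,
  [/\ ~~ [&& a == 0, b == 0 & c == 0], a + b + c = 0 & a *: x + b *: y + c *: z = 0].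

(** These minors express collinearity by equations that are holomorphic in the points, and thus
    subject to continuation. *)
Definition minor n (j k : 'I_n) (x y z : 'cV[C]_n) : C :=
  (y - x) j 0 * (z - x) k 0 - (y - x) k 0 * (z - x) j 0.

Lemma coll_minor n (x y z : 'cV[C]_n) : coll x y z -> forall j k, minor j k x y z = 0.
Proof.
move=> [a [b [c [abc s0 r0]]]] j k.
have aE : a = - b - c by apply/eqP; rewrite -subr_eq0 -s0; apply/eqP; ring.
have E l : b * (y - x) l 0 + c * (z - x) l 0 = 0.
  have := congr1 (fun M : 'cV[C]_n => M l 0) r0; rewrite aE !mxE.
  by move=> <-; ring.
rewrite /minor; move: (E j) (E k); move: (_ j 0) (_ k 0) ((z - x) j 0) ((z - x) k 0) => A B A' B' h1 h2.
case: (eqVneq b 0) => [b0|b0].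
  have c0 : c != 0 by apply: contra abc => /eqP c0; rewrite aE b0 c0 oppr0 addr0 !eqxx.
  have A0 : A' = 0 by apply: (mulfI c0); rewrite mulr0 -[RHS]h1 b0 mul0r add0r.
  have B0 : B' = 0 by apply: (mulfI c0); rewrite mulr0 -[RHS]h2 b0 mul0r add0r.
  by rewrite A0 B0 !mulr0 subrr.
apply: (mulfI b0); rewrite mulr0.
have -> : b * (A * B' - B * A') = (b * A + c * A') * B' - (b * B + c * B') * A' by ring.
by rewrite h1 h2 !mul0r subrr.
Qed.

Lemma minor_coll n (x y z : 'cV[C]_n) : (forall j k, minor j k x y z = 0) -> coll x y z.
Proof.
move=> h; case: (eqVneq (y - x) 0) => [yx|].
  exists (- 1), 1, 0; split; first by rewrite oner_eq0 andbF.
  - by rewrite addNr addr0.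
  - by rewrite scaleN1r scale1r scale0r addr0 addrC yx.
case/matrix0Pn => j [l]; rewrite ord1 {l} => yj.
exists ((y - x) j 0 * -1 + (z - x) j 0), (- (z - x) j 0), ((y - x) j 0); split.
- by rewrite (negPf yj) !andbF.
- by move: ((y - x) j 0) ((z - x) j 0) => A B; ring.
apply/matrixP => k l; rewrite ord1 [RHS]mxE.
have := h j k; rewrite /minor => E; rewrite -[RHS]E !mxE; ring.
Qed.

(** Eliminating the common point [q] from the two relations shows that two lines through [q] lie in
    one plane. *)
Lemma coll_cross n (q x y z w : 'cV[C]_n) : coll q x y -> coll q z w ->
  exists a b c d : C, [/\ ~~ [&& a == 0, b == 0, c == 0 & d == 0], a + b + c + d = 0 &
    a *: x + b *: y + c *: z + d *: w = 0].
Proof.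
move=> [a [b [c [abc s0 r0]]]] [a' [b' [c' [abc' s0' r0']]]].
case: (eqVneq a 0) => [a0|a0].
  exists b, c, 0, 0; split.
  - by move: abc; rewrite a0 !eqxx /= andbT.
  - by rewrite !addr0 -[RHS]s0 a0 add0r.
  - by rewrite !scale0r !addr0 -[RHS]r0 a0 scale0r add0r.
case: (eqVneq a' 0) => [a0'|a0'].
  exists 0, 0, b', c'; split.
  - by move: abc'; rewrite a0' !eqxx.
  - by rewrite !add0r -[RHS]s0' a0' add0r.
  - by rewrite !scale0r !add0r -[RHS]r0' a0' scale0r add0r.
exists (a' * b), (a' * c), (- (a * b')), (- (a * c')); split.
- rewrite !mulf_eq0 (negPf a0') /=; apply/negP => /and3P [/eqP b0 /eqP c0 _].
  by move: s0 a0; rewrite b0 c0 !addr0 => ->; rewrite eqxx.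
- have -> : a' * b + a' * c + - (a * b') + - (a * c') = a' * (a + b + c) - a * (a' + b' + c') by ring.
  by rewrite s0 s0' !mulr0 subrr.
- have -> : (a' * b) *: x + (a' * c) *: y + (- (a * b')) *: z + (- (a * c')) *: w =
      a' *: (a *: q + b *: x + c *: y) - a *: (a' *: q + b' *: z + c' *: w).
    by apply/matrixP => i j; rewrite !mxE; ring.
  by rewrite r0 r0' !scaler0 subrr.
Qed.

Lemma unit_identity (h : C -> C) :
  (forall t : K, 0 <= t <= 1 -> \forall s \near rc t, hol h s) ->
  (\forall s \near (0 : C), h s = 0) -> h 1 = 0.
Proof.
move=> hh h0; have : \forall s \near ((0 : C) + rc 1 * 1), h s = 0.
  apply: (identity_segment (g := h)); last by rewrite ler01 lexx.
  - by move=> t ht; rewrite add0r mulr1; exact: hh.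
  - by move=> e e0; exact: (zero_near_ex _ h0 e0).
by move/nbhs_singleton; rewrite add0r mulr1 rc1.
Qed.

Lemma along_line n (x d : 'cV[C]_n) (t a : C) : t *: (x + d) = t *: (x + a *: d) + (t * (1 - a)) *: d.
Proof. by apply/matrixP => i j; rewrite !mxE; ring. Qed.

Lemma lines_meet (x d z d' : 'cV[C]_2) : dotb d (perp2 d') != 0 ->
  exists a b, x + a *: d = z + b *: d'.
Proof.
have -> : dotb d (perp2 d') = d 1 0 * d' 0 0 - d 0 0 * d' 1 0 by rewrite dotb2 mk2_0 mk2_1; ring.
move=> D; exists (((z 1 0 - x 1 0) * d' 0 0 - (z 0 0 - x 0 0) * d' 1 0) / (d 1 0 * d' 0 0 - d 0 0 * d' 1 0)),
  (((z 1 0 - x 1 0) * d 0 0 - (z 0 0 - x 0 0) * d 1 0) / (d 1 0 * d' 0 0 - d 0 0 * d' 1 0)).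
rewrite [LHS]mk2E [RHS]mk2E !mxE.
move: (x 0 0) (x 1 0) (d 0 0) (d 1 0) (z 0 0) (z 1 0) (d' 0 0) (d' 1 0) D => x0 x1 d0 d1 z0 z1 e0 e1 D.
by congr mk2; field.
Qed.

(** A homogeneous coordinate, which turns affine relations into linear ones. *)
Definition with1 n (x : 'cV[C]_n) : 'cV[C]_(1 + n) := col_mx 1 x.

Lemma dotb_with1 n (y : 'cV[C]_n) (x : 'cV[C]_(1 + n)) :
  dotb (with1 y) x = usubmx x 0 0 + dotb y (dsubmx x).
Proof.
rewrite dotb.unlock big_split_ord /= big_ord1 col_mxEu !mxE eqxx mul1r; congr (_ + _).
by apply: eq_bigr => i _; rewrite col_mxEd !mxE.
Qed.

Lemma with1_relation n (x y z w : 'cV[C]_n) (t : 'I_4 -> 'cV[C]_n) (a b c d : C) :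
  t = (fun i => [:: x; y; z; w]`_i) ->
  ~~ [&& a == 0, b == 0, c == 0 & d == 0] -> a + b + c + d = 0 ->
  a *: x + b *: y + c *: z + d *: w = 0 ->
  exists2 v : 'rV[C]_4, v != 0 & v *m rows_mx (@with1 n) t = 0.
Proof.
move=> -> abcd s0 r0; exists (\row_i [:: a; b; c; d]`_i).
  apply: contra abcd => /eqP v0.
  have h (i : 'I_4) : [:: a; b; c; d]`_i = 0.
    by have := congr1 (fun M : 'rV[C]_4 => M 0 i) v0; rewrite !mxE.
  by apply/and4P; split; apply/eqP; [exact: (h (Ordinal (isT : 0 < 4)%N))|exact: (h (Ordinal (isT : 1 < 4)%N))|
    exact: (h (Ordinal (isT : 2 < 4)%N))|exact: (h (Ordinal (isT : 3 < 4)%N))].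
apply: trmx_inj; rewrite mul_rows_mx trmx0 !big_ord_recl big_ord0 !mxE /= addr0 /with1.
rewrite !scale_col_mx !add_col_mx -col_mx0; congr col_mx; last by rewrite !addrA.
by rewrite !addrA -!scalerDl s0 scale0r.
Qed.
End Collinear.
Lemma sum3 (V : zmodType) (f : 'I_3 -> V) :
  \sum_i f i = f ord0 + f (lift ord0 ord0) + f (lift ord0 (lift ord0 ord0)).
Proof. by rewrite !big_ord_recl big_ord0 addr0 addrA. Qed.

Section Degenerate.
Variable K : realType.
Local Notation C := (cplx K).
Variables (F : 'cV[C]_2 -> 'cV[C]_3) (r kappa : K).
Hypothesis r0 : 0 < r.
Hypothesis r1 : r < 1.
Hypothesis k0 : kappa != 0.
Hypothesis Fh : forall z, nrm z < 1 -> vhol F z.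
Hypothesis pol : forall z u, nrm z < 1 -> nrm u < 1 -> dotc z u = rc (r ^+ 2) ->
  dotc (F z) (F u) = rc kappa.
Hypothesis dep : forall p e (s : 'I_3 -> C), (forall i, nrm (p + s i *: e) < 1) ->
  \det (tuple_mx F (fun i => p + s i *: e)) = 0.

(* By polarization such a line is sent to an affine plane avoiding the origin,
   where linear dependence means collinearity. *)
Let coll_far e w q s1 s2 : nrm w = 1 -> dotb e w = 0 -> r ^+ 2 < cm (dotb q w) ->
  nrm q < 1 -> nrm (q + s1 *: e) < 1 -> nrm (q + s2 *: e) < 1 ->
  coll (F q) (F (q + s1 *: e)) (F (q + s2 *: e)).
Proof.
move=> w1 ew qw q1 h1 h2.
have a0 : 0 < r ^+ 2 by rewrite exprn_gt0.
have q0 : 0 < cm (dotb q w) by apply: lt_trans qw.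
have qn : dotb q w != 0 by rewrite -cm_gt0.
pose b : C := rc (r ^+ 2) / dotb q w; pose u := cj b *: cjv w.
have u1 : nrm u < 1.
  rewrite nrmZ cm_cj nrm_cjv w1 mulr1 cmM cmV cm_rc gtr0_norm //.
  by rewrite ltr_pdivrMr // mul1r.
have zu s : dotc (q + s *: e) u = rc (r ^+ 2).
  by rewrite /dotc cjvZ cjK cjvK dotbZr dotbDl dotbZl ew mulr0 addr0 /b divfK.
pose s (i : 'I_3) := [:: 0; s1; s2]`_i.
have s_in (i : 'I_3) : nrm (q + s i *: e) < 1.
  case: i => [[|[|[|k]]] hi]; last discriminate hi.
  - by rewrite /s /= scale0r addr0; exact: q1.
  - exact: h1.
  - exact: h2.
have /eqP/det0P [v v0 vA] := dep s_in.
have := mul_rows_mx F (fun i => q + s i *: e) v; rewrite [_ *m _]vA trmx0 => /esym E.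
have kc : rc kappa != 0 :> C by rewrite -cm_gt0 cm_rc normr_gt0.
have : \sum_i v 0 i = 0.
  have := congr1 (fun x => dotc x (F u)) E; rewrite dotc_sum /= [X in _ = X]dotb0l => E'.
  apply: (mulIf kc); rewrite mul0r -[RHS]E' mulr_suml; apply: eq_bigr => i _.
  by rewrite dotcZl (pol (s_in i) u1 (zu _)).
rewrite !sum3; move: E; rewrite sum3 /s /= scale0r addr0 => E S.
exists (v 0 ord0), (v 0 (lift ord0 ord0)), (v 0 (lift ord0 (lift ord0 ord0))); split => //.
apply: contra v0 => /and3P [/eqP e0 /eqP e1 /eqP e2]; apply/eqP/rowP => i; rewrite mxE.
by case: i => [[|[|[|//]]] hi]; [rewrite -[RHS]e0|rewrite -[RHS]e1|rewrite -[RHS]e2];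
  congr (v 0 _); apply/val_inj.
Qed.

Let hol_minor j k (a d a' d' a'' d'' : 'cV[C]_2) t : nrm (a + t *: d) < 1 -> nrm (a' + t *: d') < 1 ->
  nrm (a'' + t *: d'') < 1 ->
  hol (fun t => minor j k (F (a + t *: d)) (F (a' + t *: d')) (F (a'' + t *: d''))) t.
Proof.
move=> h h' h''.
have H (b c : 'cV[C]_2) l : nrm (b + t *: c) < 1 -> hol (fun t => F (b + t *: c) l 0) t.
  by move=> hb; apply: vhol_line; exact: Fh.
have -> : (fun t => minor j k (F (a + t *: d)) (F (a' + t *: d')) (F (a'' + t *: d''))) =
  (fun t => (F (a' + t *: d') j 0 - F (a + t *: d) j 0) * (F (a'' + t *: d'') k 0 - F (a + t *: d) k 0) -
            (F (a' + t *: d') k 0 - F (a + t *: d) k 0) * (F (a'' + t *: d'') j 0 - F (a + t *: d) j 0)).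
  by apply/funext => s; rewrite /minor !mxE.
by apply: holB; apply: holM; apply: holB; apply: H.
Qed.

(** The homothety about [p], which has height [y > r ^+ 2], contracts any line to parallel ones
    within reach of [coll_far]; the minors continue back to ratio 1. *)
Lemma line_coll q e s1 s2 : nrm q < 1 -> nrm (q + s1 *: e) < 1 -> nrm (q + s2 *: e) < 1 ->
  coll (F q) (F (q + s1 *: e)) (F (q + s2 *: e)).
Proof.
move=> q1 h1 h2; apply: minor_coll => j k.
have [w [w1 ew]] := unit_perp e.
have a1 : r ^+ 2 < 1 by rewrite expr_lt1 // ltW.
have a0 : 0 < r ^+ 2 by rewrite exprn_gt0.
pose y := (1 + r ^+ 2) / 2; have y1 : r ^+ 2 < y by rewrite /y; lra.
have y2 : y < 1 by rewrite /y; lra.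
have y0 : 0 < y by lra.
pose p := rc y *: cjv w.
have np : nrm p < 1 by rewrite nrmZ nrm_cjv w1 mulr1 cm_rc gtr0_norm.
have pw : dotb p w = rc y.
  have : dotc w w = 1 by rewrite dotcc -nrm_sqr w1 expr1n rc1.
  by rewrite dotbZl dotbC => ww; rewrite -/(dotc w w) ww mulr1.
pose h t := minor j k (F (p + t *: (q - p))) (F (p + t *: (q + s1 *: e - p)))
  (F (p + t *: (q + s2 *: e - p))).
have : h 1 = 0.
  apply: unit_identity.
  - move=> t ht; have seg z : nrm z < 1 -> \forall s \near rc t, nrm (p + s *: (z - p)) < 1.
      by move=> z1; apply: near_lt_nrm; apply: segment_ball => //; rewrite addrC subrK.
    apply: filterS3 (seg _ q1) (seg _ h1) (seg _ h2) => s; exact: hol_minor.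
  - have seg (z : 'cV[C]_2) : \forall s \near (0 : C), nrm (p + s *: (z - p)) < 1.
      by apply: near_lt_nrm; rewrite scale0r addr0.
    have far : \forall s \near (0 : C), r ^+ 2 < cm (dotb (p + s *: (q - p)) w).
      apply: (@contK_gt K (fun s => cm (dotb (p + s *: (q - p)) w))).
        apply: contK_cm; apply: hol_cont; have := @hol_dotc_line K 2 p (q - p) (cjv w) 0.
        by rewrite /dotc cjvK.
      by rewrite scale0r addr0 pw cm_rc gtr0_norm.
    have g0 := seg q; have g1 := seg (q + s1 *: e); have g2 := seg (q + s2 *: e).
    apply: filterS (filterI far (filterI g0 (filterI g1 g2))) => t [f [n0 [n1 n2]]].
    apply: coll_minor.
    have E s : p + t *: (q + s *: e - p) = (p + t *: (q - p)) + (t * s) *: e.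
      by apply/matrixP => i l; rewrite !mxE; ring.
    have n1' : nrm (p + t *: (q - p) + (t * s1) *: e) < 1 by move: n1; rewrite E; exact.
    have n2' : nrm (p + t *: (q - p) + (t * s2) *: e) < 1 by move: n2; rewrite E; exact.
    have H := coll_far w1 ew f n0 n1' n2'.
    by move: H; rewrite -(E s1) -(E s2); exact.
have E z : p + 1 *: (z - p) = z by rewrite scale1r addrC subrK.
by rewrite /h !E.
Qed.

Let F4 z := with1 (F z).
Let F4h z : nrm z < 1 -> vhol F4 z.
Proof.
move=> z1 i v; rewrite /F4 /with1; case: (splitP i) => j ij.
  have -> : (fun t => col_mx (1 : 'cV[C]_1) (F (z + t *: v)) i 0) = fun=> 1.
    apply/funext => t; have -> : i = lshift 3 j by apply/val_inj.
    by rewrite col_mxEu mxE (ord1 j).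
  exact: hol_cst.
have -> : (fun t => col_mx (1 : 'cV[C]_1) (F (z + t *: v)) i 0) = fun t => F (z + t *: v) j 0.
  apply/funext => t; have -> : i = rshift 1 j by apply/val_inj.
  by rewrite col_mxEd.
exact: Fh.
Qed.

Let quad (x y z w : 'cV[C]_2) (i : 'I_4) := [:: x; y; z; w]`_i.

Let quad_in x y z w : nrm x < 1 -> nrm y < 1 -> nrm z < 1 -> nrm w < 1 ->
  forall i, nrm (quad x y z w i) < 1.
Proof. by move=> ? ? ? ? -[[|[|[|[|//]]]] hi]. Qed.

Let quad_crossing q e e' s1 s2 s3 s4 : nrm q < 1 -> nrm (q + s1 *: e) < 1 -> nrm (q + s2 *: e) < 1 ->
  nrm (q + s3 *: e') < 1 -> nrm (q + s4 *: e') < 1 ->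
  \det (tuple_mx F4 (quad (q + s1 *: e) (q + s2 *: e) (q + s3 *: e') (q + s4 *: e'))) = 0.
Proof.
move=> q1 h1 h2 h3 h4; have [a [b [c [d [abcd s0 R]]]]] := coll_cross (line_coll q1 h1 h2) (line_coll q1 h3 h4).
apply/eqP/det0P.
have [v v0 vA] := with1_relation (erefl (fun i : 'I_4 => [:: F (q + s1 *: e); F (q + s2 *: e);
  F (q + s3 *: e'); F (q + s4 *: e')]`_i)) abcd s0 R.
exists v => //; rewrite -[RHS]vA; congr (_ *m _); apply/matrixP => i k; rewrite !mxE /F4 /quad.
by case: i => [[|[|[|[|//]]]] hi].
Qed.

(** The two lines may meet outside the ball. A homothety towards the origin brings the crossing
    point inside, and the determinant continues back to ratio 1. *)
Let quad_transverse x y z w : nrm x < 1 -> nrm y < 1 -> nrm z < 1 -> nrm w < 1 ->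
  dotb (y - x) (perp2 (w - z)) != 0 -> \det (tuple_mx F4 (quad x y z w)) = 0.
Proof.
move=> x1 y1 z1 w1; set d := y - x; set d' := w - z => dd.
have [a [b cr]] := lines_meet x z dd.
set q := x + a *: d in cr.
have yd : x + d = y by rewrite /d addrC subrK.
have wd : z + d' = w by rewrite /d' addrC subrK.
pose D t := \det (tuple_mx F4 (fun i => 0 + t *: quad x y z w i)).
have : D 1 = 0.
  apply: unit_identity.
  - move=> t ht; apply: (near_hol_tuple F4h) => i.
    by apply: segment_ball; rewrite ?nrm0 ?add0r //; exact: quad_in.
  - have seg (v : 'cV[C]_2) : \forall s \near (0 : C), nrm (0 + s *: v) < 1.
      by apply: near_lt_nrm; rewrite scale0r addr0 nrm0.
    have gq := seg q; have gx := seg x; have gy := seg y; have gz := seg z; have gw := seg w.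
    apply: filterS (filterI gq (filterI (filterI gx gy) (filterI gz gw))) => t [tq [[tx ty] [tz tw]]].
    rewrite !add0r in tq tx ty tz tw.
    have xE : t *: x = t *: q + (- (t * a)) *: d.
      by rewrite /q scalerDr scalerA scaleNr addrK.
    have yE : t *: y = t *: q + (t * (1 - a)) *: d.
      by rewrite -[in LHS]yd; exact: along_line.
    have zE : t *: z = t *: q + (- (t * b)) *: d'.
      by rewrite cr scalerDr scalerA scaleNr addrK.
    have wE : t *: w = t *: q + (t * (1 - b)) *: d'.
      by rewrite cr -[in LHS]wd; exact: along_line.
    rewrite xE in tx; rewrite yE in ty; rewrite zE in tz; rewrite wE in tw.
    have := quad_crossing tq tx ty tz tw; rewrite -xE -yE -zE -wE => Q.
    rewrite /D -[RHS]Q; congr (\det (tuple_mx _ _)); apply/funext => i.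
    by rewrite add0r /quad; case: i => [[|[|[|[|//]]]] hi].
rewrite /D => h; rewrite -[RHS]h; congr (\det (tuple_mx _ _)); apply/funext => i.
by rewrite add0r scale1r.
Qed.

(** Parallel secants are a limit case: displacing [w] transversally makes them cross, so the
    determinant vanishes for small nonzero displacements and, by the identity theorem, at 0. *)
Let quad_det x y z w : nrm x < 1 -> nrm y < 1 -> nrm z < 1 -> nrm w < 1 ->
  \det (tuple_mx F4 (quad x y z w)) = 0.
Proof.
move=> x1 y1 z1 w1; case: (eqVneq (y - x) 0) => [yx|yx].
  apply/eqP/det0P; have yx' : y = x by apply/eqP; rewrite -subr_eq0 yx.
  have [|||v v0 vA] := @with1_relation K 3 (F x) (F y) (F z) (F w) _ 1 (-1) 0 0 erefl.
  - by rewrite oner_eq0.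
  - by rewrite !addr0 subrr.
  - by rewrite yx' !scale0r !addr0 scale1r scaleN1r subrr.
  exists v => //; rewrite -[RHS]vA; congr (_ *m _); apply/matrixP => i k; rewrite !mxE /F4 /quad.
  by case: i => [[|[|[|[|//]]]] hi].
(* Chosen so that [perp2 v] is [cjv (y - x)]; the pairing with [y - x] is then its squared norm. *)
pose v := - perp2 (cjv (y - x)).
have vE : dotb (y - x) (perp2 v) = rc (nrm2 (y - x)).
  have -> : perp2 v = cjv (y - x).
    by rewrite /perp2 /v ![(- mk2 _ _) _ _]mxE mk2_0 mk2_1 opprK opprK -mk2E.
  by rewrite -dotcc.
have vn : dotb (y - x) (perp2 v) != 0.
  by rewrite vE -cm_gt0 cm_rc normr_gt0 gt_eqF // nrm2_gt0.
pose D t := \det (tuple_mx F4 (fun i => quad x y z w i + t *: quad 0 0 0 v i)).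
pose c0 := dotb (y - x) (perp2 (w - z)) / dotb (y - x) (perp2 v).
have pE t : dotb (y - x) (perp2 (w + t *: v - z)) = (c0 + t) * dotb (y - x) (perp2 v).
  have -> : perp2 (w + t *: v - z) = perp2 (w - z) + t *: perp2 v.
    by rewrite /perp2 mk2Z mk2D; congr mk2; rewrite !mxE; ring.
  by rewrite dotbDr dotbZr mulrDl /c0 divfK.
case: (eqVneq c0 0) => [c00|cn]; last first.
  by apply: quad_transverse => //; have := pE 0; rewrite scale0r !addr0 => ->; rewrite mulf_neq0.
have : \forall t \near (0 : C), D t = 0.
  apply: identity_local.
  - apply: (near_hol_tuple F4h) => i; rewrite scale0r addr0; exact: quad_in.
  - have /cm_ballP [d d0 hd] : \forall t \near (0 : C), nrm (w + t *: v) < 1.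
      by apply: near_lt_nrm; rewrite scale0r addr0.
    move=> e e0; pose m := Num.min d e / 2; have m0 : 0 < m by rewrite divr_gt0 // lt_min d0.
    have md : m < d by have : Num.min d e <= d; [rewrite ge_min lexx|rewrite /m; lra].
    have me : m < e by have : Num.min d e <= e; [rewrite ge_min lexx orbT|rewrite /m; lra].
    have cmm : cm (rc m : C) = m by rewrite cm_rc gtr0_norm.
    have mn : rc m != 0 :> C by rewrite -cm_gt0 cmm.
    exists (rc m); rewrite subr0 cmm; split => //.
    have wm : nrm (w + rc m *: v) < 1 by apply: hd; rewrite subr0 cmm.
    have := @quad_transverse x y z (w + rc m *: v) x1 y1 z1 wm; rewrite pE c00 add0r.
    move=> /(_ (mulf_neq0 mn vn)) Q; rewrite /D -[RHS]Q; congr (\det (tuple_mx _ _)).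
    apply/funext => i; rewrite /quad; case: i => [[|[|[|[|//]]]] hi] /=; by rewrite ?scaler0 ?addr0.
move/nbhs_singleton; rewrite /D => h; rewrite -[RHS]h; congr (\det (tuple_mx _ _)).
by apply/funext => i; rewrite scale0r addr0.
Qed.

(** Any four values of [F4] are dependent, so one nonzero functional annihilates them all; read in
    [F] this is an affine equation. *)
Theorem planar_of_dependent : exists (n : 'cV[C]_3) (delta : C), nrm n = 1 /\ forall z, nrm z < 1 -> dotc (F z) n = delta.
Proof.
have [|x [x0 hx]] := @span_functional K 4 _ (fun z => nrm z < 1) F4.
  move=> t t1; have := quad_det (t1 (Ordinal (isT : 0 < 4)%N)) (t1 (Ordinal (isT : 1 < 4)%N))
    (t1 (Ordinal (isT : 2 < 4)%N)) (t1 (Ordinal (isT : 3 < 4)%N)).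
  move=> Q; rewrite -[RHS]Q; congr (\det (tuple_mx F4 _)); apply/funext => i; rewrite /quad.
  by case: i => [[|[|[|[|//]]]] hi] /=; congr t; apply/val_inj.
pose x1 : 'cV[C]_1 := usubmx (x : 'cV_(1 + 3)); pose x2 : 'cV[C]_3 := dsubmx (x : 'cV_(1 + 3)).
have E z : nrm z < 1 -> dotb (F z) x2 = - x1 0 0.
  move=> z1; have := hx _ z1; rewrite (dotb_with1 (F z) (x : 'cV_(1 + 3))) => /eqP.
  by rewrite addrC addr_eq0 => /eqP.
(* If the linear part vanished, the equation at 0 would make the constant part vanish as well. *)
have x20 : x2 != 0.
  apply: contra x0 => /eqP x20; have h0 : nrm (0 : 'cV[C]_2) < 1 by rewrite nrm0.
  have := E 0 h0; rewrite x20 dotb0r => /eqP; rewrite eq_sym oppr_eq0 => /eqP x10.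
  rewrite -[x](@vsubmxK _ 1 3) -/x1 -/x2 x20 [x1]mx11_scalar x10 raddf0.
  by apply/eqP; exact: (@col_mx0 C 1 3 1).
have nx : nrm x2 != 0 by rewrite nrm_eq0.
exists (rc (nrm x2)^-1 *: cjv x2), (rc (nrm x2)^-1 * - x1 0 0); split.
  by rewrite nrmZ nrm_cjv cm_rc ger0_norm ?invr_ge0 ?nrm_ge0 // mulVf.
by move=> z z1; rewrite dotcZr cj_rc /dotc cjvK E.
Qed.
End Degenerate.

(** * Classification of the kernels in target dimensions one, two and three *)

Section Classification.
Variable K : realType.
Local Notation C := (cplx K).
Variable r : K.
Hypothesis r0 : 0 < r.
Hypothesis r1 : r < 1.

Let dep_or N (F : 'cV[C]_2 -> 'cV[C]_N) :
  (exists p e (s : 'I_N -> C), [/\ nrm p < 1, forall i, nrm (p + s i *: e) < 1 &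
     \det (tuple_mx F (fun i => p + s i *: e)) != 0]) \/
  (forall p e (s : 'I_N -> C), nrm p < 1 -> (forall i, nrm (p + s i *: e) < 1) ->
     \det (tuple_mx F (fun i => p + s i *: e)) = 0).
Proof.
case: (pselect (exists p e (s : 'I_N -> C), [/\ nrm p < 1, forall i, nrm (p + s i *: e) < 1 &
  \det (tuple_mx F (fun i => p + s i *: e)) != 0])) => h; first by left.
right => p e s p1 s1; apply/eqP/negPn/negP => D; apply: h.
by exists p, e, s.
Qed.

(** An independent value would give degree 0 and hence [kappa = 1]; otherwise every value is 0. *)
Let line_map_absurd (F : 'cV[C]_2 -> 'cV[C]_1) kappa : sphere_map F r kappa -> kappa < 1 -> False.
Proof.
move=> FS k1; case: (dep_or F) => [[p [e [s [p1 s1 D]]]]|h].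
  have [d [d1 kd _]] := nondegenerate_kernel r0 r1 FS k1 p1 s1 D.
  by case: d1 kd => <- kd; move: k1; rewrite kd expr0 ltxx.
apply: (sphere_map_neq0 FS) => z z1; apply/matrixP => i j; rewrite !ord1 mxE.
have := h z 0 (fun=> 0) z1; rewrite scaler0 addr0 => /(_ (fun=> z1)).
by rewrite det_mx11 mxE.
Qed.

(** Any two points lie on a line, so dependence on lines is dependence of all values. The image is
    then orthogonal to a unit vector, and [F] reduces to the impossible case of dimension one. *)
Let plane_map (F : 'cV[C]_2 -> 'cV[C]_2) kappa : sphere_map F r kappa -> kappa < 1 ->
  kappa = r ^+ 2 /\ forall z u, nrm z < 1 -> nrm u < 1 -> dotc (F z) (F u) = dotc z u.
Proof.
move=> FS k1; case: (dep_or F) => [[p [e [s [p1 s1 D]]]]|h].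
  have [d [d1 kd Fd]] := nondegenerate_kernel r0 r1 FS k1 p1 s1 D.
  by case: d1 kd Fd => <- kd Fd; split => [|z u z1 u1]; rewrite ?kd ?Fd ?expr1.
exfalso; have [|x [x0 hx]] := @span_functional K 2 _ (fun z => nrm z < 1) F.
  move=> t t1; pose s (i : 'I_2) : C := i%:R.
  have E : t = fun i => t 0 + s i *: (t 1 - t 0).
    apply/funext => -[[|[|//]] hi]; rewrite /s /=.
      by rewrite scale0r addr0; congr t; apply/val_inj.
    by rewrite scale1r addrC subrK; congr t; apply/val_inj.
  have H := h (t 0) (t 1 - t 0) s (t1 0); rewrite [t in rows_mx F t]E; apply: H => i.
  by have := t1 i; rewrite [t i](congr1 (fun g => g i) E).
have nx : nrm x != 0 by rewrite nrm_eq0.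
pose n := rc (nrm x)^-1 *: cjv x.
have n1 : nrm n = 1.
  by rewrite nrmZ nrm_cjv cm_rc ger0_norm ?invr_ge0 ?nrm_ge0 // mulVf.
have Fn z : nrm z < 1 -> dotc (F z) n = 0.
  by move=> z1; rewrite dotcZr cj_rc /dotc cjvK hx // mulr0.
have [G [_ GS k1' _]] := sphere_map_reduce r0 r1 FS k1 n1 Fn.
exact: (line_map_absurd GS k1').
Qed.

Theorem sphere_map_gram (F : 'cV[C]_2 -> 'cV[C]_3) kappa : sphere_map F r kappa ->
  0 < kappa < 1 ->
  (kappa = r ^+ 4 /\ forall z u, nrm z < 1 -> nrm u < 1 -> dotc (F z) (F u) = dotc z u ^+ 2) \/
  (exists n (x : K), [/\ nrm n = 1, 0 <= x, kappa - x ^+ 2 = r ^+ 2 * (1 - x ^+ 2),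
     forall z, nrm z < 1 -> dotc (F z) n = rc x &
     forall z u, nrm z < 1 -> nrm u < 1 ->
       dotc (F z) (F u) = rc (x ^+ 2) + rc (1 - x ^+ 2) * dotc z u]).
Proof.
move=> FS /andP[k0 k1]; case: (dep_or F) => [[p [e [s [p1 s1 D]]]]|h].
  have [d [d1 kd Fd]] := nondegenerate_kernel r0 r1 FS k1 p1 s1 D.
  by left; case: d1 kd Fd => <- kd Fd; split => //; rewrite kd -exprM.
right; have [Fh Fr rad] := FS; have pol := sphere_map_pol r0 FS.
have [n [delta [n1 Fn]]] : exists (n : 'cV[C]_3) (delta : C), nrm n = 1 /\
    forall z, nrm z < 1 -> dotc (F z) n = delta.
  apply: (planar_of_dependent r0 r1 _ Fh pol); first by rewrite gt_eqF.
  move=> p e s s1; case: (ltP (nrm p) 1) => p1; first exact: h.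
  (* The base point [p] may lie outside the ball; the line is based at its first sample point
     instead. *)
  have E : (fun i => p + s i *: e) = (fun i => (p + s 0 *: e) + (s i - s 0) *: e).
    by apply/funext => i; rewrite -addrA -scalerDl addrC [s 0 + _]addrC subrK addrC.
  rewrite E; apply: h => //; move=> i; have := s1 i.
  by rewrite -(congr1 (fun g => nrm (g i)) E).
have [G [d1 GS k1' FG]] := sphere_map_reduce r0 r1 FS k1 n1 Fn.
have [kE Gg] := plane_map GS k1'.
(* Rotating the normal makes the constant coordinate real and non-negative, as in
   [affine_embedding]. *)
have [om [om1 omd]] : exists om : C, cm om = 1 /\ cj om * delta = rc (cm delta).
  case: (eqVneq delta 0) => [->|dn]; first by exists 1; rewrite cm1 mulr0 cm0 rc0.
  have cn : rc (cm delta) != 0 :> C by rewrite -cm_gt0 cm_rc normr_gt0 cm_eq0.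
  exists (delta / rc (cm delta)); split.
    by rewrite cmM cmV cm_rc ger0_norm ?cm_ge0 // divff // cm_eq0.
  rewrite cjM cjV cj_rc mulrAC -[cj delta * _]mulrC mul_cj rcX expr2 mulfK //.
exists (om *: n), (cm delta); split.
- by rewrite nrmZ om1 n1 mulr1.
- exact: cm_ge0.
- by rewrite -kE divfK // gt_eqF // subr_gt0.
- by move=> z z1; rewrite dotcZr Fn.
- by move=> z u z1 u1; rewrite FG // Gg.
Qed.

Lemma H2_gram (z u : 'cV[C]_2) : dotc (H2 z) (H2 u) = dotc z u ^+ 2.
Proof.
have s2 : sqrtC 2 * cj (sqrtC 2) = 2 :> C.
  rewrite mul_cj -cmX sqrtCK -(rcn K 2) cm_rc ger0_norm ?ler0n //.
rewrite /dotc !dotb2 dotb.unlock 3!big_ord_recl big_ord0 !mxE /= addr0.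
rewrite !cjX !cjM; move: s2; move: (sqrtC 2) => s s2.
move: (z 0 0) (z 1 0) (cj (u 0 0)) (cj (u 1 0)) => a b c d.
have -> : s * a * b * (cj s * c * d) = (s * cj s) * (a * b * c * d) by ring.
by rewrite s2; ring.
Qed.

Lemma affine_gram (c d : C) (z u : 'cV[C]_2) (X := fun z : 'cV[C]_2 => \col_(i < 3) [:: c * z 0 0; c * z 1 0; d]`_i) :
  dotc (X z) (X u) = c * cj c * dotc z u + d * cj d.
Proof.
rewrite /dotc !dotb2 dotb.unlock 3!big_ord_recl big_ord0 !mxE /= addr0 !cjM.
by move: (z 0 0) (z 1 0) (cj (u 0 0)) (cj (u 1 0)) => A B A' B'; ring.
Qed.

Lemma det3_neq0 (A : 'M[C]_3) : (forall v : 'rV[C]_3, v *m A = 0 -> v = 0) -> \det A != 0.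
Proof. by move=> h; apply/negP => /det0P [v v0 /h v1]; rewrite v1 eqxx in v0. Qed.

Lemma row3_eq0 (v : 'rV[C]_3) : v 0 ord0 = 0 -> v 0 (lift ord0 ord0) = 0 ->
  v 0 (lift ord0 (lift ord0 ord0)) = 0 -> v = 0.
Proof.
move=> h0 h1 h2; apply/rowP => i; rewrite mxE; case: i => [[|[|[|//]]] hi].
- by rewrite -[RHS]h0; congr (v 0 _); apply/val_inj.
- by rewrite -[RHS]h1; congr (v 0 _); apply/val_inj.
- by rewrite -[RHS]h2; congr (v 0 _); apply/val_inj.
Qed.

Lemma half_in_ball (a b : K) : `|a| <= 1 / 2 -> `|b| <= 1 / 2 -> nrm (mk2 (rc a) (rc b) : 'cV[C]_2) < 1.
Proof.
move=> ha hb; rewrite -nrm2_lt1 nrm2_mk2 !cm_rc.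
have := normr_ge0 a; have := normr_ge0 b; nra.
Qed.

Lemma gram_H2 (F : 'cV[C]_2 -> 'cV[C]_3) :
  (forall z u, nrm z < 1 -> nrm u < 1 -> dotc (F z) (F u) = dotc z u ^+ 2) ->
  exists W : 'M[C]_3, W \is unitarymx /\ forall z, nrm z < 1 -> F z = W *m H2 z.
Proof.
move=> Fg; pose h : K := 1 / 2.
have hp : 0 < h by rewrite /h; lra.
have hh : `|h| <= 1 / 2 by rewrite gtr0_norm.
have h0 : `|0 : K| <= 1 / 2 by rewrite normr0; lra.
have hn : rc h != 0 :> C by rewrite -cm_gt0 cm_rc gtr0_norm.
pose t (i : 'I_3) : 'cV[C]_2 := [:: mk2 (rc h) (rc 0); mk2 (rc 0) (rc h); mk2 (rc h) (rc h)]`_i.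
have s2 : sqrtC 2 != 0 :> C by rewrite sqrtC_eq0 pnatr_eq0.
apply: (@gram_unitary K _ (fun z => nrm z < 1) 3 F (@H2 K) t).
- by move=> z u z1 u1; rewrite Fg // H2_gram.
- by case=> [[|[|[|//]]] hi]; apply: half_in_ball.
apply: det3_neq0 => v /(congr1 trmx); rewrite mul_rows_mx trmx0 3!big_ord_recl big_ord0 /t /= => E.
have e0 := congr1 (fun x : 'cV[C]_3 => x ord0 0) E.
have e1 := congr1 (fun x : 'cV[C]_3 => x (lift ord0 ord0) 0) E.
have e2 := congr1 (fun x : 'cV[C]_3 => x (lift ord0 (lift ord0 ord0)) 0) E.
move: e0 e1 e2; rewrite !mxE /= rc0; clear E.
move: hn s2; move: (rc h) (sqrtC 2) => y s yn sn.
rewrite !(expr0n, mulr0, mul0r, addr0, add0r) /= => e0 e1 e2.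
have v2 : v 0 (lift ord0 (lift ord0 ord0)) = 0.
  by move/eqP: e1; rewrite !mulf_eq0 (negPf yn) (negPf sn) !orbF => /eqP.
rewrite v2 mul0r ?addr0 ?add0r in e0 e2.
apply: row3_eq0 => //.
  by move/eqP: e0; rewrite mulf_eq0 expf_eq0 (negPf yn) /= orbF => /eqP.
by move/eqP: e2; rewrite mulf_eq0 expf_eq0 (negPf yn) /= orbF => /eqP.
Qed.

(** For [x = 0] the values of the affine map do not span the space, so [gram_unitary] is applied
    with one more point, [None], which stands for the normal [n] on one side and [e3] on the
    other. *)
Lemma gram_affine (F : 'cV[C]_2 -> 'cV[C]_3) n (x y : K) : nrm n = 1 -> 0 < y -> 
  (forall z, nrm z < 1 -> dotc (F z) n = rc x) ->
  (forall z u, nrm z < 1 -> nrm u < 1 -> dotc (F z) (F u) = rc (x ^+ 2) + rc (y ^+ 2) * dotc z u) ->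
  exists W : 'M[C]_3, W \is unitarymx /\ forall z, nrm z < 1 ->
    F z = W *m \col_(i < 3) [:: rc y * z 0 0; rc y * z 1 0; rc x]`_i.
Proof.
move=> n1 y0 Fn Fg; pose h : K := 1 / 2.
have hp : 0 < h by rewrite /h; lra.
have hh : `|h| <= 1 / 2 by rewrite gtr0_norm.
have h0 : `|0 : K| <= 1 / 2 by rewrite normr0; lra.
have hn : rc y * rc h != 0 :> C by rewrite -rcM -cm_gt0 cm_rc gtr0_norm // mulr_gt0.
pose e3 : 'cV[C]_3 := \col_(i < 3) [:: 0; 0; 1]`_i.
pose A (z : 'cV[C]_2) : 'cV[C]_3 := \col_(i < 3) [:: rc y * z 0 0; rc y * z 1 0; rc x]`_i.
pose X o := if o is Some z then F z else n.
pose Y o := if o is Some z then A z else e3.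
pose P o : Prop := if o is Some z then nrm (z : 'cV[C]_2) < 1 else true.
(* The list has two entries; index 2 falls on the default [None]. *)
pose t (i : 'I_3) : option ('cV[C]_2) := nth None [:: Some (mk2 (rc h) (rc 0)); Some (mk2 (rc 0) (rc h))] i.
have Ae z : dotc (A z) e3 = rc x.
  rewrite /dotc dotb.unlock 3!big_ord_recl big_ord0 !mxE /= cj0 cj1; ring.
have [|||W [Wu hW]] := @gram_unitary K _ P 3 X Y t.
- move=> [z|] [u|] /= z1 u1.
  + by rewrite Fg // affine_gram !cj_rc -!rcM -!expr2 addrC.
  + by rewrite Fn // Ae.
  + by rewrite -[LHS]cj_dotc Fn // -[RHS]cj_dotc Ae.
  + rewrite dotcc -nrm_sqr n1 expr1n /dotc dotb.unlock 3!big_ord_recl big_ord0 !mxE /= cj0 cj1 rc1; ring.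
- by case=> [[|[|[|//]]] hi] //=; apply: half_in_ball.
- apply: det3_neq0 => v /(congr1 trmx); rewrite mul_rows_mx trmx0 3!big_ord_recl big_ord0 /t /= => E.
  have e0 := congr1 (fun x : 'cV[C]_3 => x ord0 0) E.
  have e1 := congr1 (fun x : 'cV[C]_3 => x (lift ord0 ord0) 0) E.
  have e2 := congr1 (fun x : 'cV[C]_3 => x (lift ord0 (lift ord0 ord0)) 0) E.
  move: e0 e1 e2; rewrite !mxE /= rc0; clear E.
  rewrite !(mulr0, addr0, add0r) => e0 e1 e2.
  have v0 : v 0 ord0 = 0 by move/eqP: e0; rewrite mulf_eq0 (negPf hn) orbF => /eqP.
  have v1 : v 0 (lift ord0 ord0) = 0 by move/eqP: e1; rewrite mulf_eq0 (negPf hn) orbF => /eqP.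
  apply: row3_eq0 => //.
  by move: e2; rewrite v0 v1 !mul0r !add0r mulr1.
exists W; split => // z z1; exact: (hW (Some z) z1).
Qed.
End Classification.

(** * From the topology and differentiability of column vectors to Euclidean estimates *)

Section Bridge.
Variable K : realType.
Local Notation C := (cplx K).

Lemma cV_nbhsP n (z : 'cV[C]_n) (P : set 'cV[C]_n) :
  nbhs z P <-> exists2 d : K, 0 < d & forall w, nrm (w - z) < d -> P w.
Proof.
split.
  move=> /nbhs_ballP [e /= e0 h].
  have ee : e = rc (re e).
    apply: re_eq; first by [].
    by move: (e0); rewrite ltcE => /andP[/eqP h' _].
  have x0 : 0 < re e by move: e0; rewrite ee -(rmorph0 (@rc K)) rc_lt.
  exists (re e) => // w hw; apply: h; split => // i j; rewrite ord1 /ball /= ee cmE cmBC rc_lt.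
  apply: le_lt_trans hw; have := cm_le_nrm (w - z) i; by rewrite mxE [(- z) _ _]mxE.
(* A ball of the max norm of radius [d / n.+1] fits in the Euclidean one; [n.+1] instead of [n]
   covers dimension 0. *)
case=> d d0 h; pose y := d / n.+1%:R; have n0 : 0 < n.+1%:R :> K by rewrite ltr0n.
have y0 : 0 < y by rewrite divr_gt0.
apply/nbhs_ballP; exists (rc y); first by rewrite /= -(rmorph0 (@rc K)) rc_lt.
move=> w [_ hw]; apply: h; rewrite nrm_lt //.
have : nrm2 (w - z) <= \sum_(i < n) y ^+ 2.
  rewrite nrm2.unlock; apply: ler_sum => i _; rewrite ler_pXn2r ?nnegrE ?cm_ge0 ?(ltW y0) //.
  have := hw i 0; rewrite /ball /= cmE cmBC rc_lt => /ltW.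
  by rewrite mxE [(- z) _ _]mxE.
move/le_lt_trans; apply; rewrite sumr_const card_ord -mulr_natl.
have dE : d = n.+1%:R * y by rewrite mulrC divfK // gt_eqF.
have nE : n.+1%:R = 1 + n%:R :> K by rewrite -natr1 addrC.
have nn : 0 <= n%:R :> K by rewrite ler0n.
have -> : d ^+ 2 = (1 + n%:R) ^+ 2 * y ^+ 2 by rewrite dE nE; move: (y) => t; ring.
by rewrite ltr_pM2r ?exprn_gt0 //; nra.
Qed.

Lemma enormE n (z : 'cV[C]_n) : enorm z = rc (nrm z).
Proof.
rewrite /enorm -[RHS]sqrCK; last by rewrite -rc0 rc_le nrm_ge0.
congr sqrtC; rewrite -rcX nrm_sqr nrm2.unlock rc_sum; apply: eq_bigr => i _.
by rewrite cmE rcX.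
Qed.

Lemma annulusE n (r : K) (z : 'cV[C]_n) : annulus n r z <-> r < nrm z < 1.
Proof.
rewrite /annulus /= enormE; have -> : (r%:C)%C = rc r by [].
by rewrite rc_lt -rc1 rc_lt.
Qed.

Lemma nrm_continuous n (z : 'cV[C]_n) (e : K) : 0 < e -> \forall w \near z, `|nrm w - nrm z| < e.
Proof.
move=> e0; apply/cV_nbhsP; exists e => // w hw.
have h1 := nrmD (w - z) z; rewrite subrK in h1.
have h2 := nrmD (z - w) w; rewrite subrK nrmBC in h2.
by rewrite ltr_norml; apply/andP; split; lra.
Qed.

Lemma shell_compact n (a b : K) : compact [set w : 'cV[C]_n | a <= nrm w <= b].
Proof.
have tc : continuous (fun v : 'rV[C]_n => v^T).
  move=> M s /nbhs_ballP [e e0 es]; apply/nbhs_ballP; exists e => // N [_ hN].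
  by apply: es; split => // i j; rewrite !mxE.
have cI : compact ((fun v : 'rV[C]_n => v^T) @` [set v : 'rV[C]_n | forall i, cm (v 0 i - 0) <= b]).
  apply: continuous_compact; first by apply: continuous_subspaceT.
  apply: (rV_compact (A := fun=> [set x | cm (x - 0) <= b])) => i; exact: disc_compact.
apply: (subclosed_compact _ cI).
  move=> z cz /=; rewrite !leNgt; apply/andP; split; apply/negP => hz.
  - have [|w [/= /andP[h1 _]]] := cz [set w | `|nrm w - nrm z| < a - nrm z].
      by apply: nrm_continuous; rewrite subr_gt0.
    by rewrite ltr_norml => /andP[]; lra.
  - have [|w [/= /andP[_ h1]]] := cz [set w | `|nrm w - nrm z| < nrm z - b].
      by apply: nrm_continuous; rewrite subr_gt0.
    by rewrite ltr_norml => /andP[]; lra.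
move=> z /= /andP[_ hz]; exists z^T; last exact: trmxK.
by move=> i /=; rewrite mxE subr0; apply: le_trans hz; exact: cm_le_nrm.
Qed.

Variables (m n : nat) (f : 'cV[C]_m -> 'cV[C]_n) (z : 'cV[C]_m).
Hypothesis fz : differentiable f z.

Lemma differentiable_vcont i : vcont (fun z => f z i 0) z.
Proof.
move=> e e0; have : nbhs (f z) [set w : 'cV[C]_n | cm (w i 0 - f z i 0) < e].
  apply/cV_nbhsP; exists e => // w; apply: le_lt_trans.
  by have := cm_le_nrm (w - f z) i; rewrite mxE [(- f z) _ _]mxE.
move=> /(differentiable_continuous fz) /cV_nbhsP [d d0 hd]; exists d => // w; exact: hd.
Qed.

Lemma differentiable_lhol i : lhol (fun z => f z i 0) z.
Proof.
move=> v; have /cvg_ex [l hl] := @diff_derivable _ _ _ f z v fz.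
set g := fun t => f (z + t *: v) i 0.
have g0 : g 0 = f z i 0 by rewrite /g scale0r addr0.
exists (slope g 0 (l i 0)); last first.
  move=> t; rewrite /slope; case: eqVneq => [->|t0]; first by rewrite subrr mulr0 addr0.
  by rewrite divfK ?subr_eq0 // addrC subrK.
apply/contP => e e0; have : nbhs l [set w : 'cV[C]_n | cm (w i 0 - l i 0) < e].
  apply/cV_nbhsP; exists e => // w; apply: le_lt_trans.
  by have := cm_le_nrm (w - l) i; rewrite mxE [(- l) _ _]mxE.
move=> /hl /cm_ballP [d d0 hd]; exists d => // t ht; rewrite /slope eqxx.
case: eqVneq => [_|t0]; first by rewrite subrr cm0.
have := hd t ht t0; rewrite /= subr0 g0 /g [_ / t]mulrC.
by rewrite !mxE [_ *: v + z]addrC.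
Qed.
End Bridge.

Section CircleContinuity.
Variable K : realType.
Local Notation C := (cplx K).

Lemma contK_nrm2 n (X : C -> 'cV[C]_n) t : (forall i, hol (fun s => X s i 0) t) ->
  contK (fun s => nrm2 (X s)) t.
Proof.
move=> h; have -> : (fun s => nrm2 (X s)) = (fun s => \sum_i cm (X s i 0) ^+ 2).
  by apply/funext => s; rewrite nrm2.unlock.
by apply: contK_sum => i _; apply: sq_cont.
Qed.

Lemma cis_surj (w : C) : cm w = 1 -> exists s : K, 0 <= s <= 1 /\ w = cis s.
Proof.
move=> w1; have sq : re w ^+ 2 + im w ^+ 2 = 1 by rewrite -cm2 w1 expr1n.
have rw : -1 <= re w <= 1 by rewrite -ler_norml -w1 re_le.
have p0 := pi_gt0 K; pose th := acos (re w).
have th0 : 0 <= th := acos_ge0 rw.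
have th1 : th <= pi := acos_lepi rw.
have cth : cos th = re w by rewrite acosK.
have sth : sin th = `|im w| by rewrite sin_acos // -sqrtr_sqr; congr Num.sqrt; lra.
pose s := th / (2 * pi).
have sE : 2 * pi * s = th by rewrite /s mulrC divfK // gt_eqF //; lra.
have s0 : 0 <= s by rewrite divr_ge0 //; lra.
have s1 : s <= 1 by rewrite ler_pdivrMr; lra.
have cs : cis s = rc (re w) + ci * rc `|im w| by rewrite cisE sE cth sth.
case: (leP 0 (im w)) => iw.
  by exists s; rewrite s0 s1 cs ger0_norm // -cplxE.
exists (1 - s); split; first by apply/andP; split; lra.
have -> : cis (1 - s) = cj (cis s).
  by apply: (mulIf (cexp_neq0 (ci * rc (2 * pi * s)))); rewrite -/(cis s) -cisD subrK cis1 cj_cis mulVf // cexp_neq0.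
by rewrite cs ltr0_norm // cjD cjM cj_ci !cj_rc rcN mulrNN -cplxE.
Qed.

Lemma circ_surj (rho : K) (t : C) : 0 < rho -> cm t = rho -> exists s : K, 0 <= s <= 1 /\ t = circ 0 rho s.
Proof.
move=> r0 tr; have rn : rc rho != 0 :> C by rewrite -cm_gt0 cm_rc gtr0_norm.
have [|s [hs sE]] := @cis_surj (t / rc rho).
  by rewrite cmM cmV tr cm_rc gtr0_norm // divff // gt_eqF.
by exists s; rewrite circ0 -sE mulrC divfK.
Qed.

Lemma circ_contK (phi : C -> K) (rho s e : K) : 0 <= rho ->
  (forall t, cm t = rho -> contK phi t) -> 0 < e ->
  exists2 d, 0 < d & forall s', `|s' - s| < d -> `|phi (circ 0 rho s') - phi (circ 0 rho s)| < e.
Proof.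
move=> r0 hp e0; have cs : cm (circ 0 rho s) = rho by rewrite -[X in cm X]subr0 cm_circ.
have /contKP /(_ _ e0) [d d0 hd] := hp _ cs.
have [d' d'0 hd'] := circ_cont 0 rho s d0; exists d' => // s' hs'.
by apply: hd; apply: hd' => //; rewrite subrr normr0.
Qed.

End CircleContinuity.

(** * Norms of the extended map at the two boundary spheres *)

Section Boundary.
Variable K : realType.
Local Notation C := (cplx K).
Variables (n : nat) (F : 'cV[C]_2 -> 'cV[C]_n) (r R : K).
Hypothesis r0 : 0 < r.
Hypothesis r1 : r < 1.
Hypothesis Fh : forall z, nrm z < 1 -> vhol F z.
Hypothesis Fvals : forall z, r < nrm z < 1 -> R ^+ 2 < nrm2 (F z) < 1.
Hypothesis preimage_limit : forall a b z, R ^+ 2 < a -> b < 1 ->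
  (forall e : K, 0 < e -> exists w, [/\ r < nrm w < 1, nrm (w - z) < e & a <= nrm2 (F w) <= b]) ->
  r < nrm z < 1.
Hypothesis preimage_outer : forall a b, R ^+ 2 < a -> b < 1 ->
  exists2 rho, rho < 1 & forall z, r < nrm z < 1 -> rho < nrm z -> ~~ (a <= nrm2 (F z) <= b).

Let shellE (z : 'cV[C]_2) : r ^+ 2 < nrm2 z < 1 -> r < nrm z < 1.
Proof.
move=> /andP[z1 z2]; rewrite -nrm2_lt1 z2 andbT -(@ltr_pXn2r _ 2) ?nnegrE ?nrm_ge0 ?(ltW r0) //.
by rewrite nrm_sqr.
Qed.

Let Fline_hol p v t i : nrm (p + t *: v) < 1 -> hol (fun t => F (p + t *: v) i 0) t.
Proof. by move=> h; apply: vhol_line; exact: Fh. Qed.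

Let Fline_max p v (rho M : K) : 0 < rho -> (forall t, cm t <= rho -> nrm (p + t *: v) < 1) ->
  (forall t, cm t = rho -> nrm2 (F (p + t *: v)) <= M) ->
  forall t, cm t <= rho -> nrm2 (F (p + t *: v)) <= M.
Proof.
move=> h0 h1 h2 t ht; rewrite nrm2.unlock.
apply: (@max_principle K 'I_n (fun i t => F (p + t *: v) i 0) 0 rho M) => //; last by rewrite subr0.
- move=> s; rewrite subr0 => hs i; apply: hol_qhol.
  by apply: filterS (near_lt_nrm (h1 s hs)) => s' hs'; exact: Fline_hol.
- by move=> s; rewrite subr0 => /h2; rewrite nrm2.unlock.
Qed.

(** Near the unit sphere properness keeps [nrm2 F] out of the interval from [a] to [b], so on each
    circle about 0 it is below [a] throughout or above [b] throughout. The maximum principle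
    excludes the first, since a point inside has a value above [a]. *)
Lemma boundary_radial u : nrm u = 1 -> forall eps : K, 0 < eps -> exists2 del, 0 < del &
  forall t : K, 1 - del < t < 1 -> `|nrm2 (F (rc t *: u)) - 1| < eps.
Proof.
have [r0' r1'] := (r0, r1); move=> u1 eps e0; pose t0 : K := (1 + r) / 2.
have t01 : r < t0 < 1 by rewrite /t0; apply/andP; split; lra.
have nt t : 0 <= t -> nrm (rc t *: u) = t by move=> h; rewrite nrmZ u1 mulr1 cm_rc ger0_norm.
have n0 : nrm (rc t0 *: u) = t0 by apply: nt; lra.
have /andP[v0 v1] : R ^+ 2 < nrm2 (F (rc t0 *: u)) < 1 by apply: Fvals; rewrite n0.
(* Between [R ^+ 2], as properness requires, and the value [v] at an inner point, for the
   contradiction with the maximum principle. *)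
set v := nrm2 _ in v0 v1; pose a := (R ^+ 2 + v) / 2.
have a1 : R ^+ 2 < a by rewrite /a; lra.
have a2 : a < v by rewrite /a; lra.
pose b := Num.max a (1 - eps / 2).
have b1 : b < 1 by rewrite gt_max (lt_trans a2 v1) gtrBl divr_gt0.
have ab : a <= b by rewrite le_max lexx.
have eb : 1 - eps / 2 <= b by rewrite le_max lexx orbT.
have [rho rho1 hrho] := preimage_outer a1 b1.
pose m := Num.max rho t0.
have m1 : rho <= m by rewrite le_max lexx.
have m2 : t0 <= m by rewrite le_max lexx orbT.
have m3 : m < 1 by rewrite gt_max rho1; case/andP: t01.
exists (1 - m); first by rewrite subr_gt0.
move=> t /andP[tm t1]; rewrite opprB addrC subrK in tm.
have [t02 t03] : r < t /\ rho < t.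
  by case/andP: t01 => h _; split; [exact: lt_trans h (le_lt_trans m2 tm)|exact: le_lt_trans m1 tm].
have tp : 0 < t := lt_trans r0' t02.
have circ_in s : cm s = t -> r < nrm (0 + s *: u) < 1 /\ rho < nrm (0 + s *: u).
  by move=> st; rewrite add0r nrmZ u1 mulr1 st t02 t1.
have nab s : cm s = t -> ~~ (a <= nrm2 (F (0 + s *: u)) <= b).
  by move=> /circ_in [h1 h2]; exact: hrho.
have ctt : cm (rc t : C) = t by rewrite cm_rc gtr0_norm.
have /andP[_ w1] : R ^+ 2 < nrm2 (F (rc t *: u)) < 1.
  by have [h _] := circ_in _ ctt; rewrite add0r in h; exact: Fvals.
suff : b < nrm2 (F (rc t *: u)).
  by move=> w2; exact: dist1_lt e0 w1 (le_lt_trans eb w2).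
rewrite ltNge; apply/negP => wb.
have [phi phiE] : exists phi : C -> K, forall s, phi s = nrm2 (F (0 + s *: u)) by eexists.
have wa : phi (circ 0 t 0) < a.
  rewrite phiE circ0 cis0 mulr1 ltNge; apply/negP => h.
  by have := nab _ ctt; rewrite h /= add0r wb.
have cc s : cm (circ 0 t s) = t by rewrite -[X in cm X]subr0 cm_circ // ltW.
have phic s : cm s = t -> contK phi s.
  move=> st; rewrite (_ : phi = fun s => nrm2 (F (0 + s *: u))); last by apply/funext.
  apply: contK_nrm2 => i; apply: Fline_hol.
  by have [/andP[_ h] _] := circ_in _ st.
have circle_lt : forall s : K, 0 <= s <= 1 -> phi (circ 0 t s) < a.
  apply: (itv_induction (P := fun s => phi (circ 0 t s) < a)); first exact: wa.
  - move=> s' _ h; have q0 : 0 < a - phi (circ 0 t s') by rewrite subr_gt0.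
    have [d d0 hd] := circ_contK s' (ltW tp) phic q0; exists d => // s2 _ /hd.
    exact: ltr_of_dist.
  - move=> s' _ h; rewrite ltNge; apply/negP => ge.
    have gb : b < phi (circ 0 t s').
      by rewrite ltNge; apply/negP => le; have := nab _ (cc s'); rewrite -phiE ge le.
    have q0 : 0 < phi (circ 0 t s') - a by rewrite subr_gt0 (le_lt_trans ab).
    have [d d0 hd] := circ_contK s' (ltW tp) phic q0.
    have [s2 [_ /hd /gtr_of_dist s2a]] := h _ d0.
    by rewrite ltNge ltW.
have : nrm2 (F (0 + rc t0 *: u)) <= a.
  apply: (@Fline_max 0 u t a tp).
  - by move=> s st; rewrite add0r nrmZ u1 mulr1 (le_lt_trans st).
  - move=> s st; have [x [hx xE]] := circ_surj tp st.
    by rewrite xE -phiE ltW //; exact: circle_lt.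
  - have /andP[rt0 _] := t01; rewrite cm_rc ger0_norm; first by rewrite (le_trans m2) ?ltW.
    exact/ltW/(lt_trans r0').
by rewrite add0r -/v leNgt a2.
Qed.

(** By continuity the value lies between [R ^+ 2] and 1, and properness excludes the interior of
    this interval. The value 1 is excluded by the maximum principle on the complex tangent line at
    [z], which contains a circle in the shell. *)
Lemma boundary_inner z : nrm z = r -> nrm2 (F z) = R ^+ 2.
Proof.
have [r0' r1'] := (r0, r1); move=> zr; set v := nrm2 (F z).
have [phi phiE] : exists phi : C -> K, forall t, phi t = nrm2 (F (z + t *: z)) by eexists.
have phi0 : phi 0 = v by rewrite phiE scale0r addr0.
have phic : contK phi 0.
  rewrite (_ : phi = fun t => nrm2 (F (z + t *: z))); last by apply/funext.
  by apply: contK_nrm2 => i; apply: Fline_hol; rewrite scale0r addr0 zr.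
have ray (e d : K) : 0 < e -> 0 < d -> exists w, [/\ r < nrm w < 1, nrm (w - z) < d & `|nrm2 (F w) - v| < e].
  move=> e0 d0; have /contKP /(_ _ e0) [d' d'0 hd'] := phic.
  pose t := Num.min d' (Num.min d (1 - r)) / 2.
  have t0 : 0 < t by rewrite divr_gt0 // !lt_min d'0 d0 subr_gt0.
  have t1 : 2 * t <= d' by rewrite /t mulrC divfK // ge_min lexx.
  have t2 : 2 * t <= d by rewrite /t mulrC divfK // !ge_min lexx orbT.
  have t3 : 2 * t <= 1 - r by rewrite /t mulrC divfK // !ge_min lexx !orbT.
  exists (z + rc t *: z); split.
  - have -> : z + rc t *: z = rc (1 + t) *: z by rewrite rcD rc1 scalerDl scale1r.
    by rewrite nrmZ cm_rc ger0_norm ?zr; [apply/andP; split|]; nra.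
  - rewrite addrC addKr nrmZ cm_rc gtr0_norm // zr; nra.
  - by rewrite -phi0 -phiE; apply: hd'; rewrite subr0 cm_rc gtr0_norm //; lra.
have v_lo : R ^+ 2 <= v.
  rewrite leNgt; apply/negP => h; have e0 : 0 < R ^+ 2 - v by lra.
  have [w [/Fvals w1 _]] := ray _ _ e0 ltr01; rewrite ltr_norml => /andP[]; lra.
have v_hi : v <= 1.
  rewrite leNgt; apply/negP => h; have e0 : 0 < v - 1 by lra.
  have [w [/Fvals w1 _]] := ray _ _ e0 ltr01; rewrite ltr_norml => /andP[]; lra.
apply/eqP; rewrite eq_le v_lo andbT leNgt; apply/negP => vR.
case: (ltP v 1) => v1.
  pose e := Num.min (v - R ^+ 2) (1 - v) / 2.
  have e0 : 0 < e by rewrite divr_gt0 // lt_min !subr_gt0 vR.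
  have e1 : 2 * e <= v - R ^+ 2 by rewrite /e mulrC divfK // ge_min lexx.
  have e2 : 2 * e <= 1 - v by rewrite /e mulrC divfK // ge_min lexx orbT.
  have : r < nrm z < 1.
    apply: (@preimage_limit (v - e) (v + e)); [lra|lra|].
    move=> d d0; have [w [w1 w2 w3]] := ray _ _ e0 d0; exists w; split => //.
    by move: w3; rewrite ltr_norml => /andP[? ?]; apply/andP; split; lra.
  by rewrite zr ltxx.
have {}v1 : v = 1 by lra.
pose w := perp2 (cjv z).
have wz : dotc w z = 0 by rewrite /dotc dotbC dotb_perp2.
have zw : dotc z w = 0 by rewrite -cj_dotc wz cj0.
have nw : nrm2 w = r ^+ 2 by rewrite /w nrm2_perp2 nrm2_cjv -nrm_sqr zr.
have nzw t : nrm2 (z + t *: w) = r ^+ 2 * (1 + cm t ^+ 2).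
  rewrite nrm2D nrm2Z dotcZr zw mulr0 nw -nrm_sqr zr.
  by rewrite (_ : re 0 = 0) //; ring.
have r20 : 0 < r ^+ 2 by rewrite exprn_gt0.
have r21 : r ^+ 2 < 1 by rewrite expr_lt1 // ltW.
(* On the circle of this squared radius [nrm2 (z + t *: w)] is [(1 + r ^+ 2) / 2], midway between
   the two spheres. *)
pose rho2 := ((r ^+ 2)^-1 - 1) / 2; pose rho := Num.sqrt rho2.
have rr : r ^+ 2 * (r ^+ 2)^-1 = 1 by rewrite divff // gt_eqF.
have q0 : 0 < rho2 by rewrite divr_gt0 // subr_gt0 invf_gt1.
have rho0 : 0 < rho by rewrite sqrtr_gt0.
have rho_sq : rho ^+ 2 = rho2 by rewrite sqr_sqrtr // ltW.
have rE : r ^+ 2 * rho2 = (1 - r ^+ 2) / 2 by rewrite /rho2 mulrA mulrBr rr mulr1.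
have disc_in t : cm t <= rho -> nrm (z + t *: w) < 1.
  move=> ht; rewrite -nrm2_lt1 nzw; have : cm t ^+ 2 <= rho2.
    by rewrite -rho_sq ler_pXn2r // nnegrE ?cm_ge0 // ltW.
  nra.
have circ_in t : cm t = rho -> r < nrm (z + t *: w) < 1.
  move=> ht; apply: shellE; rewrite nrm2_lt1 disc_in ?ht // andbT nzw ht rho_sq; nra.
have [psi psiE] : exists psi : C -> K, forall t, psi t = nrm2 (F (z + t *: w)) by eexists.
have cc s : cm (circ 0 rho s) = rho by rewrite -[X in cm X]subr0 cm_circ // ltW.
have psic t : cm t = rho -> contK psi t.
  move=> ht; rewrite (_ : psi = fun t => nrm2 (F (z + t *: w))); last by apply/funext.
  by apply: contK_nrm2 => i; apply: Fline_hol; apply: disc_in; rewrite ht.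
(* Compactness of the circle turns values below 1 into a uniform margin [d], which the centre
   inherits. *)
have [|s _|d d0 hd] := @itv_uniform K (fun d s => psi (circ 0 rho s) <= 1 - d).
- by move=> d d' t dd h; lra.
- have /andP[_ ps] := Fvals (circ_in _ (cc s)); rewrite -psiE in ps.
  have e0 : 0 < (1 - psi (circ 0 rho s)) / 2 by lra.
  have [d d0 hd] := circ_contK s (ltW rho0) psic e0.
  exists (Num.min d ((1 - psi (circ 0 rho s)) / 2)); first by rewrite lt_min d0.
  move=> t ht; have m1 : Num.min d ((1 - psi (circ 0 rho s)) / 2) <= d by rewrite ge_min lexx.
  have m2 : Num.min d ((1 - psi (circ 0 rho s)) / 2) <= (1 - psi (circ 0 rho s)) / 2 by rewrite ge_min lexx orbT.
  exact: le_sub1_of_dist (hd t (lt_le_trans ht m1)) m2.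
have : nrm2 (F (z + 0 *: w)) <= 1 - d.
  apply: (@Fline_max z w rho) => //; last by rewrite cm0 ltW.
  by move=> t ht; have [s [hs ->]] := circ_surj rho0 ht; rewrite -psiE; exact: hd.
by rewrite scale0r addr0 -/v v1; lra.
Qed.
End Boundary.

(** * The extension of a proper map as a sphere map *)

Section ProperMaps.
Variable K : realType.
Local Notation C := (cplx K).
Variables (r R : K) (f : 'cV[C]_2 -> 'cV[C]_3).
Hypothesis r01 : 0 < r < 1.
Hypothesis R01 : 0 < R < 1.
Hypothesis fh : holomorphic_on (annulus 2 r) f.
Hypothesis fp : proper_on (annulus 2 r) (annulus 3 R) f.

Let r0 : 0 < r. Proof. by case/andP: r01. Qed.
Let r1 : r < 1. Proof. by case/andP: r01. Qed.
Let R0 : 0 < R. Proof. by case/andP: R01. Qed.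

Let shellE (z : 'cV[C]_2) : r ^+ 2 < nrm2 z < 1 -> r < nrm z < 1.
Proof.
move=> /andP[z1 z2]; rewrite -nrm2_lt1 z2 andbT -(@ltr_pXn2r _ 2) ?nnegrE ?nrm_ge0 ?(ltW r0) //.
by rewrite nrm_sqr.
Qed.

Definition extend (z : 'cV[C]_2) : 'cV[C]_3 := \col_i hartogs (fun z => f z i 0) r z.
Local Notation F := extend.

Lemma extend_vhol z : nrm z < 1 -> vhol F z.
Proof.
move=> z1 i; have -> : (fun z => F z i 0) = hartogs (fun z => f z i 0) r.
  by apply/funext => w; rewrite mxE.
apply: (hartogs_lhol r01); rewrite ?nrm2_lt1 // => w /shellE /annulusE /fh fw.
- exact: differentiable_lhol.
- exact: differentiable_vcont.
Qed.

Lemma extend_eq z : r < nrm z < 1 -> F z = f z.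
Proof.
move=> /andP[z1 z2]; apply/matrixP => i j; rewrite ord1 mxE (hartogs_eq r01) //.
- by move=> w /shellE /annulusE /fh fw; exact: differentiable_lhol.
- by move=> w /shellE /annulusE /fh fw; exact: differentiable_vcont.
- by rewrite nrm2_lt1 z2 andbT -nrm_sqr ltr_pXn2r // nnegrE ?nrm_ge0 ?(ltW r0).
Qed.

Let Fvals z : r < nrm z < 1 -> R ^+ 2 < nrm2 (F z) < 1.
Proof.
move=> hz; rewrite extend_eq //; have [_ sub _] := fp.
have /annulusE /andP[h1 h2] : annulus 3 R (f z) by apply: sub; exists z => //; apply/annulusE.
by rewrite nrm2_lt1 h2 andbT -nrm_sqr ltr_pXn2r // nnegrE ?nrm_ge0 ?(ltW R0).
Qed.

Let preimage a b : set 'cV[C]_2 := [set z | r < nrm z < 1 /\ a <= nrm2 (F z) <= b].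

Let preimage_compact a b : R ^+ 2 < a -> b < 1 -> compact (preimage a b).
Proof.
move=> Ra b1; have [_ _ pc] := fp.
have a0 : 0 < a by apply: lt_trans Ra; rewrite exprn_gt0.
have LE (w : 'cV[C]_3) : (Num.sqrt a <= nrm w <= Num.sqrt b) = (a <= nrm2 w <= b).
  (* For negative [b] both conditions are unsatisfiable: [Num.sqrt b] is 0 while [Num.sqrt a] is
     positive. *)
  case: (leP 0 b) => b0; last first.
    rewrite [RHS](_ : _ = false); last first.
      by apply/negP => /andP[_ h]; have := nrm2_ge0 w; lra.
    apply/negP => /andP[h1 h2]; have : 0 < Num.sqrt a by rewrite sqrtr_gt0.
    by have : Num.sqrt b = 0; [rewrite ler0_sqrtr // ltW|lra].
  rewrite -(@ler_pXn2r _ 2 _ (Num.sqrt a)) ?nnegrE ?sqrtr_ge0 ?nrm_ge0 //.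
  rewrite -(@ler_pXn2r _ 2 _ (nrm w)) ?nnegrE ?sqrtr_ge0 ?nrm_ge0 //.
  by rewrite nrm_sqr !sqr_sqrtr // ltW.
have := pc _ (@shell_compact K 3 (Num.sqrt a) (Num.sqrt b)) _.
have -> : annulus 2 r `&` f @^-1` [set w | Num.sqrt a <= nrm w <= Num.sqrt b] = preimage a b.
  apply/seteqP; split => z /=.
  - by move=> [/annulusE hz]; rewrite LE => h; split => //; rewrite extend_eq.
  - by move=> [hz]; rewrite extend_eq // -LE => h; split => //; apply/annulusE.
apply=> w /=; rewrite LE => /andP[h1 h2]; apply/annulusE; apply/andP; split.
- rewrite -(@ltr_pXn2r _ 2) ?nnegrE ?nrm_ge0 ?(ltW R0) // nrm_sqr; exact: lt_le_trans h1.
- by rewrite -nrm2_lt1; exact: le_lt_trans b1.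
Qed.

Let preimage_limit a b z : R ^+ 2 < a -> b < 1 ->
  (forall e : K, 0 < e -> exists w, [/\ r < nrm w < 1, nrm (w - z) < e & a <= nrm2 (F w) <= b]) ->
  r < nrm z < 1.
Proof.
move=> Ra b1 h; have := compact_closed (@norm_hausdorff _ _) (preimage_compact Ra b1).
move=> /(_ z) [] // B /cV_nbhsP [d d0 hd].
by have [w [w1 w2 w3]] := h _ d0; exists w; split => //; exact: hd.
Qed.

Let preimage_outer a b : R ^+ 2 < a -> b < 1 ->
  exists2 rho, rho < 1 & forall z, r < nrm z < 1 -> rho < nrm z -> ~~ (a <= nrm2 (F z) <= b).
Proof.
move=> Ra b1; case: (pselect (preimage a b !=set0)) => [ne|ne]; last first.
  exists r => // z hz _; apply/negP => h; apply: ne; by exists z.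
have [|z] := @compact_EVT_max _ K (@nrm K 2) _ ne (preimage_compact Ra b1).
  apply: continuous_in_subspaceT => z _.
  apply: (cvgrPdist_lt (F := nbhs z) (@nrm K 2) (nrm z)).2 => e e0.
  by apply: filterS (nrm_continuous z e0) => w; rewrite distrC.
move=> /set_mem [/andP[_ z1] _] zmax; exists (nrm z) => // w hw zw; apply/negP => h.
have : w \in preimage a b by apply/mem_set; split.
by move/zmax; rewrite leNgt zw.
Qed.

Lemma extend_sphere_map : sphere_map F r (R ^+ 2).
Proof.
split; first exact: extend_vhol.
- exact: (boundary_inner r0 r1 extend_vhol Fvals preimage_limit).
- exact: (boundary_radial r0 r1 extend_vhol Fvals preimage_outer).
Qed.
End ProperMaps.

(** * Computing affine hulls and hyperplane ranks *)

Section AffineDimension.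
Variable K : realType.
Local Notation C := (cplx K).
Implicit Types (n d : nat).

Lemma affine_subspace_sub n (p q : 'cV[C]_n) U U' :
  affine_subspace p U `<=` affine_subspace q U' -> (U <= U')%VS.
Proof.
move=> h; apply/subvP => u uU.
have h1 : q - p \in U' -> p + u - q \in U' -> u \in U'.
  move=> a b; have E : p + u - q + (q - p) = u by rewrite addrA subrK addrC addKr.
  by rewrite -E; exact: rpredD.
apply: h1.
- by rewrite -rpredN opprB; apply: (h p); rewrite /affine_subspace /= subrr mem0v.
- by apply: (h (p + u)); rewrite /affine_subspace /= addrC addKr.
Qed.

Lemma sub_aff n (X : set 'cV[C]_n) : X `<=` aff X.
Proof. by move=> x Xx p U; apply. Qed.

Lemma affdim_le n (X : set 'cV[C]_n) p U : X `<=` affine_subspace p U -> (affdim X <= \dim U)%N.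
Proof.
move=> XU; rewrite /affdim; case: xgetP => // d _ [q [U' qE <-]].
apply/dimvS/(@affine_subspace_sub _ q p); rewrite -qE.
by move=> z; apply.
Qed.

Lemma affdim_eq n (X : set 'cV[C]_n) p U : aff X = affine_subspace p U -> affdim X = \dim U.
Proof.
move=> XE; have : (affdim X <= \dim U)%N by apply: (@affdim_le _ _ p); rewrite -XE; exact: sub_aff.
rewrite /affdim; case: xgetP => [d _ [q [U' qE <-]] _|h].
  congr (\dim _); apply/eqP; rewrite eqEsubv; apply/andP; split.
    by apply: (@affine_subspace_sub _ q p); rewrite -XE -qE.
  by apply: (@affine_subspace_sub _ p q); rewrite -XE -qE.
by exfalso; apply: (h (\dim U)); exists p, U.
Qed.

(** The points [x0] and [x0 + v i], seen through [W], are an affine frame of the hull: they force it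
    to contain the span, and the last hypothesis confines it there. *)
Lemma affdim_tuple n d (W : 'M[C]_n) (X : set 'cV[C]_n) (x0 : 'cV[C]_n) (v : 'I_d -> 'cV[C]_n) :
  W \in unitmx -> X (W *m x0) -> (forall i, X (W *m (x0 + v i))) ->
  (forall k : 'I_d -> C, \sum_i k i *: v i = 0 -> forall i, k i = 0) ->
  (forall x, X x -> exists k : 'I_d -> C, x = W *m (x0 + \sum_i k i *: v i)) ->
  affdim X = d.
Proof.
move=> Wu X0 Xv vf Xs; pose s := [tuple W *m v i | i < d].
have sE (i : 'I_d) : s`_i = W *m v i by rewrite -tnth_nth tnth_mktuple.
have sf : free s.
  apply/freeP => k; under eq_bigr do rewrite sE scalemxAr.
  rewrite -mulmx_sumr => h; apply: vf; rewrite -[LHS](mulKmx Wu) h; exact: mulmx0.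
have sm i : W *m v i \in <<s>>%VS by rewrite -sE; apply/memv_span/mem_nth; rewrite size_tuple.
rewrite (@affdim_eq _ _ (W *m x0) <<s>>%VS); first by rewrite (eqP sf) size_tuple.
apply/seteqP; split => z.
- apply => x /Xs [k ->]; rewrite /affine_subspace /= mulmxDr addrC addKr mulmx_sumr.
  by apply: rpred_sum => i _; rewrite -scalemxAr memvZ.
- rewrite /affine_subspace /= => zs p U XU.
  have x0U : W *m x0 - p \in U := XU _ X0.
  have zE : z - p = (z - W *m x0) + (W *m x0 - p) by rewrite addrA subrK.
  rewrite /affine_subspace /= zE; apply: rpredD => //.
  suff sU : (<<s>> <= U)%VS by exact: (subvP sU).
  apply/span_subvP => y /mapP [i _ ->].
  have := rpredB (XU _ (Xv i)) x0U; rewrite mulmxDr opprB addrA subrK.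
  by rewrite addrC addKr.
Qed.

Lemma hyperplane_rank_eq m n (A : set 'cV[C]_m) (f : 'cV[C]_m -> 'cV[C]_n) d H : (d < n.+1)%N ->
  hyperplane H -> affdim (f @` (H `&` A)) = d ->
  (forall H, hyperplane H -> (affdim (f @` (H `&` A)) <= d)%N) -> hyperplane_rank A f = d.
Proof.
move=> dn hH Hd hle; apply/eqP; rewrite eqn_leq; apply/andP; split.
  by apply/bigmax_leqP => i /asboolP [H' hH' <-]; exact: hle.
by apply: (@leq_bigmax_cond _ _ _ (Ordinal dn)); apply/asboolP; exists H.
Qed.

Definition vertical (m : C) : set 'cV[C]_2 := [set z | z 0 0 = m].

Lemma hyperplane_vertical m : hyperplane (vertical m).
Proof.
exists (mk2 m 0), <[mk2 0 1]>%VS.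
  apply/seteqP; split => z; rewrite /affine_subspace /vertical /=.
    move=> zm; apply/vlineP; exists (z 1 0).
    by rewrite {1}(mk2E z) zm mk2B mk2Z subrr subr0 mulr0 mulr1.
  move=> /vlineP [k /eqP]; rewrite subr_eq => /eqP ->.
  by rewrite mk2Z mk2D mk2_0 mulr0 add0r.
have e1 : mk2 0 1 != 0 :> 'cV[C]_2.
  by rewrite -nrm2_gt0 nrm2_mk2 cm0 cm1 expr0n expr1n add0r ltr01.
by rewrite dim_vline e1.
Qed.

Lemma dim1_vline n (U : {vspace 'cV[C]_n}) : \dim U = 1%N -> exists u, U = <[u]>%VS.
Proof.
move=> dU; exists (vpick U); apply/eqP; rewrite eq_sym eqEdim dU dim_vline -memvE memv_pick vpick0.
by rewrite -dimv_eq0 dU.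
Qed.
End AffineDimension.

(** * The two models are not equivalent *)

Section Exclusivity.
Variable K : realType.
Local Notation C := (cplx K).

Lemma unitary_nrm2 n (W : 'M[C]_n) (x : 'cV[C]_n) : W \is unitarymx -> nrm2 (W *m x) = nrm2 x.
Proof.
move=> /unitarymxP; set Ws := map_mx _ _ => WW.
have E (y : 'cV[C]_n) : rc (nrm2 y) = (map_mx (@cj K) y^T *m y) 0 0.
  rewrite -dotcc /dotc dotb.unlock mxE; apply: eq_bigr => i _; rewrite !mxE mulrC //.
apply: (@rcI K); rewrite !E trmx_mul map_mxM mulmxA -[_ *m _ *m W]mulmxA.
have -> : map_mx (@cj K) W^T *m W = 1%:M by apply: mulmx1C; exact: WW.
by rewrite mulmx1.
Qed.

Lemma nrm2_H2 (z : 'cV[C]_2) : nrm2 (H2 z) = nrm2 z ^+ 2.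
Proof. by apply: (@rcI K); rewrite -dotcc H2_gram dotcc rcX. Qed.

Lemma affine_embeddingE (r R : K) z : affine_embedding r R z =
  \col_(i < 3) [:: rc (Num.sqrt ((1 - R ^+ 2) / (1 - r ^+ 2))) * z 0 0;
                  rc (Num.sqrt ((1 - R ^+ 2) / (1 - r ^+ 2))) * z 1 0;
                  rc (Num.sqrt ((R ^+ 2 - r ^+ 2) / (1 - r ^+ 2)))]`_i.
Proof. by []. Qed.

Lemma nrm2_affine_embedding (r R : K) z : nrm2 (affine_embedding r R z) =
  Num.sqrt ((1 - R ^+ 2) / (1 - r ^+ 2)) ^+ 2 * nrm2 z + Num.sqrt ((R ^+ 2 - r ^+ 2) / (1 - r ^+ 2)) ^+ 2.
Proof.
apply: (@rcI K); rewrite -dotcc affine_embeddingE affine_gram dotcc !cj_rc.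
by rewrite rcD rcM !rcX !expr2.
Qed.

(** Norms are unitary invariants, and on the sphere of radius [x] the two models give
    [(x ^+ 2) ^+ 2] and an affine function of [x ^+ 2]. A strictly convex function meets an affine
    one at two points at most. *)
Lemma not_both_equivalent (r R : K) (f : 'cV[C]_2 -> 'cV[C]_3) : 0 < r < 1 ->
  unitarily_equivalent (annulus 2 r) f (affine_embedding r R) ->
  unitarily_equivalent (annulus 2 r) f (@H2 K) -> False.
Proof.
move=> /andP[r0 r1] [V [W [Vu Wu fE]]] [V' [W' [Vu' Wu' fE']]].
set c := Num.sqrt ((1 - R ^+ 2) / (1 - r ^+ 2)).
set d := Num.sqrt ((R ^+ 2 - r ^+ 2) / (1 - r ^+ 2)).
have E (x : K) : r < x < 1 -> (x ^+ 2) ^+ 2 = c ^+ 2 * x ^+ 2 + d ^+ 2.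
  move=> /andP[x0 x1]; have nx : nrm (mk2 (rc x) 0 : 'cV[C]_2) = x.
    rewrite nrm.unlock nrm2_mk2 cm0 expr0n addr0 cm_rc real_normK ?num_real //.
    by rewrite sqrtr_sqr ger0_norm //; lra.
  have Ax : annulus 2 r (mk2 (rc x) 0 : 'cV[C]_2) by apply/annulusE; rewrite nx x0.
  have := congr1 nrm2 (fE _ Ax); rewrite (fE' _ Ax) !unitary_nrm2 // nrm2_H2.
  by rewrite nrm2_affine_embedding !unitary_nrm2 // -nrm_sqr nx.
(* Three distinct radii between [r] and 1, one more than such functions can share. *)
pose x1 := (3 * r + 1) / 4; pose x2 := (2 * r + 2) / 4; pose x3 := (r + 3) / 4.
have e1 := E x1 ltac:(rewrite /x1; apply/andP; split; lra).
have e2 := E x2 ltac:(rewrite /x2; apply/andP; split; lra).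
have e3 := E x3 ltac:(rewrite /x3; apply/andP; split; lra).
have y12 : x1 ^+ 2 < x2 ^+ 2 by rewrite /x1 /x2; nra.
have y23 : x2 ^+ 2 < x3 ^+ 2 by rewrite /x2 /x3; nra.
move: e1 e2 e3 y12 y23; move: (x1 ^+ 2) (x2 ^+ 2) (x3 ^+ 2) (c ^+ 2) (d ^+ 2) => y1 y2 y3 p q.
move=> e1 e2 e3 y12 y23.
have a1 : y1 + y2 = p.
  by apply: (@mulfI _ (y2 - y1)); [rewrite gt_eqF ?subr_gt0|nra].
have a2 : y2 + y3 = p.
  by apply: (@mulfI _ (y3 - y2)); [rewrite gt_eqF ?subr_gt0|nra].
lra.
Qed.
End Exclusivity.

(** * Embedding dimensions and hyperplane ranks of the two models *)

Section Dimensions.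
Variable K : realType.
Local Notation C := (cplx K).

Definition vec3 (a b c : C) : 'cV[C]_3 := \col_(i < 3) [:: a; b; c]`_i.

Lemma vec3D a b c a' b' c' : vec3 a b c + vec3 a' b' c' = vec3 (a + a') (b + b') (c + c').
Proof. by apply/colP => -[[|[|[|//]]] hi]; rewrite !mxE. Qed.

Lemma vec3Z k a b c : k *: vec3 a b c = vec3 (k * a) (k * b) (k * c).
Proof. by apply/colP => -[[|[|[|//]]] hi]; rewrite !mxE. Qed.

Lemma vec3_eq0 a b c : vec3 a b c = 0 -> [/\ a = 0, b = 0 & c = 0].
Proof.
move=> h; split.
- by have := congr1 (fun v : 'cV[C]_3 => v (Ordinal (isT : 0 < 3)%N) 0) h; rewrite !mxE.
- by have := congr1 (fun v : 'cV[C]_3 => v (Ordinal (isT : 1 < 3)%N) 0) h; rewrite !mxE.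
- by have := congr1 (fun v : 'cV[C]_3 => v (Ordinal (isT : 2 < 3)%N) 0) h; rewrite !mxE.
Qed.

Lemma eq_vec3 a b c a' b' c' : a = a' -> b = b' -> c = c' -> vec3 a b c = vec3 a' b' c'.
Proof. by move=> -> -> ->. Qed.

Variable r : K.
Hypothesis r01 : 0 < r < 1.
(** Sample points are built from [m], midway between [r] and 1, and an [h] with [m + h < 1], which
    keeps [(m, h)] and [(m, - h)] in the annulus. *)
Let m : K := (1 + r) / 2.
Let h : K := (1 - r) / 4.

Let mh : [/\ 0 < h, r < m, 0 < m & m + h < 1].
Proof. by have /andP[? ?] := r01; rewrite /m /h; split; lra. Qed.

Let in_annulus (a b : K) : r < a -> a + `|b| < 1 -> annulus 2 r (mk2 (rc a) (rc b) : 'cV[C]_2).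
Proof.
move=> ra ab; have /andP[r0 r1] := r01; have b0 := normr_ge0 b.
have E : nrm2 (mk2 (rc a) (rc b) : 'cV[C]_2) = a ^+ 2 + `|b| ^+ 2.
  by rewrite nrm2_mk2 !cm_rc (ger0_norm (_ : 0 <= a)) //; lra.
apply/annulusE; rewrite -nrm2_lt1 E; apply/andP; split; last by nra.
rewrite -(@ltr_pXn2r _ 2) ?nnegrE ?nrm_ge0 ?(ltW r0) // nrm_sqr E.
have : r ^+ 2 < a ^+ 2 by rewrite ltr_pXn2r // nnegrE; lra.
have : 0 <= `|b| ^+ 2 by apply: sqr_ge0.
lra.
Qed.

Let in_m0 : annulus 2 r (mk2 (rc m) 0 : 'cV[C]_2).
Proof. by have [? ? ? ?] := mh; apply: (in_annulus (b := 0)); rewrite ?normr0; lra. Qed.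

Let in_mh : annulus 2 r (mk2 (rc m) (rc h) : 'cV[C]_2).
Proof. by have [? ? ? ?] := mh; apply: in_annulus => //; rewrite gtr0_norm. Qed.

Let in_mNh : annulus 2 r (mk2 (rc m) (rc (- h)) : 'cV[C]_2).
Proof. by have [? ? ? ?] := mh; apply: in_annulus => //; rewrite normrN gtr0_norm. Qed.

Let in_0m : annulus 2 r (mk2 0 (rc m) : 'cV[C]_2).
Proof.
have /annulusE := in_m0; rewrite nrm.unlock nrm2_mk2 addrC -nrm2_mk2 => hh.
by apply/annulusE; rewrite nrm.unlock.
Qed.

Let mn : rc m != 0 :> C.
Proof. by have [? ? m0 ?] := mh; rewrite -cm_gt0 cm_rc gtr0_norm. Qed.
Let hn : rc h != 0 :> C.
Proof. by have [h0 ? ? ?] := mh; rewrite -cm_gt0 cm_rc gtr0_norm. Qed.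

Variables (f : 'cV[C]_2 -> 'cV[C]_3) (W : 'M[C]_3).
Hypothesis Wu : W \is unitarymx.
Let Wunit : W \in unitmx := unitarymx_unit Wu.
Local Notation A := (annulus 2 r).

Section Affine.
Variables (c d : C).
Hypothesis c0 : c != 0.
Hypothesis fE : forall z, A z -> f z = W *m vec3 (c * z 0 0) (c * z 1 0) d.

Lemma affine_embedding_dim : embedding_dim A f = 2%N.
Proof.
apply: (@affdim_tuple K 3 2 W (f @` A) (vec3 (c * rc m) 0 d)
  (fun i => [:: vec3 0 (c * rc h) 0; vec3 (- (c * rc m)) (c * rc m) 0]`_i)) => //.
- by exists (mk2 (rc m) 0); [exact: in_m0|rewrite (fE in_m0) mk2_0 mk2_1 mulr0].
- move=> [[|[|//]] hi] /=; rewrite vec3D.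
  + exists (mk2 (rc m) (rc h)); first exact: in_mh.
    by rewrite (fE in_mh) mk2_0 mk2_1; congr (_ *m _); apply: eq_vec3; ring.
  + exists (mk2 0 (rc m)); first exact: in_0m.
    by rewrite (fE in_0m) mk2_0 mk2_1; congr (_ *m _); apply: eq_vec3; ring.
- move=> k; rewrite 2!big_ord_recl big_ord0 /= addr0 !vec3Z vec3D => /vec3_eq0 [e0 e1 _].
  have k1 : k (lift ord0 ord0) = 0.
    move: e0; rewrite mulr0 add0r => /eqP; rewrite mulf_eq0 oppr_eq0 mulf_eq0 (negPf c0) (negPf mn) !orbF.
    by move/eqP.
  move: e1; rewrite k1 mul0r addr0 => /eqP; rewrite !mulf_eq0 (negPf c0) (negPf hn) !orbF => /eqP k0.
  by move=> [[|[|//]] hi]; [rewrite -[RHS]k0|rewrite -[RHS]k1]; congr k; apply/val_inj.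
- move=> _ [z /fE -> <-]; pose k1 := (rc m - z 0 0) / rc m.
  exists (fun i => [:: (z 1 0 - rc m * k1) / rc h; k1]`_i).
  rewrite 2!big_ord_recl big_ord0 /= addr0 !vec3Z !vec3D; congr (_ *m _).
  by apply: eq_vec3; rewrite /k1; field; rewrite ?mn ?hn.
Qed.

Lemma affine_hyperplane_rank : hyperplane_rank A f = 1%N.
Proof.
apply: (@hyperplane_rank_eq _ _ _ _ _ _ (vertical (rc m))) => //; first exact: hyperplane_vertical.
  apply: (@affdim_tuple K 3 1 W _ (vec3 (c * rc m) 0 d) (fun=> vec3 0 (c * rc h) 0)) => //.
  - exists (mk2 (rc m) 0); first by split; [exact: mk2_0|exact: in_m0].
    by rewrite (fE in_m0) mk2_0 mk2_1 mulr0.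
  - move=> _; exists (mk2 (rc m) (rc h)); first by split; [exact: mk2_0|exact: in_mh].
    by rewrite (fE in_mh) mk2_0 mk2_1 vec3D; congr (_ *m _); apply: eq_vec3; ring.
  - move=> k; rewrite big_ord1 vec3Z => /vec3_eq0 [_ + _].
    move/eqP; rewrite !mulf_eq0 (negPf c0) (negPf hn) !orbF => /eqP k0 i.
    by rewrite ord1.
  - move=> _ [z [zm /fE ->] <-]; exists (fun=> z 1 0 / rc h).
    rewrite big_ord1 vec3Z vec3D; congr (_ *m _).
    have -> : z 0 0 = rc m := zm.
    by apply: eq_vec3; field; rewrite ?hn.
move=> H [q [U -> dU]]; have [u ->] : exists u, U = <[u]>%VS by apply: dim1_vline; case: dU.
pose w := W *m vec3 (c * u 0 0) (c * u 1 0) 0.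
apply: (@leq_trans (\dim <[w]>%VS)); last first.
  by rewrite dim_vline leq_b1.
apply: (@affdim_le _ _ _ (W *m vec3 (c * q 0 0) (c * q 1 0) d)).
move=> _ [z [/vlineP [k zq] /fE ->] <-]; apply/vlineP; exists k.
rewrite scalemxAr -mulmxBr vec3Z -scaleN1r vec3Z vec3D; congr (_ *m _).
have -> : z = k *: u + q by rewrite -zq subrK.
by rewrite !mxE; apply: eq_vec3; ring.
Qed.
End Affine.

Section Quadratic.
Hypothesis fE : forall z, A z -> f z = W *m H2 z.

Let H2E (z : 'cV[C]_2) : H2 z = vec3 (z 0 0 ^+ 2) (sqrtC 2 * z 0 0 * z 1 0) (z 1 0 ^+ 2).
Proof. by []. Qed.

Let s2 : sqrtC 2 != 0 :> C.
Proof. by rewrite sqrtC_eq0 pnatr_eq0. Qed.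

Let x0 := vec3 (rc m ^+ 2) 0 0.
Let v1 := vec3 0 (sqrtC 2 * rc m * rc h) (rc h ^+ 2).
Let v2 := vec3 0 (- (sqrtC 2 * rc m * rc h)) (rc h ^+ 2).
Let v3 := vec3 (- (rc m ^+ 2)) 0 (rc m ^+ 2).

Let f0 : f (mk2 (rc m) 0) = W *m x0.
Proof. by rewrite (fE in_m0) H2E mk2_0 mk2_1; congr (_ *m _); apply: eq_vec3; ring. Qed.
Let f1 : f (mk2 (rc m) (rc h)) = W *m (x0 + v1).
Proof. by rewrite (fE in_mh) H2E mk2_0 mk2_1 vec3D; congr (_ *m _); apply: eq_vec3; ring. Qed.
Let f2 : f (mk2 (rc m) (rc (- h))) = W *m (x0 + v2).
Proof. by rewrite (fE in_mNh) H2E mk2_0 mk2_1 vec3D rcN; congr (_ *m _); apply: eq_vec3; ring. Qed.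
Let f3 : f (mk2 0 (rc m)) = W *m (x0 + v3).
Proof. by rewrite (fE in_0m) H2E mk2_0 mk2_1 vec3D; congr (_ *m _); apply: eq_vec3; ring. Qed.

Let two0 : 2 != 0 :> C. Proof. by rewrite pnatr_eq0. Qed.

Let free12 (k1 k2 : C) : k1 * (sqrtC 2 * rc m * rc h) + k2 * - (sqrtC 2 * rc m * rc h) = 0 ->
  k1 * rc h ^+ 2 + k2 * rc h ^+ 2 = 0 -> k1 = 0 /\ k2 = 0.
Proof.
move=> e1 e2; have k12 : k1 = k2.
  apply/eqP; rewrite -subr_eq0; move/eqP: e1; rewrite mulrN -mulrBl !mulf_eq0 (negPf s2) (negPf mn) (negPf hn).
  by rewrite !orbF.
have : k2 * 2 * rc h ^+ 2 = 0 by rewrite -[RHS]e2 k12; ring.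
move/eqP; rewrite mulf_eq0 expf_eq0 (negPf hn) /= orbF mulf_eq0 (negPf two0) orbF => /eqP k20.
by rewrite k12 k20.
Qed.

Lemma quadratic_embedding_dim : embedding_dim A f = 3%N.
Proof.
apply: (@affdim_tuple K 3 3 W (f @` A) x0 (fun i => [:: v1; v2; v3]`_i)) => //.
- by exists (mk2 (rc m) 0); [exact: in_m0|exact: f0].
- move=> [[|[|[|//]]] hi] /=.
  + by exists (mk2 (rc m) (rc h)); [exact: in_mh|exact: f1].
  + by exists (mk2 (rc m) (rc (- h))); [exact: in_mNh|exact: f2].
  + by exists (mk2 0 (rc m)); [exact: in_0m|exact: f3].
- move=> k; rewrite 3!big_ord_recl big_ord0 /= addr0 !vec3Z !vec3D => /vec3_eq0 [e0 e1 e2].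
  have k2 : k (lift ord0 (lift ord0 ord0)) = 0.
    move/eqP: e0; rewrite !mulr0 !add0r mulf_eq0 oppr_eq0 expf_eq0 (negPf mn) /= orbF.
    by move/eqP.
  move: e1 e2; rewrite k2 !mul0r !addr0 => e1 e2; have [k0 k1] := free12 e1 e2.
  by move=> [[|[|[|//]]] hi]; [rewrite -[RHS]k0|rewrite -[RHS]k1|rewrite -[RHS]k2]; congr k; apply/val_inj.
- move=> _ [z /fE -> <-]; rewrite H2E.
  move: (z 0 0 ^+ 2) (sqrtC 2 * z 0 0 * z 1 0) (z 1 0 ^+ 2) => a b c.
  pose k3 := (rc m ^+ 2 - a) / rc m ^+ 2.
  pose p := b / (sqrtC 2 * rc m * rc h); pose q := (c - k3 * rc m ^+ 2) / rc h ^+ 2.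
  exists (fun i => [:: (p + q) / 2; (q - p) / 2; k3]`_i).
  rewrite 3!big_ord_recl big_ord0 /= addr0 !vec3Z !vec3D; congr (_ *m _).
  rewrite /p /q /k3; move: (sqrtC 2) s2 => s sn.
  by apply: eq_vec3; field; rewrite ?mn ?hn ?sn ?two0.
Qed.

(** On a line [q + k u] the quadratic map is a polynomial of degree 2 in [k], so it stays in a
    plane; the line of first coordinate [m] attains dimension 2. *)
Lemma quadratic_hyperplane_rank : hyperplane_rank A f = 2%N.
Proof.
apply: (@hyperplane_rank_eq _ _ _ _ _ _ (vertical (rc m))) => //; first exact: hyperplane_vertical.
  apply: (@affdim_tuple K 3 2 W _ x0 (fun i => [:: v1; v2]`_i)) => //.
  - exists (mk2 (rc m) 0); [split; [exact: mk2_0|exact: in_m0]|exact: f0].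
  - move=> [[|[|//]] hi] /=.
    + exists (mk2 (rc m) (rc h)); [split; [exact: mk2_0|exact: in_mh]|exact: f1].
    + exists (mk2 (rc m) (rc (- h))); [split; [exact: mk2_0|exact: in_mNh]|exact: f2].
  - move=> k; rewrite 2!big_ord_recl big_ord0 /= addr0 !vec3Z !vec3D => /vec3_eq0 [_ e1 e2].
    have [k0 k1] := free12 e1 e2.
    by move=> [[|[|//]] hi]; [rewrite -[RHS]k0|rewrite -[RHS]k1]; congr k; apply/val_inj.
  - move=> _ [z [zm /fE ->] <-]; rewrite H2E; have -> : z 0 0 = rc m := zm.
    pose p := z 1 0 / rc h; pose q := z 1 0 ^+ 2 / rc h ^+ 2.
    exists (fun i => [:: (p + q) / 2; (q - p) / 2]`_i).
    rewrite 2!big_ord_recl big_ord0 /= addr0 !vec3Z !vec3D; congr (_ *m _).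
    rewrite /p /q; move: (z 1 0) (sqrtC 2) s2 => b s sn.
    by apply: eq_vec3; field; rewrite ?mn ?hn ?two0.
move=> H [q [U -> dU]]; have [u ->] : exists u, U = <[u]>%VS by apply: dim1_vline; case: dU.
(* The polar form of the quadratic map at [q] and [u], the coefficient of [k]. *)
pose B := vec3 (2 * q 0 0 * u 0 0) (sqrtC 2 * (q 0 0 * u 1 0 + u 0 0 * q 1 0)) (2 * q 1 0 * u 1 0).
pose w1 := W *m B; pose w2 := W *m H2 u.
apply: (@leq_trans (\dim <<[:: w1; w2]>>%VS)); last exact: dim_span.
apply: (@affdim_le _ _ _ (W *m H2 q)).
move=> _ [z [/vlineP [k zq] /fE ->] <-].
have -> : W *m H2 z = W *m H2 q + (k *: (W *m B) + k ^+ 2 *: (W *m H2 u)).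
  rewrite !scalemxAr -!mulmxDr !H2E !vec3Z !vec3D; congr (_ *m _).
  have -> : z = k *: u + q by rewrite -zq subrK.
  by rewrite !mxE; apply: eq_vec3; ring.
rewrite /affine_subspace /= addrC addKr; apply: rpredD; apply: memvZ; apply: memv_span;
  by rewrite !inE eqxx ?orbT.
Qed.
End Quadratic.
End Dimensions.

Theorem theorem1p4 (K : realType) (r R : K)
    (f : 'cV[cplx K]_2 -> 'cV[cplx K]_3) :
  0 < r < 1 -> 0 < R < 1 ->
  holomorphic_on (annulus 2 r) f ->
  proper_on (annulus 2 r) (annulus 3 R) f ->
  (unitarily_equivalent (annulus 2 r) f (affine_embedding r R) /\
   ~ unitarily_equivalent (annulus 2 r) f (@H2 K) /\
   r <= R /\
   embedding_dim (annulus 2 r) f = 2%N /\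
   hyperplane_rank (annulus 2 r) f = 1%N)
  \/
  (unitarily_equivalent (annulus 2 r) f (@H2 K) /\
   ~ unitarily_equivalent (annulus 2 r) f (affine_embedding r R) /\
   R = r ^+ 2 /\
   embedding_dim (annulus 2 r) f = 3%N /\
   hyperplane_rank (annulus 2 r) f = 2%N).
Proof.
move=> r01 R01 fh fp; have /andP[r0 r1] := r01; have /andP[R0 R1] := R01.
have FS := extend_sphere_map r01 R01 fh fp.
have k01 : 0 < R ^+ 2 < 1 by rewrite exprn_gt0 //= expr_lt1 // ltW.
have fW g (W : 'M[cplx K]_3) : W \is unitarymx ->
    (forall z, nrm z < 1 -> extend r f z = W *m g z) ->
    unitarily_equivalent (annulus 2 r) f g /\ forall z, annulus 2 r z -> f z = W *m g z.
  move=> Wu hW; have fE z : annulus 2 r z -> f z = W *m g z.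
    move=> /annulusE hz; rewrite -(extend_eq r01 fh hz) hW //; by case/andP: hz.
  (* The source unitary is the identity: both model kernels are functions of [dotc z u], already
     invariant under rotations of the source. *)
  split => //; exists 1%:M, W; split => //.
    by apply/unitarymxP; rewrite mul1mx trmx1 map_mx1.
  by move=> z Az; rewrite mul1mx; exact: fE.
case: (sphere_map_gram r0 r1 FS k01) => [[kE Fg]|[n [x [n1 x0 kx Fn Fg]]]].
  right; have [W [Wu hW]] := gram_H2 Fg.
  have [ue fE] := fW _ _ Wu hW.
  split; first exact: ue.
  split; first by move=> ua; exact: (not_both_equivalent r01 ua ue).
  split; last by split; [exact: (quadratic_embedding_dim r01 Wu fE)|exact: (quadratic_hyperplane_rank r01 Wu fE)].
  apply/eqP; rewrite -(@eqrXn2 _ 2) ?sqr_ge0 ?(ltW R0) // kE -exprM; exact/eqP.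
left; have r21 : 0 < 1 - r ^+ 2 by rewrite subr_gt0 expr_lt1 // ltW.
have R21 : 0 < 1 - R ^+ 2 by rewrite subr_gt0 expr_lt1 // ltW.
have r2n : 1 - r ^+ 2 != 0 by rewrite gt_eqF.
have xE : x ^+ 2 = (R ^+ 2 - r ^+ 2) / (1 - r ^+ 2).
  by apply: (mulIf r2n); rewrite divfK //; lra.
have yE : 1 - x ^+ 2 = (1 - R ^+ 2) / (1 - r ^+ 2).
  by apply: (mulIf r2n); rewrite divfK // mulrBl xE divfK //; lra.
have y0 : 0 < 1 - x ^+ 2 by rewrite yE divr_gt0.
pose y := Num.sqrt (1 - x ^+ 2).
have yp : 0 < y by rewrite sqrtr_gt0.
have y2 : y ^+ 2 = 1 - x ^+ 2 by rewrite sqr_sqrtr // ltW.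
have [|W [Wu hW]] := gram_affine n1 yp Fn; first by move=> z u z1 u1; rewrite y2 Fg.
have aE z : affine_embedding r R z = vec3 (rc y * z 0 0) (rc y * z 1 0) (rc x).
  by rewrite affine_embeddingE -xE -yE sqrtr_sqr (ger0_norm x0).
have [|ue fE] := fW (affine_embedding r R) _ Wu; first by move=> z z1; rewrite aE; exact: hW.
have fE' z : annulus 2 r z -> f z = W *m vec3 (rc y * z 0 0) (rc y * z 1 0) (rc x).
  by move=> /fE; rewrite aE.
have yn : rc y != 0 :> cplx K by rewrite -cm_gt0 cm_rc gtr0_norm.
split; first exact: ue.
split; first by move=> uh; exact: (not_both_equivalent r01 ue uh).
split; last by split; [exact: (affine_embedding_dim r01 Wu yn fE')|exact: (affine_hyperplane_rank r01 Wu yn fE')].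
(* The inequality [r <= R] comes from [x] being real: its square is the quotient under the last root
   of the embedding. *)
have : 0 <= R ^+ 2 - r ^+ 2.
  by have := sqr_ge0 x; rewrite xE pmulr_lge0 ?invr_gt0.
by rewrite subr_ge0 ler_pXn2r ?nnegrE ?(ltW r0) ?(ltW R0).
Qed.
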